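(* There is an isomorphism of $\mathbb Q(v)$-algebras $\aleph:\dot{\mathbf U}^{\jmath}\to\mathbb Q(v)\otimes_{\mathcal A}\mathbf K^{\jmath}$ which sends, for all $i=1,\dots,n$ and $\lambda\in\tilde\Xi^{\mathrm{diag}}$, $$D_\lambda\mapsto[\lambda],\qquad e_iD_\lambda\mapsto[\lambda-E^\theta_{i,i}+E^\theta_{i+1,i}],\qquad f_iD_\lambda\mapsto[\lambda-E^\theta_{i+1,i+1}+E^\theta_{i,i+1}].$$
   Context: Let $\mathcal A=\mathbb Z[v,v^{-1}]$, $n\ge1$, $N=2n+1$; $\mathbb N=\{0,1,2,\dots\}$, $|U|=\dim U$. For $d\ge0$ put $D=2d+1$. For an odd prime power $q$ equip $\mathbb F_q^D$ with a nondegenerate symmetric bilinear form with isometry group $O(D)$, and let $X$ be the set of flags $V=(0=V_0\subseteq V_1\subseteq\cdots\subseteq V_N=\mathbb F_q^D)$ with $V_i=V_{N-i}^\perp$ for all $i$. Let $\Xi_d$ be the set of $N\times N$ matrices $A=(a_{ij})$ over $\mathbb N$ with $\sum a_{ij}=D$ and $a_{ij}=a_{N+1-i,N+1-j}$. The $O(D)$-orbits $\mathcal O_A$ on $X\times X$ are indexed by $A\in\Xi_d$: $(V,V')\in\mathcal O_A$ iff $a_{ij}=|(V_{i-1}+V_i\cap V'_j)/(V_{i-1}+V_i\cap V'_{j-1})|$ for all $i,j$. The Schur algebra $\mathbf S^{\jmath}$ (depending on $d$) is the free $\mathcal A$-module with basis the characteristic functions $e_A$ ($A\in\Xi_d$)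 with convolution product $e_A*e_{A'}=\sum_{A''}g_{A,A',A''}e_{A''}$, where $g_{A,A',A''}\in\mathbb Z[v^2]$ is the polynomial whose value at $v=\sqrt q$, for all odd prime powers $q$, is the number of $V\in X$ with $(V_1,V)\in\mathcal O_A$, $(V,V_2)\in\mathcal O_{A'}$ for fixed $(V_1,V_2)\in\mathcal O_{A''}$. Its standard basis is $[A]=v^{-d_A}e_A$, where $$d_A=\sum_{i>k,\,j<l,\,i+k<N+1}a_{ij}a_{kl}+\sum_{j<l,\ (i<n+1\text{ or }j<N+1-l)}a_{ij}a_{il}+\sum_{i\ge n+1>j}\frac{a_{ij}(a_{ij}-1)}2 .$$ $\tilde\Xi$ is the set of $N\times N$ integer matrices $A=(a_{ij})$ with $a_{ij}\ge0$ for $i\ne j$, $a_{n+1,n+1}$ odd, and $a_{ij}=a_{N+1-i,N+1-j}$; $\tilde\Xi^{\mathrm{diag}}$ is its subset of diagonal matrices $\lambda=\mathrm{diag}(\lambda_1,\dots,\lambda_N)$. $E^\theta_{ij}=E_{ij}+E_{N+1-i,N+1-j}$. $\mathbf K^{\jmath}$ is the free $\mathcal A$-module with basis $[A]$, $A\in\tilde\Xi$, with the associative product: for $A_1,\dots,A_f\in\tilde\Xi$ such that the column sums of $A_i$ equal the row sums of $A_{i+1}$ for all $i$, there are $Z_i\in\tilde\Xi$ and $G_i(v,v')\in\mathbb Q(v)[v']$ with $[A_1+2pI]*\cdots*[A_f+2pI]=\sum_iG_i(v,v^{-2p})[Z_i+2pI]$ in the Schur algebras for all $p\gg0$, and $[A_1]\cdots[A_f]:=\sum_iG_i(v,1)[Z_i]$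 (the product is $0$ for non-composable matrices). $\mathbf U^{\jmath}$ is the $\mathbb Q(v)$-algebra generated by $e_i,f_i$ $(1\le i\le n)$, $d_a^{\pm1}$ $(1\le a\le n+1)$ with relations (where $\llbracket2\rrbracket=v+v^{-1}$): $d_ad_a^{-1}=d_a^{-1}d_a=1$; $d_ad_b=d_bd_a$; $d_ae_jd_a^{-1}=v^{-\delta_{a,j+1}-\delta_{N+1-a,j+1}+\delta_{a,j}}e_j$; $d_af_jd_a^{-1}=v^{-\delta_{a,j}+\delta_{a,j+1}+\delta_{N+1-a,j+1}}f_j$; $e_if_j-f_je_i=\delta_{i,j}\frac{d_id_{i+1}^{-1}-d_i^{-1}d_{i+1}}{v-v^{-1}}$ unless $i=j=n$; $e_i^2e_j+e_je_i^2=\llbracket2\rrbracket e_ie_je_i$ and $f_i^2f_j+f_jf_i^2=\llbracket2\rrbracket f_if_jf_i$ if $|i-j|=1$; $e_ie_j=e_je_i$ and $f_if_j=f_jf_i$ if $|i-j|>1$; $f_n^2e_n+e_nf_n^2=\llbracket2\rrbracket\big(f_ne_nf_n-(vd_nd_{n+1}^{-1}+v^{-1}d_n^{-1}d_{n+1})f_n\big)$; $e_n^2f_n+f_ne_n^2=\llbracket2\rrbracket\big(e_nf_ne_n-e_n(vd_nd_{n+1}^{-1}+v^{-1}d_n^{-1}d_{n+1})\big)$. Modified algebra: for $\lambda,\lambda'\in\tilde\Xi^{\mathrm{diag}}$ put ${}_\lambda\mathbf U^{\jmath}_{\lambda'}=\mathbf U^{\jmath}/\big(\sum_{a=1}^{n+1}(d_a-v^{-\lambda_a})\mathbf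 U^{\jmath}+\sum_{a=1}^{n+1}\mathbf U^{\jmath}(d_a-v^{-\lambda'_a})\big)$ with projection $\pi_{\lambda,\lambda'}$, and $\dot{\mathbf U}^{\jmath}=\bigoplus_{\lambda,\lambda'}{}_\lambda\mathbf U^{\jmath}_{\lambda'}$, with the product as in Lusztig's modified quantum groups: for $x,y\in\mathbf U^{\jmath}$ homogeneous for the conjugation action of the $d_a$, of weights compatible with $(\lambda,\lambda')$ and $(\mu,\mu')$, $\pi_{\lambda,\lambda'}(x)\pi_{\mu,\mu'}(y)=\delta_{\lambda',\mu}\pi_{\lambda,\mu'}(xy)$. $D_\lambda=\pi_{\lambda,\lambda}(1)$ are orthogonal idempotents, $\dot{\mathbf U}^{\jmath}$ is a $\mathbf U^{\jmath}$-bimodule, $d_aD_\lambda=D_\lambda d_a=v^{-\lambda_a}D_\lambda$, and $\dot{\mathbf U}^{\jmath}=\sum_\lambda\mathbf U^{\jmath}D_\lambda$. *)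

(* Defs.v *)
From HB Require Import structures.
From mathcomp Require Import all_boot all_order all_algebra finmap.
From mathcomp Require Import boolp monalg zify.

Set Implicit Arguments.
Unset Strict Implicit.
Unset Printing Implicit Defensive.

Import GRing.Theory Num.Theory.
Local Open Scope ring_scope.
Local Open Scope quotient_scope.

(* Definite description; [x0] is only a default value.  It is used for objects
   that are unique by definition and exist by a theorem. *)
Definition the (T : Type) (x0 : T) (P : T -> Prop) : T :=
  if pselect (exists x, P x) is left h then projT1 (cid h) else x0.

Definition bilinear_op (R : pzRingType) (V : lmodType R) (m : V -> V -> V) :=
  (forall c x y z, m (c *: x + y) z = c *: m x z + m y z) /\
  (forall c x y z, m z (c *: x + y) = c *: m z x + m z y).

Definition Qv : fieldType := {fraction {poly rat}}.
Definition v : Qv := tofrac 'X.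

Definition laurent (x : Qv) : bool :=
  `[< exists (p : {poly int}) (k : nat),
      x = tofrac (map_poly intr p : {poly rat}) / v ^+ k >].

Lemma v_neq0 : v != 0.
Proof. by rewrite tofrac_eq0 polyX_eq0. Qed.

Fact laurent_subring : subring_closed laurent.
Proof.
split.
- apply/asboolP; exists 1, 0%N.
  by rewrite rmorph1 rmorph1 expr0 divr1.
- move=> _ _ /asboolP[p [k ->]] /asboolP[q [l ->]]; apply/asboolP.
  exists (p * 'X^l - q * 'X^k), (k + l)%N.
  rewrite !(rmorphB, rmorphM, rmorphXn) /= !map_polyX -/v exprD.
  have h m : v ^+ m != 0 by rewrite expf_neq0 // v_neq0.
  rewrite mulrBl invfM; congr (_ - _).
    by rewrite mulrACA divff // mulr1.
  by rewrite [_^-1 * _]mulrC mulrACA divff // mulr1.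
- move=> _ _ /asboolP[p [k ->]] /asboolP[q [l ->]]; apply/asboolP.
  exists (p * q), (k + l)%N.
  by rewrite !rmorphM /= exprD invfM mulrACA.
Qed.

HB.instance Definition _ := GRing.isSubringClosed.Build Qv laurent
  laurent_subring.

Record Lau := MkLau { lau :> Qv; lauP : laurent lau }.
HB.instance Definition _ := [isSub for lau].
HB.instance Definition _ := [Choice of Lau by <:].
HB.instance Definition _ := [SubChoice_isSubComNzRing of Lau by <:].

Fact laurent_v : laurent v.
Proof.
by apply/asboolP; exists 'X, 0%N; rewrite map_polyX expr0 divr1.
Qed.

Fact laurent_vV : laurent v^-1.
Proof. by apply/asboolP; exists 1, 1%N; rewrite !rmorph1 expr1 mul1r. Qed.

Definition vL : Lau := MkLau laurent_v.
Definition vLV : Lau := MkLau laurent_vV.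

(* The bilinear product on the free module on [I] with prescribed values
   [b i j] on basis elements. *)
Definition bilin (R : comNzRingType) (I : choiceType)
    (b : I -> I -> {malg R[I]}) (x y : {malg R[I]}) : {malg R[I]} :=
  \sum_(i <- msupp x) \sum_(j <- msupp y) (x@_i * y@_j) *: b i j.

(* For a free Z[v,v^-1]-module with basis [I], its scalar extension to Q(v) is
   the free Q(v)-module on the same basis; [ext x] is 1 (x) x. *)
Definition ext (I : choiceType) (x : {malg Lau[I]}) : {malg Qv[I]} :=
  \sum_(i <- msupp x) << lau x@_i *g i >>.

Notation dimN n := (n.*2.+1).

Definition rot_sym (T : eqType) m (A : 'M[T]_m) : bool :=
  [forall i, forall j, A i j == A (rev_ord i) (rev_ord j)].

(* An entry of a matrix over N with entry sum D is at most D, hence the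
   (finite) type ['I_D.+1] for the entries, D = 2d+1. *)
Definition Xi (n d : nat) : finType :=
  {A : 'M['I_(dimN d).+1]_(dimN n) |
    ((\sum_i \sum_j (A i j : nat))%N == dimN d) && rot_sym A}.

Definition ent n d (A : Xi n d) (i j : 'I_(dimN n)) : nat := val A i j.

Definition Xi_int n d (A : Xi n d) : 'M[int]_(dimN n) :=
  \matrix_(i, j) (ent A i j)%:Z.

Definition in_tXi n (A : 'M[int]_(dimN n)) : bool :=
  [&& [forall i, forall j, (i != j) ==> (0 <= A i j)],
      ~~ (2 %| A (inord n) (inord n))%Z & rot_sym A].

Definition tXi (n : nat) : choiceType := {A : 'M[int]_(dimN n) | in_tXi A}.

Definition tXi_diag (n : nat) : choiceType :=
  {A : tXi n | is_diag_mx (val A)}.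

Definition Eth n (i j : 'I_(dimN n)) : 'M[int]_(dimN n) :=
  delta_mx i j + delta_mx (rev_ord i) (rev_ord j).

Section Flags.
Variables (n d : nat) (F : finFieldType) (B : 'M[F]_(dimN d)).

(* A subspace of F^D is represented by its canonical matrix, i.e. by the unique
   M = <<M>>%MS of which it is the row space; B is the Gram matrix. *)
Definition orthc (U : 'M[F]_(dimN d)) : 'M[F]_(dimN d) := kermx (B *m U^T).

Definition seqsp := {ffun 'I_(dimN n).+1 -> 'M[F]_(dimN d)}.

Definition is_flag (V : seqsp) : bool :=
  [&& [forall i, V i == <<V i>>%MS],
      V ord0 == 0,
      (V ord_max == 1%:M)%MS,
      [forall i : 'I_(dimN n),
         (V (widen_ord (leqnSn _) i) <= V (lift ord0 i))%MS] &
      [forall i, (V i == orthc (V (rev_ord i)))%MS]].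

Definition in_orbit (A : Xi n d) (V V' : seqsp) : bool :=
  [forall i : 'I_(dimN n), forall j : 'I_(dimN n),
    let Vi := V (lift ord0 i) in
    let Vi1 := V (widen_ord (leqnSn _) i) in
    let Vj := V' (lift ord0 j) in
    let Vj1 := V' (widen_ord (leqnSn _) j) in
    ent A i j ==
      (\rank (Vi1 + Vi :&: Vj)%MS - \rank (Vi1 + Vi :&: Vj1)%MS)%N].

Definition conv_count (A A' : Xi n d) (V1 V2 : seqsp) : nat :=
  #|[set V | [&& is_flag V, in_orbit A V1 V & in_orbit A' V V2]]|.

End Flags.

(* g_{A,A',A''}, as a polynomial in v^2, hence evaluated at q. *)
Definition gpoly n d (A A' A'' : Xi n d) : {poly int} :=
  the 0 (fun P : {poly int} =>
    forall (F : finFieldType) (B : 'M[F]_(dimN d)),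
      odd #|F| -> B^T = B -> B \in unitmx ->
      forall V1 V2 : seqsp n d F, is_flag B V1 -> is_flag B V2 ->
        in_orbit A'' V1 V2 ->
        P.[#|F|%:Z] = (conv_count B A A' V1 V2)%:Z).

Definition gconst n d (A A' A'' : Xi n d) : Lau :=
  (map_poly intr (gpoly A A' A'')).[vL ^+ 2].

Definition schur (n d : nat) := {malg Lau[Xi n d]}.

Definition schur_mul n d : schur n d -> schur n d -> schur n d :=
  bilin (fun A A' => \sum_(A'' : Xi n d) << gconst A A' A'' *g A'' >>).

(* Indices are shifted by one with respect to the usual 1..N. *)
Definition dA n d (A : Xi n d) : nat :=
  (let I := 'I_(dimN n) in
   \sum_(i : I) \sum_(j : I) \sum_(k : I)
     \sum_(l : I | [&& k < i, j < l & i.+1 + k.+1 < (dimN n).+1])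
       ent A i j * ent A k l
   + \sum_(i : I) \sum_(j : I)
       \sum_(l : I | (j < l) &&
                     ((i.+1 < n.+1) || (j.+1 + l.+1 < (dimN n).+1)))
         ent A i j * ent A i l
   + \sum_(i : I) \sum_(j : I | (n.+1 <= i.+1) && (j.+1 < n.+1))
       (ent A i j * (ent A i j).-1)./2)%N.

(* The element [M] of the standard basis, for M in Xi_d (0 otherwise). *)
Definition std n d (M : 'M[int]_(dimN n)) : schur n d :=
  if [pick A : Xi n d | Xi_int A == M] is Some A
  then << vLV ^+ dA A *g A >> else 0.

Definition Kj (n : nat) := {malg Lau[tXi n]}.

Definition composable n (A B : tXi n) : bool :=
  [forall i, \sum_k val A k i == \sum_k val B i k].

Definition shift n (A : tXi n) (p : nat) : 'M[int]_(dimN n) :=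
  val A + ((2 * p)%N%:Z)%:M.

(* [x] is sum_i G_i(v,1)[Z_i], where (Z_i), (G_i) describe the products
   [A+2pI] * [A_2+2pI] * ... for all large p. *)
Definition stabilizes_to n (A : tXi n) (As : seq (tXi n)) (x : Kj n) : Prop :=
  exists (r : nat) (Z : 'I_r -> tXi n) (G : 'I_r -> {poly Qv}),
    (exists p0 : nat, forall p d : nat, (p0 <= p)%N ->
       \sum_i \sum_j shift A p i j = (dimN d)%:Z ->
       (forall i, exists C : Xi n d, Xi_int C = shift (Z i) p) /\
       ext (foldl (@schur_mul n d) (std d (shift A p))
                  [seq std d (shift B p) | B <- As])
       = \sum_i (G i).[v ^- (2 * p)] *: ext (std d (shift (Z i) p)))
    /\ ext x = \sum_i (G i).[1] *: << Z i >>.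

Definition is_Kj_product n (m : Kj n -> Kj n -> Kj n) : Prop :=
  [/\ bilinear_op m, associative m,
      forall A B : tXi n, ~~ composable A B -> m << A >> << B >> = 0 &
      forall (A : tXi n) (As : seq (tXi n)), path (@composable n) A As ->
        stabilizes_to A As (foldl m << A >> [seq << B >> | B <- As])].

Definition Kj_mul n : Kj n -> Kj n -> Kj n :=
  the (fun _ _ => 0) (@is_Kj_product n).

Definition QKj (n : nat) := {malg Qv[tXi n]}.

Definition QKj_mul n : QKj n -> QKj n -> QKj n :=
  bilin (fun A B => ext (Kj_mul << A >> << B >>)).

Section QuotLmod.
Variables (R : pzRingType) (V : lmodType R) (S : V -> bool).
Hypothesis S_submod : submod_closed S.

Definition submod_zmod : zmodClosed V :=
  HB.pack S (GRing.isZmodClosed.Build V S (GRing.submod_closedB S_submod)).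

Definition quotl : Type := Quotient.quot submod_zmod.
HB.instance Definition _ := GRing.Zmodule.on quotl.
HB.instance Definition _ := EqQuotient.on quotl.

Definition quotl_pi (x : V) : quotl := \pi_(quotl) x.

Lemma quotl_eq x y : (quotl_pi x == quotl_pi y) = (x - y \in S).
Proof. by rewrite /quotl_pi -Quotient.idealrBE. Qed.

Lemma quotl_piP (q : quotl) : quotl_pi (repr q) = q.
Proof. exact: reprK. Qed.

Fact quotl_pi_zmod : zmod_morphism quotl_pi.
Proof. by move=> x y; rewrite /quotl_pi !piE. Qed.
HB.instance Definition _ := GRing.isZmodMorphism.Build V quotl quotl_pi
  quotl_pi_zmod.

Definition quotl_scale (c : R) (q : quotl) : quotl := quotl_pi (c *: repr q).

Lemma quotl_scaleE c x : quotl_scale c (quotl_pi x) = quotl_pi (c *: x).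
Proof.
have [S0 Sl] := S_submod.
apply/eqP; rewrite quotl_eq -scalerBr -[_ *: _]addr0 Sl //.
by rewrite -quotl_eq quotl_piP.
Qed.

Fact quotl_scaleA a b q :
  quotl_scale a (quotl_scale b q) = quotl_scale (a * b) q.
Proof. by rewrite -[q]quotl_piP !quotl_scaleE scalerA. Qed.

Fact quotl_scale1 : left_id 1 quotl_scale.
Proof. by move=> q; rewrite -[q]quotl_piP quotl_scaleE scale1r. Qed.

Fact quotl_scaleDr : right_distributive quotl_scale +%R.
Proof.
move=> a p q; rewrite -[p]quotl_piP -[q]quotl_piP -raddfD !quotl_scaleE.
by rewrite scalerDr raddfD.
Qed.

Fact quotl_scaleDl q : {morph quotl_scale^~ q : a b / a + b}.
Proof.
by move=> a b; rewrite -[q]quotl_piP !quotl_scaleE scalerDl raddfD.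
Qed.

HB.instance Definition _ := GRing.Zmodule_isLmodule.Build R quotl
  quotl_scaleA quotl_scale1 quotl_scaleDr quotl_scaleDl.

End QuotLmod.

Section QuotAlg.
Variables (R : pzRingType) (A : lalgType R) (S : A -> bool).
Hypothesis S_submod : submod_closed S.
Hypothesis S_ideal : forall x y z, S x -> S (y * x * z).
Hypothesis S_proper : ~~ S 1.
Hypothesis A_scalerAr : forall (c : R) (x y : A), c *: (x * y) = x * (c *: y).

(* The unused arguments carry what the ring and algebra instances need. *)
Definition quota_of
    & (forall x y z, S x -> S (y * x * z)) & ~~ S 1
    & (forall (c : R) (x y : A), c *: (x * y) = x * (c *: y)) : Type :=
  quotl S_submod.
Let quota := quota_of S_ideal S_proper A_scalerAr.
HB.instance Definition _ := GRing.Lmodule.on quota.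

Let qpi : A -> quota := quotl_pi S_submod.

Definition quota_mul (p q : quota) : quota := qpi (repr p * repr q).

Lemma quota_mulE x y : quota_mul (qpi x) (qpi y) = qpi (x * y).
Proof.
apply/eqP; rewrite quotl_eq.
have e z : (repr (quotl_pi S_submod z) - z) \in S.
  by rewrite -(quotl_eq S_submod) quotl_piP.
have hx := e x; have hy := e y.
rewrite -/qpi in hx hy; move: (repr (qpi x)) (repr (qpi y)) hx hy => x' y' hx hy.
have -> : x' * y' - x * y = 1 *: (1 * (x' - x) * y') + (x * (y' - y) * 1).
  by rewrite scale1r mul1r mulr1 mulrBl mulrBr addrA addrNK.
by case: S_submod => _; apply; exact: S_ideal.
Qed.

Lemma qpi_surj (q : quota) : exists x, q = qpi x.
Proof. by exists (repr q); rewrite /qpi quotl_piP. Qed.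

Lemma qpiD x y : qpi (x + y) = qpi x + qpi y.
Proof. exact: raddfD. Qed.

Fact quota_mulA : associative quota_mul.
Proof.
move=> p q r; have [x ->] := qpi_surj p; have [y ->] := qpi_surj q.
by have [z ->] := qpi_surj r; rewrite !quota_mulE mulrA.
Qed.

Fact quota_mul1 : left_id (qpi 1) quota_mul.
Proof. by move=> p; have [x ->] := qpi_surj p; rewrite quota_mulE mul1r. Qed.

Fact quota_mulr1 : right_id (qpi 1) quota_mul.
Proof. by move=> p; have [x ->] := qpi_surj p; rewrite quota_mulE mulr1. Qed.

Fact quota_mulDl : left_distributive quota_mul +%R.
Proof.
move=> p q r; have [x ->] := qpi_surj p; have [y ->] := qpi_surj q.
have [z ->] := qpi_surj r.
by rewrite -qpiD !quota_mulE mulrDl qpiD.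
Qed.

Fact quota_mulDr : right_distributive quota_mul +%R.
Proof.
move=> p q r; have [x ->] := qpi_surj p; have [y ->] := qpi_surj q.
have [z ->] := qpi_surj r.
by rewrite -qpiD !quota_mulE mulrDr qpiD.
Qed.

Fact quota_1neq0 : qpi 1 != 0.
Proof. by rewrite -(raddf0 (quotl_pi S_submod)) quotl_eq subr0. Qed.

HB.instance Definition _ := GRing.Zmodule_isNzRing.Build quota
  quota_mulA quota_mul1 quota_mulr1 quota_mulDl quota_mulDr quota_1neq0.

Lemma qpiZ c x : qpi (c *: x) = c *: qpi x.
Proof. by rewrite /qpi -quotl_scaleE. Qed.

Fact quota_scalerAl (c : R) (p q : quota) : c *: (p * q) = (c *: p) * q.
Proof.
have [x ->] := qpi_surj p; have [y ->] := qpi_surj q.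
rewrite -[qpi x * qpi y]/(quota_mul (qpi x) (qpi y)) quota_mulE.
rewrite -!qpiZ -[RHS]/(quota_mul (qpi (c *: x)) (qpi y)) quota_mulE.
by rewrite scalerAl.
Qed.
HB.instance Definition _ := GRing.Lmodule_isLalgebra.Build R quota
  quota_scalerAl.

Fact quota_scalerAr (c : R) (p q : quota) : c *: (p * q) = p * (c *: q).
Proof.
have [x ->] := qpi_surj p; have [y ->] := qpi_surj q.
rewrite -[qpi x * qpi y]/(quota_mul (qpi x) (qpi y)) quota_mulE.
rewrite -!qpiZ -[RHS]/(quota_mul (qpi x) (qpi (c *: y))) quota_mulE.
by rewrite A_scalerAr.
Qed.
HB.instance Definition _ := GRing.Lalgebra_isAlgebra.Build R quota
  quota_scalerAr.

End QuotAlg.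

Section DirectSum.
Variables (R : pzRingType) (I : choiceType) (M : I -> lmodType R).

Record dsum := DSum {
  dcomp :> forall i, M i;
  dsum_fin : exists s : seq I, forall i, i \notin s -> dcomp i = 0 }.

HB.instance Definition _ := gen_eqMixin dsum.
HB.instance Definition _ := gen_choiceMixin dsum.

Lemma dsumP (x y : dsum) : (forall i, x i = y i) -> x = y.
Proof.
case: x y => [x hx] [y hy] /= e.
have exy : x = y by apply: functional_extensionality_dep.
by case: y / exy hy {e} => hy; congr DSum; apply: Prop_irrelevance.
Qed.

Fact dsum0_fin : exists s : seq I, forall i, i \notin s -> (0 : M i) = 0.
Proof. by exists [::]. Qed.
Definition dsum0 := DSum dsum0_fin.

Fact dsumD_fin (x y : dsum) :
  exists s : seq I, forall i, i \notin s -> x i + y i = 0.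
Proof.
have [s hs] := dsum_fin x; have [t ht] := dsum_fin y.
exists (s ++ t) => i; rewrite mem_cat negb_or => /andP[/hs-> /ht->].
by rewrite addr0.
Qed.
Definition dsumD x y := DSum (dsumD_fin x y).

Fact dsumN_fin (x : dsum) :
  exists s : seq I, forall i, i \notin s -> - x i = 0.
Proof. by have [s hs] := dsum_fin x; exists s => i /hs ->; rewrite oppr0. Qed.
Definition dsumN x := DSum (dsumN_fin x).

Fact dsumZ_fin c (x : dsum) :
  exists s : seq I, forall i, i \notin s -> c *: x i = 0.
Proof. by have [s hs] := dsum_fin x; exists s => i /hs ->; rewrite scaler0. Qed.
Definition dsumZ c x := DSum (dsumZ_fin c x).

Fact dsum_addA : associative dsumD.
Proof. by move=> x y z; apply: dsumP => i /=; rewrite addrA. Qed.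
Fact dsum_addC : commutative dsumD.
Proof. by move=> x y; apply: dsumP => i /=; rewrite addrC. Qed.
Fact dsum_add0 : left_id dsum0 dsumD.
Proof. by move=> x; apply: dsumP => i /=; rewrite add0r. Qed.
Fact dsum_addN : left_inverse dsum0 dsumN dsumD.
Proof. by move=> x; apply: dsumP => i /=; rewrite addNr. Qed.

HB.instance Definition _ := GRing.isZmodule.Build dsum
  dsum_addA dsum_addC dsum_add0 dsum_addN.

Fact dsum_scaleA a b x : dsumZ a (dsumZ b x) = dsumZ (a * b) x.
Proof. by apply: dsumP => i /=; rewrite scalerA. Qed.
Fact dsum_scale1 : left_id 1 dsumZ.
Proof. by move=> x; apply: dsumP => i /=; rewrite scale1r. Qed.
Fact dsum_scaleDr : right_distributive dsumZ +%R.
Proof. by move=> a x y; apply: dsumP => i /=; rewrite scalerDr. Qed.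
Fact dsum_scaleDl x : {morph dsumZ^~ x : a b / a + b}.
Proof. by move=> a b; apply: dsumP => i /=; rewrite scalerDl. Qed.

HB.instance Definition _ := GRing.Zmodule_isLmodule.Build R dsum
  dsum_scaleA dsum_scale1 dsum_scaleDr dsum_scaleDl.

(* For a family [x] of elements of the summands, [dinj x i] is the [i]-th
   component [x i], placed in the direct sum. *)
Fact dinj_fin (x : forall i, M i) i :
  exists s : seq I, forall j, j \notin s -> (if j == i then x j else 0) = 0.
Proof. by exists [:: i] => j; rewrite inE => /negbTE ->. Qed.
Definition dinj (x : forall i, M i) i : dsum := DSum (dinj_fin x i).

End DirectSum.

(* [ge i], [gf i] : i in 'I_n is the usual index i.+1 in 1..n;
   [gd a], [gdV a] : a in 'I_n.+1 is the usual index a.+1 in 1..n+1. *)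
Inductive gen (n : nat) :=
  | ge of 'I_n | gf of 'I_n | gd of 'I_n.+1 | gdV of 'I_n.+1.

Section GenChoice.
Variable n : nat.
Definition gen_enc (x : gen n) : 'I_n + 'I_n + ('I_n.+1 + 'I_n.+1) :=
  match x with
  | ge i => inl (inl i) | gf i => inl (inr i)
  | gd a => inr (inl a) | gdV a => inr (inr a)
  end.
Definition gen_dec (x : 'I_n + 'I_n + ('I_n.+1 + 'I_n.+1)) : gen n :=
  match x with
  | inl (inl i) => ge i | inl (inr i) => gf i
  | inr (inl a) => gd a | inr (inr a) => gdV a
  end.
Fact gen_encK : cancel gen_enc gen_dec. Proof. by case. Qed.
HB.instance Definition _ := Equality.copy (gen n) (can_type gen_encK).
HB.instance Definition _ := Choice.copy (gen n) (can_type gen_encK).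
End GenChoice.

Section Relations.
Variables (n : nat) (A : lalgType Qv).
Variables (e f : 'I_n -> A) (d dV : 'I_n.+1 -> A).
Implicit Types (i j : 'I_n) (a b : 'I_n.+1).

Let lo i : 'I_n.+1 := widen_ord (leqnSn n) i.
Let hi i : 'I_n.+1 := lift ord0 i.
Let qnt2 : Qv := v + v^-1.

(* The exponents of v in d_a e_j d_a^-1 and d_a f_j d_a^-1. *)
Definition wt_e a j : int :=
  - Posz (a.+1 == j.+2)%N - Posz ((dimN n).+1 - a.+1 == j.+2)%N
  + Posz (a.+1 == j.+1)%N.
Definition wt_f a j : int :=
  - Posz (a.+1 == j.+1)%N + Posz (a.+1 == j.+2)%N
  + Posz ((dimN n).+1 - a.+1 == j.+2)%N.

Let T i : A := v *: (d (lo i) * dV (hi i)) + v^-1 *: (dV (lo i) * d (hi i)).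

Definition adj_idx i j : bool := (i.+1 == j :> nat) || (j.+1 == i :> nat).
Definition far_idx i j : bool := (i.+1 < j)%N || (j.+1 < i)%N.

(* The defining relations "left = right" of U^j, for elements of [A]. *)
Inductive Urel : A -> A -> Prop :=
  | Udv a : Urel (d a * dV a) 1
  | Uvd a : Urel (dV a * d a) 1
  | Udd a b : Urel (d a * d b) (d b * d a)
  | Ude a j : Urel (d a * e j * dV a) (v ^ wt_e a j *: e j)
  | Udf a j : Urel (d a * f j * dV a) (v ^ wt_f a j *: f j)
  | Uef i j : ~~ ((i == j) && (i.+1 == n)) ->
      Urel (e i * f j - f j * e i)
           (if i == j then
              (v - v^-1)^-1 *: (d (lo i) * dV (hi i) - dV (lo i) * d (hi i))
            else 0)
  | Ueee i j : adj_idx i j ->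
      Urel (e i ^+ 2 * e j + e j * e i ^+ 2) (qnt2 *: (e i * e j * e i))
  | Ufff i j : adj_idx i j ->
      Urel (f i ^+ 2 * f j + f j * f i ^+ 2) (qnt2 *: (f i * f j * f i))
  | Uee i j : far_idx i j -> Urel (e i * e j) (e j * e i)
  | Uff i j : far_idx i j -> Urel (f i * f j) (f j * f i)
  | Uffe i : i.+1 = n ->
      Urel (f i ^+ 2 * e i + e i * f i ^+ 2)
           (qnt2 *: (f i * e i * f i - T i * f i))
  | Ueef i : i.+1 = n ->
      Urel (e i ^+ 2 * f i + f i * e i ^+ 2)
           (qnt2 *: (e i * f i * e i - e i * T i)).

Inductive Uideal : A -> Prop :=
  | Uideal0 : Uideal 0
  | UidealD x y l r z : Uideal x -> Urel l r -> Uideal (x + y * (l - r) * z).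

Lemma Uideal_add x y : Uideal x -> Uideal y -> Uideal (x + y).
Proof.
move=> hx; elim=> [|y' a l r b _ h hr]; first by rewrite addr0.
by rewrite addrA; apply: UidealD.
Qed.

Lemma Uideal_mul x y z : Uideal x -> Uideal (y * x * z).
Proof.
elim=> [|x' a l r b _ h hr]; first by rewrite mulr0 mul0r; left.
by rewrite mulrDr mulrDl !mulrA -(mulrA _ b z); apply: UidealD.
Qed.

Fact Uideal_submod : submod_closed (fun x => `[< Uideal x >]).
Proof.
split; first by apply/asboolP; left.
move=> c x y /asboolP hx /asboolP hy; apply/asboolP/Uideal_add => //.
by rewrite -[x]mul1r scalerAl -[_ * _]mulr1; apply: Uideal_mul.
Qed.

Section Counit.
Variables (K : comNzRingType) (phi : Qv -> K) (c : A -> K).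
Hypothesis cD : {morph c : x y / x + y}.
Hypothesis cB : {morph c : x y / x - y}.
Hypothesis cM : {morph c : x y / x * y}.
Hypotheses (c1 : c 1 = 1) (c0 : c 0 = 0).
Hypothesis cZ : forall (q : Qv) x, c (q *: x) = phi q * c x.
Hypotheses (ce : forall i, c (e i) = 0) (cf : forall i, c (f i) = 0).
Hypotheses (cd : forall a, c (d a) = 1) (cdV : forall a, c (dV a) = 1).

Fact Urel_counit l r : Urel l r -> c l = c r.
Proof.
case=> [a|a|a b|a j|a j|i j _|i j _|i j _|i j _|i j _|i _|i _];
  rewrite ?expr2.
- by rewrite cM cd cdV c1 mulr1.
- by rewrite cM cd cdV c1 mulr1.
- by rewrite !cM !cd.
- by rewrite cZ !cM ce !(mulr0, mul0r).
- by rewrite cZ !cM cf !(mulr0, mul0r).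
- rewrite cB !cM ce cf !(mulr0, mul0r, subrr); case: ifP => _; last by rewrite c0.
  by rewrite cZ cB !cM !cd !cdV mulr1 subrr mulr0.
- by rewrite cD cZ !cM !ce !(mulr0, mul0r, addr0).
- by rewrite cD cZ !cM !cf !(mulr0, mul0r, addr0).
- by rewrite !cM !ce.
- by rewrite !cM !cf.
- by rewrite cD cZ cB !cM ce cf !(mulr0, mul0r, addr0, subrr).
- by rewrite cD cZ cB !cM ce cf !(mulr0, mul0r, addr0, subrr).
Qed.

Fact Uideal_proper : ~ Uideal 1.
Proof.
suff h x : Uideal x -> c x = 0 by move/h/eqP; rewrite c1 oner_eq0.
elim=> [//|x' y l r z _ IH /Urel_counit e0].
by rewrite cD IH !cM cB e0 subrr mulr0 mul0r addr0.
Qed.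
End Counit.

End Relations.

Definition Ufree (n : nat) : lalgType Qv := {malg Qv[{fmonom gen n}]}.
Definition Ugen n (x : gen n) : Ufree n := << fmu x >>.

Definition Uj_ideal n : Ufree n -> Prop :=
  @Uideal n (Ufree n) (fun i => Ugen (ge i)) (fun i => Ugen (gf i))
    (fun a => Ugen (gd a)) (fun a => Ugen (gdV a)).

Section UjAlg.
Variable n : nat.

Fact Uj_ideal_submod : submod_closed (fun x : Ufree n => `[< Uj_ideal x >]).
Proof. exact: Uideal_submod. Qed.

Let counit_gen (x : gen n) : Qv := if x is (gd _ | gdV _) then 1 else 0.
Let counit_word (m : {fmonom gen n}) : Qv := \prod_(x <- m) counit_gen x.

Fact counit_word_mmorph : mmorphism counit_word.
Proof.
split; last by rewrite /counit_word fm1 big_nil.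
by move=> x y; rewrite /counit_word fmM big_cat.
Qed.
HB.instance Definition _ :=
  monalg.isMultiplicative.Build _ _ counit_word counit_word_mmorph.

Let counit (x : Ufree n) : Qv := mmap idfun counit_word x.

Fact Uj_ideal_proper : ~ Uj_ideal (1 : Ufree n).
Proof.
have cG x : counit (Ugen x) = counit_gen x.
  by rewrite /counit mmapU mul1r /counit_word fmuE big_seq1.
apply: (@Uideal_proper _ _ _ _ _ _ Qv idfun counit).
- by move=> x y; exact: raddfD.
- by move=> x y; exact: raddfB.
- by move=> x y; exact: rmorphM.
- exact: rmorph1.
- exact: raddf0.
- by move=> q x; exact: mmapZ.
- by move=> i; exact: cG.
- by move=> i; exact: cG.
- by move=> a; exact: cG.
- by move=> a; exact: cG.
Qed.

Fact Ufree_scalerAr (c : Qv) (x y : Ufree n) : c *: (x * y) = x * (c *: y).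
Proof.
have cc (z : {malg Qv[{fmonom gen n}]}) : c%:MP * z = z * c%:MP.
  rewrite [z]monalgE mulr_sumr mulr_suml; apply: eq_bigr => m _.
  by rewrite !malgM_def !fgmulUU mul1m mulm1 mulrC.
by rewrite -[LHS]mul_malgC -[c *: y]mul_malgC mulrA cc -mulrA.
Qed.

End UjAlg.

Fact Uj_ideal_mul n (x y z : Ufree n) :
  `[< Uj_ideal x >] -> `[< Uj_ideal (y * x * z) >].
Proof. by move=> /asboolP h; apply/asboolP; exact: Uideal_mul. Qed.

Fact Uj_ideal_1 n : ~~ `[< @Uj_ideal n 1 >].
Proof. by apply/asboolP; exact: Uj_ideal_proper. Qed.

Definition Uj (n : nat) : algType Qv :=
  quota_of (Uj_ideal_submod n) (@Uj_ideal_mul n) (Uj_ideal_1 n)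
           (@Ufree_scalerAr n).

Definition Uj_pi n (x : Ufree n) : Uj n := quotl_pi (Uj_ideal_submod n) x.

Lemma Uj_piM n (x y : Ufree n) : Uj_pi (x * y) = Uj_pi x * Uj_pi y.
Proof. by symmetry; exact: quota_mulE. Qed.

Lemma Uj_piZ n (c : Qv) (x : Ufree n) : Uj_pi (c *: x) = c *: Uj_pi x.
Proof. exact: qpiZ. Qed.

Lemma Uj_pi_eq n (x y : Ufree n) : Uj_pi x = Uj_pi y <-> Uj_ideal (x - y).
Proof.
split=> [/eqP|h].
  by rewrite [_ == _]quotl_eq => /asboolP.
by apply/eqP; rewrite [_ == _]quotl_eq; apply/asboolP.
Qed.

Definition Uj_gen n (x : gen n) : Uj n := Uj_pi (Ugen x).

Section SideSpan.
Variables (R : pzRingType) (A : algType R) (I : finType) (s t : I -> A).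

(* sum_a s_a A + sum_a A t_a *)
Definition side_span (x : A) : bool :=
  `[< exists y z : I -> A, x = \sum_a s a * y a + \sum_a z a * t a >].

Fact side_span_submod : submod_closed side_span.
Proof.
split.
  apply/asboolP; exists (fun _ => 0), (fun _ => 0).
  by rewrite !big1 ?addr0 // => a _; rewrite ?mulr0 ?mul0r.
move=> c _ _ /asboolP[y [z ->]] /asboolP[y' [z' ->]]; apply/asboolP.
exists (fun a => c *: y a + y' a), (fun a => c *: z a + z' a).
rewrite scalerDr addrACA.
congr (_ + _); rewrite scaler_sumr -big_split; apply: eq_bigr => a _ /=.
  by rewrite mulrDr scalerAr.
by rewrite mulrDl scalerAl.
Qed.
End SideSpan.

Section Modified.
Variable n : nat.
Implicit Types (la mu : tXi_diag n) (x y : Uj n).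

Definition diag_ent la (a : 'I_n.+1) : int :=
  val (val la) (inord a) (inord a).

Definition dshift la (a : 'I_n.+1) : Uj n :=
  Uj_gen (gd a) - (v ^ (- diag_ent la a))%:A.

(* sum_a (d_a - v^{-la_a}) U + sum_a U (d_a - v^{-mu_a}) *)
Definition in_J la mu : Uj n -> bool := side_span (dshift la) (dshift mu).

Fact in_J_submod la mu : submod_closed (in_J la mu).
Proof. exact: side_span_submod. Qed.

Definition Ublock (p : tXi_diag n * tXi_diag n) : lmodType Qv :=
  quotl (in_J_submod p.1 p.2).

Definition Udot : lmodType Qv := dsum Ublock.

(* pi_{la,mu} : U -> Udot *)
Definition Upi la mu (x : Uj n) : Udot :=
  dinj (fun p => quotl_pi (in_J_submod p.1 p.2) x : Ublock p) (la, mu).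

(* [x] is homogeneous of the weight compatible with (la,mu). *)
Definition homog la mu (x : Uj n) : Prop :=
  forall a, Uj_gen (gd a) * x * Uj_gen (gdV a)
            = v ^ (diag_ent mu a - diag_ent la a) *: x.

Definition is_Udot_product (m : Udot -> Udot -> Udot) : Prop :=
  bilinear_op m /\
  forall la la' mu mu' x y, homog la la' x -> homog mu mu' y ->
    m (Upi la la' x) (Upi mu mu' y) =
    if la' == mu then Upi la mu' (x * y) else 0.

Definition Udot_mul : Udot -> Udot -> Udot :=
  the (fun _ _ => 0) is_Udot_product.

Definition Did la : Udot := Upi la la 1.

End Modified.

Section Moves.
Variable n : nat.
Implicit Types (la : tXi_diag n) (r s : 'I_(dimN n)).

Lemma Eth_rot r s : rot_sym (Eth r s).
Proof.
apply/forallP => i; apply/forallP => j; apply/eqP.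
rewrite !mxE !(inj_eq rev_ord_inj).
by rewrite ![rev_ord _ == _](can2_eq rev_ordK rev_ordK) addrC.
Qed.

Lemma Eth_ge0 r s i j : 0 <= Eth r s i j.
Proof. by rewrite !mxE addr_ge0 // ler0n. Qed.

Lemma Eth_diag r : is_diag_mx (Eth r r).
Proof.
apply/is_diag_mxP => i j ij; rewrite !mxE.
suff h x : (i == x) && (j == x) = false by rewrite !h.
by apply: contraNF ij => /andP[/eqP-> /eqP->].
Qed.

Lemma rev_center : rev_ord (inord n : 'I_(dimN n)) = inord n.
Proof.
have h : (n < dimN n)%N by rewrite ltnS -addnn leq_addr.
by apply: val_inj; rewrite /= inordK // subSS -addnn addnK.
Qed.

Lemma Eth_center r s : Eth r s (inord n) (inord n) =
  ((r == inord n) && (s == inord n))%:Z * 2.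
Proof.
rewrite !mxE ![inord n == _]eq_sym ![rev_ord _ == _](can2_eq rev_ordK rev_ordK).
by rewrite !rev_center; case: (_ && _).
Qed.

Lemma rot_symD m (A B : 'M[int]_m) : rot_sym A -> rot_sym B -> rot_sym (A + B).
Proof.
move=> /forallP hA /forallP hB; apply/forallP=> i; apply/forallP=> j.
by have /forallP/(_ j)/eqP := hA i; have /forallP/(_ j)/eqP := hB i; rewrite !mxE => -> ->.
Qed.

Lemma rot_symN m (A : 'M[int]_m) : rot_sym A -> rot_sym (- A).
Proof.
move=> /forallP hA; apply/forallP=> i; apply/forallP=> j.
by have /forallP/(_ j)/eqP := hA i; rewrite !mxE => ->.
Qed.

(* la - E^theta_ss + E^theta_rs *)
Definition move_mx r s la : 'M[int]_(dimN n) :=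
  val (val la) - Eth s s + Eth r s.

Fact move_in_tXi r s la : in_tXi (move_mx r s la).
Proof.
have /and3P[hla odd_la rot_la] := valP (val la).
have /is_diag_mxP dla := valP la.
apply/and3P; split.
- apply/forallP=> i; apply/forallP=> j; apply/implyP=> ij.
  have /is_diag_mxP dE := Eth_diag s.
  by rewrite mxE [X in X + _]mxE [X in _ + X + _]mxE dla // dE // subr0 add0r Eth_ge0.
- rewrite mxE [X in X + _]mxE [X in _ + X + _]mxE !Eth_center -addrA.
  by rewrite -mulNr -mulrDl rpredDr // dvdz_mull.
- by apply: rot_symD; [apply: rot_symD => //; apply: rot_symN|]; exact: Eth_rot.
Qed.

Definition move r s la : tXi n :=
  exist (fun A => is_true (in_tXi A)) _ (move_in_tXi r s la).

(* la - E^theta_ss + E^theta_rr *)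
Definition wmove_mx r s la : 'M[int]_(dimN n) :=
  val (val la) - Eth s s + Eth r r.

Fact wmove_diag r s la : is_diag_mx (wmove_mx r s la).
Proof.
apply/is_diag_mxP => i j ij; have /is_diag_mxP dla := valP la.
have /is_diag_mxP dr := Eth_diag r; have /is_diag_mxP ds := Eth_diag s.
by rewrite mxE [X in X + _]mxE [X in _ + X + _]mxE dla // dr // ds // subr0 addr0.
Qed.

Fact wmove_in_tXi r s la : in_tXi (wmove_mx r s la).
Proof.
have /and3P[hla odd_la rot_la] := valP (val la).
apply/and3P; split.
- apply/forallP=> i; apply/forallP=> j; apply/implyP=> ij.
  by have /is_diag_mxP -> := wmove_diag r s la.
- rewrite mxE [X in X + _]mxE [X in _ + X + _]mxE !Eth_center -addrA.
  by rewrite -mulNr -mulrDl rpredDr // dvdz_mull.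
- by apply: rot_symD; [apply: rot_symD => //; apply: rot_symN|]; exact: Eth_rot.
Qed.

Definition wmove r s la : tXi_diag n :=
  exist (fun A : tXi n => is_true (is_diag_mx (val A)))
    (exist (fun A => is_true (in_tXi A)) _ (wmove_in_tXi r s la))
    (wmove_diag r s la).
End Moves.

Section GenImages.
Variable n : nat.
Implicit Types (la : tXi_diag n) (i : 'I_n).

(* The indices i and i+1, for the generator number [i.+1]. *)
Definition lo i : 'I_(dimN n) := inord i.
Definition hi i : 'I_(dimN n) := inord i.+1.

Lemma inordN (k : nat) : (k <= n)%N -> (inord k : 'I_(dimN n)) = k :> nat.
Proof. by move=> h; rewrite inordK // ltnS (leq_trans h) // -addnn leq_addr. Qed.

Lemma Eth_ent (r : 'I_(dimN n)) (a : 'I_n.+1) :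
  Eth r r (inord a) (inord a) =
  Posz (r == a :> nat) + Posz ((dimN n).+1 - a.+1 == r.+1)%N.
Proof.
have ha : (a <= n)%N by rewrite -ltnS.
rewrite !mxE !andbb -!natz ![inord a == _]eq_sym; congr (_%:R + _%:R).
  by rewrite -val_eqE /= inordN.
rewrite ![rev_ord _ == _](can2_eq rev_ordK rev_ordK) -val_eqE /= inordN //.
rewrite !subSS; congr (nat_of_bool _).
have := ltn_ord r; move: (val r) => k hk.
by lia.
Qed.

Lemma diag_ent_wmove r s la a :
  diag_ent (wmove r s la) a = diag_ent la a
    - Eth s s (inord a) (inord a) + Eth r r (inord a) (inord a).
Proof.
rewrite -[LHS]/(wmove_mx r s la (inord a) (inord a)).
by rewrite mxE [X in X + _]mxE [X in _ + X + _]mxE.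
Qed.

Lemma Uj_homog (la mu : tXi_diag n) (x : gen n) (w : 'I_n.+1 -> int) :
  (forall a, Urel (fun i => Ugen (ge i)) (fun i => Ugen (gf i))
               (fun a => Ugen (gd a)) (fun a => Ugen (gdV a))
               (Ugen (gd a) * Ugen x * Ugen (gdV a)) (v ^ w a *: Ugen x)) ->
  (forall a, w a = diag_ent mu a - diag_ent la a) ->
  homog la mu (Uj_gen x).
Proof.
move=> hr hw a; rewrite -hw /Uj_gen -!Uj_piM -Uj_piZ; apply/Uj_pi_eq.
set l := (X in X - _); set r := (X in _ - X).
have -> : l - r = 0 + 1 * (l - r) * 1 by rewrite add0r mul1r mulr1.
by apply: UidealD; [left|exact: hr].
Qed.

(* In the U^j-bimodule Udot, x D_la = pi_{mu,la}(x) for x homogeneous of the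
   weight compatible with (mu,la). *)
Definition eD i la : Udot n :=
  Upi (wmove (hi i) (lo i) la) la (Uj_gen (ge i)).

Definition fD i la : Udot n :=
  Upi (wmove (lo i) (hi i) la) la (Uj_gen (gf i)).

Lemma homog_e i la : homog (wmove (hi i) (lo i) la) la (Uj_gen (ge i)).
Proof.
apply: (@Uj_homog _ _ _ (fun a => wt_e a i)) => [a|a]; first exact: Ude.
rewrite diag_ent_wmove !Eth_ent /wt_e /lo /hi !inordN ?(ltnW (ltn_ord i)) //.
have := ltn_ord i; have := ltn_ord a; move: (diag_ent la a) => x; lia.
Qed.

Lemma homog_f i la : homog (wmove (lo i) (hi i) la) la (Uj_gen (gf i)).
Proof.
apply: (@Uj_homog _ _ _ (fun a => wt_f a i)) => [a|a]; first exact: Udf.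
rewrite diag_ent_wmove !Eth_ent /wt_f /lo /hi !inordN ?(ltnW (ltn_ord i)) //.
have := ltn_ord i; have := ltn_ord a; move: (diag_ent la a) => x; lia.
Qed.

End GenImages.

(* Main.v *)
From HB Require Import structures.
Require Import Defs.
From mathcomp Require Import all_boot all_order all_algebra all_field finmap.
From mathcomp Require Import mxabelem boolp monalg zify ring.

Set Implicit Arguments.
Unset Strict Implicit.
Unset Printing Implicit Defensive.

Import Defs Order.TTheory GRing.Theory Num.Theory.
Local Open Scope ring_scope.

(* Indices start at 0, and B_r (0 <= r < 2n) is e_{r+1} for r < n and f_{2n-r}
   for r >= n.  On the basis of the Schur algebra, multiplication by the
   generator B_r moves one unit of some column p from row r to row r+1 (and
   symmetrically); over a finite field this is a count of the isotropic lines
   between two members of a flag.  After adding 2pI the coefficients are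
   polynomials in v^{-2p}, hence B_r acts on K^j, and K^j is generated by the
   B_r and the idempotents because the matrix obtained by the largest possible
   move is the leading term; this determines the product of K^j.

   The relations of U^j hold for these operators on the diagonal matrices,
   which gives aleph.  Conversely, modulo the d_a and words of smaller length
   the B_r satisfy only the Serre relations of type A_{2n}, so that U^j is spanned
   by the words made of blocks B_{2n-1}^{c_{2n-1}} ... B_j^{c_j} with
   c_{2n-1} <= ... <= c_j, for j = 0, ..., 2n-1.  Applied to a diagonal matrix,
   such a word has a leading term A, and A determines the word: the c_i are sums
   of the entries of A in column j below row i.  Hence aleph maps a spanning
   family onto a basis by a unitriangular matrix. *)

(** [gpoly], [Kj_mul] and [Udot_mul] are definite descriptions, so each object must be shown to
    exist and to have the expected values. For [gpoly] the obstacle is integrality: solving the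
    recursion for the leading term means dividing in Z[X], which works because the divisor is monic
    and the quotient takes integer values at arbitrarily large odd primes; nonempty orbits over such
    fields give uniqueness. For K^j the computation takes place over Q(v)[t]: what holds after t =
    v^{-2m} for all large m holds for polynomials, so associativity is inherited from the Schur
    algebras, whereas integrality at t = 1, that is m = 0, has to be carried down from large m. The
    product of the modified algebra is obtained by transport of structure, hence aleph is proved
    bijective as a linear map before any product is available on its source. No basis of U^j has to
    be known beforehand: a spanning set of each block, indexed by matrices, suffices, because its
    images in K^j are independent. *)

(* [lia] is slow in the presence of many non-arithmetical hypotheses. *)
Ltac arith_type T :=
  match T with
  | is_true (leq _ _) => idtac
  | is_true (_ && _) => idtac
  | is_true (_ || _) => idtac
  | is_true (~~ _) => idtac
  | is_true (@eq_op ?U _ _) => let V := eval hnf in (Equality.sort U) in first [unify V nat | unify V int]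
  | @eq ?U _ _ => first [unify U nat | unify U bool | unify U int]
  | not (@eq ?U _ _) => first [unify U nat | unify U int]
  | is_true (@Order.le _ int _ _) => idtac
  | is_true (@Order.lt _ int _ _) => idtac
  end.
Ltac nlia :=
  repeat match goal with H : ?T |- _ =>
    tryif arith_type T then fail else clear H end; lia.

(** * Quadratic forms over finite fields of odd order *)

Section OddField.
Variable F : finFieldType.
Hypothesis oddF : odd #|F|.

Lemma odd_field_2 : (2%:R : F) != 0.
Proof.
apply/eqP => h2; have c2 : 2 \in [pchar F] by rewrite inE h2 eqxx.
have [m hm] : exists m, #|F| = (2 ^ m)%N.
  by exists (logn 2 #|F|); exact: (card_pprimeChar c2).
have := finNzRing_gt1 F; move: oddF; rewrite hm oddX orbF => /eqP ->.
by rewrite ltnn.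
Qed.

(** Squaring is at most two-to-one, which gives the weak inequality; the two sides differ in
    parity. *)
Lemma card_squares : (#|F| < 2 * #|[set x ^+ 2 | x : F]|)%N.
Proof.
have h : (#|F| <= 2 * #|[set x ^+ 2 | x : F]|)%N.
  rewrite -[#|F|]sum1_card (partition_big (fun x : F => x ^+ 2)
    (fun y => y \in [set x ^+ 2 | x : F])) /=; last first.
    by move=> x _; apply/imsetP; exists x.
  rewrite mulnC -sum_nat_const; apply: leq_sum => y /imsetP[x _ ->].
  rewrite sum1_card; apply: leq_trans (_ : #|[set x; -x]| <= _)%N.
    apply/subset_leq_card/subsetP=> z hz; have {hz} : z ^+ 2 == x ^+ 2 := hz.
    by rewrite eqf_sqr !inE.
  by rewrite cards2; case: eqP.
rewrite ltn_neqAle h andbT; apply: contraTneq oddF => ->.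
by rewrite oddM.
Qed.

(** Pigeonhole: the squares and the elements [e - d * s], [s] a square, each make up more than half
    of the field. *)
Lemma binary_form_onto (d e : F) : d != 0 ->
  exists x y : F, x ^+ 2 + d * y ^+ 2 = e.
Proof.
move=> d0; pose S := [set x ^+ 2 | x : F]; pose T := [set e - d * s | s in S].
have cT : #|T| = #|S|.
  by rewrite card_imset // => s t /addrI/oppr_inj/(mulfI d0).
have := cardsUI S T; have := card_squares; rewrite -/S => h1.
case: (set_0Vmem (S :&: T)) => [->|[z]].
  rewrite cards0 addn0 cT => h2.
  have := subset_leq_card (subsetT (S :|: T)); rewrite cardsT h2.
  by move: h1; move: #|S| #|F| => k l; lia.
rewrite inE => /andP[/imsetP[x _ ->] /imsetP[_ /imsetP[y _ ->] h]] _.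
by exists x, y; rewrite h subrK.
Qed.

Definition nbin (a b c : F) := #|[set st : F * F | a * st.1 ^+ 2 + b * st.2 ^+ 2 == c]|.
Arguments nbin (a b c)%_R.

(* Multiplication by an element of norm [e] of F[sqrt(-b/a)]. *)
Lemma nbin_le (a b c e : F) : a != 0 -> b != 0 -> e != 0 ->
  (nbin a b c <= nbin a b (c * e))%N.
Proof.
move=> a0 b0 e0; have d0 : b / a != 0 by rewrite mulf_neq0 ?invr_neq0.
have [x [y exy]] := binary_form_onto e d0; set d := b / a in d0 exy.
pose f (st : F * F) := (st.1 * x - d * st.2 * y, st.1 * y + st.2 * x).
have fi : injective f.
  apply: (can_inj (g := fun uv => ((uv.1 * x + d * uv.2 * y) / e,
                                   (uv.2 * x - uv.1 * y) / e))).
  by move=> [s t]; rewrite /f /=; congr (_, _); rewrite -exy; field; rewrite exy.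
rewrite /nbin -(card_imset _ fi); apply/subset_leq_card/subsetP => _ /imsetP[[s t] + ->].
rewrite !inE /= => /eqP <-; rewrite -exy; apply/eqP.
have -> : b = a * d by rewrite /d mulrCA divff ?mulr1.
ring.
Qed.

Lemma nbin_const (a b c c' : F) : a != 0 -> b != 0 -> c != 0 -> c' != 0 ->
  nbin a b c = nbin a b c'.
Proof.
move=> a0 b0 c0 c'0; apply/eqP; rewrite eqn_leq; apply/andP; split.
  have := @nbin_le a b c (c' / c) a0 b0; rewrite mulf_neq0 ?invr_neq0 // => /(_ isT).
  by rewrite mulrCA divff // mulr1.
have := @nbin_le a b c' (c / c') a0 b0; rewrite mulf_neq0 ?invr_neq0 // => /(_ isT).
by rewrite mulrCA divff // mulr1.
Qed.

Lemma nbin_sum (a b : F) : a != 0 -> b != 0 ->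
  (nbin a b 0 + (#|F|).-1 * nbin a b 1 = #|F| ^ 2)%N.
Proof.
move=> a0 b0; have -> : (#|F| ^ 2)%N = #|{: F * F}| by rewrite card_prod.
rewrite -[RHS]sum1_card (partition_big (fun st : F * F => a * st.1 ^+ 2 + b * st.2 ^+ 2)
    predT) //= (bigD1 0) //=; congr (_ + _)%N.
  by rewrite sum1_card /nbin; apply: eq_card => st; rewrite inE.
rewrite (eq_bigr (fun _ => nbin a b 1)) => [|c c0].
  rewrite sum_nat_const; congr (_ * _)%N.
  by rewrite -(cardC1 (0 : F)); apply: eq_card.
rewrite -(@nbin_const a b c) ?oner_eq0 // sum1_card /nbin.
by apply: eq_card => st; rewrite inE.
Qed.
End OddField.
Arguments nbin {F} (a b c)%_R.

(** * Isotropic vectors of a possibly degenerate form *)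

Section QuadCount.
Variables (F : finFieldType) (D : nat) (B : 'M[F]_D).
Hypotheses (oddF : odd #|F|) (Bs : B^T = B).
Implicit Types (x y u w : 'rV[F]_D) (Y Z : 'M[F]_D).

Definition bil x y : F := (x *m B *m y^T) 0 0.
Definition nval (Y : 'M[F]_D) (c : F) := #|[set w : 'rV_D | (w <= Y)%MS && (bil w w == c)]|.
Arguments nval Y c%_R.

Lemma bilC x y : bil x y = bil y x.
Proof.
rewrite /bil -[LHS]/((x *m B *m y^T) 0 0).
have <- : (y *m B *m x^T)^T = x *m B *m y^T by rewrite !trmx_mul trmxK Bs mulmxA.
by rewrite mxE.
Qed.

Lemma bilDl x x' y : bil (x + x') y = bil x y + bil x' y.
Proof. by rewrite /bil !mulmxDl mxE. Qed.
Lemma bilZl a x y : bil (a *: x) y = a * bil x y.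
Proof. by rewrite /bil -!scalemxAl mxE. Qed.
Lemma bilDr x y y' : bil x (y + y') = bil x y + bil x y'.
Proof. by rewrite bilC bilDl ![bil _ x]bilC. Qed.
Lemma bilZr a x y : bil x (a *: y) = a * bil x y.
Proof. by rewrite bilC bilZl bilC. Qed.

Lemma orthcP m n (W : 'M[F]_(m, D)) (U : 'M[F]_(n, D)) :
  reflect (forall w u, (w <= W)%MS -> (u <= U)%MS -> bil w u = 0)
          (W <= kermx (B *m U^T))%MS.
Proof.
apply: (iffP sub_kermxP) => [h w u /submxP[a ->] /submxP[b ->]|h].
  rewrite /bil trmx_mul.
  have -> : a *m W *m B *m (U^T *m b^T) = a *m (W *m (B *m U^T)) *m b^T by rewrite !mulmxA.
  by rewrite h mulmx0 mul0mx mxE.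
apply/matrixP=> i j; rewrite [RHS]mxE -[RHS](h (row i W) (row j U)) ?row_sub //.
by rewrite /bil tr_row mulmxA -!row_mul !mxE; apply: eq_bigr => k _; rewrite !mxE.
Qed.

Lemma sub_orth1 w x : (w <= kermx (B *m x^T))%MS = (bil w x == 0).
Proof.
apply/idP/eqP => [/orthcP|h]; first by apply.
by apply/orthcP=> w' x' /sub_rVP[a ->] /sub_rVP[b ->]; rewrite bilZl bilZr h !mulr0.
Qed.

Lemma card_sub Y : #|[set w : 'rV_D | (w <= Y)%MS]| = (#|F| ^ \rank Y)%N.
Proof. by rewrite -card_rowg; apply: eq_card => w; rewrite !inE. Qed.

Section Split.
Variables (Y : 'M[F]_D) (x : 'rV[F]_D).
Hypotheses (xY : (x <= Y)%MS) (x0 : bil x x != 0).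
Let Y' := (Y :&: kermx (B *m x^T))%MS.

Let in_Y' w : (w <= Y')%MS = (w <= Y)%MS && (bil w x == 0).
Proof. by rewrite sub_capmx sub_orth1. Qed.

Let proj_Y' w : (w <= Y)%MS -> (w - (bil w x / bil x x) *: x <= Y')%MS.
Proof.
move=> wY; rewrite in_Y' addmx_sub //= ?eqmx_opp ?scalemx_sub //.
by rewrite bilDl -scaleN1r !bilZl divfK // mulN1r subrr.
Qed.

(** Orthogonal decomposition along the anisotropic vector [x]: the component [s *: x] fixes the
    value that is left for the component in the complement. *)
Lemma nval_split c : nval Y c = (\sum_(s : F) nval Y' (c - bil x x * s ^+ 2))%N.
Proof.
rewrite /nval -sum1_card (partition_big (fun w => bil w x / bil x x) predT) //=.
apply: eq_bigr => s _; rewrite sum1_card.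
have i2 : injective (fun w : 'rV[F]_D => w + s *: x) by move=> u w /addIr.
rewrite -[RHS](card_imset _ i2); apply: eq_card => w; rewrite unfold_in /= inE.
apply/idP/imsetP => [/andP[/andP[wY /eqP wc] /eqP ws]|[u + ->]].
  exists (w - s *: x); last by rewrite subrK.
  rewrite inE -ws proj_Y' //=.
  rewrite -scaleNr !bilDl !bilDr !bilZl !bilZr wc (bilC x w) -subr_eq0.
  by apply/eqP; field.
rewrite inE in_Y' => /andP[/andP[uY /eqP ux] /eqP uc].
rewrite addmx_sub ?scalemx_sub //= !bilDl !bilDr !bilZl !bilZr uc (bilC x u) ux.
by rewrite add0r mulfK // eqxx andbT; apply/eqP; ring.
Qed.

Lemma rank_split : \rank Y = (\rank Y').+1.
Proof.
have h : (Y :=: Y' + x)%MS.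
  apply/eqmxP/andP; split; last by rewrite addsmx_sub capmxSl xY.
  apply/rV_subP => w wY; rewrite -[w](subrK ((bil w x / bil x x) *: x)).
  by rewrite addmx_sub_adds ?proj_Y' // scalemx_sub.
have xn0 : x != 0 by apply: contraNneq x0 => ->; rewrite /bil mul0mx mul0mx mxE.
rewrite h; have := mxrank_sum_cap Y' x.
have -> : (Y' :&: x)%MS = 0.
  apply/eqP; rewrite -submx0; apply/rV_subP=> w; rewrite sub_capmx in_Y' => /andP[/andP[_ h0]].
  by move=> /sub_rVP[a wa]; move: h0; rewrite wa bilZl mulf_eq0 (negbTE x0) orbF => /eqP ->; rewrite scale0r sub0mx.
by rewrite mxrank0 addn0 rank_rV xn0 addn1.
Qed.

(** Splitting off an anisotropic vector leaves the radical alone, so the induction in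
    [nval_odd_rank] can run through degenerate spaces. *)
Lemma rad_split : (Y :&: kermx (B *m Y^T) :=: Y' :&: kermx (B *m Y'^T))%MS.
Proof.
apply/eqmxP/andP; split; apply/rV_subP => w; rewrite !sub_capmx.
  move=> /andP[wY /orthcP wo]; rewrite wY sub_orth1 wo //= ?eqxx //=.
  by apply/orthcP => w' u w'w; rewrite in_Y' => /andP[uY _]; apply: wo.
move=> /andP[/andP[wY wx] /orthcP wo]; rewrite wY; apply/orthcP => w' u w'w uY.
rewrite -[u](subrK ((bil u x / bil x x) *: x)) bilDr wo ?proj_Y' // add0r bilZr.
by case/sub_rVP: w'w => a ->; rewrite bilZl; move: wx; rewrite sub_orth1 => /eqP ->; rewrite !mulr0.
Qed.
End Split.

Lemma isotropic_bil0 Y : (forall w, (w <= Y)%MS -> bil w w = 0) ->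
  forall u w, (u <= Y)%MS -> (w <= Y)%MS -> bil u w = 0.
Proof.
move=> h u w uY wY; have := h (u + w); rewrite addmx_sub // => /(_ isT).
rewrite bilDl !bilDr !h // add0r addr0 (bilC w u) -mulr2n -mulr_natl.
by move/eqP; rewrite mulf_eq0 (negbTE (odd_field_2 oddF)) => /eqP.
Qed.

Lemma anisotropicP Y : (forall w, (w <= Y)%MS -> bil w w = 0) \/
  exists2 x, (x <= Y)%MS & bil x x != 0.
Proof.
case: (pickP [pred x : 'rV[F]_D | (x <= Y)%MS && (bil x x != 0)]) => [x /andP[h1 h2]|h].
  by right; exists x.
by left=> w wY; have := h w; rewrite /= wY /= => /negbFE/eqP.
Qed.

(** When the quotient by the radical has odd dimension, the count does not depend on the type of the
    form; this is why the structure constants are polynomials in q. Two anisotropic vectors are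
    split off at a time: the binary form on them takes all nonzero values equally often, so of the
    remaining space only the number of isotropic vectors matters. *)
Lemma nval_odd_rank Y : odd (\rank Y - \rank (Y :&: kermx (B *m Y^T))%MS) ->
  nval Y 0 = (#|F| ^ (\rank Y).-1)%N.
Proof.
have [k] := ubnP (\rank Y); elim: k => // k IH in Y *; rewrite ltnS => hk.
have [iso|[x xY x0]] := anisotropicP Y.
  have -> : (Y :&: kermx (B *m Y^T) :=: Y)%MS.
    by apply/capmx_idPl/orthcP => u w; apply: isotropic_bil0.
  by rewrite subnn.
have rY := rank_split xY x0; have radY := rad_split xY x0.
have spY := nval_split xY x0.
set Y1 := (Y :&: kermx (B *m x^T))%MS in rY radY spY.
(* If the complement of [x] is totally isotropic, the isotropic vectors of [Y] are exactly the
   vectors of [Y1]. *)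
have [iso|[y yY y0]] := anisotropicP Y1.
  move=> _; rewrite spY (bigD1 0) //= big1 => [|s s0].
    rewrite expr0n mulr0 subr0 addn0 rY /= -card_sub /nval.
    by apply: eq_card => w; rewrite !inE; case: (boolP (w <= _)%MS) => // /iso ->; rewrite eqxx.
  apply: eq_card0 => w; rewrite inE; apply/negP => /andP[/iso -> /eqP/esym/eqP].
  by rewrite sub0r oppr_eq0 mulf_eq0 expf_eq0 (negbTE x0) (negbTE s0).
have rY1 := rank_split yY y0; have radY1 := rad_split yY y0.
have spY1 := nval_split yY y0.
set Z := (Y1 :&: kermx (B *m y^T))%MS in rY1 radY1 spY1.
rewrite radY radY1 rY rY1 => od.
have leZ : (\rank (Z :&: kermx (B *m Z^T))%MS <= \rank Z)%N by rewrite mxrankS ?capmxSl.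
have odZ : odd (\rank Z - \rank (Z :&: kermx (B *m Z^T))%MS).
  by move: od; rewrite !subSn //= ?negbK // leqW.
have Z0 : (0 < \rank Z)%N.
  by case: posnP odZ => // ->; rewrite sub0n.
have nZ : nval Z 0 = (#|F| ^ (\rank Z).-1)%N.
  by apply: IH odZ; move: hk; rewrite rY rY1; apply: ltnW.
pose a := bil x x; pose b := bil y y.
have sumN : (\sum_(c : F) nval Z c = #|F| ^ \rank Z)%N.
  rewrite -card_sub -sum1_card (partition_big (fun w => bil w w) predT) //=.
  by apply: eq_bigr => c _; rewrite sum1_card /nval; apply: eq_card => w; rewrite !inE unfold_in /= inE.
rewrite spY.
have -> : (\sum_s nval Y1 (0 - a * s ^+ 2) = \sum_(c : F) nbin a b (- c) * nval Z c)%N.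
  under eq_bigr do rewrite spY1.
  rewrite pair_big /= (partition_big (fun st : F * F => 0 - a * st.1 ^+ 2 - b * st.2 ^+ 2) predT) //=.
  apply: eq_bigr => c _; rewrite (eq_bigr (fun _ => nval Z c)); last first.
    by move=> st /eqP ->.
  rewrite sum_nat_const; congr (_ * _)%N; apply: eq_card => st.
  rewrite !inE unfold_in /= -(inj_eq oppr_inj (a * _ + _)) opprK opprD.
  by rewrite sub0r.
rewrite (bigD1 0) //= oppr0 nZ.
rewrite (eq_bigr (fun c => nbin a b 1 * nval Z c)%N); last first.
  by move=> c c0; rewrite (@nbin_const _ oddF a b (-c) 1) ?oppr_eq0 ?oner_eq0.
rewrite -big_distrr /=.
have := sumN; rewrite (bigD1 0) //= nZ; set S := (\sum_(i | _) _)%N.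
have := @nbin_sum _ oddF a b x0 y0.
have qp : (0 < #|F|)%N by apply/card_gt0P; exists 0.
case: (\rank Z) Z0 => // m _ /=; rewrite !expnS.
move: (#|F| ^ m)%N => qm.
case: #|F| qp => // q _ /= e1 e2.
have -> : S = (q * qm)%N by lia.
rewrite mulnA (mulnC (nbin a b 1)) -mulnDl e1; lia.
Qed.
End QuadCount.

Lemma posz_sum (I : Type) (r : seq I) (P : pred I) (f : I -> nat) :
  (\sum_(i <- r | P i) f i)%N%:Z = \sum_(i <- r | P i) (f i)%:Z.
Proof. by rewrite -natz natr_sum; apply: eq_bigr => i _; rewrite natz. Qed.

(** * Isotropic flags and their orbits *)

Section PartialSums.
Variable m : nat.
Implicit Types M : 'M[int]_m.

(** For a pair of flags in the orbit of [M] this is the dimension of the intersection of the i-th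
    and the j-th member, see [in_orbitP]. *)
Definition psum M (i j : nat) : int :=
  \sum_(k : 'I_m | (k < i)%N) \sum_(l : 'I_m | (l < j)%N) M k l.

Lemma big_ltS (R : zmodType) (f : 'I_m -> R) (i : 'I_m) :
  \sum_(k : 'I_m | (k < i.+1)%N) f k = \sum_(k : 'I_m | (k < i)%N) f k + f i.
Proof.
rewrite (bigD1 i) //= addrC; congr (_ + _); apply: eq_bigl => k.
by rewrite ltnS ltn_neqAle andbC.
Qed.

Lemma psumSl M (i : 'I_m) j :
  psum M i.+1 j = psum M i j + \sum_(l : 'I_m | (l < j)%N) M i l.
Proof. by rewrite /psum big_ltS. Qed.

Lemma psumSS M (i j : 'I_m) :
  psum M i.+1 j.+1 = psum M i j.+1 + psum M i.+1 j - psum M i j + M i j.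
Proof. by rewrite !psumSl big_ltS; ring. Qed.

Lemma psum0l M j : psum M 0 j = 0.
Proof. by rewrite /psum big_pred0. Qed.
Lemma psum0r M i : psum M i 0 = 0.
Proof. by rewrite /psum big1 // => k _; rewrite big_pred0. Qed.

Lemma psumD M M' i j : psum (M + M') i j = psum M i j + psum M' i j.
Proof.
rewrite /psum -big_split; apply: eq_bigr => k _ /=.
by rewrite -big_split; apply: eq_bigr => l _; rewrite mxE.
Qed.
Lemma psumN M i j : psum (- M) i j = - psum M i j.
Proof.
rewrite /psum -sumrN; apply: eq_bigr => k _ /=.
by rewrite -sumrN; apply: eq_bigr => l _; rewrite mxE.
Qed.

Lemma psum_delta (a b : 'I_m) i j :
  psum (delta_mx a b) i j = ((a < i)%N && (b < j)%N)%:Z.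
Proof.
rewrite /psum; case: (ltnP a i) => ai /=; last first.
  rewrite big1 // => k ki; rewrite big1 // => l _; rewrite mxE.
  by case: eqP ki ai => // ->; nlia.
rewrite (bigD1 a) //= [X in _ + X]big1 ?addr0 => [|k /andP[_ /negbTE ka]]; last first.
  by rewrite big1 // => l _; rewrite mxE ka.
case: (ltnP b j) => bj.
  rewrite (bigD1 b) //= big1 ?addr0 => [|l /andP[_ /negbTE lb]].
    by rewrite mxE !eqxx.
  by rewrite mxE lb andbF.
rewrite big1 // => l lj; rewrite mxE.
by case: (l =P b) lj bj => [->|]; [nlia | rewrite andbF].
Qed.

Lemma psum_inj M M' :
  (forall i j, (i <= m)%N -> (j <= m)%N -> psum M i j = psum M' i j) -> M = M'.
Proof.
move=> h; apply/matrixP => i j; have := psumSS M i j; have := psumSS M' i j.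
rewrite !h ?ltn_ord ?(ltnW (ltn_ord _)) // => -> /addrI; by [].
Qed.
End PartialSums.

Notation rlo r := (widen_ord (leqnSn _) r).
Notation rhi r := (lift ord0 r).

(* Adding [mv r p] moves a unit of column [p] from row [r] to row [r+1], and
   symmetrically. *)
Definition mv n (r : 'I_(n.*2)) (p : 'I_(dimN n)) : 'M[int]_(dimN n) :=
  Eth (rhi r) p - Eth (rlo r) p.

(** Only the partial sums in the rows r+1 and N-(r+1) change, just as one step between flags alters
    only these two members. *)
Lemma psum_mv n (r : 'I_(n.*2)) (p : 'I_(dimN n)) i j :
  psum (mv r p) i j =
  ((i == (dimN n - r.+1)%N) && (dimN n - p <= j)%N)%:Z
   - ((i == r.+1) && (p < j)%N)%:Z.
Proof.
rewrite /mv /Eth psumD psumN !psumD !psum_delta /= /bump /=.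
have := ltn_ord r; have := ltn_ord p; move: (val r) (val p) => {}r {}p; nlia.
Qed.

Section Flags.
Variables (n d : nat) (F : finFieldType) (B : 'M[F]_(dimN d)).
Hypotheses (oddF : odd #|F|) (Bs : B^T = B) (Bu : B \in unitmx).
Local Notation D := (dimN d).
Local Notation N := (dimN n).
Local Notation perp := (orthc B).
Implicit Types (U W : 'M[F]_D) (V X : seqsp n d F).

Lemma perpP m (W : 'M[F]_(m, D)) U : reflect (forall w u, (w <= W)%MS -> (u <= U)%MS -> bil B w u = 0)
   (W <= perp U)%MS.
Proof. exact: orthcP. Qed.

Lemma perp_sym W U : (W <= perp U)%MS = (U <= perp W)%MS.
Proof.
by apply/idP/idP => /perpP h; apply/perpP => w u wU uW; rewrite bilC // h.
Qed.

Lemma perpS U W : (U <= W)%MS -> (perp W <= perp U)%MS.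
Proof. by move=> UW; rewrite perp_sym (submx_trans UW) // perp_sym. Qed.

Lemma rank_perp U : \rank (perp U) = (D - \rank U)%N.
Proof.
rewrite mxrank_ker; congr (_ - _)%N; rewrite -mxrank_tr trmx_mul trmxK.
by rewrite mxrankMfree // row_free_unit unitmx_tr.
Qed.

Lemma perpK U : (perp (perp U) :=: U)%MS.
Proof.
apply: eqmx_sym; apply/eqmxP; rewrite -(geq_leqif (mxrank_leqif_eq _)); last by rewrite perp_sym.
by rewrite !rank_perp subKn // rank_leq_row.
Qed.

Lemma perpD U W : (perp (U + W)%MS :=: perp U :&: perp W)%MS.
Proof.
apply/eqmxP/andP; split.
  by rewrite sub_capmx; apply/andP; split; apply: perpS; [apply: addsmxSl | apply: addsmxSr].
by rewrite perp_sym addsmx_sub perp_sym capmxSl perp_sym capmxSr.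
Qed.

Lemma eq_perp U W : (U :=: W)%MS -> (perp U :=: perp W)%MS.
Proof. by move=> e; apply/eqmxP; rewrite !perpS ?e. Qed.

Lemma dim_cap_perp U W : (\rank (perp U :&: perp W) + \rank U + \rank W =
  D + \rank (U :&: W))%N.
Proof.
have := mxrank_sum_cap U W; have := rank_leq_row (U + W)%MS.
have e : \rank (perp U :&: perp W)%MS = (D - \rank (U + W)%MS)%N.
  by rewrite -perpD rank_perp.
by rewrite e; move: (\rank (U + W)%MS) (\rank (U :&: W)%MS) (\rank U) (\rank W) => x1 x2 x3 x4; nlia.
Qed.

Definition fl V (k : nat) : 'M[F]_D := V (inord k).

Lemma fl_lift V (i : 'I_N) : V (lift ord0 i) = fl V i.+1.
Proof. by congr (V _); apply: val_inj; rewrite /= inordK // ltnS. Qed.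
Lemma fl_widen V (i : 'I_N) : V (widen_ord (leqnSn _) i) = fl V i.
Proof. by congr (V _); apply: val_inj; rewrite /= inordK // ltnS ltnW. Qed.

Lemma is_flagP V : reflect
  [/\ forall i, V i = <<V i>>%MS, fl V 0 = 0, (fl V N :=: 1%:M)%MS,
      forall k, (k < N)%N -> (fl V k <= fl V k.+1)%MS &
      forall k, (k <= N)%N -> (fl V k :=: perp (fl V (N - k)))%MS]
  (is_flag B V).
Proof.
have e0 : V ord0 = fl V 0 by congr (V _); apply: val_inj; rewrite /= inordK.
have eN : V ord_max = fl V N by congr (V _); apply: val_inj; rewrite /= inordK.
rewrite /is_flag e0 eN; apply: (iffP and5P) => -[h1 h2 h3 h4 h5]; split.
- by move=> i; apply/eqP/(forallP h1).
- exact/eqP.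
- exact/eqmxP.
- by move=> k kN; have := forallP h4 (Ordinal kN); rewrite fl_lift fl_widen.
- move=> k kN; have /eqmxP := forallP h5 (inord k); rewrite -/(fl V k).
  suff -> : rev_ord (inord k : 'I_N.+1) = inord (N - k) by [].
  by apply: val_inj; rewrite /= !inordK // ?ltnS ?leq_subr // subSS.
- by apply/forallP => i; rewrite -h1.
- exact/eqP.
- exact/eqmxP.
- by apply/forallP => i; rewrite fl_lift fl_widen h4.
- apply/forallP => i; have := h5 i (ltn_ord i); rewrite /fl inord_val => e; apply/eqmxP.
  suff <- : inord (N - i) = rev_ord i by [].
  by apply: val_inj; rewrite /= inordK // ?subSS // ltnS leq_subr.
Qed.

Lemma flag_spec V : is_flag B V ->
  [/\ forall i, V i = <<V i>>%MS, fl V 0 = 0, (fl V N :=: 1%:M)%MS,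
      forall k, (k < N)%N -> (fl V k <= fl V k.+1)%MS &
      forall k, (k <= N)%N -> (fl V k :=: perp (fl V (N - k)))%MS].
Proof. exact: elimT (is_flagP V). Qed.

Lemma fl_mono V i j : is_flag B V -> (i <= j <= N)%N -> (fl V i <= fl V j)%MS.
Proof.
move=> /is_flagP[_ _ _ h _] /andP[]; elim: j => [|j IH]; first by case: i.
rewrite leq_eqVlt => /orP[/eqP-> //|ij] jN.
by apply: submx_trans (h _ jN); apply: IH => //; apply: ltnW.
Qed.

Lemma fl_perp V k : is_flag B V -> (k <= N)%N -> (fl V k :=: perp (fl V (N - k)))%MS.
Proof. by case/is_flagP=> _ _ _ _; apply. Qed.

Lemma fl_ext V X : is_flag B V -> is_flag B X ->
  (forall k, (k <= N)%N -> (fl V k :=: fl X k)%MS) -> V = X.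
Proof.
move=> /is_flagP[hV _ _ _ _] /is_flagP[hX _ _ _ _] e; apply/ffunP => i.
rewrite hV hX; apply/genmxP; have := e i (ltn_ord i); rewrite /fl inord_val.
by move=> /eqmxP.
Qed.

Definition sdim V X i j : nat := \rank (fl V i :&: fl X j)%MS.

Section Pair.
Variables V X : seqsp n d F.
Hypotheses (fV : is_flag B V) (fX : is_flag B X).

Lemma sdim0l j : sdim V X 0 j = 0%N.
Proof. by rewrite /sdim; case/is_flagP: fV => _ -> _ _ _; rewrite cap0mx mxrank0. Qed.
Lemma sdim0r j : sdim V X j 0 = 0%N.
Proof. by rewrite /sdim; case/is_flagP: fX => _ -> _ _ _; rewrite capmx0 mxrank0. Qed.
Lemma sdimNl j : sdim V X N j = \rank (fl X j).
Proof.
rewrite /sdim; case/is_flagP: fV => _ _ h _ _.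
by rewrite (capmx_idPr _) // h submx1.
Qed.
Lemma sdimNr j : sdim V X j N = \rank (fl V j).
Proof.
rewrite /sdim; case/is_flagP: fX => _ _ h _ _.
by rewrite (capmx_idPl _) // h submx1.
Qed.

Lemma rank_flN : \rank (fl V N) = D.
Proof. by case/is_flagP: fV => _ _ -> _ _; rewrite mxrank1. Qed.

Lemma sdim_dual i j : (i <= N)%N -> (j <= N)%N ->
  (sdim V X (N - i) (N - j) + \rank (fl V i) + \rank (fl X j) = D + sdim V X i j)%N.
Proof.
move=> hi hj; rewrite /sdim -dim_cap_perp; congr (_ + _ + _)%N.
have eV := fl_perp fV (leq_subr i N); have eX := fl_perp fX (leq_subr j N).
rewrite subKn // in eV; rewrite subKn // in eX.
by rewrite (cap_eqmx eV eX).
Qed.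

(** For fixed [i] these spaces grow from V_i to V_{i+1}; modulo V_i they form the filtration that
    [X] induces on the quotient. *)
Definition layer i j : 'M[F]_D := (fl V i + fl V i.+1 :&: fl X j)%MS.

Lemma rank_layer i j : (i < N)%N ->
  (\rank (layer i j) + sdim V X i j = \rank (fl V i) + sdim V X i.+1 j)%N.
Proof.
move=> iN; rewrite /sdim -(mxrank_sum_cap (fl V i)); congr (_ + _)%N.
apply/eqP; rewrite eqn_leq; apply/andP; split; apply: mxrankS.
  by rewrite !sub_capmx capmxSl capmxSr (submx_trans (capmxSl _ _)) // fl_mono // leqnSn.
by rewrite sub_capmx capmxSl capmxA (submx_trans (capmxSr _ _)).
Qed.

Lemma layerS i j j' : (j <= j' <= N)%N -> (layer i j <= layer i j')%MS.
Proof. by move=> h; rewrite addsmxS // capmxS // fl_mono. Qed.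

Lemma sdim_layer_mono i j : (i < N)%N -> (j < N)%N ->
  (sdim V X i.+1 j + sdim V X i j.+1 <= sdim V X i.+1 j.+1 + sdim V X i j)%N.
Proof.
move=> iN jN; have := rank_layer j iN; have := rank_layer j.+1 iN.
have /mxrankS : (layer i j <= layer i j.+1)%MS by rewrite layerS // leqnSn.
nlia.
Qed.

(** [rank_layer] turns the truncated difference in [in_orbit] into a second difference of dimensions
    of intersections; summation inverts it. *)
Lemma in_orbitP (A : Xi n d) : reflect
  (forall i j, (i <= N)%N -> (j <= N)%N -> (sdim V X i j)%:Z = psum (Xi_int A) i j)
  (in_orbit A V X).
Proof.
have loc (i j : 'I_N) :
   (\rank (fl V i + fl V i.+1 :&: fl X j.+1)%MS - \rank (fl V i + fl V i.+1 :&: fl X j)%MS)%:Z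
   = (sdim V X i.+1 j.+1)%:Z - (sdim V X i.+1 j)%:Z - (sdim V X i j.+1)%:Z + (sdim V X i j)%:Z.
  have := rank_layer j (ltn_ord i); have := rank_layer j.+1 (ltn_ord i).
  have := sdim_layer_mono (ltn_ord i) (ltn_ord j); rewrite /layer; nlia.
apply: (iffP forallP) => [h|h i].
  have {}h (i j : 'I_N) : (ent A i j)%:Z = (sdim V X i.+1 j.+1)%:Z - (sdim V X i.+1 j)%:Z
       - (sdim V X i j.+1)%:Z + (sdim V X i j)%:Z.
    by have /forallP/(_ j)/eqP -> := h i; rewrite -loc !fl_lift !fl_widen.
  elim=> [|i IHi]; first by move=> j _ _; rewrite psum0l sdim0l.
  elim=> [|j IHj] hi hj; first by rewrite psum0r sdim0r.
  have := psumSS (Xi_int A) (Ordinal hi) (Ordinal hj); rewrite /= => ->.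
  rewrite -IHi ?(ltnW hi) // -IHj ?(ltnW hj) // -IHi ?(ltnW hi) ?(ltnW hj) //.
  rewrite mxE h /=; ring.
apply/forallP => j; rewrite /= !fl_lift !fl_widen -eqz_nat loc.
have := psumSS (Xi_int A) i j; rewrite -!h ?ltn_ord ?(ltnW (ltn_ord _)) // mxE => ->.
apply/eqP; ring.
Qed.

End Pair.

Lemma XiP (a : 'I_N -> 'I_N -> nat) :
  (\sum_i \sum_j a i j)%N = D -> (forall i j, a i j = a (rev_ord i) (rev_ord j)) ->
  exists A : Xi n d, forall i j, ent A i j = a i j.
Proof.
move=> sa ra; pose M := \matrix_(i, j) (inord (a i j) : 'I_D.+1).
have ha i j : (a i j < D.+1)%N.
  rewrite -sa ltnS (bigD1 i) //= (bigD1 j) //= -addnA leq_addr; by [].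
have hM : ((\sum_i \sum_j (M i j : nat))%N == D) && rot_sym M.
  apply/andP; split.
    by apply/eqP; rewrite -[RHS]sa; apply: eq_bigr => i _; apply: eq_bigr => j _; rewrite mxE inordK.
  by apply/forallP=> i; apply/forallP=> j; rewrite !mxE ra.
exists (exist (fun A : 'M['I_D.+1]_N => is_true ((\sum_i \sum_j (A i j : nat) == D)%N && rot_sym A)) M hM) => i j.
by rewrite /ent /= mxE inordK.
Qed.

Lemma Xi_int_inj : injective (@Xi_int n d).
Proof.
move=> A A' h; apply: val_inj; apply/matrixP=> i j; apply: val_inj.
by have := congr1 (fun M : 'M[int]__ => M i j) h; rewrite !mxE => -[].
Qed.

Lemma Xi_sum (A : Xi n d) : (\sum_i \sum_j ent A i j)%N = D.
Proof. by have /andP[/eqP h _] := valP A. Qed.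
Lemma Xi_rot (A : Xi n d) i j : ent A i j = ent A (rev_ord i) (rev_ord j).
Proof. by have /andP[_ /forallP/(_ i)/forallP/(_ j)/eqP h] := valP A; rewrite /ent h. Qed.

Lemma psum_full (M : 'M[int]_N) : psum M N N = \sum_i \sum_j M i j.
Proof.
rewrite /psum; apply: eq_big => [i|i _]; first by rewrite ltn_ord.
by apply: eq_bigl => j; rewrite ltn_ord.
Qed.

(** The second differences of [sdim] are nonnegative by [sdim_layer_mono] and invariant under
    rotation by [sdim_dual]. *)
Lemma in_orbit_ex V X : is_flag B V -> is_flag B X -> exists A : Xi n d, in_orbit A V X.
Proof.
move=> fV fX.
pose a (i j : 'I_N) := (sdim V X i.+1 j.+1 + sdim V X i j - sdim V X i.+1 j - sdim V X i j.+1)%N.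
have ha i j : (a i j)%:Z = (sdim V X i.+1 j.+1)%:Z - (sdim V X i.+1 j)%:Z
       - (sdim V X i j.+1)%:Z + (sdim V X i j)%:Z.
  by have := sdim_layer_mono fV fX (ltn_ord i) (ltn_ord j); rewrite /a; nlia.
pose M : 'M[int]_N := \matrix_(i, j) (a i j)%:Z.
have hM i j : (i <= N)%N -> (j <= N)%N -> (sdim V X i j)%:Z = psum M i j.
  elim: i j => [|i IHi]; first by move=> j _ _; rewrite psum0l sdim0l.
  elim=> [|j IHj] hi hj; first by rewrite psum0r sdim0r.
  have := psumSS M (Ordinal hi) (Ordinal hj); rewrite /= => ->.
  rewrite -IHi ?(ltnW hi) // -IHj ?(ltnW hj) // -IHi ?(ltnW hi) ?(ltnW hj) //.
  rewrite mxE ha /=; ring.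
have [||A hA] := @XiP a.
- apply/eqP; rewrite -eqz_nat -(rank_flN fV) -(sdimNr V fX) hM // psum_full.
  rewrite posz_sum; apply/eqP; apply: eq_bigr => i _.
  by rewrite posz_sum; apply: eq_bigr => j _; rewrite mxE.
- move=> i j; apply/eqP; rewrite -eqz_nat !ha /=.
  have D1 := sdim_dual fV fX (ltn_ord i) (ltn_ord j).
  have D2 := sdim_dual fV fX (ltnW (ltn_ord i)) (ltn_ord j).
  have D3 := sdim_dual fV fX (ltn_ord i) (ltnW (ltn_ord j)).
  have D4 := sdim_dual fV fX (ltnW (ltn_ord i)) (ltnW (ltn_ord j)).
  rewrite -!subSn ?ltn_ord // !subSS.
  by rewrite !subSS in D1 D2 D3 D4; move: D1 D2 D3 D4; nlia.
exists A; apply/in_orbitP => // i j hi hj; rewrite hM //; congr (psum _ i j).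
by apply/matrixP=> k l; rewrite !mxE hA.
Qed.

Lemma in_orbit_uniq V X A A' : is_flag B V -> is_flag B X ->
  in_orbit A V X -> in_orbit A' V X -> A = A'.
Proof.
move=> fV fX /(in_orbitP fV fX) h /(in_orbitP fV fX) h'; apply: Xi_int_inj.
by apply: psum_inj => i j hi hj; rewrite -h // h'.
Qed.
End Flags.

Lemma rank_addline (F : fieldType) m k (A : 'M[F]_(k, m)) (w : 'rV[F]_m) :
  \rank (A + w)%MS = (\rank A + ~~ (w <= A)%MS)%N.
Proof.
case: (boolP (w <= A)%MS) => h /=.
  by rewrite addn0; apply/eqmx_rank/eqmxP; apply/addsmx_idPl.
have := mxrank_sum_cap A w.
have -> : \rank (A :&: w)%MS = 0%N.
  apply/eqP; rewrite mxrank_eq0; apply: contraNT h => /rowV0Pn[u].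
  rewrite sub_capmx => /andP[uA /sub_rVP[c uc]] u0.
  have c0 : c != 0 by apply: contraNneq u0 => c0; rewrite uc c0 scale0r.
  by rewrite -[w]scale1r -(mulVf c0) -scalerA -uc scalemx_sub.
by rewrite addn0 => ->; rewrite rank_rV; case: eqP h => // ->; rewrite sub0mx.
Qed.

Lemma big_ltS_nat m (f : 'I_m -> nat) (i : 'I_m) :
  (\sum_(k : 'I_m | (k < i.+1)%N) f k = \sum_(k : 'I_m | (k < i)%N) f k + f i)%N.
Proof.
rewrite (bigD1 i) //= addnC; congr (_ + _)%N; apply: eq_bigl => k.
by rewrite ltnS ltn_neqAle andbC.
Qed.

Section Steps.
Variables (n d : nat) (F : finFieldType) (B : 'M[F]_(dimN d)).
Hypotheses (oddF : odd #|F|) (Bs : B^T = B) (Bu : B \in unitmx).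
Local Notation D := (dimN d).
Local Notation N := (dimN n).
Local Notation perp := (orthc B).
Implicit Types (V X U : seqsp n d F) (r : 'I_(n.*2)) (w : 'rV[F]_D).

(** The index [N - r.+1] is left free because the member there is the orthogonal complement of the
    one at [r.+1]. *)
Definition step V r U : bool :=
  [&& (fl V r.+1 <= fl U r.+1)%MS, \rank (fl U r.+1) == (\rank (fl V r.+1)).+1,
      (fl U r.+1 <= fl V r.+2)%MS &
      [forall i : 'I_N.+1, (i != r.+1 :> nat) && (i != N - r.+1 :> nat)%N ==> (U i == V i)]].

(** For [r.+1 = n] the enlarged space must lie in its orthogonal complement, the next member of the
    flag; for other [r] a vector of V_{r+2} is subject to no such condition. *)
Definition iso_at r w : bool := (r.+1 == n) ==> (bil B w w == 0).

Definition addline V r w : seqsp n d F :=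
  [ffun i : 'I_N.+1 => if i == r.+1 :> nat then <<(fl V r.+1 + w)%MS>>%MS
     else if i == (N - r.+1)%N :> nat then <<perp (fl V r.+1 + w)%MS>>%MS else V i].

Lemma fl_addline V r w k : (k <= N)%N ->
  (fl (addline V r w) k :=: if k == r.+1 then (fl V r.+1 + w)%MS
     else if k == (N - r.+1)%N then perp (fl V r.+1 + w)%MS else fl V k)%MS.
Proof.
move=> kN; rewrite /fl /addline ffunE inordK //.
by case: ifP => _; [exact: genmxE|]; case: ifP => _ //; exact: genmxE.
Qed.

(** * Counting flags one step away *)

Section OneLine.
Variables (V : seqsp n d F) (r : 'I_(n.*2)) (w : 'rV[F]_D).
Hypotheses (fV : is_flag B V) (wV : (w <= fl V r.+2)%MS) (wi : iso_at r w).
Let L := (fl V r.+1 + w)%MS.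
Let U := addline V r w.
Let rN : (r < n.*2)%N := ltn_ord r.

Let LV : (L <= fl V r.+2)%MS.
Proof. by rewrite addsmx_sub wV andbT (fl_mono fV) //; apply/andP; split. Qed.
Let VL : (fl V r.+1 <= L)%MS. Proof. exact: addsmxSl. Qed.

Let LperpL : r.+1 = n -> (L <= perp L)%MS.
Proof.
move=> rn; have r2N : (r.+2 <= N)%N by nlia.
have e := fl_perp fV r2N; rewrite (_ : N - r.+2 = r.+1)%N in e; last by nlia.
have w1 : (w <= perp (fl V r.+1))%MS by rewrite -e.
have V1 : (fl V r.+1 <= perp (fl V r.+1))%MS.
  by rewrite -e (fl_mono fV) //; apply/andP; split.
have bVw x : (x <= fl V r.+1)%MS -> bil B x w = 0.
  by move=> xV; rewrite (bilC Bs); apply: (elimT (perpP _ _ _) w1) (submx_refl w) xV.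
apply/perpP => x y /sub_addsmxP[[x1 x2] /= ->] /sub_addsmxP[[y1 y2] /= ->].
rewrite !(bilDl, bilDr Bs) (elimT (perpP _ _ _) V1) ?submxMl // add0r.
have [a ->] := sub_rVP (submxMl x2 w); have [b ->] := sub_rVP (submxMl y2 w).
rewrite !bilZl !(bilZr Bs) bVw ?submxMl // (bilC Bs w) bVw ?submxMl //.
by move: wi; rewrite /iso_at rn eqxx => /eqP ->; rewrite !mulr0 !addr0.
Qed.

Lemma addline_flag : is_flag B U.
Proof.
have [cV V0 VN ch pe] := flag_spec fV.
have pV k : (k <= N)%N -> (fl V k <= perp (fl V (N - k)))%MS /\ (perp (fl V (N - k)) <= fl V k)%MS.
  by move=> /pe/eqmxP/andP.
have m i j : (i <= j <= N)%N -> (fl V i <= fl V j)%MS by apply: fl_mono fV.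
apply/is_flagP; split.
- move=> i; rewrite /U /addline ffunE; case: ifP => _; first by rewrite genmx_id.
  by case: ifP => _; [rewrite genmx_id | rewrite -cV].
- have e0 : (0 == N - r.+1)%N = false by apply/eqP; nlia.
  by apply/eqP; rewrite -mxrank_eq0 fl_addline // e0 V0 mxrank0.
- apply: eqmx_trans (fl_addline _ _ _ _) _ => //; case: eqP => [|_]; first by nlia.
  by case: eqP => [|_ //]; nlia.
- move=> k kN; rewrite !fl_addline ?(ltnW kN) // eqSS.
  case: (k =P r.+1) => [->|k1].
    case: eqP => [|_]; first by nlia.
    case: eqP => [h|_]; last exact: LV.
    by apply: LperpL; nlia.
  case: (k =P r) => [k2|k2].
    case: eqP => [h|_].
      apply: (submx_trans _ VL).
      have h2 : (perp (fl V (N - r.+1)) <= fl V r.+1)%MS by apply pV; nlia.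
      apply: submx_trans h2; apply: perpS => //; apply: submx_trans VL.
      by apply: m; nlia.
    by apply: submx_trans VL; rewrite k2; apply: m; nlia.
  case: eqP => [h|_].
    case: eqP => [|_]; first by nlia.
    apply: submx_trans (_ : perp (fl V (N - k.+1)) <= _)%MS.
      by apply: perpS => //; apply: submx_trans VL; apply: m; nlia.
    by apply pV; nlia.
  case: eqP => [h|_]; last by apply: m; nlia.
  apply: submx_trans (_ : perp (fl V (N - k)) <= _)%MS; first by apply pV; nlia.
  by apply: perpS => //; apply: submx_trans LV _; apply: m; nlia.
- move=> k kN; apply: eqmx_trans (fl_addline _ _ _ kN) _; apply: eqmx_sym.
  apply: eqmx_trans (eq_perp Bs (fl_addline _ _ _ (leq_subr _ _))) _.
  have -> : (N - k == r.+1)%N = (k == N - r.+1)%N by apply/eqP/eqP; nlia.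
  have -> : (N - k == N - r.+1)%N = (k == r.+1)%N by apply/eqP/eqP; nlia.
  case: (k =P r.+1) => [k1|_].
    have -> : (k == N - r.+1)%N = false by apply/eqP; nlia.
    exact: perpK.
  by case: eqP => [_ //|_]; apply: eqmx_sym; apply: pe.
Qed.

Lemma step_addline : ~~ (w <= fl V r.+1)%MS -> step V r U.
Proof.
move=> wn; have r1 : (r.+1 <= N)%N by nlia.
apply/and4P; split; rewrite ?fl_addline ?eqxx //.
- by rewrite rank_addline wn addn1.
- apply/forallP => i; apply/implyP => /andP[/negbTE i1 /negbTE i2].
  by rewrite /U /addline ffunE i1 i2.
Qed.

Variable (X : seqsp n d F) (p : 'I_N).
Hypotheses (fX : is_flag B X) (wp : ~~ (w <= layer V X r.+1 p)%MS)
  (wp1 : (w <= layer V X r.+1 p.+1)%MS).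

Let in_layer j : (j <= N)%N -> (w <= fl V r.+1 + fl X j)%MS = (p < j)%N.
Proof.
move=> jN; have -> : (w <= fl V r.+1 + fl X j)%MS = (w <= layer V X r.+1 j)%MS.
  rewrite /layer; apply/idP/idP => h; last first.
    by apply: submx_trans h _; rewrite addsmxS // capmxSr.
  have VV : (fl V r.+1 <= fl V r.+2)%MS by apply: (fl_mono fV); nlia.
  have /eqmxP e := matrix_modl (fl X j) VV.
  rewrite capmxC in e; apply: submx_trans (_ : (fl V r.+1 + fl X j) :&: fl V r.+2 <= _)%MS.
    by rewrite sub_capmx h.
  by move/andP: e => -[].
case: ltnP => pj.
  by apply: submx_trans wp1 _; apply: (layerS _ fX); rewrite pj.
by apply: contraNF wp => h; apply: submx_trans h _; apply: (layerS _ fX); rewrite pj ltnW.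
Qed.

(** Column [p] is where [w] enters the filtration of V_{r+2}/V_{r+1} by [X]: the intersections with
    X_j grow exactly for j > p. The values at the mirrored index follow from [sdim_dual]. *)
Lemma sdim_addline i j : (i <= N)%N -> (j <= N)%N ->
  (sdim U X i j)%:Z = (sdim V X i j)%:Z - psum (mv r p) i j.
Proof.
have h1 j' : (j' <= N)%N -> sdim U X r.+1 j' = (sdim V X r.+1 j' + (p < j'))%N.
  move=> jN; have e : (fl U r.+1 :=: L)%MS.
    by apply: eqmx_trans (fl_addline _ _ _ _) _; rewrite ?eqxx //; nlia.
  rewrite /sdim (cap_eqmx e (eqmx_refl _)).
  have := mxrank_sum_cap L (fl X j'); have := mxrank_sum_cap (fl V r.+1) (fl X j').
  have -> : \rank (L + fl X j')%MS = (\rank (fl V r.+1 + fl X j')%MS + ~~ (p < j'))%N.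
    rewrite -in_layer // -rank_addline; apply/eqmx_rank/eqmxP.
    by rewrite /L -addsmxA (addsmxC w) addsmxA.
  have -> : \rank L = (\rank (fl V r.+1) + 1)%N.
    rewrite /L rank_addline; congr (_ + _)%N; apply/eqP; rewrite eqb1.
    by apply: contra wp => h; apply: submx_trans h (addsmxSl _ _).
  by case: ltnP => /=; nlia.
move=> iN jN; rewrite psum_mv.
case: (i =P r.+1) => [->|i1].
  by rewrite h1 //; case: eqP => [|_]; nlia.
case: (i =P (N - r.+1)%N) => [->|i2] /=; last first.
  rewrite !subr0; congr (Posz _); rewrite /sdim; congr (\rank (_ :&: _)%MS).
  by rewrite /fl /U /addline ffunE inordK //; case: eqP i1 => // _ _; case: eqP i2.
have r1 : (r.+1 <= N)%N by nlia.
have fU := addline_flag.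
have := sdim_dual Bs Bu fV fX r1 (leq_subr j N).
have := sdim_dual Bs Bu fU fX r1 (leq_subr j N).
rewrite !subKn // h1 ?leq_subr //.
have -> : \rank (fl U r.+1) = (\rank (fl V r.+1) + 1)%N.
  by rewrite -!(sdimNr _ fX) h1 // ltn_ord.
by case: ltnP; case: leqP => /=; have := ltn_ord p; nlia.
Qed.
End OneLine.

(** A step can be produced by any vector of the larger space outside the smaller one, so the number
    of vectors per flag is constant. *)
Lemma addline_step V U r w : is_flag B V -> is_flag B U -> step V r U ->
  (w <= fl U r.+1)%MS -> ~~ (w <= fl V r.+1)%MS ->
  [/\ (w <= fl V r.+2)%MS, iso_at r w & addline V r w = U].
Proof.
move=> fV fU /and4P[s1 /eqP s2 s3 /forallP s4] wU wV.
have rN := ltn_ord r.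
have w2 : (w <= fl V r.+2)%MS by apply: submx_trans wU s3.
have wi : iso_at r w.
  apply/implyP => /eqP rn; apply/eqP.
  have /perpP : (fl U r.+1 <= perp (fl U r.+1))%MS.
    have h : (r.+1 <= r.+2 <= N)%N by nlia.
    apply: submx_trans (fl_mono fU h) _.
    have h2 : (r.+2 <= N)%N by nlia.
    have e2 : (N - r.+2 = r.+1)%N by nlia.
    have := fl_perp fU h2; rewrite e2.
    by move=> e; rewrite e.
  by apply.
have fA := addline_flag fV w2 wi.
split=> //; apply: (fl_ext fA fU) => k kN; apply: eqmx_trans (fl_addline _ _ _ kN) _.
have e : (fl V r.+1 + w :=: fl U r.+1)%MS.
  apply/eqmxP; rewrite -(geq_leqif (mxrank_leqif_eq _)).
    by rewrite rank_addline wV s2 addn1.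
  by rewrite addsmx_sub s1.
case: eqP => [->|/eqP k1]; first exact: e.
case: eqP => [->|/eqP k2].
  apply: eqmx_trans (eq_perp Bs e) _; apply: eqmx_sym.
  have h := fl_perp fU (leq_subr r.+1 N); rewrite subKn in h; last by nlia.
  exact: h.
have := s4 (inord k); rewrite inordK // k1 k2 /= => /eqP h.
by rewrite /fl h.
Qed.

Lemma card_sub_rV (Y : 'M[F]_D) : #|[set w : 'rV_D | (w <= Y)%MS]| = (#|F| ^ \rank Y)%N.
Proof. exact: card_sub. Qed.

Section Count.
Variables (V X : seqsp n d F) (r : 'I_(n.*2)).
Hypotheses (fV : is_flag B V) (fX : is_flag B X).
Local Notation q := #|F|.
Local Notation Y := (layer V X r.+1).
Let rN : (r < n.*2)%N := ltn_ord r.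

Lemma layer0 : (Y 0%N :=: fl V r.+1)%MS.
Proof.
rewrite /layer; have [_ -> _ _ _] := flag_spec fX.
by rewrite capmx0; apply: adds0mx_id || apply: addsmx0.
Qed.

Lemma layerN : (Y N :=: fl V r.+2)%MS.
Proof.
apply/eqmxP; rewrite /layer; have [_ _ h _ _] := flag_spec fX; apply/andP; split.
  by rewrite addsmx_sub capmxSl andbT (fl_mono fV) //; nlia.
by apply: submx_trans (addsmxSr _ _); rewrite sub_capmx submx_refl h submx1.
Qed.

(** For [r.+1 = n] the layers at j and N-j are orthogonal complements of each other. Up to j = n
    they are totally isotropic; beyond, the quotient of the layer by its radical has odd dimension
    since D is odd, and [nval_odd_rank] removes one factor q. *)
Lemma card_iso_layer j : (j <= N)%N ->
  #|[set w | (w <= Y j)%MS && iso_at r w]| =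
  (q ^ (\rank (Y j) - ((r.+1 == n) && (n < j)%N)))%N.
Proof.
move=> jN; rewrite /iso_at; case: (r.+1 =P n) => [rn|_] /=; last first.
  by rewrite subn0 -card_sub; apply: eq_card => w; rewrite !inE andbT.
have r2N : (r.+2 <= N)%N by nlia.
have p1 := fl_perp fV r2N; rewrite (_ : N - r.+2 = r.+1)%N in p1; last by nlia.
have VV : (fl V r.+1 <= fl V r.+2)%MS by apply: (fl_mono fV); apply/andP; split.
have pY k : (k <= N)%N -> (Y (N - k)%N :=: perp (Y k))%MS.
  move=> kN; apply/eqmxP; rewrite -(geq_leqif (mxrank_leqif_eq _)).
    rewrite rank_perp //.
    have := rank_layer X fV k r2N; have := rank_layer X fV (N - k) r2N.
    have := sdim_dual Bs Bu fV fX (ltnW r2N) kN.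
    have := sdim_dual Bs Bu fV fX r2N kN.
    have e1 : (N - r.+1 = r.+2)%N by nlia.
    have e2 : (N - r.+2 = r.+1)%N by nlia.
    rewrite e1 e2.
    have : (\rank (fl V r.+1) + \rank (fl V r.+2) = D)%N.
      by rewrite p1 rank_perp // subnKC // rank_leq_row.
    have := rank_leq_row (Y k).
    move: (\rank (Y k)) (\rank (Y _)) (\rank (fl V r.+1)) (\rank (fl V r.+2)).
    move: (\rank (fl X k)) => x1 x2 x3 x4 x5; clear; nlia.
  have e3 := fl_perp fX (leq_subr k N); rewrite subKn // in e3.
  rewrite /layer (perpD Bs) sub_capmx !addsmx_sub -!p1 VV capmxSl /=.
  rewrite (submx_trans (capmxSr _ _)) ?andbT.
    by rewrite (perp_sym Bs) (submx_trans (capmxSl _ _)) // p1.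
  by rewrite e3 perpS // capmxSr.
case: ltnP => jn.
  have Yj : (Y (N - j) <= Y j)%MS by apply: (layerS _ fX); nlia.
  rewrite subn1 -(nval_odd_rank oddF Bs); first by [].
  have -> : (Y j :&: kermx (B *m (Y j)^T) :=: Y (N - j))%MS.
    by apply: eqmx_trans (cap_eqmx (eqmx_refl _) (eqmx_sym (pY j jN))) _; apply/capmx_idPr.
  rewrite pY // rank_perp //; have := rank_leq_row (Y j).
  have : (\rank (Y (N - j)) <= \rank (Y j))%N by apply: mxrankS.
  by rewrite pY // rank_perp //; move: (\rank _) => x; nlia.
rewrite subn0 -card_sub; apply: eq_card => w; rewrite !inE.
case: (boolP (w <= _)%MS) => //= wY; apply/eqP.
have /perpP : (Y j <= perp (Y j))%MS.
  by rewrite -pY //; apply: (layerS _ fX); nlia.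
by apply.
Qed.

(** The sum is the quantum integer of a+1 in its unsymmetric form; the normalization of the standard
    basis turns the whole into [gcoef]. *)
Definition cq (A : Xi n d) (r : 'I_(n.*2)) (p : 'I_N) (q : nat) : nat :=
  (q ^ (\sum_(l : 'I_N | (l < p)%N) ent A (rhi r) l) *
   \sum_(i < (ent A (rhi r) p).+1) q ^ i)%N.

Variables (A C : Xi n d).
Hypothesis oC : in_orbit C V X.
Let s := \rank (fl V r.+1).
Let good := [set U | [&& is_flag B U, step V r U & in_orbit A U X]].
Let W := [set w : 'rV[F]_D | [&& (w <= fl V r.+2)%MS, ~~ (w <= fl V r.+1)%MS, iso_at r w &
  in_orbit A (addline V r w) X]].
Let T j := [set w : 'rV[F]_D | (w <= Y j)%MS && iso_at r w].
Let qpos : (1 < q)%N := finNzRing_gt1 F.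

Let cardW1 : #|W| = (#|good| * (q ^ s.+1 - q ^ s))%N.
Proof.
rewrite -sum1_card (partition_big (addline V r) (mem good)) /=; last first.
  move=> w; rewrite !inE => /and4P[w1 w2 w3 w4].
  by rewrite addline_flag // step_addline.
rewrite -sum_nat_const; apply: eq_bigr => U; rewrite inE => /and3P[fU sU oU].
have /and4P[s1 /eqP s2 _ _] := sU.
rewrite sum1_card -s2 -/s -!card_sub_rV.
rewrite -(_ : [set w : 'rV_D | (w <= fl U r.+1)%MS] :&: [set w | (w <= fl V r.+1)%MS] =
   [set w | (w <= fl V r.+1)%MS]); last first.
  by apply/setIidPr/subsetP => w; rewrite !inE => /submx_trans; apply.
rewrite -cardsD; apply: eq_card => w; rewrite unfold_in /= !inE.
apply/idP/idP => [/andP[/and4P[w1 w2 w3 w4] /eqP eU]|/andP[w2 wU]].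
  rewrite w2 -eU fl_addline ?eqxx ?addsmxSr //=; nlia.
by have [w1 w3 eU] := addline_step fV fU sU wU w2; rewrite w1 w2 w3 eU oU eqxx.
Qed.

Let T_sub (j j' : nat) : (j <= j' <= N)%N -> T j \subset T j'.
Proof.
move=> h; apply/subsetP=> w; rewrite !inE => /andP[w1 ->]; rewrite andbT.
exact: submx_trans w1 (layerS _ fX _ h).
Qed.

Let cardW2 : #|W| = (\sum_(p : 'I_N) #|W :&: (T p.+1 :\: T p)|)%N.
Proof.
transitivity (\sum_(w in W) \sum_(p : 'I_N) (w \in T p.+1 :\: T p))%N; last first.
  rewrite exchange_big; apply: eq_bigr => p _ /=.
  rewrite -sum1_card big_mkcond [RHS]big_mkcond; apply: eq_bigr => w _ /=.
  by rewrite in_setI; case: (w \in W) => //=; case: (w \in _).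
rewrite -sum1_card; apply: eq_bigr => w wW.
pose f j : nat := w \in T (minn j N).
have tl := @telescope_sumn 0 N f; rewrite big_mkord in tl.
rewrite (eq_bigr (fun p : 'I_N => f p.+1 - f p)%N) => [|p _].
  rewrite tl => [|i j ij]; last first.
    have /subsetP h : T (minn i N) \subset T (minn j N) by apply: T_sub; nlia.
    by rewrite /f; case: (boolP (w \in T (minn i N))) => // /h ->.
  rewrite /f minnn min0n; move: wW; rewrite !inE => /and4P[w1 /negbTE w2 -> _].
  by rewrite layerN w1 layer0 w2.
have hp := ltn_ord p; rewrite /f (minn_idPl _) // (minn_idPl (ltnW _)) //.
have /subsetP h : T p \subset T p.+1 by apply: T_sub; nlia.
by rewrite inE; case: (boolP (w \in T p)) => [/h ->|_] //=; case: (w \in T _).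
Qed.

Let WT (p : 'I_N) : W :&: (T p.+1 :\: T p) =
  if Xi_int C == Xi_int A + mv r p then T p.+1 :\: T p else set0.
Proof.
have key w : w \in T p.+1 :\: T p -> w \in W = (Xi_int C == Xi_int A + mv r p).
  rewrite !inE; case: (boolP (iso_at r w)) => wi; rewrite ?andbT ?andbF // => /andP[wp wp1].
  have w1 : (w <= fl V r.+2)%MS.
    by rewrite -layerN; apply: submx_trans wp1 (layerS _ fX _ _); have := ltn_ord p; nlia.
  have w2 : ~~ (w <= fl V r.+1)%MS.
    by apply: contra wp => h; apply: submx_trans h _; apply: addsmxSl.
  rewrite w1 w2 /=; have fU := addline_flag fV w1 wi.
  apply/(in_orbitP fU fX)/eqP => [h|h i j iN jN].
    apply: psum_inj => i j iN jN; rewrite psumD -h // -(elimT (in_orbitP fV fX C) oC) //.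
    by rewrite (sdim_addline fV w1 wi fX wp wp1) // subrK.
  rewrite (sdim_addline fV w1 wi fX wp wp1) // (elimT (in_orbitP fV fX C) oC) //.
  by rewrite h psumD addrK.
apply/setP => w; rewrite in_setI; case: (boolP (w \in _ :\: _)) => wT.
  by rewrite key // andbT; case: eqP => _; rewrite ?wT ?inE.
by rewrite andbF; case: eqP => _; rewrite ?(negbTE wT) ?inE.
Qed.

Let cardT (p : 'I_N) : Xi_int C = Xi_int A + mv r p ->
  #|T p.+1 :\: T p| = ((q ^ s.+1 - q ^ s) * cq A r p q)%N.
Proof.
move=> eC; have pN := ltn_ord p.
rewrite cardsD (setIidPr _) ?T_sub ?leqnSn // !card_iso_layer //; last exact: ltnW.
have rN2 : (r.+1 < N)%N by nlia.
(* One formula serves all [r]: the factor q lost to isotropy for r+1 = n and j > n is compensated by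
   the mirrored unit of [mv r p], which then lies in the row under consideration. *)
have e (j : nat) : (p <= j <= p.+1)%N ->
   (\rank (Y j) - ((r.+1 == n) && (n < j)) = s + \sum_(l : 'I_N | l < j) ent A (rhi r) l + (p < j))%N.
  move=> /andP[pj jp]; have jN : (j <= N)%N by nlia.
  have := rank_layer X fV j rN2; rewrite -/s.
  have o1 := elimT (in_orbitP fV fX C) oC r.+1 j (ltnW rN2) jN.
  have o2 := elimT (in_orbitP fV fX C) oC r.+2 j rN2 jN.
  have eA : psum (Xi_int A) r.+2 j = psum (Xi_int A) r.+1 j + (\sum_(l : 'I_N | (l < j)%N) ent A (rhi r) l)%:Z.
    rewrite (psumSl _ (rhi r)) posz_sum; congr (_ + _); apply: eq_bigr => l _.
    by rewrite mxE.
  rewrite eC psumD psum_mv in o1; rewrite eC psumD psum_mv in o2.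
  have ar (r0 p0 x1 x2 x3 z s0 : nat) (y1 : int) :
      (p0 <= j <= p0.+1)%N -> (r0.+1 < N)%N -> (p0 < N)%N -> (x1 + x3 = s0 + x2)%N ->
      x3%:Z = y1 + (((r0.+1 == (N - r0.+1)%N) && (N - p0 <= j)%N)%:Z - ((r0.+1 == r0.+1) && (p0 < j)%N)%:Z) ->
      x2%:Z = y1 + z%:Z + (((r0.+2 == (N - r0.+1)%N) && (N - p0 <= j)%N)%:Z - ((r0.+2 == r0.+1) && (p0 < j)%N)%:Z) ->
      (x1 - ((r0.+1 == n) && (n < j)%N) = s0 + z + (p0 < j))%N.
    clear; case: (r0.+1 =P n) => h1; nlia.
  by rewrite eA in o2 => h; apply: ar o1 o2 => //; rewrite pj.
rewrite !e ?leqnn ?leqnSn // ltnn addn0 big_ltS_nat addn1.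
rewrite /cq; set al := (\sum_(l | _) _)%N; set a := ent _ _ _.
have := predn_exp q a.+1; move: qpos; clear.
rewrite addnA !expnS !expnD; move: (\sum_(i < _) _)%N => S.
case: q => // q' _ /= h.
have h2 : (q'.+1 * q'.+1 ^ a = (q' * S).+1)%N.
  by rewrite -h -expnS prednK // expn_gt0.
move: (q'.+1 ^ s)%N (q'.+1 ^ al)%N (q'.+1 ^ a)%N h2 => x y z h2.
have -> : (q'.+1 * (x * y * z) = x * y * (q'.+1 * z))%N by ring.
by rewrite h2 mulnS addKn mulSn addKn; ring.
Qed.

(** Vectors are counted in place of flags: each flag comes from q^{s+1} - q^s vectors of V_{r+2},
    and these are sorted by the column in which they enter the filtration. *)
Lemma step_count :
  #|good| = (\sum_(p : 'I_N | Xi_int C == (Xi_int A + mv r p)%R) cq A r p q)%N.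
Proof.
have q0 : (0 < q ^ s.+1 - q ^ s)%N by rewrite subn_gt0 ltn_exp2l.
apply/eqP; rewrite -(eqn_pmul2r q0) -cardW1 cardW2 big_distrl /=; apply/eqP.
rewrite [RHS]big_mkcond; apply: eq_bigr => p _; rewrite WT.
by case: eqP => [h|_]; [rewrite mulnC cardT | rewrite cards0].
Qed.
End Count.
End Steps.

(** * Nonempty orbits *)

Section IntMatrices.
Variable n : nat.
Local Notation N := (dimN n).
Implicit Types (M : 'M[int]_N) (r : 'I_(n.*2)) (p : 'I_N).

Lemma rot_symE M : rot_sym M -> forall i j, M (rev_ord i) (rev_ord j) = M i j.
Proof. by move=> /forallP h i j; have /forallP/(_ j)/eqP := h i. Qed.

Lemma rot_sym_mv r p : rot_sym (mv r p).
Proof. by apply: rot_symD; [|apply: rot_symN]; apply: Eth_rot. Qed.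

Lemma mvE r p k l : mv r p k l =
  (((k == rhi r) && (l == p))%:Z + ((k == rev_ord (rhi r)) && (l == rev_ord p))%:Z)
  - (((k == rlo r) && (l == p))%:Z + ((k == rev_ord (rlo r)) && (l == rev_ord p))%:Z).
Proof. by rewrite /mv /Eth !mxE !natz. Qed.

(** For r = p = n the move takes two units from the central entry, hence the additional 1 in the
    bound. *)
Lemma mv_ge0 M r p k l : rot_sym M -> 0 <= M k l ->
  1 + ((r == n :> nat) && (p == n :> nat))%:Z <= M (rlo r) p ->
  0 <= M k l + mv r p k l.
Proof.
move=> rM M0 h; rewrite mvE; have rMM := rot_symE rM (rlo r) p.
have e : (k == rlo r) && (l == p) && ((k == rev_ord (rlo r)) && (l == rev_ord p)) ->
   (r == n :> nat) && (p == n :> nat).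
  case/andP=> /andP[/eqP -> /eqP ->] /andP[/eqP/(congr1 val) /= h1 /eqP/(congr1 val) /= h2].
  by have := ltn_ord p; have := ltn_ord r; move: (val r) (val p) h1 h2; lia.
have e1 : (k == rlo r) && (l == p) -> M k l = M (rlo r) p by case/andP=> /eqP -> /eqP ->.
have e2 : (k == rev_ord (rlo r)) && (l == rev_ord p) -> M k l = M (rlo r) p.
  by case/andP=> /eqP -> /eqP ->.
move: e e1 e2 M0 h; set b1 := (k == rlo r) && _; set b2 := (k == rev_ord (rlo r)) && _.
set b3 := (k == rhi r) && _; set b4 := (k == rev_ord (rhi r)) && _; set b5 := (r == n :> nat) && _.
move: (M k l) (M (rlo r) p) b1 b2 b3 b4 b5 => x y b1 b2 b3 b4 b5; clear.
case: b1; case: b2 => /= e e1 e2; last (by move=> h _; case: b3; case: b4; lia).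
- by rewrite e // e1 //; case: b3; case: b4; lia.
- by rewrite e1 //; case: b3; case: b4; case: b5 {e}; lia.
- by rewrite e2 //; case: b3; case: b4; case: b5 {e}; lia.
Qed.

Lemma Xi_of_int d M : (forall i j, 0 <= M i j) -> rot_sym M ->
  psum M N N = (dimN d)%:Z -> exists A : Xi n d, Xi_int A = M.
Proof.
move=> M0 rM sM; have [||A hA] := @XiP n d (fun i j => `|M i j|%N).
- apply/eqP; rewrite -eqz_nat -sM psum_full posz_sum; apply/eqP/eq_bigr => i _.
  by rewrite posz_sum; apply: eq_bigr => j _; rewrite gez0_abs.
- by move=> i j; rewrite rot_symE.
by exists A; apply/matrixP=> i j; rewrite mxE hA gez0_abs.
Qed.

Lemma Xi_int_ge0 d (A : Xi n d) i j : 0 <= Xi_int A i j.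
Proof. by rewrite mxE. Qed.
Lemma Xi_int_rot d (A : Xi n d) : rot_sym (Xi_int A).
Proof. by apply/forallP=> i; apply/forallP=> j; rewrite !mxE -Xi_rot. Qed.
Lemma Xi_int_psum d (A : Xi n d) : psum (Xi_int A) N N = (dimN d)%:Z.
Proof.
rewrite psum_full -[in RHS](Xi_sum A) posz_sum; apply: eq_bigr => i _.
by rewrite posz_sum; apply: eq_bigr => j _; rewrite mxE.
Qed.

Lemma psum_mvN r p j : psum (mv r p) N j = 0.
Proof. by rewrite psum_mv; have := ltn_ord r; nlia. Qed.

Lemma psum_tr M i j : psum M^T i j = psum M j i.
Proof.
by rewrite /psum exchange_big; apply: eq_bigr => k _; apply: eq_bigr => l _; rewrite mxE.
Qed.

Lemma psum_ge0 M i j : (forall k l, 0 <= M k l) -> 0 <= psum M i j.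
Proof. by move=> h; apply: sumr_ge0 => k _; apply: sumr_ge0. Qed.

Lemma psum_diag M i j : is_diag_mx M -> psum M i j = psum M (minn i j) N.
Proof.
move=> /is_diag_mxP dM; rewrite /psum [LHS]big_mkcond [RHS]big_mkcond; apply: eq_bigr => k _.
have e j' : \sum_(l : 'I_N | (l < j')%N) M k l = if (k < j')%N then M k k else 0.
  rewrite big_mkcond (bigD1 k) //= [X in _ + X]big1 ?addr0 // => l lk.
  by case: ifP => // _; apply: dM; rewrite eq_sym.
by rewrite !e ltn_ord leq_min; case: ltnP.
Qed.

Lemma psum_diag_sym M i j : is_diag_mx M -> psum M i j = psum M j i.
Proof. by move=> h; rewrite (psum_diag i j h) (psum_diag j i h) minnC. Qed.
End IntMatrices.

Section Orbits.
Variables (n d : nat) (F : finFieldType) (B : 'M[F]_(dimN d)).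
Hypotheses (oddF : odd #|F|) (Bs : B^T = B) (Bu : B \in unitmx).
Local Notation D := (dimN d).
Local Notation N := (dimN n).
Local Notation perp := (orthc B).
Implicit Types (A C G : Xi n d) (V X U : seqsp n d F) (r : 'I_(n.*2)).

Definition nonempty_orbit A := exists V X, [/\ is_flag B V, is_flag B X & in_orbit A V X].

Lemma in_orbit_tr A A' : Xi_int A' = (Xi_int A)^T -> nonempty_orbit A -> nonempty_orbit A'.
Proof.
move=> e [V [X [fV fX oA]]]; exists X, V; split=> //.
apply/(in_orbitP fX fV) => i j iN jN; rewrite e psum_tr.
by rewrite -(elimT (in_orbitP fV fX A) oA) // /sdim capmxC.
Qed.

Lemma Xi_tr A : exists A', Xi_int A' = (Xi_int A)^T.
Proof.
apply: Xi_of_int; first by move=> i j; rewrite mxE Xi_int_ge0.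
  by apply/forallP=> i; apply/forallP=> j; rewrite !mxE -Xi_rot.
by rewrite psum_tr Xi_int_psum.
Qed.

(** A unit in row i < n counts n-i times, the number of moves that bring it to the middle row. *)
Definition offrow A : int := \sum_(j < n) psum (Xi_int A) j.+1 N.

Lemma offrow_ge0 A : 0 <= offrow A.
Proof. by apply: sumr_ge0 => j _; apply: psum_ge0; apply: Xi_int_ge0. Qed.

Lemma nonempty_step A C r (p : 'I_N) : Xi_int C = Xi_int A + mv r p ->
  nonempty_orbit C -> nonempty_orbit A.
Proof.
move=> e [V [X [fV fX oC]]].
have := step_count oddF Bs Bu r fV fX A oC.
rewrite (bigD1 p) /=; last by rewrite e.
have h : (0 < cq A r p #|F|)%N.
  by rewrite muln_gt0 expn_gt0 big_ord_recl expn0 (ltnW (finNzRing_gt1 F)).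
move=> h2; have : (0 < #|[set U | [&& is_flag B U, step V r U & in_orbit A U X]]|)%N.
  by rewrite h2 addn_gt0 h.
by case/card_gt0P => U; rewrite inE => /and3P[fU _ oU]; exists U, X.
Qed.

Lemma ent_psum A (i j : 'I_N) : (ent A i j)%:Z <= psum (Xi_int A) i.+1 N.
Proof.
rewrite (psumSl _ i) -[(ent A i j)%:Z]add0r lerD ?psum_ge0 //; first exact: Xi_int_ge0.
rewrite (bigD1 j) //= mxE lerDl sumr_ge0 // => l _; exact: Xi_int_ge0.
Qed.

Lemma offrow0 A : offrow A = 0 -> forall i j : 'I_N, i != n :> nat -> ent A i j = 0%N.
Proof.
move=> A0; have h (i j : 'I_N) : (i < n)%N -> ent A i j = 0%N.
  move=> iN; have := ent_psum A i j.
  have /eqP := A0; rewrite psumr_eq0 => [/allP/(_ (Ordinal iN))|k _]; last first.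
    by apply: psum_ge0; apply: Xi_int_ge0.
  by rewrite mem_index_enum => /(_ isT)/eqP -> ; case: (ent A i j).
move=> i j; case: (ltngtP i n) => // [/h -> //|ni _].
by rewrite Xi_rot h //= ; have := ltn_ord i; nlia.
Qed.

(** Moving the units above the middle row downwards keeps the column sums and ends with [offrow]
    zero; [nonempty_step] carries non-emptiness back along each move. *)
Lemma row_induction A :
  (forall C, offrow C = 0 -> (forall j, psum (Xi_int C) N j = psum (Xi_int A) N j) ->
    nonempty_orbit C) -> nonempty_orbit A.
Proof.
have [k] := ubnP `|offrow A|%N; elim: k => // k IH in A *; rewrite ltnS => hk hC.
have [/eqP A0|A0] := boolP (offrow A == 0); first by apply: hC.
have [i /existsP[p ip]] : exists i : 'I_n, [exists p : 'I_N, (0 < ent A (inord i) p)%N].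
  apply/existsP; apply: contraNT A0; rewrite negb_exists => /forallP h.
  apply/eqP/big1 => j _; rewrite /psum big1 // => i ij; rewrite big1 // => l _; rewrite mxE.
  have iN : (i < n)%N by have := ltn_ord j; nlia.
  have := h (Ordinal iN); rewrite negb_exists => /forallP/(_ l).
  by rewrite /= inord_val -eqn0Ngt => /eqP ->.
have rN : (i < n.*2)%N by have := ltn_ord i; nlia.
pose r := Ordinal rN; have er : rlo r = inord i.
  by apply: val_inj; rewrite /= inordK //; nlia.
have [|||C eC] := @Xi_of_int n d (Xi_int A + mv r p).
- move=> k' l; rewrite mxE; apply: mv_ge0 (Xi_int_rot A) (Xi_int_ge0 _ _ _) _.
  rewrite er mxE (_ : (r == n :> nat) = false) /=; last by apply/eqP; rewrite /=; have := ltn_ord i; nlia.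
  by move: ip; nlia.
- by apply: rot_symD (Xi_int_rot A) (rot_sym_mv _ _).
- by rewrite psumD psum_mvN addr0 Xi_int_psum.
apply: (nonempty_step eC); apply: IH => [|C' C'0 hC']; last first.
  by apply: hC => // j; rewrite hC' eC psumD psum_mvN addr0.
have : offrow C = offrow A - 1.
  rewrite /offrow (eq_bigr (fun j : 'I_n => psum (Xi_int A) j.+1 N - (j == i)%:Z)) => [|j _].
    rewrite sumrB; congr (_ - _); rewrite (bigD1 i) //= eqxx big1 // => j /negbTE ->; by [].
  rewrite eC psumD psum_mv -[j == i]val_eqE eqSS /= ltn_ord andbT.
  by have := ltn_ord j; have := ltn_ord i; move: (psum _ _ _); nlia.
have := offrow_ge0 A; have := offrow_ge0 C; move: A0 hk.
by move: (offrow A) (offrow C); lia.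
Qed.

Definition triv_flag : seqsp n d F :=
  [ffun i : 'I_N.+1 => if (i <= n)%N then 0 else <<1%:M>>%MS].

Lemma fl_triv k : (k <= N)%N -> fl triv_flag k = if (k <= n)%N then 0 else <<1%:M>>%MS.
Proof. by move=> kN; rewrite /fl ffunE inordK. Qed.

Lemma triv_is_flag : is_flag B triv_flag.
Proof.
apply/is_flagP; split.
- by move=> i; rewrite ffunE; case: ifP => _; rewrite ?genmx0 ?genmx_id.
- by rewrite fl_triv.
- by rewrite fl_triv // ifN; [exact: genmxE | nlia].
- move=> k kN; rewrite !fl_triv ?(ltnW kN) //; case: ifP => h; first exact: sub0mx.
  by rewrite ifN; [exact: submx_refl | nlia].
move=> k kN; rewrite !fl_triv ?leq_subr //.
have p0 : (<<1%:M>>%MS :=: perp 0)%MS.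
  apply: eqmx_trans (genmxE _) _; apply/eqmxP; rewrite submx1 andbT.
  by apply/perpP => w u _ /submx0null ->; rewrite /bil trmx0 mulmx0 mxE.
case: ifP => h.
  rewrite ifN; last by nlia.
  apply: eqmx_sym; apply: eqmx_trans (eq_perp Bs p0) _; exact: perpK.
by rewrite ifT; last by nlia.
Qed.

(** [row_induction] is applied to the matrix and then to the transpose of the result; there remains
    the matrix whose only entry is D at the centre, the orbit of the pair of trivial flags. *)
Lemma orbit_nonempty A : nonempty_orbit A.
Proof.
apply: row_induction => C /offrow0 C0 _.
have [Ct eCt] := Xi_tr C; apply: (@in_orbit_tr Ct); first by rewrite eCt trmxK.
apply: row_induction => E /offrow0 E0 hE.
have E0' (i j : 'I_N) : (i != n :> nat) || (j != n :> nat) -> ent E i j = 0%N.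
  case: (boolP (i == n :> nat)) => [_|/E0 -> //] /= jn.
  have : psum (Xi_int E) N j.+1 - psum (Xi_int E) N j = 0.
    rewrite !hE eCt !psum_tr (psumSl _ j) addrC addKr big1 // => l _.
    by rewrite mxE C0.
  rewrite -[psum _ _ j.+1]psum_tr -[psum _ _ j]psum_tr (psumSl _ j) addrC addKr.
  rewrite (eq_bigr (fun l => (ent E l j)%:Z)) => [|l _]; last by rewrite !mxE.
  rewrite -posz_sum => /eqP; rewrite eqz_nat sum_nat_eq0 => /forallP/(_ i).
  by rewrite ltn_ord => /eqP.
exists triv_flag, triv_flag; have fT := triv_is_flag; split=> //.
apply/(in_orbitP fT fT) => i j iN jN; rewrite /sdim !fl_triv //.
have D0 i' j' : psum (Xi_int E) i' j' = if (n < i')%N && (n < j')%N then D%:Z else 0.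
  have nN : (n < N)%N by nlia.
  pose c := Ordinal nN.
  have eE : Xi_int E = (ent E c c)%:Z *: delta_mx c c.
    apply/matrixP=> k l; rewrite !mxE -!val_eqE /=.
    case: (boolP ((k == n :> nat) && (l == n :> nat))) => [/andP[/eqP hk /eqP hl]|h].
      have -> : k = c by apply: val_inj.
      by have -> : l = c by [apply: val_inj]; rewrite mulr1.
    by rewrite E0' ?mulr0 // -negb_and.
  have psumZ k' (M : 'M[int]_N) a b : psum (k' *: M) a b = k' * psum M a b.
    rewrite /psum mulr_sumr; apply: eq_bigr => k _; rewrite mulr_sumr; apply: eq_bigr => l _.
    by rewrite mxE.
  have cE : (ent E c c)%:Z = D%:Z.
    by have := Xi_int_psum E; rewrite eE psumZ psum_delta /= nN mulr1.
  by rewrite eE psumZ psum_delta cE /=; case: (_ && _); rewrite ?mulr1 ?mulr0.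
rewrite D0 !ltnNge; case: (leqP i n) => _; case: (leqP j n) => _ /=;
  rewrite ?cap0mx ?capmx0 ?mxrank0 //.
by rewrite (capmx_idPl (submx_refl _)) genmxE mxrank1.
Qed.

(** The matrices of the Chevalley generators: a diagonal matrix in which one diagonal unit of column
    [r] has been moved down. *)
Definition is_gen r G := is_diag_mx (Xi_int G - mv r (rlo r)).

Section OnePair.
Variables V U : seqsp n d F.
Hypotheses (fV : is_flag B V) (fU : is_flag B U).

Lemma in_orbit_ranks A : in_orbit A V U -> forall k, (k <= N)%N ->
  (\rank (fl V k))%:Z = psum (Xi_int A) k N /\ (\rank (fl U k))%:Z = psum (Xi_int A) N k.
Proof.
move=> /(in_orbitP fV fU) h k kN; rewrite -!h // (sdimNr _ fU) //.
by rewrite (sdimNl _ fV).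
Qed.

Lemma gen_step r G : is_gen r G -> in_orbit G V U -> step V r U.
Proof.
move=> gG oG; have rk := in_orbit_ranks oG; have rN := ltn_ord r.
have sd i j : (i <= N)%N -> (j <= N)%N -> (sdim V U i j)%:Z =
   psum (Xi_int G - mv r (rlo r)) (minn i j) N + psum (mv r (rlo r)) i j.
  move=> iN jN; rewrite (elimT (in_orbitP fV fU G) oG) // -psum_diag // -psumD subrK.
  by [].
have rV k : (k <= N)%N -> (\rank (fl V k))%:Z =
   psum (Xi_int G - mv r (rlo r)) k N + psum (mv r (rlo r)) k N.
  by move=> kN; rewrite -(sdimNr _ fU) sd // (minn_idPl kN).
have rU k : (k <= N)%N -> (\rank (fl U k))%:Z =
   psum (Xi_int G - mv r (rlo r)) k N.
  by move=> kN; rewrite -(sdimNl _ fV) sd // (minn_idPr kN) psum_mvN addr0.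
have r1 : (r.+1 <= N)%N by nlia.
have r2 : (r.+2 <= N)%N by nlia.
have subl i j : (i <= N)%N -> (j <= N)%N -> sdim V U i j = \rank (fl V i) -> (fl V i <= fl U j)%MS.
  move=> _ _ h; apply/capmx_idPl/eqmxP; rewrite -(geq_leqif (mxrank_leqif_eq _)) ?capmxSl //.
  by rewrite -h.
have subr i j : (i <= N)%N -> (j <= N)%N -> sdim V U i j = \rank (fl U j) -> (fl U j <= fl V i)%MS.
  move=> _ _ h; apply/capmx_idPr/eqmxP; rewrite -(geq_leqif (mxrank_leqif_eq _)) ?capmxSr //.
  by rewrite -h.
have mvr i j : (i <= N)%N -> (j <= N)%N -> psum (mv r (rlo r)) i j =
   ((i == (N - r.+1)%N) && (N - r <= j)%N)%:Z - ((i == r.+1) && (r < j)%N)%:Z.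
  by move=> _ _; rewrite psum_mv.
apply/and4P; split.
- apply: subl => //; apply/eqP; rewrite -eqz_nat sd // rV // minnn !mvr //.
  by apply/eqP; move: (psum _ _ _); nlia.
- have h1 := rU _ r1; have h2 := rV _ r1; rewrite mvr // in h2.
  move: h1 h2; move: (\rank _) (\rank _) (psum _ _ _); nlia.
- apply: subr => //; apply/eqP; rewrite -eqz_nat sd // rU // mvr //.
  rewrite (minn_idPr (leqnSn _)).
  by apply/eqP; move: (psum _ _ _); nlia.
apply/forallP => i; apply/implyP => /andP[i1 i2]; have iN : (i <= N)%N by rewrite -ltnS.
apply/eqP; have [cV _ _ _ _] := flag_spec fV; have [cU _ _ _ _] := flag_spec fU.
have mi j : (j <= N)%N -> psum (mv r (rlo r)) i j = 0.
  by move=> jN; rewrite mvr // (negbTE i1) (negbTE i2).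
have ei W : fl W i = W i :> 'M[F]_D by rewrite /fl inord_val.
rewrite cV cU; apply/genmxP; rewrite -!ei; apply/andP; split.
  by apply: subr => //; apply/eqP; rewrite -eqz_nat sd // rU // mi // minnn addr0.
by apply: subl => //; apply/eqP; rewrite -eqz_nat sd // rV // !mi // minnn.
Qed.

Lemma diag_orbit A : is_diag_mx (Xi_int A) -> in_orbit A V U -> V = U.
Proof.
move=> dA oA; have rk := in_orbit_ranks oA.
apply: (fl_ext fV fU) => k kN; have [h1 h2] := rk k kN.
have h3 : (sdim V U k k)%:Z = psum (Xi_int A) k N.
  by rewrite (elimT (in_orbitP fV fU A) oA) // psum_diag // minnn.
have h4 : psum (Xi_int A) N k = psum (Xi_int A) k N by rewrite psum_diag_sym.
have e1 : (fl V k <= fl U k)%MS.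
  apply/capmx_idPl/eqmxP; rewrite -(geq_leqif (mxrank_leqif_eq _)) ?capmxSl //.
  by move: h1 h3; rewrite /sdim; move: (psum _ _ _); nlia.
apply/eqmxP; rewrite -(geq_leqif (mxrank_leqif_eq _)) //.
by move: h1 h2 h4; move: (psum _ _ _) (psum _ _ _); nlia.
Qed.
End OnePair.

Lemma orbit_self V A : is_flag B V -> in_orbit A V V -> is_diag_mx (Xi_int A).
Proof.
move=> fV oA; apply/is_diag_mxP => i j ij; have iN := ltn_ord i; have jN := ltn_ord j.
have sd k l : (k <= N)%N -> (l <= N)%N -> psum (Xi_int A) k l = (\rank (fl V (minn k l)))%:Z.
  move=> kN lN; rewrite -(elimT (in_orbitP fV fV A) oA) // /sdim.
  case: (leqP k l) => kl.
    by rewrite (capmx_idPl _) // (fl_mono fV) // kl.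
  by rewrite (capmx_idPr _) // (fl_mono fV) // ltnW.
have := psumSS (Xi_int A) i j; rewrite !sd //; try exact: ltnW.
case: (ltngtP i j) ij => // h _.
  rewrite (minn_idPl (ltnW _)) // (minn_idPl h) (minn_idPl _); last by nlia.
  by move: (\rank _) (\rank _) (Xi_int A i j); nlia.
rewrite (minn_idPr (ltnW _)) // (minn_idPr h) (minn_idPr _); last by nlia.
by move: (\rank _) (\rank _) (Xi_int A i j); nlia.
Qed.

(** Together with [gen_step]: the relation [step] is the union of the orbits of the generators, so
    counting steps computes products with generators. *)
Lemma step_gen V r U : is_flag B V -> is_flag B U -> step V r U ->
  exists2 G : Xi n d, is_gen r G & in_orbit G V U.
Proof.
move=> fV fU sU; have [G oG] := in_orbit_ex Bs Bu fV fU; exists G => //.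
have [A oA] := in_orbit_ex Bs Bu fU fU; have dA := orbit_self fU oA.
have /and4P[s1 /eqP s2 s3 /forallP s4] := sU; have rN := ltn_ord r.
have [w wU wV] : exists2 w : 'rV[F]_D, (w <= fl U r.+1)%MS & ~~ (w <= fl V r.+1)%MS.
  have : ~~ (fl U r.+1 <= fl V r.+1)%MS.
    by apply/negP => /mxrankS; rewrite s2 ltnn.
  by case/row_subPn => i hi; exists (row i (fl U r.+1)) => //; apply: row_sub.
have [w2 wi eU] := addline_step Bs Bu fV fU sU wU wV.
have wp : ~~ (w <= layer V U r.+1 (rlo r))%MS.
  apply: contra wV => h; apply: submx_trans h _; rewrite addsmx_sub submx_refl /=.
  apply: submx_trans (capmxSr _ _) _.
  (* For r = n the index r equals N-(r+1), where [step] compares nothing; the inclusion comes from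
     duality instead. *)
  case: (boolP (r == n :> nat)) => [/eqP rn|rn].
    have hr : (r <= N)%N by nlia.
    have hr1 : (r.+1 <= N)%N by nlia.
    have e1 : (N - r = r.+1)%N by nlia.
    have e2 : (N - r.+1 = r)%N by nlia.
    rewrite (fl_perp fU hr) e1.
    apply: submx_trans (_ : fl V r <= _)%MS; last by apply: (fl_mono fV); nlia.
    by have h := fl_perp fV hr; rewrite h e1 perpS.
  have -> : fl U (rlo r) = fl V r.
    have hr : (r < N.+1)%N by nlia.
    have := s4 (inord r); rewrite !inordK // => /implyP h2; rewrite /fl; apply/eqP/h2.
    by apply/andP; split; apply/eqP; move: rn; nlia.
  by apply: (fl_mono fV); nlia.
have wp1 : (w <= layer V U r.+1 (rlo r).+1)%MS.
  by apply: submx_trans (addsmxSr _ _); rewrite sub_capmx w2 wU.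
have eG : Xi_int A = Xi_int G - mv r (rlo r).
  apply: psum_inj => i j iN jN; rewrite psumD psumN.
  rewrite -(elimT (in_orbitP fU fU A) oA) // -(elimT (in_orbitP fV fU G) oG) //.
  by have := sdim_addline Bs Bu fV w2 wi fU wp wp1 iN jN; rewrite eU.
by rewrite /is_gen -eG.
Qed.
End Orbits.

Lemma the_spec (T : Type) (x0 : T) (P : T -> Prop) : (exists x, P x) -> P (the x0 P).
Proof. by rewrite /the; case: pselect => // h _; case: (cid h). Qed.

(** * Integer polynomials and their values at large arguments *)

Lemma poly_infinite_roots (R : idomainType) (f : nat -> R) (P : {poly R}) :
  injective f -> (forall m, exists2 q, (m <= q)%N & P.[f q] = 0) -> P = 0.
Proof.
move=> fi h; apply/eqP; apply: contraT => P0.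
have [s [us ss rs]] : exists s : seq nat, [/\ uniq s, size s = size P & all (fun q => root P (f q)) s].
  elim: (size P) => [|k [s [us ss rs]]]; first by exists [::].
  have [q qs hq] := h (\max_(i <- s) i).+1; exists (q :: s); split=> /=.
  - rewrite us andbT; apply: contraTN qs => qs; rewrite -ltnNge ltnS.
    exact: (@leq_bigmax_seq _ s predT id q qs isT).
  - by rewrite ss.
  - by rewrite rs andbT; apply/eqP.
have := @max_poly_roots _ P (map f s) P0; rewrite all_map map_inj_uniq // size_map ss ltnn.
by move=> /(_ rs us).
Qed.

(** [c] is monic, so division with remainder stays in Z[X]. At arbitrarily large [q] the value of
    the remainder is divisible by that of [c] and yet smaller in absolute value; so it vanishes
    infinitely often. *)
Lemma monic_division (e m : nat) (H : {poly int}) :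
  let c : {poly int} := 'X^e * \sum_(i < m.+1) 'X^i in
  (forall b, exists2 q : nat, (b <= q)%N & exists k : int, c.[q%:Z] * k = H.[q%:Z]) ->
  exists P, H = c * P.
Proof.
move=> c h.
have c_top (q : nat) : c.[q%:Z] >= q%:Z ^+ (e + m).
  rewrite hornerM hornerXn horner_sum exprD ler_wpM2l ?exprn_ge0 //.
  rewrite big_ord_recr /= hornerXn lerDr sumr_ge0 // => i _.
  by rewrite hornerXn exprn_ge0.
have size_c : size c = (e + m).+1 /\ c \is monic.
  have mS : \sum_(i < m.+1) ('X^i : {poly int}) = \poly_(i < m.+1) 1.
    by rewrite poly_def; apply: eq_bigr => i _; rewrite scale1r.
  have sS : size (\poly_(i < m.+1) (1 : int)) = m.+1 by rewrite size_poly_eq ?oner_eq0.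
  have mon : \poly_(i < m.+1) (1 : int) \is monic.
    by rewrite monicE lead_coefE sS coef_poly ltnSn.
  split; last by rewrite /c mS rpredM ?monicXn.
  rewrite /c mS size_Mmonic ?monic_neq0 ?monicXn // size_polyXn sS; lia.
have [sc mc] := size_c.
exists (Pdiv.Ring.rdivp H c); set P := Pdiv.Ring.rdivp H c; pose R := Pdiv.Ring.rmodp H c.
have eH : H = P * c + R := Pdiv.RingMonic.rdivp_eq mc H.
rewrite mulrC {1}eH; suff -> : R = 0 by rewrite addr0.
have sR : (size R <= e + m)%N.
  by have := Pdiv.Ring.ltn_rmodpN0 H (monic_neq0 mc); rewrite sc ltnS.
apply: (@poly_infinite_roots _ (fun q => q%:Z)) => [q q' [] //|b].
(* For q > M the value of [R] is at most M q^{e+m-1}, hence below q^{e+m}. *)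
pose M := (\sum_(i < size R) absz (R`_i)%R)%N.
have [q qb [k hk]] := h (maxn b M.+1); exists q; first by apply: leq_trans qb; rewrite leq_maxl.
have qM : (M < q)%N by apply: leq_trans qb; rewrite leq_maxr.
have hR : R.[q%:Z] = c.[q%:Z] * (k - P.[q%:Z]).
  by rewrite mulrBr hk eH hornerD hornerM; ring.
apply/eqP; apply: contraT => R0.
have le1 : q%:Z ^+ (e + m) <= `|R.[q%:Z]|.
  rewrite hR normrM; apply: le_trans (c_top q) _; apply: le_trans (ler_norm _) _.
  rewrite ler_peMr // -[1]/(1%:Z); move: R0; rewrite hR mulf_eq0 negb_or => /andP[_].
  by move: (k - _) => x; lia.
have : `|R.[q%:Z]| <= M%:Z * q%:Z ^+ (e + m).-1.
  rewrite horner_coef; apply: le_trans (ler_norm_sum _ _ _) _.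
  rewrite /M posz_sum mulr_suml; apply: ler_sum => i _.
  rewrite normrM (ger0_norm (exprn_ge0 _ _)) // abszE ler_wpM2l // -!rmorphXn /= lez_nat.
  rewrite leq_pexp2l //; first by lia.
  by have h1 := leq_trans (ltn_ord i) sR; rewrite -ltnS prednK // (leq_ltn_trans _ h1).
move=> le2; have := le_trans le1 le2.
have em : (0 < e + m)%N.
  rewrite lt0n; apply: contraNneq R0 => em0; move: sR; rewrite em0 leqn0 size_poly_eq0.
  by move=> /eqP ->; rewrite horner0.
rewrite -[in X in X -> _](prednK em) exprS; move: (e + m).-1 => k'.
have : 0 < q%:Z ^+ k' by rewrite exprn_gt0 //; lia.
by move: (q%:Z ^+ k') => x x0; rewrite ler_pM2r //; lia.
Qed.

Lemma large_odd_field (m : nat) : exists F : finFieldType, odd #|F| /\ (m <= #|F|)%N.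
Proof.
have [p mp pp] := prime_above (maxn m 2).
exists 'F_p; rewrite card_Fp //; split; last first.
  by apply: ltnW; apply: leq_ltn_trans mp; rewrite leq_maxl.
have [p2|//] := even_prime pp; move: mp; rewrite p2; lia.
Qed.

Lemma mxDE m k (M M' : 'M[int]_(m, k)) i j : (M + M') i j = M i j + M' i j.
Proof. by rewrite mxE. Qed.
Lemma mxBE m k (M M' : 'M[int]_(m, k)) i j : (M - M') i j = M i j - M' i j.
Proof. by rewrite !mxE. Qed.

(** * Structure polynomials of the Schur algebra *)

Section Combinatorics.
Variable n : nat.
Local Notation N := (dimN n).
Implicit Types (M : 'M[int]_N) (r : 'I_(n.*2)) (p : 'I_N).

(** The sum of the entries in a lower left corner, see [low_sum]. Comparing these sums for j <= i is
    the usual partial order on matrices with given row and column sums; [mu] is a measure compatible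
    with it. *)
Definition low M (i j : nat) : int := psum M N j - psum M i j.
Definition mu M : int := \sum_(i < N) \sum_(j < N | (j <= i)%N) low M i j.

Lemma lowD M M' i j : low (M + M') i j = low M i j + low M' i j.
Proof. by rewrite /low !psumD; ring. Qed.
Lemma lowN M i j : low (- M) i j = - low M i j.
Proof. by rewrite /low !psumN; ring. Qed.

Lemma low_mv r p i j : low (mv r p) i j =
  ((i == r.+1) && (p < j)%N)%:Z - ((i == (N - r.+1)%N) && (N - p <= j)%N)%:Z.
Proof. by rewrite /low psum_mvN psum_mv; ring. Qed.

Definition offdiag_ge0 M := forall k l, k != l -> 0 <= M k l.

Lemma low_sum M i j : low M i j = \sum_(k : 'I_N | (i <= k)%N) \sum_(l : 'I_N | (l < j)%N) M k l.
Proof.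
rewrite /low /psum (bigID (fun k : 'I_N => (k < i)%N)) /=.
rewrite (eq_bigl (fun k : 'I_N => (k < N)%N && (k < i)%N)) ?[X in X - _](_ : _ = 
  \sum_(k : 'I_N | (k < i)%N) \sum_(l < N | (l < j)%N) M k l + 
  \sum_(k : 'I_N | (i <= k)%N) \sum_(l < N | (l < j)%N) M k l) //.
  by rewrite addrAC subrr add0r.
by congr (_ + _); apply: eq_bigl => k; rewrite ltn_ord /= -?leqNgt.
Qed.

Lemma low_ge0 M i j : offdiag_ge0 M -> (j <= i)%N -> 0 <= low M i j.
Proof.
move=> M0 ji; rewrite low_sum; apply: sumr_ge0 => k ik; apply: sumr_ge0 => l lj.
by apply: M0; apply: contraTneq lj => <-; rewrite -leqNgt; lia.
Qed.

Lemma mu_ge0 M : offdiag_ge0 M -> 0 <= mu M.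
Proof. by move=> M0; apply: sumr_ge0 => i _; apply: sumr_ge0 => j; apply: low_ge0. Qed.

Lemma ltr_sum_strict (I : finType) (P : pred I) (f g : I -> int) i0 :
  P i0 -> (forall i, P i -> f i <= g i) -> f i0 < g i0 ->
  \sum_(i | P i) f i < \sum_(i | P i) g i.
Proof.
move=> Pi h hi; rewrite (bigD1 i0) //= [X in _ < X](bigD1 i0) //= ltr_leD // ler_sum //.
by move=> i /andP[/h].
Qed.

Lemma mu_lt M M' (i0 j0 : 'I_N) :
  (forall i j, (j <= i < N)%N -> low M i j <= low M' i j) ->
  (j0 <= i0)%N -> low M i0 j0 < low M' i0 j0 -> mu M < mu M'.
Proof.
move=> h ji hlt; apply: (@ltr_sum_strict _ _ _ _ i0) => // [i _|].
  by apply: ler_sum => j ji'; apply: h; rewrite ji' ltn_ord.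
apply: (@ltr_sum_strict _ _ _ _ j0) => // j ji'; apply: h; rewrite ji' ltn_ord.
by [].
Qed.

(* The last move used to build M from a diagonal matrix: the leftmost column
   with an entry below the diagonal, and the lowest such entry. *)
Definition last_move M r (j : 'I_N) :=
  [/\ (j <= r)%N, 1 <= M (rhi r) j, forall k l : 'I_N, (l < j)%N -> (l < k)%N -> M k l = 0
    & forall k : 'I_N, (r.+1 < k)%N -> M k j = 0].

Lemma last_move_ex M : rot_sym M -> offdiag_ge0 M -> ~~ is_diag_mx M ->
  exists r j, last_move M r j.
Proof.
move=> rM M0 nd.
have ex0 : exists j : 'I_N, [exists k : 'I_N, (j < k)%N && (M k j != 0)].
  apply/existsP; apply: contraR nd; rewrite negb_exists => /forallP h.
  have h' (k j : 'I_N) : (j < k)%N -> M k j = 0.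
    move=> jk; have := h j; rewrite negb_exists => /forallP/(_ k).
    by rewrite jk negbK => /eqP.
  apply/is_diag_mxP => i j; case: (ltngtP i j) => // ij _; last exact: h'.
  rewrite -(rot_symE rM); apply: h' => /=; have := ltn_ord j; lia.
case: ex0 => j0 hj0.
case: (@arg_minnP _ j0 (fun j : 'I_N => [exists k : 'I_N, (j < k)%N && (M k j != 0)]) (fun j => val j) hj0).
move=> j /existsP[k0 hk0] jmin.
case: (@arg_maxnP _ k0 (fun k : 'I_N => (j < k)%N && (M k j != 0)) (fun j => val j) hk0).
move=> k /andP[jk kj] kmax.
have rN : (k.-1 < n.*2)%N by have := ltn_ord k; lia.
exists (Ordinal rN), j; have ek : rhi (Ordinal rN) = k by apply: val_inj; rewrite /= /bump /=; lia.
split; rewrite ?ek //=; first by lia.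
- have := M0 k j; rewrite -val_eqE /= (gtn_eqF jk) => /(_ isT).
  by move: kj; move: (M k j); lia.
- move=> k' l lj lk; apply/eqP; apply: contraTT lj => h; rewrite -leqNgt; apply: jmin.
  by apply/existsP; exists k'; rewrite lk.
move=> k' kk'; apply/eqP; apply: contraTT kk' => h; rewrite -leqNgt.
have := kmax k'; rewrite h andbT /=; case: (ltnP j k') => [_ /(_ isT)|]; lia.
Qed.

Section Last.
Variables (M : 'M[int]_N) (r : 'I_(n.*2)) (j : 'I_N).
Hypothesis lm : last_move M r j.
Let rN := ltn_ord r.

Lemma last_move_ge0 : rot_sym M -> offdiag_ge0 M -> offdiag_ge0 (M - mv r j).
Proof.
move=> rM M0 k l kl; have [jr h _ _] := lm; have := M0 k l kl; rewrite mxBE mvE.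
have e1 : (k == rhi r) && (l == j) -> M k l = M (rhi r) j by case/andP=> /eqP -> /eqP ->.
have e2 : (k == rev_ord (rhi r)) && (l == rev_ord j) -> M k l = M (rhi r) j.
  by case/andP=> /eqP -> /eqP ->; rewrite (rot_symE rM).
have e3 : ~~ (((k == rhi r) && (l == j)) && ((k == rev_ord (rhi r)) && (l == rev_ord j))).
  apply/negP => /andP[/andP[/eqP k1 /eqP l1] /andP[/eqP k2 /eqP l2]].
  have := congr1 val k1; have := congr1 val k2; have := congr1 val l1; have := congr1 val l2.
  by rewrite /= /bump /=; have := ltn_ord k; nlia.
move: e1 e2 e3; set b1 := (k == rhi r) && _; set b2 := (k == rev_ord (rhi r)) && _.
set b3 := (k == rlo r) && _; set b4 := (k == rev_ord (rlo r)) && _.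
move: b1 b2 b3 b4 (M k l) (M (rhi r) j) h => b1 b2 b3 b4 x y; clear.
by case: b1; case: b2; case: b3; case: b4 => /= h e1 e2 e3;
  try have := e1 isT; try have := e2 isT; move: h e3; lia.
Qed.

Lemma mu_last_move : mu (M - mv r j) < mu M.
Proof.
have [jr _ _ _] := lm; have jN := ltn_ord j.
have j1 : (j.+1 < N)%N by nlia.
have r1 : (r.+1 < N)%N by nlia.
apply: (@mu_lt _ _ (Ordinal r1) (Ordinal j1)) => [i k ik||]; rewrite ?lowD ?lowN ?low_mv /=; try nlia.

Qed.

Lemma low_exchange p i k : (j < p)%N -> (k <= i < N)%N ->
  low (mv r p) i k <= low (mv r j) i k.
Proof. by move=> jp ik; rewrite !low_mv; have := ltn_ord p; nlia. Qed.

(** A unit further to the right lies in fewer lower left corners. Hence, if the last move is undone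
    and replaced by a move in a column to its right, a smaller matrix results. *)
Lemma mu_exchange M' p : (j < p)%N -> mu (M' - mv r j + mv r p) < mu M'.
Proof.
move=> jp; have [jr _ _ _] := lm; have pN := ltn_ord p.
have j1 : (j.+1 < N)%N by nlia.
have r1 : (r.+1 < N)%N by nlia.
apply: (@mu_lt _ _ (Ordinal r1) (Ordinal j1)) => [i k ik||] /=; first 1 last.
- nlia.
- by rewrite lowD lowD lowN low_mv low_mv; move: (low _ _ _); nlia.
by rewrite lowD lowD lowN; have := low_exchange jp ik; move: (low _ _ _) (low _ _ _) (low _ _ _); lia.
Qed.

(* As column p has no unit below the diagonal, a further move would make an
   off-diagonal entry negative. *)
Lemma no_left_move p : (p < j)%N -> ~ offdiag_ge0 (M - mv r j + mv r p).
Proof.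
move=> pj h; have [jr _ h0 _] := lm.
have := h (rlo r) p; rewrite -val_eqE /= => /(_ _) hh.
have := hh _; rewrite mxDE mxBE !mvE h0 ?eqxx //=; last by nlia.
rewrite -!val_eqE /= /bump /=.
by move=> /(_ _); have := ltn_ord p; have := ltn_ord j; nlia.
Qed.
End Last.
End Combinatorics.

(** * Existence and uniqueness of the structure polynomials *)

Section StructurePolynomials.
Variables n d : nat.
Local Notation D := (dimN d).
Local Notation N := (dimN n).
Implicit Types (A C G E : Xi n d) (r : 'I_(n.*2)) (p : 'I_N).

Definition cqp A r p : {poly int} :=
  'X^(\sum_(l : 'I_N | (l < p)%N) ent A (rhi r) l)%N *
  \sum_(i < (ent A (rhi r) p).+1) 'X^i.

Lemma cqpE A r p (q : nat) : (cqp A r p).[q%:Z] = (cq A r p q)%:Z.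
Proof.
rewrite hornerM hornerXn horner_sum /cq PoszM posz_sum -!rmorphXn /=; congr (_ * _).
by apply: eq_bigr => i _; rewrite hornerXn -rmorphXn.
Qed.

Lemma cq_gt0 A r p q : (0 < q)%N -> (0 < cq A r p q)%N.
Proof.
by move=> q0; rewrite muln_gt0 expn_gt0 q0 big_ord_recl expn0.
Qed.

Section OneForm.
Variables (F : finFieldType) (B : 'M[F]_(dimN d)).
Hypotheses (oddF : odd #|F|) (Bs : B^T = B) (Bu : B \in unitmx).
Variables (V1 V2 : seqsp n d F).
Hypotheses (f1 : is_flag B V1) (f2 : is_flag B V2).
Local Notation q := #|F|.

(** Associativity with a generator on the left, as a double count: the pairs (U, V) with a step from
    [V1] to U, (U, V) in the orbit of [A] and (V, V2) in that of [A'] are summed over U first or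
    over V first. *)
Lemma count_step A A' r :
  (\sum_(U | is_flag B U && step V1 r U) conv_count B A A' U V2 =
   \sum_E \sum_(p | Xi_int E == (Xi_int A + mv r p)%R) cq A r p q * conv_count B E A' V1 V2)%N.
Proof.
transitivity (\sum_(V | is_flag B V && in_orbit A' V V2)
   #|[set U | [&& is_flag B U, step V1 r U & in_orbit A U V]]|)%N.
  rewrite /conv_count; under eq_bigr do rewrite -sum1_card.
  under [RHS]eq_bigr do rewrite -sum1_card.
  rewrite (exchange_big_dep (fun V => is_flag B V && in_orbit A' V V2)) /=; last first.
    by move=> U V _; rewrite inE => /and3P[-> _ ->].
  apply: eq_bigr => V /andP[fV oV]; apply: eq_bigl => U; rewrite !inE fV oV andbT.
  by rewrite -andbA.
rewrite (eq_bigr (fun V => \sum_E (in_orbit E V1 V) *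
    \sum_(p | Xi_int E == (Xi_int A + mv r p)%R) cq A r p q)%N); last first.
  move=> V /andP[fV oV]; have [E0 oE0] := in_orbit_ex Bs Bu f1 fV.
  rewrite (bigD1 E0) //= oE0 mul1n [X in (_ + X)%N]big1 ?addn0.
    by rewrite (step_count oddF Bs Bu r f1 fV A oE0).
  move=> E; case: (boolP (in_orbit E V1 V)) => // oE.
  by rewrite (in_orbit_uniq f1 fV oE oE0) eqxx.
rewrite exchange_big; apply: eq_bigr => E _ /=.
rewrite -big_distrl /= -big_distrl /= mulnC; congr (_ * _)%N.
rewrite /conv_count -sum1_card big_mkcond [RHS]big_mkcond; apply: eq_bigr => V _.
rewrite inE; case: (is_flag B V) => //=.
by case: (in_orbit A' V V2); case: (in_orbit E V1 V).
Qed.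

Lemma sum_step_orbit C r (f : Xi n d -> int) : in_orbit C V1 V2 ->
  \sum_(U | is_flag B U && step V1 r U) \sum_(E | in_orbit E U V2) f E =
  \sum_E \sum_(p | Xi_int C == Xi_int E + mv r p) (cq E r p q)%:Z * f E.
Proof.
move=> oC; rewrite (exchange_big_dep predT) //=; apply: eq_bigr => E _.
rewrite -mulr_suml -posz_sum -(step_count oddF Bs Bu r f1 f2 E oC).
rewrite -sum1_card posz_sum mulr_suml; apply: eq_big => [U|U _]; last by rewrite mul1r.
by rewrite inE andbA.
Qed.

(** The orbit of a diagonal matrix consists of pairs (V, V), so [V1] is the only candidate for the
    middle flag. *)
Lemma count_diag A A' C : is_diag_mx (Xi_int A) -> in_orbit C V1 V2 ->
  conv_count B A A' V1 V2 =
  ((A' == C) && [forall k : 'I_N.+1, psum (Xi_int A) k N == psum (Xi_int C) k N]).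
Proof.
move=> dA oC; have [E oE] := in_orbit_ex Bs Bu f1 f1; have dE := orbit_self f1 oE.
have rk := in_orbit_ranks f1 f2 oC; have rkE := in_orbit_ranks f1 f1 oE.
have -> : [forall k : 'I_N.+1, psum (Xi_int A) k N == psum (Xi_int C) k N] = in_orbit A V1 V1.
  apply/forallP/idP => [h|oA k].
    suff -> : A = E by [].
    apply: Xi_int_inj; apply: psum_inj => i j iN jN.
    rewrite (psum_diag _ _ dA) (psum_diag _ _ dE).
    have hm : (minn i j <= N)%N by rewrite geq_min iN.
    have := h (inord (minn i j)); rewrite inordK // => /eqP ->.
    by have [<- _] := rk _ hm; have [<- _] := rkE _ hm.
  have kN : (k <= N)%N by rewrite -ltnS.
  have [<- _] := rk _ kN.
  by have [<- _] := in_orbit_ranks f1 f1 oA kN.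
case: (boolP (in_orbit A V1 V1)) => oA; rewrite ?andbT ?andbF.
  rewrite /conv_count; have -> : (A' == C) = in_orbit A' V1 V2.
    by apply/eqP/idP => [->|/(in_orbit_uniq f1 f2)/(_ oC)].
  case: (boolP (in_orbit A' V1 V2)) => oA'.
    transitivity #|[set V1]|; last by rewrite cards1.
    congr #|pred_of_set _|; apply/setP=> V; rewrite !inE.
    apply/and3P/eqP => [[fV oV _]|->]; last by [].
    by apply/esym: (diag_orbit f1 fV dA oV).
  apply: eq_card0 => V; rewrite inE; apply/and3P => -[fV oV oA2].
  by move: oA'; rewrite (diag_orbit f1 fV dA oV) oA2.
apply: eq_card0 => V; rewrite inE; apply/and3P => -[fV oV oA2].
by move: oA; rewrite {2}(diag_orbit f1 fV dA oV) oV.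
Qed.
End OneForm.

Definition count_poly A A' C (P : {poly int}) :=
  forall (F : finFieldType) (B : 'M[F]_(dimN d)),
    odd #|F| -> B^T = B -> B \in unitmx ->
    forall V1 V2 : seqsp n d F, is_flag B V1 -> is_flag B V2 ->
      in_orbit C V1 V2 -> P.[#|F|%:Z] = (conv_count B A A' V1 V2)%:Z.

(** The supply of evaluation points for identities between structure polynomials; the identity
    matrix serves as Gram matrix. *)
Lemma large_orbit C b : exists F : finFieldType, exists B : 'M[F]_(dimN d),
  exists V1 V2 : seqsp n d F,
  [/\ odd #|F|, (b <= #|F|)%N, B^T = B, B \in unitmx &
    [/\ is_flag B V1, is_flag B V2 & in_orbit C V1 V2]].
Proof.
have [F [oF bF]] := large_odd_field b; exists F, 1%:M.
have [V1 [V2 h]] := @orbit_nonempty n d F 1%:M oF (trmx1 _ _) (unitmx1 _ _) C.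
by exists V1, V2; split=> //; rewrite ?trmx1 ?unitmx1.
Qed.

Lemma count_poly_uniq A A' C P Q : count_poly A A' C P -> count_poly A A' C Q -> P = Q.
Proof.
move=> hP hQ; apply/eqP; rewrite -subr_eq0; apply/eqP.
apply: (@poly_infinite_roots _ Posz) => [x y []//|b].
have [F [B [V1 [V2 [oF bF Bs Bu [f1 f2 oC]]]]]] := large_orbit C b.
by exists #|F| => //; rewrite hornerD hornerN (hP F B oF Bs Bu V1 V2) // (hQ F B oF Bs Bu V1 V2) // subrr.
Qed.

Lemma Xi_mu_ge0 A : 0 <= mu (Xi_int A).
Proof. by apply: mu_ge0 => k l _; apply: Xi_int_ge0. Qed.

Lemma Xi_minus_move A r p : last_move (Xi_int A) r p -> exists E, Xi_int E = Xi_int A - mv r p.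
Proof.
move=> lm; apply: Xi_of_int.
- move=> k l; case: (boolP (k == l)) => [/eqP <-|kl]; last first.
    apply: last_move_ge0 => //; first exact: Xi_int_rot.
    by move=> k' l' _; apply: Xi_int_ge0.
  rewrite mxBE mvE; have := Xi_int_ge0 A k k; have [jr h _ _] := lm.
  have : ~~ ((k == rhi r) && (k == p)).
    by apply/negP => /andP[/eqP -> /eqP/(congr1 val)]; rewrite /= /bump; lia.
  have : ~~ ((k == rev_ord (rhi r)) && (k == rev_ord p)).
    apply/negP => /andP[/eqP -> /eqP/rev_ord_inj/(congr1 val)]; rewrite /= /bump; lia.
  move: (Xi_int A k k); lia.
- by apply: rot_symD (Xi_int_rot A) (rot_symN (rot_sym_mv _ _)).
by rewrite psumD psumN psum_mvN subr0 Xi_int_psum.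
Qed.

(** Induction on [mu]. If [A] arises from [A0] by its last move, the product of a generator, [A0]
    and [A'] is expanded in two ways; [A] appears with coefficient [cqp A0 r j], and every other
    matrix in the expansion is smaller. *)
Lemma gpolyP A A' C : count_poly A A' C (gpoly A A' C).
Proof.
have [k] := ubnP `|mu (Xi_int A)|%N; elim: k => // k IH in A A' C *.
rewrite ltnS => hk; apply: the_spec.
case: (boolP (is_diag_mx (Xi_int A))) => [dA|nd].
  exists (((A' == C) && [forall k : 'I_N.+1, psum (Xi_int A) k N == psum (Xi_int C) k N]) : nat)%:R.
  move=> F B oF Bs Bu V1 V2 f1 f2 oC; rewrite (count_diag Bs Bu f1 f2 A' dA oC).
  by rewrite -polyC_natr hornerC natz.
have [r [j lm]] : exists r j, last_move (Xi_int A) r j.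
  apply: last_move_ex => //; first exact: Xi_int_rot.
  by move=> k' l' _; apply: Xi_int_ge0.
have [A0 eA0] := Xi_minus_move lm.
have IH' E A1 C1 : mu (Xi_int E) < mu (Xi_int A) -> count_poly E A1 C1 (gpoly E A1 C1).
  by move=> h; apply: IH; move: hk (Xi_mu_ge0 E) (Xi_mu_ge0 A) h; lia.
have mA0 : mu (Xi_int A0) < mu (Xi_int A) by rewrite eA0; apply: mu_last_move.
have mE E p : Xi_int E = Xi_int A0 + mv r p -> E != A -> mu (Xi_int E) < mu (Xi_int A).
  move=> eE nE; rewrite eE eA0; case: (ltngtP p j) => [pj|jp|pj].
  - exfalso; apply: (no_left_move lm pj); rewrite -eA0 -eE => k' l' _; exact: Xi_int_ge0.
  - exact: (mu_exchange lm).
  have {}pj : p = j by apply: val_inj.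
  by move: nE; rewrite (_ : E = A) ?eqxx //; apply: Xi_int_inj; rewrite eE eA0 pj subrK.
(* The first sum is the generator times the product of [A0] and [A']; the second removes the
   matrices other than [A] from the generator times [A0]. *)
pose H := \sum_E \sum_(p | Xi_int C == Xi_int E + mv r p) cqp E r p * gpoly A0 A' E
   - \sum_(E | E != A) \sum_(p | Xi_int E == Xi_int A0 + mv r p) cqp A0 r p * gpoly E A' C.
have hH (F : finFieldType) (B : 'M[F]_(dimN d)) : odd #|F| -> B^T = B -> B \in unitmx ->
    forall V1 V2 : seqsp n d F, is_flag B V1 -> is_flag B V2 -> in_orbit C V1 V2 ->
    (cqp A0 r j).[#|F|%:Z] * (conv_count B A A' V1 V2)%:Z = H.[#|F|%:Z].
  move=> oF Bs Bu V1 V2 f1 f2 oC; rewrite /H hornerD hornerN !horner_sum.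
  have e1 : \sum_E (\sum_(p | Xi_int C == Xi_int E + mv r p) cqp E r p * gpoly A0 A' E).[#|F|%:Z]
     = (\sum_(U | is_flag B U && step V1 r U) conv_count B A0 A' U V2)%N%:Z.
    rewrite (eq_bigr (fun E => \sum_(p | Xi_int C == Xi_int E + mv r p)
        (cq E r p #|F|)%:Z * (gpoly A0 A' E).[#|F|%:Z])) => [|E _]; last first.
      by rewrite horner_sum; apply: eq_bigr => p _; rewrite hornerM cqpE.
    rewrite -(@sum_step_orbit F B oF Bs Bu V1 V2 f1 f2 C r (fun E => (gpoly A0 A' E).[#|F|%:Z]) oC) posz_sum.
    apply: eq_bigr => U /andP[fU _]; have [E0 oE0] := in_orbit_ex Bs Bu fU f2.
    rewrite (bigD1 E0) //= [X in _ + X]big1 ?addr0 => [|E /andP[oE]].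
      by rewrite (IH' A0 A' E0 mA0 F B oF Bs Bu U V2).
    by rewrite (in_orbit_uniq fU f2 oE oE0) eqxx.
  rewrite e1 (count_step oF Bs Bu V2 f1) posz_sum (bigD1 A) //=.
  rewrite (_ : \sum_(i | i != A) _ = \sum_(E | E != A)
     (\sum_(p | Xi_int E == Xi_int A0 + mv r p) cqp A0 r p * gpoly E A' C).[#|F|%:Z]).
    rewrite addrK posz_sum (bigD1 j) /= ?big1 ?addr0 ?PoszM ?cqpE //.
      move=> p /andP[/eqP e pj]; exfalso; move: e; rewrite eA0 => e.
      have pj' : (p != j :> nat) by [].
      case: (ltngtP p j) pj' => // pj' _.
        by apply: (no_left_move lm pj'); rewrite -e => k' l' _; apply: Xi_int_ge0.
      by have := mu_exchange lm (Xi_int A) pj'; rewrite -e ltxx.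
    by rewrite eA0 subrK.
  apply: eq_bigr => E nE; rewrite horner_sum posz_sum; apply: eq_bigr => p /eqP eE.
  by rewrite hornerM cqpE PoszM (IH' E A' C (mE _ _ eE nE) F B oF Bs Bu V1 V2).
(* At each prime power the quotient of the values is a number of flags, hence an integer, as
   [monic_division] requires. *)
have [P eP] : exists P, H = cqp A0 r j * P.
  apply: monic_division => b; have [F [B [V1 [V2 [oF bF Bs Bu [f1 f2 oC]]]]]] := large_orbit C b.
  by exists #|F| => //; exists (conv_count B A A' V1 V2)%:Z; apply: hH.
exists P => F B oF Bs Bu V1 V2 f1 f2 oC.
have c0 : (cqp A0 r j).[#|F|%:Z] != 0.
  by rewrite cqpE -lt0n // cq_gt0 // ltnW // finNzRing_gt1.
by apply: (mulfI c0); rewrite -hornerM -eP (hH F B oF Bs Bu V1 V2).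
Qed.
End StructurePolynomials.

(** * The normalization d_A *)

Section PairSums.
Variable n : nat.
Local Notation N := (dimN n).
Local Notation I := ('I_N * 'I_N)%type.
Implicit Types (M : 'M[int]_N) (c : I -> I -> int) (r : 'I_(n.*2)) (p : 'I_N).

Definition pairsum c M : int := \sum_(x : I) \sum_(y : I) c x y * (M x.1 x.2 * M y.1 y.2).
Definition rev2 (x : I) : I := (rev_ord x.1, rev_ord x.2).

Lemma rev2K : involutive rev2.
Proof. by case=> i j; rewrite /rev2 /= !rev_ordK. Qed.

Lemma eq_pairsum c c' M : (forall x y, c x y = c' x y) -> pairsum c M = pairsum c' M.
Proof. by move=> e; apply: eq_bigr => x _; apply: eq_bigr => y _; rewrite e. Qed.
Lemma pairsumD c c' M : pairsum (fun x y => c x y + c' x y) M = pairsum c M + pairsum c' M.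
Proof.
rewrite -big_split; apply: eq_bigr => x _ /=; rewrite -big_split; apply: eq_bigr => y _ /=.
by rewrite mulrDl.
Qed.
Lemma pairsum_swap c M : pairsum (fun x y => c y x) M = pairsum c M.
Proof.
rewrite /pairsum exchange_big; apply: eq_bigr => x _; apply: eq_bigr => y _ /=.
by rewrite (mulrC (M _ _)).
Qed.
Lemma pairsum_revr c M : rot_sym M -> pairsum (fun x y => c x (rev2 y)) M = pairsum c M.
Proof.
move=> rM; apply: eq_bigr => x _.
rewrite [RHS](reindex_inj (can_inj rev2K)); apply: eq_bigr => y _.
by rewrite /= (rot_symE rM).
Qed.
Lemma pairsum_rev c M : rot_sym M -> pairsum (fun x y => c (rev2 y) (rev2 x)) M = pairsum c M.
Proof.
move=> rM; rewrite -[RHS]pairsum_revr // -[RHS]pairsum_swap -[RHS]pairsum_revr //.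
Qed.

Definition wt (x y : I) : int := ((y.1 <= x.1)%N && (x.2 < y.2)%N)%:Z.
Definition low_half M : int := \sum_(x : I | (n <= x.1)%N && (x.2 < n)%N) M x.1 x.2.

(** Rotation symmetry merges the irregular sums in [dA] into the single quadratic form of [wt], in
    which the middle row and the antidiagonal play no special part. This makes the change of [dA]
    under a move computable. *)
Lemma pairsum_wt M : rot_sym M -> pairsum wt M =
  2 * pairsum (fun x y => ([&& y.1 < x.1, x.2 < y.2 & x.1 + y.1 < n.*2]%N)%:Z) M +
  2 * pairsum (fun x y => ([&& x.1 == y.1, x.2 < y.2 & (x.1 < n) || (x.2 + y.2 < n.*2)]%N)%:Z) M +
  \sum_(x : I | (n <= x.1)%N && (x.2 < n)%N) M x.1 x.2 * M x.1 x.2.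
Proof.
move=> rM.
(* The pairs are sorted by rows: the [A] have different rows, with sum below, above or equal to 2n;
   the [B] share a row above or below the middle one; the [C] share the middle row and are sorted by
   the sum of their columns. *)
pose A1 (x y : I) := ([&& y.1 < x.1, x.2 < y.2 & x.1 + y.1 < n.*2]%N)%:Z : int.
pose A2 (x y : I) := ([&& y.1 < x.1, x.2 < y.2 & n.*2 < x.1 + y.1]%N)%:Z : int.
pose A3 (x y : I) := ([&& y.1 < x.1, x.2 < y.2 & x.1 + y.1 == n.*2]%N)%:Z : int.
pose B1 (x y : I) := ([&& x.1 == y.1, x.2 < y.2 & x.1 < n]%N)%:Z : int.
pose B2 (x y : I) := ([&& x.1 == y.1, x.2 < y.2 & n < x.1]%N)%:Z : int.
pose C1 (x y : I) := ([&& x.1 == y.1, x.2 < y.2, x.1 == n :> nat & x.2 + y.2 < n.*2]%N)%:Z : int.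
pose C2 (x y : I) := ([&& x.1 == y.1, x.2 < y.2, x.1 == n :> nat & n.*2 < x.2 + y.2]%N)%:Z : int.
pose C3 (x y : I) := ([&& x.1 == y.1, x.2 < y.2, x.1 == n :> nat & x.2 + y.2 == n.*2]%N)%:Z : int.
pose P (x y : I) := ([&& x.1 == y.1, x.2 < y.2, n < x.1 & x.2 + y.2 < n.*2]%N)%:Z : int.
pose Dg (x y : I) := ([&& x.1 == y.1, x.2 == y.2, n <= x.1 & x.2 < n]%N)%:Z : int.
have eord (i j : 'I_N) : (i == j) = (i == j :> nat) by [].
have lt (i : 'I_N) : (i <= n.*2)%N by rewrite -ltnS.
have e0 : pairsum wt M = pairsum A1 M + pairsum A2 M + pairsum A3 M + (pairsum B1 M + pairsum B2 M)
   + (pairsum C1 M + pairsum C2 M + pairsum C3 M).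
  rewrite -!pairsumD; apply: eq_pairsum => -[i j] [k l].
  rewrite /wt /A1 /A2 /A3 /B1 /B2 /C1 /C2 /C3 /= !eord; case: (ltnP j l) => _; rewrite ?andbF //=.
  by move: (nat_of_ord i) (nat_of_ord k) (nat_of_ord j) (nat_of_ord l) => {}i {}k {}j {}l; lia.
have e1 : pairsum A2 M = pairsum A1 M.
  rewrite -[RHS]pairsum_rev //; apply: eq_pairsum => -[i j] [k l]; rewrite /A1 /A2 /= !subSS.
  by move: (lt i) (lt j) (lt k) (lt l); nlia.
have e2 : pairsum B2 M = pairsum B1 M.
  rewrite -[RHS]pairsum_rev //; apply: eq_pairsum => -[i j] [k l]; rewrite /B1 /B2 /= !eord /= !subSS.
  by move: (lt i) (lt j) (lt k) (lt l); nlia.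
have e3 : pairsum C2 M = pairsum C1 M.
  rewrite -[RHS]pairsum_rev //; apply: eq_pairsum => -[i j] [k l]; rewrite /C1 /C2 /= !eord /= !subSS.
  by move: (lt i) (lt j) (lt k) (lt l); nlia.
(* Replacing one factor by its mirror image turns pairs in mirrored rows into pairs in the same row;
   [Dg] collects the pairs of equal positions. *)
have e4 : pairsum A3 M + pairsum C3 M = pairsum P M + pairsum P M + pairsum Dg M.
  rewrite -{2}(pairsum_swap P) -!pairsumD -pairsum_revr //; apply: eq_pairsum => -[i j] [k l].
  rewrite /A3 /C3 /P /Dg /= !eord /= !subSS.
  move: (lt i) (lt j) (lt k) (lt l); move: (nat_of_ord i) (nat_of_ord j) (nat_of_ord k) (nat_of_ord l).
  clear=> i j k l hi hj hk hl.
  have -> : (i + (n.*2 - k) == n.*2)%N = (i == k) by apply/eqP/eqP; nlia.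
  have -> : (j + (n.*2 - l) == n.*2)%N = (j == l) by apply/eqP/eqP; nlia.
  have -> : (j < n.*2 - l)%N = (j + l < n.*2)%N by nlia.
  rewrite (addnC l j) [(k == i)]eq_sym; case: (i =P k) => [<-|ik] /=; last first.
    by rewrite !andbF; case: eqP => //= h; case: eqP => //= h2; nlia.
  have -> : (n.*2 - i < i)%N = (n < i)%N by nlia.
  have -> : (i == n.*2 - i)%N = (i == n) by apply/eqP/eqP; nlia.
  by case: (ltngtP i n) => _ /=; rewrite ?andbF //; case: (ltngtP j l) => [jl|jl|<-] /=;
    rewrite ?andbF ?andbT ?addr0 ?add0r //; congr (Posz (nat_of_bool _)); nlia.
have e5 : pairsum (fun x y => ([&& x.1 == y.1, x.2 < y.2 & (x.1 < n) || (x.2 + y.2 < n.*2)]%N)%:Z) M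
   = pairsum B1 M + (pairsum C1 M + pairsum P M).
  rewrite -!pairsumD; apply: eq_pairsum => -[i j] [k l]; rewrite /B1 /C1 /P /= !eord.
  by move: (lt i) (lt j) (lt k) (lt l); nlia.
have e6 : pairsum Dg M = \sum_(x : I | (n <= x.1)%N && (x.2 < n)%N) M x.1 x.2 * M x.1 x.2.
  rewrite [RHS]big_mkcond; apply: eq_bigr => x _ /=; rewrite (bigD1 x) //= [X in _ + X]big1 ?addr0 => [|y yx].
    by rewrite /Dg !eqxx /=; case: ifP; rewrite ?mul1r ?mul0r.
  rewrite /Dg; case: (boolP (x.1 == y.1)) => [/eqP e|]; last by rewrite mul0r.
  case: (boolP (x.2 == y.2)) => [/eqP e'|]; last by rewrite mul0r.
  by move: yx; rewrite [x]surjective_pairing e e' -surjective_pairing eqxx.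
rewrite -/A1 e5 -e6 e0 e1 e2 e3; move: e4.
by move: (pairsum A3 M) (pairsum C3 M) (pairsum P M) (pairsum Dg M) => a3 c3 p dg; lia.
Qed.

Lemma low_halfE M : low_half M = psum M N n - psum M n n.
Proof.
have -> : psum M N n - psum M n n = low M n n by [].
by rewrite low_sum pair_big.
Qed.

Lemma low_halfD M M' : low_half (M + M') = low_half M + low_half M'.
Proof. by rewrite /low_half -big_split; apply: eq_bigr => x _; rewrite mxDE. Qed.

Lemma low_half_mv r p : low_half (mv r p) =
  ((r.+1 == n) && (p < n)%N)%:Z - ((r == n :> nat) && (n < p)%N)%:Z.
Proof.
rewrite low_halfE psum_mvN psum_mv; have := ltn_ord r; have := ltn_ord p; nlia.
Qed.

Lemma dAE d (A : Xi n d) :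
  2 * (dA A)%:Z = pairsum wt (Xi_int A) - low_half (Xi_int A).
Proof.
have e1 : (\sum_(i : 'I_N) \sum_(j : 'I_N) \sum_(k : 'I_N)
     \sum_(l : 'I_N | [&& k < i, j < l & i.+1 + k.+1 < N.+1]) ent A i j * ent A k l)%N%:Z =
   pairsum (fun x y => ([&& y.1 < x.1, x.2 < y.2 & x.1 + y.1 < n.*2]%N)%:Z) (Xi_int A).
  rewrite /pairsum -(pair_big predT predT
    (fun i j : 'I_N => \sum_(y : I) ([&& y.1 < i, j < y.2 & i + y.1 < n.*2]%N)%:Z *
       (Xi_int A i j * Xi_int A y.1 y.2))) /=.
  rewrite posz_sum; apply: eq_bigr => i _; rewrite posz_sum; apply: eq_bigr => j _.
  rewrite -(pair_big predT predT (fun k l : 'I_N => ([&& k < i, j < l & i + k < n.*2]%N)%:Z *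
       (Xi_int A i j * Xi_int A k l))) /= posz_sum.
  apply: eq_bigr => k _; rewrite posz_sum big_mkcond; apply: eq_bigr => l _ /=.
  rewrite !mxE -PoszM addSn addnS !ltnS.
  by case: ifP => /= _; rewrite ?mul1r ?mul0r.
have e2 : (\sum_(i : 'I_N) \sum_(j : 'I_N)
     \sum_(l : 'I_N | (j < l) && ((i.+1 < n.+1) || (j.+1 + l.+1 < N.+1))) ent A i j * ent A i l)%N%:Z =
   pairsum (fun x y => ([&& x.1 == y.1, x.2 < y.2 & (x.1 < n) || (x.2 + y.2 < n.*2)]%N)%:Z) (Xi_int A).
  rewrite /pairsum -(pair_big predT predT
    (fun i j : 'I_N => \sum_(y : I) ([&& i == y.1, j < y.2 & (i < n) || (j + y.2 < n.*2)]%N)%:Z *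
       (Xi_int A i j * Xi_int A y.1 y.2))) /=.
  rewrite posz_sum; apply: eq_bigr => i _; rewrite posz_sum; apply: eq_bigr => j _.
  rewrite -(pair_big predT predT (fun k l : 'I_N => ([&& i == k, j < l & (i < n) || (j + l < n.*2)]%N)%:Z *
       (Xi_int A i j * Xi_int A k l))) /=.
  rewrite [RHS](bigD1 i) //= [X in _ = _ + X]big1 ?addr0 => [|k ki]; last first.
    by apply: big1 => l _; rewrite eq_sym (negbTE ki) mul0r.
  rewrite posz_sum big_mkcond; apply: eq_bigr => l _ /=.
  rewrite !mxE -PoszM eqxx addSn addnS !ltnS.
  by case: ifP => /= _; rewrite ?mul1r ?mul0r.
have e3 : 2 * (\sum_(i : 'I_N) \sum_(j : 'I_N | (n.+1 <= i.+1) && (j.+1 < n.+1))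
     (ent A i j * (ent A i j).-1)./2)%N%:Z =
   \sum_(x : I | (n <= x.1)%N && (x.2 < n)%N) Xi_int A x.1 x.2 * Xi_int A x.1 x.2 - low_half (Xi_int A).
  rewrite /low_half -sumrB -(pair_big_dep predT (fun i j : 'I_N => (n <= i)%N && (j < n)%N)
     (fun i j : 'I_N => Xi_int A i j * Xi_int A i j - Xi_int A i j)) /=.
  rewrite posz_sum mulr_sumr; apply: eq_bigr => i _; rewrite posz_sum mulr_sumr.
  apply: eq_big => [j|j _]; first by rewrite !ltnS.
  rewrite !mxE; case: (ent A i j) => [|a] //=.
  have : (a.+1 * a)./2.*2 = (a.+1 * a)%N.
    by rewrite -[RHS]odd_double_half oddM /= andNb.
  by move: (_./2) => h; lia.
rewrite (pairsum_wt (Xi_int_rot A)) /dA !PoszD e1 e2 !mulrDr e3; ring.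
Qed.

(** The partial derivative of [pairsum wt] in the entry (i, j), see [side_wt]. *)
Definition side (M : 'M[int]_N) (i j : 'I_N) : int :=
  \sum_(k : 'I_N | (k <= i)%N) \sum_(l : 'I_N | (j < l)%N) M k l +
  \sum_(k : 'I_N | (i <= k)%N) \sum_(l : 'I_N | (l < j)%N) M k l.

Definition rowdiff (M : 'M[int]_N) (r : 'I_(n.*2)) (p : 'I_N) : int :=
  \sum_(l : 'I_N | (p < l)%N) M (rhi r) l - \sum_(l : 'I_N | (l < p)%N) M (rlo r) l.

Lemma side_rev M i j : rot_sym M -> side M (rev_ord i) (rev_ord j) = side M i j.
Proof.
move=> rM; rewrite /side addrC; congr (_ + _).
  rewrite [RHS](reindex_inj rev_ord_inj); apply: eq_big => [k|k _] /=.
    by have := ltn_ord i; have := ltn_ord k; nlia.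
  rewrite [RHS](reindex_inj rev_ord_inj); apply: eq_big => [l|l _] /=.
    by have := ltn_ord j; have := ltn_ord l; nlia.
  by rewrite (rot_symE rM).
rewrite [RHS](reindex_inj rev_ord_inj); apply: eq_big => [k|k _] /=.
  by have := ltn_ord i; have := ltn_ord k; nlia.
rewrite [RHS](reindex_inj rev_ord_inj); apply: eq_big => [l|l _] /=.
  by have := ltn_ord j; have := ltn_ord l; nlia.
by rewrite (rot_symE rM).
Qed.

Lemma side_diff M r p : side M (rhi r) p - side M (rlo r) p = rowdiff M r p.
Proof.
have h1 (f : 'I_N -> int) : \sum_(k : 'I_N | (k <= rhi r)%N) f k =
   \sum_(k : 'I_N | (k <= rlo r)%N) f k + f (rhi r) by exact: (big_ltS f (rhi r)).
have h2 (g : 'I_N -> int) : \sum_(k : 'I_N | (rlo r <= k)%N) g k =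
   \sum_(k : 'I_N | (rhi r <= k)%N) g k + g (rlo r).
  rewrite (bigD1 (rlo r)) //= addrC; congr (_ + _); apply: eq_bigl => k.
  by rewrite -val_eqE /= /bump /=; nlia.
by rewrite /side /rowdiff h1 h2; ring.
Qed.

Lemma pairsumDM c M M' : pairsum c (M + M') = pairsum c M + pairsum c M' +
  \sum_(y : I) (\sum_(x : I) (c x y + c y x) * M x.1 x.2) * M' y.1 y.2.
Proof.
have -> : \sum_(y : I) (\sum_(x : I) (c x y + c y x) * M x.1 x.2) * M' y.1 y.2 =
   \sum_(x : I) \sum_(y : I) c x y * (M x.1 x.2 * M' y.1 y.2) +
   \sum_(x : I) \sum_(y : I) c x y * (M' x.1 x.2 * M y.1 y.2).
  rewrite [X in _ = X + _]exchange_big -big_split; apply: eq_bigr => y _ /=.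
  by rewrite mulr_suml -big_split; apply: eq_bigr => x _ /=; ring.
rewrite /pairsum -!big_split; apply: eq_bigr => x _ /=.
rewrite -!big_split; apply: eq_bigr => y _ /=; rewrite !mxDE; ring.
Qed.

Lemma side_wt M (y : I) : \sum_(x : I) (wt x y + wt y x) * M x.1 x.2 = side M y.1 y.2.
Proof.
rewrite /side !pair_big [X in _ = X + _]big_mkcond [X in _ = _ + X]big_mkcond -big_split.
apply: eq_bigr => -[k l] _; rewrite /wt /= mulrDl addrC.
by congr (_ + _); case: ifP; rewrite ?mul1r ?mul0r.
Qed.

Lemma mv_linear M r p (f : I -> int) :
  \sum_(y : I) f y * mv r p y.1 y.2 = (f (rhi r, p) + f (rev_ord (rhi r), rev_ord p))
   - (f (rlo r, p) + f (rev_ord (rlo r), rev_ord p)).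
Proof.
have dl (a b : 'I_N) : \sum_(y : I) f y * ((y.1 == a) && (y.2 == b))%:Z = f (a, b).
  rewrite (bigD1 (a, b)) //= !eqxx mulr1 big1 ?addr0 // => -[k l].
  by rewrite xpair_eqE => /negbTE ->; rewrite mulr0.
rewrite -!dl -!big_split /= -sumrB; apply: eq_bigr => y _.
by rewrite mvE !mulrBr !mulrDr.
Qed.

(** Taylor expansion of a quadratic form. The gradient is invariant under rotation, so the two units
    of the move contribute equally, whence the factor 2; the quadratic term is half the linear one
    taken at the move itself. *)
Lemma pairsum_move M r p : rot_sym M -> pairsum wt (M + mv r p) =
  pairsum wt M + 2 * rowdiff M r p + rowdiff (mv r p) r p.
Proof.
have lin M' : rot_sym M' ->
   \sum_(y : I) (\sum_(x : I) (wt x y + wt y x) * M' x.1 x.2) * mv r p y.1 y.2 = 2 * rowdiff M' r p.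
  move=> rM; rewrite (mv_linear M') !side_wt /= !side_rev // -side_diff; ring.
move=> rM; rewrite pairsumDM lin // -addrA -addrA; congr (_ + _); rewrite addrC; congr (_ + _).
have := lin _ (rot_sym_mv r p).
have -> : \sum_(y : I) (\sum_(x : I) (wt x y + wt y x) * mv r p x.1 x.2) * mv r p y.1 y.2 =
   2 * pairsum wt (mv r p).
  rewrite mulrDl mul1r -{2}(pairsum_swap wt) /pairsum -big_split; apply: eq_bigr => y _ /=.
  by rewrite mulr_suml -big_split; apply: eq_bigr => x _ /=; ring.
by move/mulfI; apply.
Qed.

Lemma rowdiff_mv r p : rowdiff (mv r p) r p =
  ((r.+1 == n) && (p < n)%N)%:Z + ((r == n :> nat) && (n < p)%N)%:Z.
Proof.
have rN := ltn_ord r; have pN := ltn_ord p.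
have e1 : \sum_(l : 'I_N | (p < l)%N) mv r p (rhi r) l = ((r.+1 == n) && (p < n)%N)%:Z.
  have : \sum_(l : 'I_N) mv r p (rhi r) l = \sum_(l : 'I_N | (l < p.+1)%N) mv r p (rhi r) l
     + \sum_(l : 'I_N | (p < l)%N) mv r p (rhi r) l.
    rewrite (bigID (fun l : 'I_N => (l < p.+1)%N)) /=; congr (_ + _).
    by apply: eq_bigl => l; rewrite -leqNgt.
  have := psumSl (mv r p) (rhi r) p.+1; have := psumSl (mv r p) (rhi r) N.
  rewrite (eq_bigl predT) => [|l]; last by rewrite ltn_ord.
  by rewrite !psum_mv /= /bump /=; move: (\sum_(l | _) _) (\sum_(l | _) _) (\sum_l _); nlia.
have e2 : \sum_(l : 'I_N | (l < p)%N) mv r p (rlo r) l = - ((r == n :> nat) && (n < p)%N)%:Z.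
  have := psumSl (mv r p) (rlo r) p.
  by rewrite !psum_mv /=; move: (\sum_(l | _) _); nlia.
by rewrite /rowdiff e1 e2 opprK.
Qed.
End PairSums.

(** Halving [dAE]: [low_half] of the move and the interaction of the move with itself combine to
    twice the indicator of r = n < p, which is absorbed by taking the last sum at [C] and not at
    [A]. The diagonal part of [G] has quadratic form 0. *)
Lemma dA_move n d (A C G : Xi n d) (r : 'I_(n.*2)) (p : 'I_(dimN n)) :
  Xi_int C = Xi_int A + mv r p -> is_gen r G ->
  (forall k, (k <= dimN n)%N -> psum (Xi_int G) (dimN n) k = psum (Xi_int A) k (dimN n)) ->
  (dA C)%:Z + \sum_(l : 'I_(dimN n) | (l < p.+1)%N) Xi_int A (rhi r) l
   + \sum_(l : 'I_(dimN n) | (l < p)%N) Xi_int C (rlo r) l = (dA A)%:Z + (dA G)%:Z.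
Proof.
move=> eC gG hG; have dC := dAE C; have dAA := dAE A; have dG := dAE G.
set L := Xi_int G - mv r (rlo r); have eG : Xi_int G = L + mv r (rlo r) by rewrite subrK.
have rL : rot_sym L by apply: rot_symD (Xi_int_rot G) (rot_symN (rot_sym_mv _ _)).
have dL : pairsum (@wt n) L = 0.
  apply: big1 => x _; apply: big1 => y _; rewrite /wt.
  have /is_diag_mxP dd : is_diag_mx L := gG.
  case: (boolP (x.1 == x.2)) => [/eqP e1|e1]; last by rewrite dd ?mul0r ?mulr0.
  case: (boolP (y.1 == y.2)) => [/eqP e2|e2]; last by rewrite (dd y.1 y.2) ?mulr0.
  by rewrite e1 e2; case: leqP; case: ltnP => //=; rewrite ?mul0r //; lia.
rewrite eC pairsum_move ?Xi_int_rot // in dC; rewrite eG pairsum_move // dL in dG.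
have lL : low_half L = 0.
  by apply: big1 => x /andP[h1 h2]; have /is_diag_mxP -> // : is_diag_mx L := gG; apply/eqP; nlia.
have rdL : rowdiff L r (rlo r) = \sum_(l : 'I_(dimN n)) Xi_int A (rhi r) l.
  have /is_diag_mxP dd : is_diag_mx L := gG.
  have rN := ltn_ord r.
  rewrite /rowdiff [X in _ - X]big1 ?subr0 => [|l lr]; last by rewrite dd //= gtn_eqF.
  have hp k : (k <= dimN n)%N -> psum L (dimN n) k = psum (Xi_int A) k (dimN n).
    by move=> kN; rewrite -hG // eG psumD psum_mvN addr0.
  have h1 := psumSl (Xi_int A) (rhi r) (dimN n).
  have h2 := psumSl L^T (rhi r) (dimN n).
  rewrite !psum_tr !hp // in h2; try by rewrite /= /bump /=; nlia.
  rewrite h1 in h2; move: h2 => /addrI; rewrite (eq_bigl predT) => [->|l]; last by rewrite ltn_ord.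
  rewrite (bigD1 (rhi r)) /=; last by rewrite /bump /=; nlia.
  rewrite (bigD1 (rhi r) (P := fun l : 'I_(dimN n) => (l < dimN n)%N)) //=.
  rewrite [L^T _ _]mxE; congr (_ + _); rewrite [LHS]big1 ?[RHS]big1 // => l /andP[_ h].
    by rewrite mxE dd.
  by rewrite dd // eq_sym.
rewrite low_halfD low_half_mv in dC; rewrite low_halfD low_half_mv lL rdL in dG.
rewrite rowdiff_mv in dC; rewrite rowdiff_mv in dG.
have e1 : \sum_(l : 'I_(dimN n)) Xi_int A (rhi r) l = \sum_(l : 'I_(dimN n) | (l < p.+1)%N) Xi_int A (rhi r) l
   + \sum_(l : 'I_(dimN n) | (p < l)%N) Xi_int A (rhi r) l.
  rewrite (bigID (fun l : 'I_(dimN n) => (l < p.+1)%N)) /=; congr (_ + _).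
  by apply: eq_bigl => l; rewrite -leqNgt.
have e2 : \sum_(l : 'I_(dimN n) | (l < p)%N) Xi_int C (rlo r) l =
   \sum_(l : 'I_(dimN n) | (l < p)%N) Xi_int A (rlo r) l - ((r == n :> nat) && (n < p)%N)%:Z.
  rewrite eC; under eq_bigr do rewrite mxDE; rewrite big_split /=; congr (_ + _).
  have := psumSl (mv r p) (rlo r) p; rewrite !psum_mv /=; have := ltn_ord r; have := ltn_ord p.
  by move: (\sum_(l | _) _); nlia.
have rr : (r < n.*2)%N := ltn_ord r.
rewrite e2; move: dC dAA dG; rewrite /rowdiff e1 /=.
move: (pairsum _ _) (low_half _) (\sum_(l | _) _) (\sum_(l | _) _) (\sum_(l | _) _) => x1 x2 x3 x4 x5.
move: (dA C) (dA A) (dA G) => y1 y2 y3.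
by move: (ltn_ord p); move: (nat_of_ord r) (nat_of_ord p) rr => r' p' h1 h2; clear; nlia.
Qed.

(** * Linear maps on free modules *)

Section LinearExtension.
Variables (R : comNzRingType) (I : choiceType).

Section Lin.
Variables (V : lmodType R) (f : I -> V).
Definition lin (x : {malg R[I]}) : V := \sum_(i <- msupp x) x@_i *: f i.

Lemma linEw (x : {malg R[I]}) (d : {fset I}) : (msupp x `<=` d)%fset ->
  lin x = \sum_(i <- d) x@_i *: f i.
Proof.
move=> h; apply: (big_fset_incl _ h) => i _ /mcoeff_outdom ->.
by rewrite scale0r.
Qed.

Fact lin_linear : linear lin.
Proof.
move=> c x y; pose d := (msupp (c *: x + y) `|` msupp x `|` msupp y)%fset.
rewrite !(@linEw _ d) ?scaler_sumr -?big_split; first last.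
- by rewrite /d -fsetUA fsubsetUl.
- by rewrite /d (fsubset_trans (fsubsetUr (msupp (c *: x + y)) (msupp x))) // fsubsetUl.
- by rewrite /d fsubsetUr.
by apply: eq_bigr => i _ /=; rewrite mcoeffD mcoeffZ scalerDl scalerA.
Qed.
HB.instance Definition _ := GRing.isLinear.Build R {malg R[I]} V _ lin lin_linear.

Lemma linD x y : lin (x + y) = lin x + lin y. Proof. exact: raddfD. Qed.
Lemma linZ c x : lin (c *: x) = c *: lin x. Proof. exact: linearZ. Qed.
Lemma linU c i : lin << c *g i >> = c *: f i.
Proof. by rewrite (linEw msuppU_le) big_seq_fset1 mcoeffUU. Qed.
Lemma lin1 i : lin << i >> = f i.
Proof. by rewrite linU scale1r. Qed.
End Lin.

Lemma malgZU (c : R) (i : I) : << c *g i >> = c *: << i >> :> {malg R[I]}.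
Proof. by apply/malgP=> k; rewrite mcoeffZ !mcoeffU mulrnAr mulr1. Qed.

Lemma malg_sumE (x : {malg R[I]}) : x = \sum_(i <- msupp x) x@_i *: << i >>.
Proof. by rewrite {1}[x]monalgE; apply: eq_bigr => i _; rewrite malgZU. Qed.

Lemma bilin_lin (b : I -> I -> {malg R[I]}) x y :
  bilin b x y = lin (fun i => lin (b i) y) x.
Proof.
rewrite /bilin /lin; apply: eq_bigr => i _; rewrite scaler_sumr; apply: eq_bigr => j _.
by rewrite scalerA.
Qed.

Lemma bilin1 (b : I -> I -> {malg R[I]}) i j : bilin b << i >> << j >> = b i j.
Proof. by rewrite bilin_lin !lin1. Qed.

Lemma bilin_bilinear (b : I -> I -> {malg R[I]}) : bilinear_op (bilin b).
Proof.
split=> c x y z; rewrite !bilin_lin; first by rewrite linearP.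
rewrite /lin scaler_sumr -big_split; apply: eq_bigr => i _ /=.
by rewrite -/(lin (b i) _) linearP scalerDr !scalerA mulrC.
Qed.
End LinearExtension.

Section Bilinear.
Variables (R : comNzRingType) (V : lmodType R) (m : V -> V -> V).
Hypothesis bm : bilinear_op m.
Lemma bopDl x y z : m (x + y) z = m x z + m y z.
Proof. by have := bm.1 1 x y z; rewrite !scale1r. Qed.
Lemma bopDr x y z : m z (x + y) = m z x + m z y.
Proof. by have := bm.2 1 x y z; rewrite !scale1r. Qed.
Lemma bop0l z : m 0 z = 0.
Proof. by apply: (@addrI _ (m 0 z)); rewrite -bopDl !addr0. Qed.
Lemma bop0r z : m z 0 = 0.
Proof. by apply: (@addrI _ (m z 0)); rewrite -bopDr !addr0. Qed.
Lemma bopZl c x z : m (c *: x) z = c *: m x z.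
Proof. by have := bm.1 c x 0 z; rewrite bop0l !addr0. Qed.
Lemma bopZr c x z : m z (c *: x) = c *: m z x.
Proof. by have := bm.2 c x 0 z; rewrite bop0r !addr0. Qed.
Lemma bop_suml (T : Type) (r : seq T) (P : pred T) (F : T -> V) z :
  m (\sum_(i <- r | P i) F i) z = \sum_(i <- r | P i) m (F i) z.
Proof. by apply: (big_morph (m^~ z)) => [x y|]; rewrite ?bopDl ?bop0l. Qed.
Lemma bop_sumr (T : Type) (r : seq T) (P : pred T) (F : T -> V) z :
  m z (\sum_(i <- r | P i) F i) = \sum_(i <- r | P i) m z (F i).
Proof. by apply: (big_morph (m z)) => [x y|]; rewrite ?bopDr ?bop0r. Qed.
End Bilinear.

Section BasisAssoc.
Variables (R : comNzRingType) (I : choiceType) (m : {malg R[I]} -> {malg R[I]} -> {malg R[I]}).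
Hypothesis bm : bilinear_op m.

Lemma bop_basis m' : bilinear_op m' ->
  (forall i j, m << i >> << j >> = m' << i >> << j >>) -> forall x y, m x y = m' x y.
Proof.
move=> bm' h x y; rewrite [x]malg_sumE [y]malg_sumE !(bop_suml bm) !(bop_suml bm').
apply: eq_bigr => i _; rewrite !(bop_sumr bm) !(bop_sumr bm'); apply: eq_bigr => j _.
by rewrite !(bopZl bm) !(bopZr bm) !(bopZl bm') !(bopZr bm') h.
Qed.

Lemma bop_assoc :
  (forall i j k, m << i >> (m << j >> << k >>) = m (m << i >> << j >>) << k >>) -> associative m.
Proof.
move=> h; have hz i j z : m << i >> (m << j >> z) = m (m << i >> << j >>) z.
  rewrite [z]malg_sumE (bop_sumr bm) (bop_sumr bm) (bop_sumr bm).
  by apply: eq_bigr => k _; rewrite !(bopZr bm) h.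
have hy i y z : m << i >> (m y z) = m (m << i >> y) z.
  rewrite [y]malg_sumE (bop_suml bm) !(bop_sumr bm) (bop_suml bm).
  by apply: eq_bigr => k _; rewrite !(bopZl bm, bopZr bm) hz.
move=> x y z; rewrite [x]malg_sumE !(bop_suml bm).
by apply: eq_bigr => k _; rewrite !(bopZl bm) hy.
Qed.
End BasisAssoc.

Section CoefMap.
Variables (R S : comNzRingType) (phi : {rmorphism R -> S}) (I : choiceType).

Definition mapc (x : {malg R[I]}) : {malg S[I]} := \sum_(i <- msupp x) << phi x@_i *g i >>.

Lemma mapcE x i : (mapc x)@_i = phi x@_i.
Proof.
rewrite /mapc raddf_sum /=; case: (boolP (i \in msupp x)) => h.
  rewrite (big_fsetD1 i) //= mcoeffUU big1_fset ?addr0 // => j.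
  by rewrite in_fsetD1 mcoeffU => /andP[/negbTE ->].
rewrite mcoeff_outdom // rmorph0 big1_fset // => j hj _.
by rewrite mcoeffU; case: eqP => // e; move: h; rewrite -e hj.
Qed.

Lemma mapcU c i : mapc << c *g i >> = << phi c *g i >>.
Proof. by apply/malgP=> k; rewrite mapcE !mcoeffU raddfMn. Qed.
Lemma mapcD x y : mapc (x + y) = mapc x + mapc y.
Proof. by apply/malgP=> k; rewrite mcoeffD !mapcE mcoeffD rmorphD. Qed.
Lemma mapcZ c x : mapc (c *: x) = phi c *: mapc x.
Proof. by apply/malgP=> k; rewrite mcoeffZ !mapcE mcoeffZ rmorphM. Qed.
Lemma mapc0 : mapc 0 = 0.
Proof. by apply/malgP=> k; rewrite mapcE !mcoeff0 rmorph0. Qed.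
Lemma mapc1 i : mapc << i >> = << i >>.
Proof. by rewrite mapcU rmorph1. Qed.
Lemma mapc_sum (T : Type) (r : seq T) (P : pred T) (F : T -> {malg R[I]}) :
  mapc (\sum_(i <- r | P i) F i) = \sum_(i <- r | P i) mapc (F i).
Proof. by apply: (big_morph mapc) => [x y|]; rewrite ?mapcD ?mapc0. Qed.

Lemma mapc_bop m m' : bilinear_op m -> bilinear_op m' ->
  (forall i j, mapc (m << i >> << j >>) = m' << i >> << j >>) ->
  forall x y, mapc (m x y) = m' (mapc x) (mapc y).
Proof.
move=> bm bm' h x y; rewrite [x]malg_sumE [y]malg_sumE (bop_suml bm) !mapc_sum (bop_suml bm').
apply: eq_bigr => i _; rewrite (bop_sumr bm) (bop_sumr bm') mapc_sum; apply: eq_bigr => j _.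
by rewrite (bopZl bm) (bopZr bm) !mapcZ (bopZl bm') (bopZr bm') !mapc1 h.
Qed.
End CoefMap.

Lemma lau_val (x : Lau) : lau x = val x. Proof. by []. Qed.
Fact lau_zmod : zmod_morphism lau. Proof. by move=> x y; rewrite !lau_val rmorphB. Qed.
Fact lau_monoid : monoid_morphism lau.
Proof. by split=> [|x y]; rewrite !lau_val ?rmorph1 ?rmorphM. Qed.
HB.instance Definition _ := GRing.isZmodMorphism.Build Lau Qv lau lau_zmod.
HB.instance Definition _ := GRing.isMonoidMorphism.Build Lau Qv lau lau_monoid.

Lemma ext_mapc (I : choiceType) (x : {malg Lau[I]}) : ext x = mapc lau x.
Proof. by []. Qed.

Lemma lau_inj : injective lau.
Proof. by move=> x y /val_inj. Qed.

Lemma ext_inj (I : choiceType) : injective (@ext I).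
Proof.
move=> x y /malgP e; apply/malgP => k; apply: lau_inj.
by have := e k; rewrite !ext_mapc !mapcE.
Qed.

Definition lin_map (R : pzRingType) (V W : lmodType R) (F : V -> W) :=
  forall a x y, F (a *: x + y) = a *: F x + F y.

Section LinMap.
Variables (R : pzRingType) (V W : lmodType R) (F : V -> W).
Hypothesis h : lin_map F.
Lemma lmD x y : F (x + y) = F x + F y.
Proof. by have := h 1 x y; rewrite !scale1r. Qed.
Lemma lm0 : F 0 = 0.
Proof. by apply: (@addrI _ (F 0)); rewrite -lmD !addr0. Qed.
Lemma lmZ a x : F (a *: x) = a *: F x.
Proof. by have := h a x 0; rewrite lm0 !addr0. Qed.
Lemma lmN x : F (- x) = - F x.
Proof. by rewrite -!scaleN1r lmZ. Qed.
Lemma lmB x y : F (x - y) = F x - F y.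
Proof. by rewrite lmD lmN. Qed.
Lemma lm_sum (T : Type) (s : seq T) (P : pred T) (f : T -> V) :
  F (\sum_(i <- s | P i) f i) = \sum_(i <- s | P i) F (f i).
Proof. by apply: (big_morph F) => [x y|]; [exact: lmD|exact: lm0]. Qed.
End LinMap.

Lemma lm_comp (R : pzRingType) (U V W : lmodType R) (F : V -> W) (G : U -> V) :
  lin_map F -> lin_map G -> lin_map (fun x => F (G x)).
Proof. by move=> hF hG a x y; rewrite hG hF. Qed.
Lemma lm_add (R : pzRingType) (V W : lmodType R) (F G : V -> W) :
  lin_map F -> lin_map G -> lin_map (fun x => F x + G x).
Proof. by move=> hF hG a x y; rewrite hF hG scalerDr addrACA. Qed.
Lemma lm_scale (R : comPzRingType) (V : lmodType R) (c : R) : lin_map (fun x : V => c *: x).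
Proof. by move=> a x y; rewrite scalerDr !scalerA mulrC. Qed.

Section LinMalg.
Variables (R : comNzRingType) (I : choiceType).
Lemma lin_lm (V : lmodType R) (f : I -> V) : lin_map (lin f).
Proof. by move=> a x y; rewrite linD linZ. Qed.

Lemma lm_ext (V : lmodType R) (F G : {malg R[I]} -> V) : lin_map F -> lin_map G ->
  (forall i, F << i >> = G << i >>) -> forall x, F x = G x.
Proof.
move=> hF hG e x; rewrite [x]malg_sumE (lm_sum hF) (lm_sum hG).
by apply: eq_bigr => i _; rewrite (lmZ hF) (lmZ hG) e.
Qed.

Lemma lin_diag_coef (c : I -> R) (x : {malg R[I]}) i :
  (lin (fun i => c i *: << i >>) x)@_i = c i * x@_i.
Proof.
apply: (@lm_ext R^o (fun x => (lin (fun i => c i *: << i >>) x)@_i) (fun x => c i * x@_i)) => [a y z|a y z|j].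
- by rewrite linD linZ mcoeffD mcoeffZ.
- by rewrite mcoeffD mcoeffZ mulrDr mulrCA.
rewrite lin1 mcoeffZ !mcoeffU.
by case: eqVneq => [->//|_]; rewrite ?mulr0n !mulr0.
Qed.

Lemma lin_diag_supp (c : I -> R) a (x : {malg R[I]}) : (forall i, x@_i != 0 -> c i = a) ->
  lin (fun i => c i *: << i >>) x = a *: x.
Proof.
move=> h; apply/malgP=> i; rewrite lin_diag_coef mcoeffZ.
by case: (eqVneq x@_i 0) => [->|/h ->//]; rewrite !mulr0.
Qed.
End LinMalg.

Lemma mapc_lm (R S : comNzRingType) (phi : {rmorphism R -> S}) (I : choiceType)
  (F : {malg R[I]} -> {malg R[I]}) (G : {malg S[I]} -> {malg S[I]}) : lin_map F -> lin_map G ->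
  (forall i, mapc phi (F << i >>) = G << i >>) -> forall x, mapc phi (F x) = G (mapc phi x).
Proof.
move=> hF hG e x; rewrite [x]malg_sumE (lm_sum hF) !mapc_sum (lm_sum hG).
by apply: eq_bigr => i _; rewrite (lmZ hF) !mapcZ (lmZ hG) mapc1 e.
Qed.

Lemma bop_lml (R : comNzRingType) (V : lmodType R) (m : V -> V -> V) z : bilinear_op m -> lin_map (m^~ z).
Proof. by move=> b a x y; apply: b.1. Qed.
Lemma bop_lmr (R : comNzRingType) (V : lmodType R) (m : V -> V -> V) z : bilinear_op m -> lin_map (m z).
Proof. by move=> b a x y; apply: b.2. Qed.

Section FreeWords.
Variables (I : choiceType) (R : nzRingType).
Lemma free_mulUU (m m' : {fmonom I}) : << m >> * << m' >> = << mmul m m' >> :> {malg R[{fmonom I}]}.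
Proof. by rewrite malgM_def fgmulUU mulr1. Qed.
Lemma free_1 : 1 = << mone >> :> {malg R[{fmonom I}]}.
Proof. by []. Qed.
End FreeWords.

(** * The Schur algebra over Q(v) *)

Section StructureConstants.
Variables n d : nat.
Local Notation D := (dimN d).
Local Notation N := (dimN n).
Implicit Types (A C G E : Xi n d) (r : 'I_(n.*2)) (p : 'I_N).

Lemma gpoly_eq A A' C P : count_poly A A' C P -> gpoly A A' C = P.
Proof. by move=> h; apply: (count_poly_uniq _ h) => F B oF Bs Bu V1 V2 f1 f2 oC; apply: (gpolyP A A' oF Bs Bu f1 f2 oC). Qed.

(** A nonzero structure polynomial is realized by three flags over some field; the ranks of their
    members give the equalities. *)
Lemma gpoly_neq0 A A' C : gpoly A A' C != 0 -> forall k, (k <= N)%N ->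
  [/\ psum (Xi_int A) k N = psum (Xi_int C) k N, psum (Xi_int A') N k = psum (Xi_int C) N k
    & psum (Xi_int A) N k = psum (Xi_int A') k N].
Proof.
move=> g0; have [|h] := pselect (exists (F : finFieldType) (B : 'M[F]_(dimN d)) (V1 V2 : seqsp n d F),
   [/\ is_flag B V1, is_flag B V2, in_orbit C V1 V2 & conv_count B A A' V1 V2 != 0%N]).
  move=> [F [B [V1 [V2 [f1 f2 oC]]]]]; rewrite /conv_count -lt0n => /card_gt0P[U].
  rewrite inE => /and3P[fU o1 o2] k kN.
  have [a1 a2] := in_orbit_ranks f1 fU o1 kN; have [b1 b2] := in_orbit_ranks fU f2 o2 kN.
  by have [c1 c2] := in_orbit_ranks f1 f2 oC kN; rewrite -a1 -a2 -b1 -b2 -c1 -c2.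
move: g0; rewrite (@gpoly_eq A A' C 0) ?eqxx // => F B oF Bs Bu V1 V2 f1 f2 oC.
rewrite horner0; case: (boolP (conv_count B A A' V1 V2 == 0%N)) => [/eqP -> //|h2].
by case: h; exists F, B, V1, V2.
Qed.

Lemma gpoly_diag A A' C : is_diag_mx (Xi_int A) -> gpoly A A' C =
  ((A' == C) && [forall k : 'I_N.+1, psum (Xi_int A) k N == psum (Xi_int C) k N])%:R.
Proof.
move=> dA; apply: gpoly_eq => F B oF Bs Bu V1 V2 f1 f2 oC.
by rewrite (count_diag Bs Bu f1 f2 A' dA oC) -polyC_natr hornerC natz.
Qed.

(** The condition on column sums singles out, among the orbits that make up [step], the one that can
    be composed with [A]; so the count of all steps is the product with [G] alone. *)
Lemma gpoly_gen G A C r : is_gen r G ->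
  (forall k, (k <= N)%N -> psum (Xi_int G) N k = psum (Xi_int A) k N) ->
  gpoly G A C = \sum_(p | Xi_int C == Xi_int A + mv r p) cqp A r p.
Proof.
move=> gG hG; apply: gpoly_eq => F B oF Bs Bu V1 V2 f1 f2 oC.
rewrite horner_sum (eq_bigr (fun p => (cq A r p #|F|)%:Z)) => [|p _]; last by rewrite cqpE.
rewrite -posz_sum -(step_count oF Bs Bu r f1 f2 A oC); congr (Posz #|pred_of_set _|).
apply/setP=> U; rewrite !inE; case: (boolP (is_flag B U)) => //= fU.
case: (boolP (in_orbit A U V2)) => oA; rewrite ?andbF ?andbT //.
apply/idP/idP => [sU|oG]; last exact: (gen_step f1 fU gG oG).
have [G' gG' oG'] := step_gen Bs Bu f1 fU sU.
suff -> : G = G' by [].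
apply: Xi_int_inj; apply: (@addIr _ (- mv r (rlo r))); apply: psum_inj => i j iN jN.
rewrite (psum_diag i j gG) (psum_diag i j gG').
have mN : (minn i j <= N)%N by rewrite geq_min iN.
rewrite (psum_diag_sym _ _ gG) (psum_diag_sym _ _ gG') !psumD !psumN psum_mvN hG //.
have [_ <-] := in_orbit_ranks f1 fU oG' mN.
by have [<- _] := in_orbit_ranks fU f2 oA mN.
Qed.

(** At every large odd prime both sides count the pairs (W, U) for which (V1, W), (W, U), (U, V2)
    lie in the three given orbits. *)
Lemma gpoly_assoc A A' A'' E :
  \sum_C gpoly A A' C * gpoly C A'' E = \sum_C gpoly A' A'' C * gpoly A C E.
Proof.
apply/eqP; rewrite -subr_eq0; apply/eqP.
apply: (@poly_infinite_roots _ Posz) => [x y []//|b].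
have [F [B [V1 [V2 [oF bF Bs Bu [f1 f2 oE]]]]]] := large_orbit E b.
exists #|F| => //; rewrite hornerD hornerN !horner_sum; apply/eqP; rewrite subr_eq0; apply/eqP.
transitivity (\sum_(U | is_flag B U && in_orbit A'' U V2) (conv_count B A A' V1 U)%:Z).
  rewrite (eq_bigr (fun C => \sum_(U | is_flag B U && in_orbit A'' U V2)
      (in_orbit C V1 U)%:Z * (gpoly A A' C).[#|F|%:Z])) => [|C _].
    rewrite exchange_big; apply: eq_bigr => U /andP[fU oU] /=.
    have [C oC] := in_orbit_ex Bs Bu f1 fU.
    rewrite (bigD1 C) //= oC mul1r [X in _ + X]big1 ?addr0 => [|C' nC].
      by rewrite (gpolyP A A' oF Bs Bu f1 fU oC).
    case: (boolP (in_orbit C' V1 U)) => [o|]; last by rewrite mul0r.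
    by move: nC; rewrite (in_orbit_uniq f1 fU o oC) eqxx.
  rewrite hornerM (gpolyP C A'' oF Bs Bu f1 f2 oE) -mulr_suml mulrC; congr (_ * _).
  rewrite -posz_sum; congr Posz; rewrite /conv_count -sum1_card big_mkcond [RHS]big_mkcond.
  apply: eq_bigr => U _; rewrite inE; case: (is_flag B U) => //=.
  by case: (in_orbit C V1 U); case: (in_orbit A'' U V2).
transitivity (\sum_(W | is_flag B W && in_orbit A V1 W) (conv_count B A' A'' W V2)%:Z); last first.
  apply/esym; rewrite (eq_bigr (fun C => \sum_(W | is_flag B W && in_orbit A V1 W)
      (in_orbit C W V2)%:Z * (gpoly A' A'' C).[#|F|%:Z])) => [|C _].
    rewrite exchange_big; apply: eq_bigr => W /andP[fW oW] /=.
    have [C oC] := in_orbit_ex Bs Bu fW f2.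
    rewrite (bigD1 C) //= oC mul1r [X in _ + X]big1 ?addr0 => [|C' nC].
      by rewrite (gpolyP A' A'' oF Bs Bu fW f2 oC).
    case: (boolP (in_orbit C' W V2)) => [o|]; last by rewrite mul0r.
    by move: nC; rewrite (in_orbit_uniq fW f2 o oC) eqxx.
  rewrite hornerM (gpolyP A C oF Bs Bu f1 f2 oE) -mulr_suml mulrC; congr (_ * _).
  rewrite -posz_sum; congr Posz; rewrite /conv_count -sum1_card big_mkcond [RHS]big_mkcond.
  apply: eq_bigr => W _; rewrite inE; case: (is_flag B W) => //=.
  by case: (in_orbit A V1 W); case: (in_orbit C W V2).
rewrite -!posz_sum; congr Posz; rewrite /conv_count.
under eq_bigr do rewrite -sum1_card big_mkcond; under [RHS]eq_bigr do rewrite -sum1_card big_mkcond.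
rewrite big_mkcond [RHS]big_mkcond.
rewrite (eq_bigr (fun U => \sum_W ([&& is_flag B U, in_orbit A'' U V2, is_flag B W, in_orbit A V1 W & in_orbit A' W U] : nat))%N) => [|U _].
  rewrite exchange_big; apply: eq_bigr => W _ /=.
  case: (boolP (is_flag B W && in_orbit A V1 W)) => h; last first.
    by rewrite big1 // => U _; move: h; case: (is_flag B W) => /=; rewrite ?andbF //= => /negbTE ->; rewrite !andbF.
  apply: eq_bigr => U _; rewrite inE; move/andP: h => [-> ->] /=.
  by case: (is_flag B U); case: (in_orbit A'' U V2); case: (in_orbit A' W U).
case: (boolP (is_flag B U && in_orbit A'' U V2)) => h; last first.
  by rewrite big1 // => W _; move: h; case: (is_flag B U) => //= /negbTE ->.
apply: eq_bigr => W _; rewrite inE; move/andP: h => [-> ->] /=.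
by case: (is_flag B W); case: (in_orbit A V1 W); case: (in_orbit A' W U).
Qed.
End StructureConstants.

Lemma qint_step (F : fieldType) (X w S : F) : X != 0 -> w != 0 ->
  X^-1 * S * (w - w^-1) = X * w - X^-1 / w ->
  X^-1 / w * (S + X * w * (X * w)) * (w - w^-1) = X * w * w - X^-1 / w / w.
Proof.
move=> X0 w0 e.
have -> : X^-1 / w * (S + X * w * (X * w)) * (w - w^-1) =
  w^-1 * (X^-1 * S * (w - w^-1)) + X * w * (w - w^-1) by field; rewrite X0 w0.
by rewrite e; field; rewrite X0 w0.
Qed.

Section SchurOverQv.
Opaque Qv.
Variables n d : nat.
Local Notation D := (dimN d).
Local Notation N := (dimN n).
Implicit Types (A C G E : Xi n d) (r : 'I_(n.*2)) (p : 'I_N) (M : 'M[int]_N).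
Local Notation V := {malg Qv[Xi n d]}.

Definition evq (P : {poly int}) : Qv := (map_poly intr P).[v ^+ 2].
Fact evq_zmod : zmod_morphism evq.
Proof. by move=> P Q; rewrite /evq rmorphB hornerD hornerN. Qed.
Fact evq_monoid : monoid_morphism evq.
Proof. by split=> [|P Q]; rewrite /evq ?rmorph1 ?hornerC // rmorphM hornerM. Qed.
HB.instance Definition _ := GRing.isZmodMorphism.Build {poly int} Qv evq evq_zmod.
HB.instance Definition _ := GRing.isMonoidMorphism.Build {poly int} Qv evq evq_monoid.

Lemma evqX : evq 'X = v ^+ 2. Proof. by rewrite /evq map_polyX hornerX. Qed.

Lemma evq_gconst A A' C : lau (gconst A A' C) = evq (gpoly A A' C).
Proof.
rewrite /evq /gconst.
rewrite [X in _ = X.[_]](_ : _ = map_poly lau (map_poly intr (gpoly A A' C))); last first.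
  by rewrite -map_poly_comp; apply: eq_map_poly => x /=; rewrite rmorph_int.
by rewrite [v ^+ 2](_ : _ = lau (vL ^+ 2)) ?horner_map // rmorphXn.
Qed.

Definition qmul : V -> V -> V :=
  locked (bilin (fun A A' => \sum_C << evq (gpoly A A' C) *g C >>)).

Lemma qmul_bilinear : bilinear_op qmul.
Proof. by rewrite /qmul -lock; exact: bilin_bilinear. Qed.

Lemma qmul1 A A' : qmul << A >> << A' >> = \sum_C << evq (gpoly A A' C) *g C >>.
Proof. by rewrite /qmul -lock bilin1. Qed.

Lemma schur_mul_bilinear : bilinear_op (@schur_mul n d). Proof. exact: bilin_bilinear. Qed.
Lemma schur_mul1 A A' : schur_mul << A >> << A' >> = \sum_C << gconst A A' C *g C >>.
Proof. exact: bilin1. Qed.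

Opaque schur_mul evq.

Lemma ext_schur_mul x y : ext (schur_mul x y) = qmul (ext x) (ext y).
Proof.
rewrite !ext_mapc; apply: (mapc_bop schur_mul_bilinear qmul_bilinear).
move=> A A'; rewrite schur_mul1 qmul1 mapc_sum; apply: eq_bigr => C _.
by rewrite mapcU; congr << _ *g C >>; exact: evq_gconst.
Qed.

Lemma malgUM (I : choiceType) (R : nzRingType) (a c : R) (i : I) : << c * a *g i >> = c *: << a *g i >> :> {malg R[I]}.
Proof. by apply/malgP=> k; rewrite mcoeffZ !mcoeffU mulrnAr. Qed.

Lemma qmulZr A c C : qmul << A >> << c *g C >> = \sum_E << c * evq (gpoly A C E) *g E >>.
Proof.
by rewrite (malgZU c C) (bopZr qmul_bilinear) qmul1 scaler_sumr; apply: eq_bigr => E _; rewrite malgUM.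
Qed.
Lemma qmulZl A c C : qmul << c *g C >> << A >> = \sum_E << c * evq (gpoly C A E) *g E >>.
Proof.
by rewrite (malgZU c C) (bopZl qmul_bilinear) qmul1 scaler_sumr; apply: eq_bigr => E _; rewrite malgUM.
Qed.

Lemma malgU_suml (I : choiceType) (J : finType) (P : pred J) (f : J -> Qv) (i : I) :
  \sum_(j | P j) << f j *g i >> = << \sum_(j | P j) f j *g i >> :> {malg Qv[I]}.
Proof. by rewrite malgZU scaler_suml; apply: eq_bigr => j _; rewrite malgZU. Qed.

Lemma qmul_assoc : associative qmul.
Proof.
refine (bop_assoc qmul_bilinear _) => A A' A''.
transitivity (qmul << A >> (\sum_C << evq (gpoly A' A'' C) *g C >>)).
  by congr (qmul _ _); exact: qmul1.
transitivity (qmul (\sum_C << evq (gpoly A A' C) *g C >>) << A'' >>); last first.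
  by congr (qmul _ _); rewrite qmul1.
rewrite (bop_sumr qmul_bilinear) (bop_suml qmul_bilinear).
transitivity (\sum_C \sum_E << evq (gpoly A' A'' C) * evq (gpoly A C E) *g E >> : V).
  by apply: eq_bigr => C _; exact: qmulZr.
transitivity (\sum_C \sum_E << evq (gpoly A A' C) * evq (gpoly C A'' E) *g E >> : V); last first.
  by apply: eq_bigr => C _; rewrite qmulZl.
apply: etrans (exchange_big _ _ _ _ _ _) (esym (etrans (exchange_big _ _ _ _ _ _) _)).
apply: eq_bigr => E _.
apply: etrans (malgU_suml _ _ _) (etrans _ (esym (malgU_suml _ _ _))).
suff e : \sum_C evq (gpoly A A' C) * evq (gpoly C A'' E) =
         \sum_C evq (gpoly A' A'' C) * evq (gpoly A C E) by exact: (congr1 (fun x => << x *g E >>) e).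
transitivity (evq (\sum_C gpoly A A' C * gpoly C A'' E)).
  by rewrite rmorph_sum; apply: eq_bigr => C _; rewrite rmorphM.
by rewrite gpoly_assoc rmorph_sum; apply: eq_bigr => C _; rewrite rmorphM.
Qed.

Definition stdQ M : V := locked (ext (std d M)).

Lemma stdQ_Xi A : stdQ (Xi_int A) = << v ^- dA A *g A >>.
Proof.
rewrite /stdQ -lock /std; case: pickP => [A' /eqP /Xi_int_inj ->|/(_ A)]; last by rewrite eqxx.
by rewrite ext_mapc mapcU rmorphXn -exprVn.
Qed.

Lemma stdQ0 M : (forall A, Xi_int A != M) -> stdQ M = 0.
Proof. by rewrite /stdQ -lock /std => h; case: pickP => [A|_]; rewrite ?(negbTE (h A)) // ext_mapc mapc0. Qed.

Lemma stdQP M : (exists2 A, Xi_int A = M & stdQ M = << v ^- dA A *g A >>) \/ ((forall A, Xi_int A != M) /\ stdQ M = 0).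
Proof.
have [[A eA]|h] := pselect (exists A, Xi_int A = M); first by left; exists A; rewrite // -eA stdQ_Xi.
by right; split; [|apply: stdQ0] => A; apply/eqP => e; apply: h; exists A.
Qed.

Lemma qmul_stdQ A A' : qmul (stdQ (Xi_int A)) (stdQ (Xi_int A')) =
  \sum_C << v ^- dA A * v ^- dA A' * evq (gpoly A A' C) *g C >>.
Proof.
rewrite !stdQ_Xi ![<< v ^- dA _ *g _ >>]malgZU (bopZl qmul_bilinear) (bopZr qmul_bilinear) qmul1.
by rewrite scalerA scaler_sumr; apply: eq_bigr => C _; rewrite malgZU [RHS]malgZU scalerA.
Qed.

Lemma malgU0 (I : choiceType) (R : nzRingType) (i : I) : << 0 *g i >> = 0 :> {malg R[I]}.
Proof. by apply/malgP=> k; rewrite mcoeffU mcoeff0 mul0rn. Qed.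

Lemma stdQ_noncomp M M' k : (k <= N)%N -> psum M N k != psum M' k N ->
  qmul (stdQ M) (stdQ M') = 0.
Proof.
move=> kN h; have [[A eA _]|[_ ->]] := stdQP M; last exact: bop0l qmul_bilinear _.
have [[A' eA' _]|[_ ->]] := stdQP M'; last exact: bop0r qmul_bilinear _.
move: h; rewrite -eA -eA' qmul_stdQ => h; apply: big1 => C _.
have [->|/gpoly_neq0 /(_ k kN)[_ _ e]] := eqVneq (gpoly A A' C) 0.
  by rewrite rmorph0 mulr0 malgU0.
by rewrite e eqxx in h.
Qed.

Lemma dA_diag A : is_diag_mx (Xi_int A) -> dA A = 0%N.
Proof.
move=> /is_diag_mxP h; have hA i j : i != j -> ent A i j = 0%N by move=> /h; rewrite mxE => -[].
apply/eqP; rewrite /dA !addn_eq0 -andbA; apply/and3P; split; rewrite sum_nat_eq0; apply/forallP=> i.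
- rewrite sum_nat_eq0; apply/forallP=> j; rewrite sum_nat_eq0; apply/forallP=> k.
  rewrite sum_nat_eq0; apply/forallP=> l; apply/implyP => /and3P[ki jl _].
  case: (eqVneq i j) => [e|/hA -> //]; case: (eqVneq k l) => [e'|/hA ->]; last by rewrite muln0.
  by move: jl; rewrite -e -e' ltnNge ltnW.
- rewrite sum_nat_eq0; apply/forallP=> j; rewrite sum_nat_eq0; apply/forallP=> l.
  apply/implyP => /andP[jl _]; case: (eqVneq i j) => [e|/hA -> //].
  by rewrite (@hA i l) ?muln0 // e -val_eqE /= ltn_eqF.
rewrite sum_nat_eq0; apply/forallP=> j; apply/implyP => /andP[ni nj].
by rewrite (@hA i j) // -val_eqE /= gtn_eqF //; exact: leq_trans nj ni.
Qed.

Lemma stdQ_diag A M : is_diag_mx (Xi_int A) -> (forall k, (k <= N)%N -> psum (Xi_int A) N k = psum M k N) ->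
  qmul (stdQ (Xi_int A)) (stdQ M) = stdQ M.
Proof.
move=> dA1 h; have [[A' eA' _]|[_ ->]] := stdQP M; last exact: bop0r qmul_bilinear _.
rewrite -eA' in h *; rewrite qmul_stdQ (bigD1 A') //= big1 ?addr0 => [|C nC].
  have e : [forall k : 'I_N.+1, psum (Xi_int A) k N == psum (Xi_int A') k N].
    by apply/forallP=> k; rewrite -h -1?ltnS // (psum_diag_sym _ _ dA1).
  by rewrite (gpoly_diag _ _ dA1) eqxx e (dA_diag dA1) rmorph1 mulr1 invr1 mul1r stdQ_Xi.
by rewrite (gpoly_diag _ _ dA1) eq_sym (negbTE nC) rmorph0 mulr0 malgU0.
Qed.

(** One element for all weights: multiplied by a basis element, it picks out the summand of the
    matching weight. *)
Definition sgen r : V := \sum_(G : Xi n d | is_gen r G) stdQ (Xi_int G).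

(* The coefficients of the product with a Chevalley generator: the factor
   v^{sum_{l<p} (a_{r+1,l} - b_{r,l})} [[a_{r+1,p} + 1]]; only the term
   p = r+1 is affected by adding 2m I to A, by the factor
   t = v^{-2m}. *)
Definition qint (x : int) : Qv := (v ^ x - v ^ (- x)) / (v - v^-1).
Definition mexp M r p : int :=
  \sum_(l : 'I_N | (l < p)%N) (M (rhi r) l - (M + mv r p) (rlo r) l).

Lemma vX_neq0 (x : int) : v ^ x != 0. Proof. by rewrite expfz_neq0 // v_neq0. Qed.

Lemma v_free m : (0 < m)%N -> v ^+ m != 1.
Proof.
move=> m0; rewrite /v -rmorphXn -tofrac1 tofrac_eq.
by apply/eqP => /(congr1 (fun p : {poly rat} => size p)); rewrite size_polyXn size_poly1 => -[e]; rewrite e in m0.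
Qed.

Lemma v_subVneq0 : v - v^-1 != 0.
Proof.
rewrite subr_eq0; apply/eqP => /(congr1 ( *%R v)); rewrite divff ?v_neq0 // => e.
by have := @v_free 2 isT; rewrite expr2 e eqxx.
Qed.

Lemma qint_sum (k : nat) : v ^ (- (k%:Z)) * \sum_(i < k.+1) v ^+ 2 ^+ i = qint k.+1.
Proof.
have v0 := v_neq0; apply: (mulIf v_subVneq0); rewrite /qint divfK ?v_subVneq0 //.
elim: k => [|k IH]; first by rewrite big_ord1 expr0 !expr1z oppr0 expr0z !mul1r exprN1.
rewrite big_ord_recr /=; set S := \sum_(i < _) _ in IH *.
have X0 : v ^+ k != 0 by rewrite expf_neq0.
move: IH; rewrite -!exprnN -!exprnP -exprM mulnC exprM !exprSr expr0 mul1r !invfM.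
move: (v ^+ k) X0 => X X0 IH.
exact: qint_step.
Qed.

Lemma gen_uniq r G G' : is_gen r G -> is_gen r G' ->
  (forall k, (k <= N)%N -> psum (Xi_int G) N k = psum (Xi_int G') N k) -> G = G'.
Proof.
move=> gG gG' h; apply: Xi_int_inj; apply: (@addIr _ (- mv r (rlo r))).
apply: psum_inj => i j iN jN; rewrite (psum_diag i j gG) (psum_diag i j gG').
have mN : (minn i j <= N)%N by rewrite geq_min iN.
by rewrite (psum_diag_sym _ _ gG) (psum_diag_sym _ _ gG') !psumD !psumN h.
Qed.

(** The generator of the right weight is found geometrically: the orbit of [C] is not empty and the
    number of steps is positive, so there is a flag U one step from V1 with (U, V2) in the orbit of
    [A]; [G] is the orbit of (V1, U). *)
Lemma gen_exists A C r p : Xi_int C = Xi_int A + mv r p -> exists2 G : Xi n d, is_gen r G &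
  forall k, (k <= N)%N -> psum (Xi_int G) N k = psum (Xi_int A) k N.
Proof.
move=> e; have [F [B [V1 [V2 [oF bF Bs Bu [f1 f2 oC]]]]]] := large_orbit C 0.
have := step_count oF Bs Bu r f1 f2 A oC.
rewrite (bigD1 p) ?e //=; have q0 : (0 < #|F|)%N by case: #|F| oF.
have := cq_gt0 A r p q0; case: (cq A r p _) => // c _.
case: (set_0Vmem [set U | [&& is_flag B U, step V1 r U & in_orbit A U V2]]) => [-> |[U]].
  by rewrite cards0.
rewrite inE => /and3P[fU sU oA] _; have [G gG oG] := step_gen Bs Bu f1 fU sU.
exists G => // k kN; have [_ <-] := in_orbit_ranks f1 fU oG kN.
by have [<- _] := in_orbit_ranks fU f2 oA kN.
Qed.

Definition gcoef M r p : Qv := v ^ mexp M r p * qint (M (rhi r) p + 1).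

(** [dA_move] balances the powers of v, and the geometric sum in v^2 becomes the symmetric quantum
    integer. *)
Lemma gcoefE A C G r p : Xi_int C = Xi_int A + mv r p -> is_gen r G ->
  (forall k, (k <= N)%N -> psum (Xi_int G) N k = psum (Xi_int A) k N) ->
  v ^- dA G * v ^- dA A * evq (cqp A r p) = gcoef (Xi_int A) r p * v ^- dA C.
Proof.
move=> eC gG hG; have := dA_move eC gG hG.
rewrite /gcoef /mexp -eC sumrB big_ltS; set x := \sum_(l | _) _; set y := \sum_(l | _) _.
set a := Xi_int A (rhi r) p; move=> e.
have ea : a = ent A (rhi r) p by rewrite /a mxE.
have ex : x = (\sum_(l : 'I_N | (l < p)%N) ent A (rhi r) l)%N.
  by rewrite posz_sum; apply: eq_bigr => l _; rewrite mxE.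
have -> : a + 1 = (ent A (rhi r) p).+1 by rewrite ea; move: (ent A _ _) => k; nlia.
rewrite -qint_sum -ea.
have -> : evq (cqp A r p) = v ^ (2 * x) * \sum_(i < (ent A (rhi r) p).+1) v ^+ 2 ^+ i.
  rewrite ex rmorphM rmorphXn rmorph_sum; congr (_ * _).
    by rewrite -[X in X ^+ _]/(evq 'X) evqX -exprM -PoszM -exprnP.
  by apply: eq_bigr => i _; rewrite rmorphXn -[X in X ^+ _]/(evq 'X) evqX.
set S := \sum_(i < _) _; rewrite !exprnN mulrA (mulrA (v ^ (x - y))) [RHS]mulrAC.
apply: (congr1 (fun z => z * S)); rewrite -!expfzDr ?v_neq0 //; congr (v ^ _); move: e; rewrite -/a.
by move: (dA G) (dA A) (dA C) => g1 g2 g3; nlia.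
Qed.

(** Only the generator whose column sums are the row sums of [A] contributes, and it is unique by
    [gen_uniq]. *)
Lemma sgen_step A r : qmul (sgen r) (stdQ (Xi_int A)) =
  \sum_p gcoef (Xi_int A) r p *: stdQ (Xi_int A + mv r p).
Proof.
rewrite (bop_suml qmul_bilinear).
transitivity (\sum_(G | is_gen r G) \sum_C << v ^- dA G * v ^- dA A * evq (gpoly G A C) *g C >> : V).
  by apply: eq_bigr => G _; exact: qmul_stdQ.
transitivity (\sum_p \sum_(C | Xi_int C == Xi_int A + mv r p) << gcoef (Xi_int A) r p * v ^- dA C *g C >> : V); last first.
  apply: eq_bigr => p _; have [[C eC ->]|[h ->]] := stdQP (Xi_int A + mv r p).
    rewrite (big_pred1 C) ?malgUM // => C'; rewrite /= -eC.
    by apply/eqP/eqP => [/Xi_int_inj|->].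
  by rewrite scaler0 big_pred0 // => C; exact: negbTE (h C).
apply: etrans (exchange_big _ _ _ _ _ _) (etrans _ (esym (@exchange_big_dep _ _ _ _ _ _ _ predT _ predT _ _))) => //.
apply: eq_bigr => C _ /=.
have [[p eC]|h] := pselect (exists p, Xi_int C = Xi_int A + mv r p); last first.
  rewrite [RHS]big_pred0 => [|p]; last by apply/eqP => e; apply: h; exists p.
  apply: big1 => G gG; have [hG|hG] := pselect (forall k, (k <= N)%N -> psum (Xi_int G) N k = psum (Xi_int A) k N).
    rewrite (gpoly_gen C gG hG) big_pred0 => [|p]; last by apply/eqP => e; apply: h; exists p.
    by rewrite rmorph0 mulr0 malgU0.
  have -> : gpoly G A C = 0 by apply: contra_notP hG => /eqP /gpoly_neq0 g0 k /g0[].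
  by rewrite rmorph0 mulr0 malgU0.
have [G gG hG] := gen_exists eC; rewrite (bigD1 G) //= [X in _ + X]big1 ?addr0 => [|G' /andP[gG' nG]].
  apply: etrans (esym (malgU_suml _ _ _)).
  apply: (congr1 (fun x => << x *g C >>)); rewrite (gpoly_gen C gG hG) rmorph_sum mulr_sumr.
  by apply: eq_bigr => p' /eqP eC'; exact: gcoefE.
have -> : gpoly G' A C = 0; last by rewrite rmorph0 mulr0 malgU0.
apply: contra_neq_eq nG => /gpoly_neq0 g0; apply: (gen_uniq gG' gG) => k kN.
by have [_ _ ->] := g0 k kN; rewrite hG.
Qed.
End SchurOverQv.

Definition evl (P : nat -> Prop) := exists p0, forall p, (p0 <= p)%N -> P p.

Lemma evl_and (P Q : nat -> Prop) : evl P -> evl Q -> evl (fun p => P p /\ Q p).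
Proof.
move=> [a ha] [b hb]; exists (maxn a b) => p; rewrite geq_max => /andP[ap bp].
by split; [apply: ha|apply: hb].
Qed.
Lemma evl_mono (P Q : nat -> Prop) : (forall p, P p -> Q p) -> evl P -> evl Q.
Proof. by move=> h [a ha]; exists a => p /ha /h. Qed.
Lemma evl_all (I : eqType) (s : seq I) (P : I -> nat -> Prop) :
  (forall i, evl (P i)) -> evl (fun p => forall i, i \in s -> P i p).
Proof.
move=> h; elim: s => [|i s IH]; first by exists 0%N.
apply: evl_mono (evl_and (h i) IH) => p [hi hs] j; rewrite inE => /orP[/eqP ->//|].
exact: hs.
Qed.

(** * Integer matrices and their shifts by multiples of the identity *)

Section Matrices.
Variable n : nat.
Local Notation N := (dimN n).
Implicit Types (A B : tXi n) (M : 'M[int]_N) (r : 'I_(n.*2)) (p : 'I_N).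

Lemma tXi_offdiag A : offdiag_ge0 (val A).
Proof.
by have /and3P[/forallP h _ _] := valP A => i j ij; have /forallP/(_ j) := h i; rewrite ij.
Qed.
Lemma tXi_rot A : rot_sym (val A).
Proof. by have /and3P[] := valP A. Qed.

Lemma center_mv r p : exists k : int, mv r p (inord n) (inord n) = k * 2.
Proof.
rewrite /mv mxBE !Eth_center -mulrBl; by eexists.
Qed.

Lemma in_tXi_move M r p : in_tXi M -> in_tXi (M + mv r p) = `[< offdiag_ge0 (M + mv r p) >].
Proof.
move=> /and3P[_ o s]; rewrite /in_tXi (rot_symD s (rot_sym_mv r p)) andbT.
have -> : ~~ (2 %| (M + mv r p)%R (inord n) (inord n))%Z.
  by rewrite mxDE; have [k ->] := center_mv r p; rewrite rpredDr // dvdz_mull.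
rewrite andbT; apply/forallP/asboolP => [h i j ij|h i].
  by have /forallP/(_ j) := h i; rewrite ij.
by apply/forallP=> j; apply/implyP=> /h.
Qed.

Lemma shiftD A B M m : val B = val A + M -> shift B m = shift A m + M.
Proof. by rewrite /shift => ->; rewrite addrAC. Qed.

Lemma shiftE A m i j : shift A m i j = val A i j + (2 * m)%N%:Z * (i == j)%:Z.
Proof. by rewrite !mxE mulrb; case: (i == j); rewrite ?mulr1 ?mulr0. Qed.

Lemma psum_scalar (c : int) i : (i <= N)%N -> psum (c%:M : 'M[int]_N) i N = c * i%:Z.
Proof.
elim: i => [|i IH] iN; first by rewrite psum0l mulr0.
rewrite (psumSl _ (Ordinal iN)) IH ?(ltnW iN) // (bigD1 (Ordinal iN)) //= mxE eqxx.
rewrite big1 => [|l /andP[_ lk]]; last by rewrite mxE eq_sym (negbTE lk).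
by rewrite addr0 -[in RHS]addn1 PoszD mulrDr mulr1.
Qed.

Lemma psum_shift A m i : (i <= N)%N -> psum (shift A m) i N = psum (val A) i N + (2 * m * i)%N%:Z.
Proof. by move=> iN; rewrite psumD psum_scalar // -PoszM. Qed.

Lemma psum_shiftr A m i : (i <= N)%N -> psum (shift A m) N i = psum (val A) N i + (2 * m * i)%N%:Z.
Proof. by move=> iN; rewrite psumD (psum_diag_sym _ _ (scalar_mx_is_diag _ _)) psum_scalar // -PoszM. Qed.

Lemma shift_diag_ge0 A : evl (fun m => forall i j, 0 <= shift A m i j).
Proof.
exists (\sum_i `|val A i i|)%N => m hm i j; rewrite shiftE.
case: eqVneq => [<-|ij]; last by rewrite mulr0 addr0 tXi_offdiag.
rewrite mulr1; have : (`|val A i i| <= m)%N.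
  by apply: leq_trans hm; rewrite (bigD1 i) //= leq_addr.
by lia.
Qed.

Lemma rot_shift A m : rot_sym (shift A m).
Proof.
apply: rot_symD; first exact: tXi_rot.
by apply/forallP=> i; apply/forallP=> j; rewrite !mxE (inj_eq rev_ord_inj).
Qed.

Lemma sum_rev (f : 'I_N -> int) : (forall i, f (rev_ord i) = f i) ->
  \sum_i f i = 2 * (\sum_(i : 'I_N | (i < n)%N) f i) + f (inord n).
Proof.
move=> h; have nN : (n < N)%N by rewrite ltnS -addnn leq_addr.
rewrite (bigD1 (inord n)) //= addrC; congr (_ + _).
rewrite (bigID (fun i : 'I_N => (i < n)%N)) /= mulrDl mul1r; congr (_ + _).
  by apply: eq_bigl => i; case: eqP => [->|//]; rewrite inordK // ltnn.
rewrite (reindex_inj rev_ord_inj) /=; apply: eq_big => [i|i _]; last exact: h.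
by rewrite -val_eqE /= inordK //; have := ltn_ord i; nlia.
Qed.

(** Rotation pairs all entries except the central one, which is odd. Hence the shifted matrices have
    an entry sum of the form 2d+1, see [shift_dim]. *)
Lemma psum_tXi_odd A : exists k : int, psum (val A) N N = 2 * k + 1.
Proof.
have rA := rot_symE (tXi_rot A); have /and3P[_ oA _] := valP A.
rewrite psum_full sum_rev => [|i]; last first.
  by rewrite (reindex_inj rev_ord_inj); apply: eq_bigr => j _; rewrite rA.
rewrite (@sum_rev (fun j => val A (inord n) j)) => [|j]; last by rewrite -{1}(rev_center n) rA.
set x := \sum_(i | _) _; set y := \sum_(i | _) _; move: oA; set a := val A _ _ => oA.
have [k ->] : exists k : int, a = 2 * k + 1.
  by exists (a %/ 2)%Z; move: oA; rewrite dvdzE; nlia.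
by exists (x + y + k); ring.
Qed.

Lemma shift_inj m : injective (fun A => shift A m).
Proof. by move=> A B /addIr /val_inj. Qed.

Lemma shift_dim A : evl (fun m => exists d, psum (shift A m) N N = (dimN d)%:Z).
Proof.
have [k hk] := psum_tXi_odd A; exists (absz k) => m km; exists (absz (k + (m * N)%N%:Z)).
rewrite psum_shift // hk; have : (m <= m * N)%N by rewrite leq_pmulr.
rewrite -mulnA; move: (m * N)%N => y my; have h : 0 <= k + y%:Z by nlia.
have [z hz] : exists z : nat, k + y = z by exists (absz (k + y)); rewrite gez0_abs.
by rewrite hz absz_nat; nlia.
Qed.
End Matrices.

Section Basis.
Variables (R : comNzRingType) (n : nat).
Local Notation N := (dimN n).
(** Extended by 0 to all integer matrices, so that sums over all columns of a move need no side
    condition. *)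
Definition tb (M : 'M[int]_N) : {malg R[tXi n]} :=
  locked (if insub M is Some A then << A >> else 0).

Lemma tb_val (A : tXi n) : tb (val A) = << A >>.
Proof. by rewrite /tb -lock valK. Qed.
Lemma tb0 M : ~~ in_tXi M -> tb M = 0.
Proof. by move=> h; rewrite /tb -lock insubN. Qed.

Lemma tbP M : (exists2 A : tXi n, val A = M & tb M = << A >>) \/ (~~ in_tXi M /\ tb M = 0).
Proof.
by case: (boolP (in_tXi M)) => h; [left; exists (Sub M h)|right; rewrite tb0]; rewrite -?tb_val ?SubK.
Qed.
End Basis.
Arguments tb {R n}.

(** * Stabilization *)

Section Stable.
Variable n : nat.
Local Notation N := (dimN n).
Implicit Types (A B : tXi n) (M : 'M[int]_N) (r : 'I_(n.*2)) (p : 'I_N).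
Local Notation Kt := {malg {poly Qv}[tXi n]}.
Implicit Types x y : Kt.

(** The variable is t = v^{-2m}. For p = r+1 the shift by 2mI lowers [mexp] by 2m and raises the
    quantum integer by 2m; together this multiplies only the term v^{-(a+1)} of its numerator, by
    t^2. *)
Definition tcf M r p : {poly Qv} :=
  (v ^ mexp M r p / (v - v^-1)) *:
  ((v ^ (M (rhi r) p + 1))%:P - v ^ (- (M (rhi r) p + 1)) *: (if p == rhi r then 'X^2 else 1)).

(** The universal left multiplication by a generator: one operator over Q(v)[t] whose
    specializations for large m are the multiplications by [sgen], see [sp_Th]. *)
Definition Th r : Kt -> Kt :=
  locked (lin (fun A => \sum_p tcf (val A) r p *: tb (val A + mv r p)) : Kt -> Kt).
Lemma ThP r c x y : Th r (c *: x + y) = c *: Th r x + Th r y.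
Proof. by rewrite /Th -lock linD linZ. Qed.
Lemma Th0 r : Th r 0 = 0. Proof. by rewrite /Th -lock linear0. Qed.
Lemma Th1 r A : Th r << A >> = \sum_p tcf (val A) r p *: tb (val A + mv r p).
Proof. by rewrite /Th -lock lin1. Qed.

Definition tm (m : nat) : Qv := v ^- (2 * m).

Lemma tcf_shift A r p m : (tcf (val A) r p).[tm m] = gcoef (shift A m) r p.
Proof.
have e1 : mexp (shift A m) r p = mexp (val A) r p - (2 * m)%N%:Z * (p == rhi r)%:Z.
  rewrite /mexp; transitivity (mexp (val A) r p + \sum_(l : 'I_N | (l < p)%N) (2 * m)%N%:Z * ((l == rhi r)%:Z - (l == rlo r)%:Z)).
    rewrite -big_split; apply: eq_bigr => l _ /=; rewrite !mxDE !mxE !mulrb eq_sym [rlo r == l]eq_sym.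
    by case: (l == rhi r); case: (l == rlo r); rewrite /=; ring.
  rewrite -mulr_sumr sumrB -mulrN; congr (_ + _ * _).
  have h (k : 'I_N) : \sum_(l : 'I_N | (l < p)%N) (l == k)%:Z = (k < p)%N%:Z.
    rewrite big_mkcond (bigD1 k) //= eqxx big1 ?addr0 => [|l lk]; first by case: ifP.
    by rewrite (negbTE lk) if_same.
  rewrite (h (rhi r)) (h (rlo r)) -val_eqE /= /bump /=; case: (ltngtP p (1 + r)%N) => c; nlia.
have e2 : shift A m (rhi r) p = val A (rhi r) p + (2 * m)%N%:Z * (p == rhi r)%:Z.
  by rewrite shiftE eq_sym.
rewrite /tcf /gcoef /qint e1 e2; move: (mexp _ _ _) (val A _ _) => x a.
have v0 := v_neq0; rewrite hornerZ hornerD hornerN hornerC hornerZ -mulrA [X in _ * X]mulrC mulrA.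
apply: esym; rewrite mulrA; congr (_ / _).
case: eqP => _; rewrite -?[Posz true]/(1 : int) -?[Posz false]/(0 : int).
  rewrite !mulr1 hornerXn; have -> : tm m ^+ 2 = v ^ (- (4 * m)%N%:Z).
    by rewrite /tm exprVn -exprM exprnN; congr (v ^ _); nlia.
  by rewrite !mulrBr -!expfzDr //; congr (v ^ _ - v ^ _); nlia.
by rewrite !mulr0 subr0 addr0 hornerC mulr1.
Qed.

Section Specialize.
Variables m d : nat.
(** Specialization t = v^{-2m} with A sent to [A+2mI] in the Schur algebra of index [d]. A wrong
    entry sum gives 0, so all [d] can be treated at once. *)
Definition sp (x : Kt) : {malg Qv[Xi n d]} :=
  locked (fun x => lin (fun A => stdQ d (shift A m)) (mapc (horner_eval (tm m)) x)) x.

Lemma spD x y : sp (x + y) = sp x + sp y.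
Proof. by rewrite /sp -lock mapcD linD. Qed.
Lemma spZ c x : sp (c *: x) = c.[tm m] *: sp x.
Proof. rewrite /sp -lock; exact: etrans (congr1 (lin _) (mapcZ _ c x)) (linZ _ _ _). Qed.
Lemma spP c x y : sp (c *: x + y) = c.[tm m] *: sp x + sp y.
Proof. by rewrite spD spZ. Qed.
Lemma sp0 : sp 0 = 0.
Proof. by rewrite /sp -lock mapc0 raddf0. Qed.
Lemma sp1 A : sp << A >> = stdQ d (shift A m).
Proof. by rewrite /sp -lock mapc1 lin1. Qed.
Lemma sp_sum (T : Type) (s : seq T) (P : pred T) (F : T -> Kt) :
  sp (\sum_(i <- s | P i) F i) = \sum_(i <- s | P i) sp (F i).
Proof. by apply: (big_morph sp) => [x y|]; rewrite ?spD ?sp0. Qed.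
End Specialize.

Lemma stdQ_dim d M : psum M N N != (dimN d)%:Z -> stdQ d M = 0.
Proof.
move=> h; apply: stdQ0 => C; apply: contraNneq h => <-; by rewrite Xi_int_psum.
Qed.

Lemma sp_tb A m d r p :
  sp m d (tb (val A + mv r p)) = stdQ d (shift A m + mv r p).
Proof.
have [[B eB ->]|[h ->]] := tbP {poly Qv} (val A + mv r p); first by rewrite sp1 (shiftD m eB).
rewrite sp0 stdQ0 // => C; apply: contraNneq h => eC.
rewrite in_tXi_move ?(valP A) //; apply/asboolP => k l kl.
have := Xi_int_ge0 C k l; rewrite eC mxDE [X in _ -> 0 <= X]mxDE shiftE (negbTE kl).
by rewrite mulr0 addr0.
Qed.

(** Once the diagonal of A+2mI is nonnegative, the two formulas agree term by term; for [d] of the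
    wrong size both sides are 0. *)
Lemma sp_Th1 A r : evl (fun m => forall d,
  sp m d (Th r << A >>) = qmul (sgen d r) (sp m d << A >>)).
Proof.
apply: evl_mono (shift_diag_ge0 A) => m h d; rewrite Th1 sp1 sp_sum.
have [e|e] := eqVneq (psum (shift A m) N N) (dimN d); last first.
  rewrite stdQ_dim // (bop0r (@qmul_bilinear n d)) big1 // => p _.
  by rewrite spZ sp_tb stdQ_dim ?scaler0 // psumD psum_mvN addr0.
have [C eC] := Xi_of_int h (rot_shift A m) e.
rewrite -eC sgen_step eC; apply: eq_bigr => p _.
by rewrite spZ sp_tb tcf_shift.
Qed.

Lemma evl_lin (P : nat -> Kt -> Prop) :
  (forall A, evl (fun m => P m << A >>)) ->
  (forall m c x y, P m x -> P m y -> P m (c *: x + y)) -> (forall m, P m 0) ->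
  forall x, evl (fun m => P m x).
Proof.
move=> h hl h0 x; apply: evl_mono (evl_all (msupp x) h) => m hm.
rewrite [x]malg_sumE big_seq; apply: big_ind => [|y z hy hz|A /hm hA]; first exact: h0.
  by rewrite -[y]scale1r; apply: hl.
by rewrite -[_ *: _]addr0; apply: hl.
Qed.

Lemma sp_Th r x : evl (fun m => forall d, sp m d (Th r x) = qmul (sgen d r) (sp m d x)).
Proof.
move: x; apply: evl_lin => [A|m c x y hx hy d|m d]; first exact: sp_Th1.
  rewrite ThP !spP hx hy; apply: esym; exact: (@qmul_bilinear n d).2.
by rewrite Th0 sp0 (bop0r (@qmul_bilinear n d)).
Qed.

Definition Thw (w : seq 'I_(n.*2)) x : Kt := foldr Th x w.
Definition opw (s : seq ({poly Qv} * seq 'I_(n.*2))) x : Kt :=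
  \sum_(i <- s) i.1 *: Thw i.2 x.

Lemma opw0 x : opw [::] x = 0. Proof. exact: big_nil. Qed.
Lemma opwS i s x : opw (i :: s) x = i.1 *: Thw i.2 x + opw s x. Proof. exact: big_cons. Qed.

Definition Lw d (w : seq 'I_(n.*2)) (z : {malg Qv[Xi n d]}) : {malg Qv[Xi n d]} :=
  foldr (fun r => qmul (sgen d r)) z w.
Definition Ls m d (s : seq ({poly Qv} * seq 'I_(n.*2))) (z : {malg Qv[Xi n d]}) : {malg Qv[Xi n d]} :=
  \sum_(i <- s) i.1.[tm m] *: Lw i.2 z.

(** Left multiplications commute with right ones: a combination of words that produces an element
    from an idempotent computes the product with that element as well. *)
Lemma Ls_mul m d s z z' : qmul (@Ls m d s z) z' = Ls m s (qmul z z').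
Proof.
rewrite (bop_suml (@qmul_bilinear n d)); apply: eq_bigr => i _.
rewrite (bopZl (@qmul_bilinear n d)); congr (_ *: _).
elim: i.2 => [//|r w IH]; apply: etrans (esym (qmul_assoc _ _ _)) _.
by rewrite IH.
Qed.

Lemma sp_Thw w x : evl (fun m => forall d, sp m d (Thw w x) = Lw w (sp m d x)).
Proof.
elim: w => [|r w IH]; first by exists 0%N.
by apply: evl_mono (evl_and IH (sp_Th r (Thw w x))) => m [h1 h2] d /=; rewrite h2 h1.
Qed.

Lemma sp_opw s x : evl (fun m => forall d, sp m d (opw s x) = Ls m s (sp m d x)).
Proof.
have := evl_all s (fun i => sp_Thw i.2 x); apply: evl_mono => m h d.
rewrite /opw sp_sum /Ls big_seq [RHS]big_seq; apply: eq_bigr => i /h hi.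
by rewrite spZ hi.
Qed.

Lemma spE m d x : sp m d x = \sum_(A <- msupp x) (x@_A).[tm m] *: stdQ d (shift A m).
Proof.
rewrite {1}[x]malg_sumE sp_sum; apply: eq_bigr => A _.
by rewrite spZ sp1.
Qed.

Lemma sp_coef m d x A C : Xi_int C = shift A m -> (sp m d x)@_C = (x@_A).[tm m] * v ^- dA C.
Proof.
move=> eC; rewrite spE raddf_sum /=.
rewrite (eq_bigr (fun B => (B == A)%:R * ((x@_A).[tm m] * v ^- dA C))) => [|B _].
  rewrite -mulr_suml; case: (boolP (A \in msupp x)) => hA.
    rewrite (big_fsetD1 A) //= eqxx big1_fset => [|B]; first by rewrite addr0 mul1r.
    by rewrite in_fsetD1 => /andP[/negbTE -> _] _.
  by rewrite (mcoeff_outdom hA) horner0 mul0r mulr0.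
rewrite mcoeffZ; case: eqVneq => [->|nB]; first by rewrite mul1r -eC stdQ_Xi mcoeffUU.
rewrite mul0r; have [[C' eC' ->]|[_ ->]] := stdQP d (shift B m); last by rewrite mcoeff0 mulr0.
rewrite mcoeffU; case: eqP => [e|]; last by rewrite mulr0.
by case/eqP: nB; apply: (@shift_inj _ m); rewrite -eC' -eC e.
Qed.

Lemma tm_inj : injective tm.
Proof.
have h i j : (i < j)%N -> tm i != tm j.
  move=> ij; apply: contra_neq (@v_free (2 * (j - i)) _); last by rewrite muln_gt0 subn_gt0 ij.
  move=> /(congr1 (fun z => z * v ^+ (2 * j))); rewrite /tm mulVf ?expf_neq0 ?v_neq0 // => <-.
  by rewrite -{2}(subnKC (ltnW ij)) mulnDr exprD mulrA mulVf ?mul1r // expf_neq0 ?v_neq0.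
by move=> i j e; case: (ltngtP i j) => // /h; rewrite e eqxx.
Qed.

(** The coefficient of [A] is a polynomial in t that vanishes at v^{-2m} for infinitely many m. *)
Lemma sp_eq0 x A :
  evl (fun m => forall d, psum (shift A m) N N = dimN d -> sp m d x = 0) -> x@_A = 0.
Proof.
move=> h; have [p0 h0] := evl_and (evl_and h (shift_dim A)) (shift_diag_ge0 A).
apply: (@poly_infinite_roots _ tm) => [|b]; first exact: tm_inj.
exists (maxn b p0); first exact: leq_maxl.
have [[hm [d hd]] hp] := h0 (maxn b p0) (leq_maxr _ _).
have [C eC] := Xi_of_int hp (rot_shift A _) hd.
have := sp_coef x eC; rewrite hm // mcoeff0 => /esym/eqP; rewrite mulf_eq0 => /orP[/eqP //|].
by rewrite invr_eq0 expf_eq0 (negbTE v_neq0) andbF.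
Qed.
End Stable.

(** * The product of K^j *)

Section Weights.
Variable n : nat.
Local Notation N := (dimN n).
Implicit Types (A B : tXi n) (M : 'M[int]_N) (r : 'I_(n.*2)) (p : 'I_N).

Lemma psum_row M (i : 'I_N) : psum M i.+1 N = psum M i N + \sum_j M i j.
Proof. by rewrite psumSl; congr (_ + _); apply: eq_bigl => j; rewrite ltn_ord. Qed.
Lemma psum_col M (i : 'I_N) : psum M N i.+1 = psum M N i + \sum_j M j i.
Proof.
rewrite -(psum_tr M i.+1 N) -(psum_tr M i N) psum_row; congr (_ + _).
by apply: eq_bigr => j _; rewrite mxE.
Qed.

Lemma composableP A B : reflect (forall k, (k <= N)%N -> psum (val A) N k = psum (val B) k N)
  (composable A B).
Proof.
apply: (iffP forallP) => [h k|h i]; last first.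
  by have := h i.+1 (ltn_ord i); rewrite psum_row psum_col h ?(ltnW (ltn_ord i)) // => /addrI ->.
elim: k => [|k IH] kN; first by rewrite psum0l psum0r.
by rewrite (psum_row _ (Ordinal kN)) (psum_col _ (Ordinal kN)) IH ?(ltnW kN) //= (eqP (h _)).
Qed.

Definition dcol A : 'M[int]_N := diag_mx (\row_j \sum_k val A k j).

Fact dcol_in A : in_tXi (dcol A).
Proof.
have rA := rot_symE (tXi_rot A); have /and3P[_ oA _] := valP A.
have dE i j : dcol A i j = (i == j)%:Z * \sum_k val A k j.
  by rewrite !mxE; case: eqVneq => [->|_]; rewrite ?mul1r ?mul0r.
apply/and3P; split.
- by apply/forallP=> i; apply/forallP=> j; apply/implyP=> /negbTE ij; rewrite dE ij mul0r.
- rewrite dE eqxx mul1r sum_rev => [|i]; last by rewrite -{1}(rev_center n) rA.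
  by rewrite rpredDl // dvdz_mulr.
- apply/forallP=> i; apply/forallP=> j; rewrite !dE (inj_eq rev_ord_inj); apply/eqP; congr (_ * _).
  by rewrite [RHS](reindex_inj rev_ord_inj); apply: eq_bigr => k _; rewrite rA.
Qed.
Definition tdcol A : tXi n := exist (fun M => is_true (in_tXi M)) _ (dcol_in A).
(** The diagonal matrix whose idempotent is the right unit of [A]. *)
Definition co A : tXi_diag n := exist (fun M : tXi n => is_true (is_diag_mx (val M))) (tdcol A) (diag_mx_is_diag _).

Lemma val_co A : val (val (co A)) = dcol A. Proof. by []. Qed.

Lemma psum_co A k : (k <= N)%N -> psum (dcol A) N k = psum (val A) N k.
Proof.
elim: k => [|k IH] kN; first by rewrite !psum0r.
rewrite !(psum_col _ (Ordinal kN)) IH ?(ltnW kN) //=; congr (_ + _).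
rewrite (bigD1 (Ordinal kN)) //= big1 ?addr0 => [|i ik]; last by rewrite !mxE (negbTE ik).
by rewrite !mxE eqxx.
Qed.

Lemma diag_ext (la mu : tXi_diag n) :
  (forall k, (k <= N)%N -> psum (val (val la)) N k = psum (val (val mu)) N k) -> la = mu.
Proof.
move=> h; apply: val_inj; apply: val_inj; apply: psum_inj => i j iN jN.
rewrite (psum_diag i j (valP la)) (psum_diag i j (valP mu)).
have mN : (minn i j <= N)%N by rewrite geq_min iN.
by rewrite (psum_diag_sym _ _ (valP la)) (psum_diag_sym _ _ (valP mu)) h.
Qed.

Lemma co_eq A B : (forall k, (k <= N)%N -> psum (val A) N k = psum (val B) N k) -> co A = co B.
Proof. by move=> h; apply: diag_ext => k kN; rewrite !val_co !psum_co // h. Qed.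

Lemma co_diag (la : tXi_diag n) : co (val la) = la.
Proof. by apply: diag_ext => k kN; rewrite val_co psum_co. Qed.

Lemma composable_co A B : composable A B = composable (val (co A)) B.
Proof.
by apply/composableP/composableP => h k kN; have := h k kN; rewrite val_co psum_co.
Qed.

Lemma co_move A B r p : val B = val A + mv r p -> co B = co A.
Proof. by move=> e; apply: co_eq => k kN; rewrite e psumD psum_mvN addr0. Qed.
End Weights.

Section Triangular.
Variable n : nat.
Local Notation N := (dimN n).
Implicit Types (A B : tXi n) (M : 'M[int]_N) (r : 'I_(n.*2)) (p : 'I_N).
Local Notation Kt := {malg {poly Qv}[tXi n]}.

Lemma gcoef_neq0 M r p : 0 <= M (rhi r) p -> gcoef M r p != 0.
Proof.
move=> h; apply: mulf_neq0; first exact: vX_neq0.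
apply: mulf_neq0; last by rewrite invr_eq0 v_subVneq0.
have [k ->] : exists k : nat, M (rhi r) p + 1 = k.+1.
  by case: (M _ _) h => // a _; exists a; rewrite -addn1 PoszD.
rewrite subr_eq0; apply: contra_neq (@v_free (k.+1 + k.+1) isT) => e.
by rewrite exprD [X in X * _]e -exprnN mulVf // expf_neq0 // v_neq0.
Qed.

Fact scale_const (R : comNzRingType) (c a b : R) : c *: (a%:P - b *: 1) = (c * (a - b))%:P :> {poly R}.
Proof. by rewrite -!mul_polyC mulr1 -polyCB -polyCM. Qed.
Fact mulrAC_div (F : fieldType) (a b c : F) : a / b * c = a * (c / b).
Proof. by rewrite mulrAC mulrA. Qed.

Lemma tcf_const M r p : p != rhi r -> tcf M r p = (gcoef M r p)%:P.
Proof.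
move=> /negbTE h; rewrite /tcf h.
by apply: etrans (scale_const _ _ _) _; rewrite mulrAC_div.
Qed.

Lemma tXi_minus_move A r p : last_move (val A) r p -> in_tXi (val A - mv r p).
Proof.
move=> lm; have := last_move_ge0 lm (tXi_rot A) (@tXi_offdiag _ A) => h.
have /and3P[_ o s] := valP A.
apply/and3P; split.
- by apply/forallP=> i; apply/forallP=> j; apply/implyP=> /h.
- by rewrite mxBE; have [k ->] := center_mv r p; rewrite rpredBr // dvdz_mull.
- by apply: rot_symD => //; apply: rot_symN; apply: rot_sym_mv.
Qed.

(** Column [j] lies to the left of column r+1, so the leading coefficient does not involve t
    ([tcf_const]) and is invertible in Q(v)[t]; the columns left of [j] drop out by
    [no_left_move]. *)
Lemma Th_last A r j : last_move (val A) r j -> exists A0 : tXi n, exists2 u : Qv,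
  u != 0 & val A0 = val A - mv r j /\
  Th r << A0 >> = u%:P *: << A >> + \sum_(p : 'I_N | (j < p)%N) tcf (val A0) r p *: tb (val A0 + mv r p).
Proof.
move=> lm; have h := tXi_minus_move lm; exists (exist (fun M => is_true (in_tXi M)) _ h).
have [jr _ _ _] := lm; have nj : j != rhi r by rewrite -val_eqE /= /bump /=; nlia.
exists (gcoef (val A - mv r j) r j).
  apply: gcoef_neq0; apply: (last_move_ge0 lm (tXi_rot A) (@tXi_offdiag _ A)).
  by rewrite eq_sym.
split=> //; rewrite Th1 (bigID (fun p : 'I_N => (j < p)%N)) /= addrC; congr (_ + _).
rewrite (bigD1 j) ?ltnn //= big1 ?addr0 => [|p /andP[jp pj]].
  by rewrite (tcf_const _ nj) subrK; congr (_ *: _); exact: tb_val.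
rewrite tb0 ?scaler0 // in_tXi_move //; apply/asboolP; apply: (no_left_move lm).
by rewrite ltn_neqAle pj leqNgt.
Qed.
End Triangular.

Section Star.
Variable n : nat.
Local Notation N := (dimN n).
Implicit Types (A B C : tXi n) (M : 'M[int]_N) (r : 'I_(n.*2)) (p : 'I_N).
Local Notation Kt := {malg {poly Qv}[tXi n]}.
Implicit Types x y z : Kt.

Definition generated la x := exists s, opw s << val (la : tXi_diag n) >> = x.

Lemma generated_lin la c x y : generated la x -> generated la y -> generated la (c *: x + y).
Proof.
move=> [s <-] [t <-]; exists ([seq (c * i.1, i.2) | i <- s] ++ t).
elim: s => [|i s IH] /=; first by rewrite opw0 scaler0 add0r.
by rewrite !opwS IH scalerDr scalerA addrA.
Qed.
Lemma generated0 la : generated la 0.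
Proof. by exists [::]; rewrite opw0. Qed.
Lemma generatedZ la c x : generated la x -> generated la (c *: x).
Proof. by move=> h; rewrite -[_ *: _]addr0; apply: generated_lin => //; exact: generated0. Qed.
Lemma generatedD la x y : generated la x -> generated la y -> generated la (x + y).
Proof. by move=> h h'; rewrite -[x]scale1r; exact: generated_lin. Qed.
Lemma generated_Th la r x : generated la x -> generated la (Th r x).
Proof.
move=> [s <-]; exists [seq (i.1, r :: i.2) | i <- s].
elim: s => [|i s IH]; first by rewrite !opw0 Th0.
by rewrite map_cons !opwS ThP IH.
Qed.

(** Induction on [mu]: the formula of [Th_last] is solved for its leading term. *)
Lemma generated_basis A : generated (co A) << A >>.
Proof.
have [k] := ubnP `|mu (val A)|%N; elim: k => // k IH in A *; rewrite ltnS => hk.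
have muA := mu_ge0 (@tXi_offdiag _ A).
case: (boolP (is_diag_mx (val A))) => [dA1|/(last_move_ex (tXi_rot A) (@tXi_offdiag _ A)) [r [j lm]]].
  have -> : A = val (exist (fun M : tXi n => is_true (is_diag_mx (val M))) A dA1) by [].
  rewrite co_diag; exists [:: (1, [::])].
  by rewrite opwS opw0 addr0 scale1r.
have [A0 [u u0 [e eT]]] := Th_last lm.
have IH' B : mu (val B) < mu (val A) -> co B = co A -> generated (co A) << B >>.
  move=> h <-; apply: IH; have := mu_ge0 (@tXi_offdiag _ B).
  by move: (mu (val A)) (mu (val B)) h hk muA => a b; nlia.
have eA : val A = val A0 + mv r j by rewrite e subrK.
have -> : << A >> = u^-1%:P *: (Th r << A0 >> - \sum_(p : 'I_N | (j < p)%N) tcf (val A0) r p *: tb (val A0 + mv r p)).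
  by rewrite eT addrK scalerA -polyCM mulVf // scale1r.
apply: generatedZ; apply: generatedD.
  by apply: generated_Th; apply: IH'; [rewrite e mu_last_move | rewrite (co_move eA)].
rewrite -scaleN1r; apply: generatedZ; apply: big_ind => [|x y|p jp]; [exact: generated0|exact: generatedD|].
apply: generatedZ; have [[B eB ->]|[_ ->]] := tbP {poly Qv} (val A0 + mv r p); last exact: generated0.
apply: IH'; first by rewrite eB e (mu_exchange lm).
by rewrite (co_move eB) (co_move eA).
Qed.

Definition word_rep A := projT1 (cid (generated_basis A)).
Lemma word_repE A : opw (word_rep A) << val (co A) >> = << A >>.
Proof. exact: projT2 (cid (generated_basis A)). Qed.

(** The words that produce [A] from its right idempotent are applied to [B]. The words are chosen
    arbitrarily; the result is pinned down by [sp_star] and [sp_inj]. *)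
Definition starb A B : Kt := if composable A B then opw (word_rep A) << B >> else 0.
Definition star : Kt -> Kt -> Kt := locked (bilin starb).
Lemma star_bilinear : bilinear_op star.
Proof. by rewrite /star -lock; exact: bilin_bilinear. Qed.
Lemma star1 A B : star << A >> << B >> = starb A B.
Proof. by rewrite /star -lock bilin1. Qed.

Lemma shift_composable A B m k : (k <= N)%N ->
  (psum (shift A m) N k == psum (shift B m) k N) = (psum (val A) N k == psum (val B) k N).
Proof. by move=> kN; rewrite psum_shift // psum_shiftr // (inj_eq (addIr _)). Qed.

Lemma shift_diag_unit (la : tXi_diag n) B m d : (forall i j, 0 <= shift (val la) m i j) ->
  composable (val la) B ->
  qmul (stdQ d (shift (val la) m)) (stdQ d (shift B m)) = stdQ d (shift B m).
Proof.
move=> hd /composableP c.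
have [e|e] := eqVneq (psum (shift (val la) m) N N) (dimN d).
  have [L eL] := Xi_of_int hd (rot_shift _ _) e.
  have dL : is_diag_mx (Xi_int L).
    rewrite eL; apply/is_diag_mxP => i j ij; rewrite shiftE -val_eqE (negbTE ij) mulr0 addr0.
    by have /is_diag_mxP -> := valP la.
  rewrite -eL (stdQ_diag dL) // => k kN; rewrite eL.
  by apply/eqP; rewrite shift_composable // c.
rewrite !(@stdQ_dim _ d) ?(bop0l (@qmul_bilinear n d)) //.
by apply: contraNneq e => <-; rewrite shift_composable // c.
Qed.

(** For large m, [word_rep A] expresses [A+2mI] by generators applied to its right idempotent, and
    this idempotent is a left unit for [B+2mI]. *)
Lemma sp_star1 A B : evl (fun m => forall d,
  sp m d (star << A >> << B >>) = qmul (sp m d << A >>) (sp m d << B >>)).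
Proof.
have := evl_and (evl_and (sp_opw (word_rep A) << val (co A) >>) (sp_opw (word_rep A) << B >>))
  (shift_diag_ge0 (val (co A))).
apply: evl_mono => m [[h1 h2] hd] d; rewrite star1 /starb.
have [c|nc] := boolP (composable A B); last first.
  have [k [kN]] : exists k, (k <= N)%N /\ psum (val A) N k != psum (val B) k N.
    apply: contrapT => h; case/composableP: nc => k kN; apply/eqP; apply: contraT => h'.
    by case: h; exists k.
  rewrite -(@shift_composable A B m k kN) => h'.
  rewrite sp0; apply: esym; apply: etrans (congr2 (@qmul n d) (sp1 m d A) (sp1 m d B)) _.
  exact: stdQ_noncomp kN h'.
rewrite h2 -[in RHS](word_repE A) h1 Ls_mul; congr (Ls _ _ _).
apply: etrans (sp1 m d B) (esym (etrans (congr2 (@qmul n d) (sp1 m d _) (sp1 m d B)) _)).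
by apply: shift_diag_unit => //; rewrite -composable_co.
Qed.

Lemma sp_star x y : evl (fun m => forall d, sp m d (star x y) = qmul (sp m d x) (sp m d y)).
Proof.
move: x; apply: evl_lin => [A|m c x x' hx hx' d|m d]; first 1 last.
- by rewrite star_bilinear.1 !spP hx hx'; apply: esym; exact: (@qmul_bilinear n d).1.
- by rewrite (bop0l star_bilinear) sp0 (bop0l (@qmul_bilinear n d)).
move: y; apply: evl_lin => [B|m c x x' hx hx' d|m d]; first exact: sp_star1.
- by rewrite star_bilinear.2 !spP hx hx'; apply: esym; exact: (@qmul_bilinear n d).2.
by rewrite (bop0r star_bilinear) sp0 (bop0r (@qmul_bilinear n d)).
Qed.

(** The specializations at large m are jointly faithful; in this way identities pass from the Schur
    algebras to Q(v)[t]. *)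
Lemma sp_inj x y : evl (fun m => forall d, sp m d x = sp m d y) -> x = y.
Proof.
move=> h; apply/malgP => A; apply/eqP; rewrite -subr_eq0 -mcoeffB; apply/eqP.
apply: sp_eq0; apply: evl_mono h => m h d _.
by rewrite -scaleN1r addrC spP h hornerN hornerC scaleN1r addNr.
Qed.

Lemma star_assoc : associative star.
Proof.
move=> x y z; apply: sp_inj.
have := evl_and (evl_and (sp_star x (star y z)) (sp_star y z)) (evl_and (sp_star (star x y) z) (sp_star x y)).
apply: evl_mono => m [[h1 h2] [h3 h4]] d.
by rewrite h1 h2 h3 h4 qmul_assoc.
Qed.
End Star.

Opaque Kj_mul.

(** * Integrality of the coefficients at t = 1 *)

Section Integrality.

Fact term_split (R : comNzRingType) (g a b c : R) : g * (a - b) * c = g * (a * c) - b * (g * c).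
Proof. by ring. Qed.

Fact laurentB x y : laurent x -> laurent y -> laurent (x - y).
Proof. by case: laurent_subring => _ h _; apply: h. Qed.
Fact laurentM x y : laurent x -> laurent y -> laurent (x * y).
Proof. by case: laurent_subring => _ _ h; apply: h. Qed.
Fact laurent1 : laurent 1.
Proof. by case: laurent_subring. Qed.
Fact laurent0 : laurent 0.
Proof. by rewrite -(subrr 1); apply: laurentB; exact: laurent1. Qed.
Fact laurentX x k : laurent x -> laurent (x ^+ k).
Proof. by move=> h; elim: k => [|k IH]; rewrite ?expr0 ?exprS; [exact: laurent1|exact: laurentM]. Qed.
Fact laurentVX k : laurent (v ^- k).
Proof. by rewrite -exprVn; apply: laurentX; exact: laurent_vV. Qed.

(* If all values at t = v^{-2m}, m large, are Laurent polynomials then so are those for all m: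
   G(v^{-2} t) - v^{-2k} G(t) has degree smaller than k = deg G, so that the
   claim for it transfers integrality of G from m+1 to m. *)
Lemma laurent_values (G : {poly Qv}) : evl (fun m => laurent G.[tm m]) -> forall m, laurent G.[tm m].
Proof.
have [k] := ubnP (size G); elim: k => // k IH in G *; rewrite ltnS => hk [p0 hp].
case: k => [|k] in IH hk *.
  by move: hk; rewrite leqn0 size_poly_eq0 => /eqP -> m; rewrite horner0 laurent0.
pose H : {poly Qv} := \poly_(i < k) (G`_i * (v ^- (2 * i) - v ^- (2 * k))).
have HE m : H.[tm m] = G.[tm m.+1] - v ^- (2 * k) * G.[tm m].
  rewrite horner_poly !(horner_coef_wide _ hk) mulr_sumr -sumrB big_ord_recr /=.
  have e i : tm m.+1 ^+ i = v ^- (2 * i) * tm m ^+ i.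
    by rewrite /tm -!exprVn -!exprM -exprD; congr (_ ^+ _); nlia.
  rewrite [X in _ + X](_ : _ = 0) ?addr0; last by rewrite e mulrCA subrr.
  by apply: eq_bigr => i _; rewrite e; exact: term_split.
have hH : forall m, laurent H.[tm m].
  apply: IH; first by rewrite ltnS size_poly.
  exists p0 => m hm; rewrite HE; apply: laurentB; first by apply: hp; apply: leqW.
  by apply: laurentM; [exact: laurentVX|exact: hp].
have down m : laurent G.[tm m.+1] -> laurent G.[tm m].
  move=> h; have -> : G.[tm m] = v ^+ (2 * k) * (G.[tm m.+1] - H.[tm m]).
    rewrite HE opprB addrC subrK mulrA divff ?mul1r // expf_neq0 ?v_neq0 //.
  apply: laurentM; first by apply: laurentX; exact: laurent_v.
  by apply: laurentB => //; apply: hH.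
move=> m; have [/hp //|] := leqP p0 m; elim: p0 {hp} (hp p0 (leqnn _)) => // q IHq hq.
rewrite ltnS leq_eqVlt => /orP[/eqP -> |]; first exact: down.
by apply: IHq; exact: down.
Qed.

Lemma ext_coef (I : choiceType) (y : {malg Lau[I]}) i : (ext y)@_i = lau (y@_i).
Proof. by rewrite ext_mapc mapcE. Qed.

Lemma ext_lift (I : choiceType) (x : {malg Qv[I]}) : (forall i, laurent x@_i) -> exists y, ext y = x.
Proof.
move=> h; exists (\sum_(i <- msupp x) << MkLau (h i) *g i >>).
rewrite ext_mapc mapc_sum; apply: etrans (esym (monalgE x)).
by apply: eq_bigr => i _; exact: mapcU.
Qed.
End Integrality.

Section Kproduct.
Variable n : nat.
Local Notation N := (dimN n).
Implicit Types (A B C : tXi n).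
Local Notation Kt := {malg {poly Qv}[tXi n]}.
Implicit Types x y z : Kt.

Definition ev1 x : QKj n := mapc (horner_eval 1) x.

Definition Qstar : QKj n -> QKj n -> QKj n :=
  locked (bilin (fun A B => ev1 (star << A >> << B >>))).
Lemma Qstar_bilinear : bilinear_op Qstar.
Proof. by rewrite /Qstar -lock; exact: bilin_bilinear. Qed.
Lemma Qstar1 A B : Qstar << A >> << B >> = ev1 (star << A >> << B >>).
Proof. by rewrite /Qstar -lock bilin1. Qed.

Lemma ev1_star x y : ev1 (star x y) = Qstar (ev1 x) (ev1 y).
Proof. by apply: (mapc_bop (@star_bilinear n) Qstar_bilinear) => A B; rewrite Qstar1. Qed.

Lemma ev1_1 A : ev1 << A >> = << A >>. Proof. exact: mapc1. Qed.

Lemma Qstar_assoc : associative Qstar.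
Proof.
apply: (bop_assoc Qstar_bilinear) => A B C.
transitivity (ev1 (star << A >> (star << B >> << C >>))).
  by rewrite ev1_star; apply: (congr2 Qstar); [rewrite ev1_1|rewrite Qstar1].
rewrite star_assoc ev1_star; apply: (congr2 Qstar); last by rewrite ev1_1.
by rewrite Qstar1.
Qed.

Lemma stdQE d (M : 'M[int]_N) : stdQ d M = ext (std d M). Proof. by rewrite /stdQ -lock. Qed.

Lemma sp_fold_star x (As : seq (tXi n)) : evl (fun m => forall d,
  sp m d (foldl (@star n) x [seq << B >> | B <- As]) =
  foldl (@qmul n d) (sp m d x) [seq stdQ d (shift B m) | B <- As]).
Proof.
elim: As x => [|B As IH] x; first by exists 0%N.
apply: evl_mono (evl_and (IH (star x << B >>)) (sp_star x << B >>)) => m [h1 h2] d /=.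
by rewrite h1 h2 sp1.
Qed.

Lemma ext_fold_schur d (s : schur n d) (As : seq (tXi n)) m :
  ext (foldl (@schur_mul n d) s [seq (std d (shift B m) : schur n d) | B <- As]) =
  foldl (@qmul n d) (ext s) [seq stdQ d (shift B m) | B <- As].
Proof. by elim: As s => //= B As IH s; rewrite IH ext_schur_mul stdQE. Qed.

Lemma fold_qmul0 d (zs : seq {malg Qv[Xi n d]}) : foldl (@qmul n d) 0 zs = 0.
Proof. by elim: zs => //= z zs; rewrite (bop0l (@qmul_bilinear n d)). Qed.

(** For large m the value at t = v^{-2m} is, up to a power of v, a coefficient of a product in a
    Schur algebra; [laurent_values] carries integrality down to m = 0, which is t = 1. *)
Lemma ev1_laurent A B C : laurent (ev1 (star << A >> << B >>))@_C.
Proof.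
rewrite mapcE; have -> : (1 : Qv) = tm 0 by rewrite /tm muln0 expr0 invr1.
rewrite /horner_eval; apply: laurent_values.
apply: evl_mono (evl_and (evl_and (sp_star << A >> << B >>) (shift_diag_ge0 C)) (shift_dim C)).
move=> m [[h hC] [d hd]]; have [E eE] := Xi_of_int hC (rot_shift C m) hd.
have e2 : sp m d (star << A >> << B >>) = ext (schur_mul (std d (shift A m)) (std d (shift B m))).
  rewrite ext_schur_mul -(stdQE d (shift A m)) -(stdQE d (shift B m)) h.
  by apply: (congr2 (@qmul n d)); exact: sp1.
have := sp_coef (star << A >> << B >>) eE; rewrite e2 ext_coef => e.
have -> : ((star << A >> << B >>)@_C).[tm m] = lau (schur_mul (std d (shift A m)) (std d (shift B m)))@_E * v ^+ dA E.
  by rewrite e mulfVK // expf_neq0 // v_neq0.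
by apply: laurentM; [exact: lauP|apply: laurentX; exact: laurent_v].
Qed.

Definition Kb A B : Kj n := projT1 (cid (ext_lift (ev1_laurent A B))).
Definition Km : Kj n -> Kj n -> Kj n := locked (bilin Kb).
Lemma Km_bilinear : bilinear_op Km.
Proof. by rewrite /Km -lock; exact: bilin_bilinear. Qed.
Lemma ext_Km1 A B : ext (Km << A >> << B >>) = ev1 (star << A >> << B >>).
Proof. by rewrite /Km -lock bilin1; exact: projT2 (cid (ext_lift (ev1_laurent A B))). Qed.

Lemma ext_Km (x y : Kj n) : ext (Km x y) = Qstar (ext x) (ext y).
Proof.
rewrite !ext_mapc; apply: (mapc_bop Km_bilinear Qstar_bilinear) => A B.
by rewrite -ext_mapc ext_Km1 Qstar1.
Qed.

Lemma sum_msupp (V : nmodType) (x : Kt) (F : tXi n -> V) (s := msupp x : seq (tXi n)) :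
  \sum_(A <- msupp x) F A = \sum_(i < size s) F (tnth (in_tuple s) i).
Proof. exact: big_tnth. Qed.

(** [stabilizes_to] wants each Z_i+2pI to lie in the same [Xi n d] as A+2pI, so the support must
    consist of matrices with the entry sum of [A]. *)
Lemma sp_totals x A : evl (fun m => forall d, psum (shift A m) N N != dimN d -> sp m d x = 0) ->
  forall C, C \in msupp x -> psum (val C) N N = psum (val A) N N.
Proof.
move=> h C; rewrite -mcoeff_neq0 => /eqP xC; apply: contrapT => /eqP nC; apply: xC; apply: sp_eq0.
apply: evl_mono h => m hm d hd; apply: hm.
rewrite -hd !psum_shift // (inj_eq (addIr _)) eq_sym //.
Qed.

Lemma ext_fold_Km (y : Kj n) x (As : seq (tXi n)) : ext y = ev1 x ->
  ext (foldl Km y [seq << B >> | B <- As]) = ev1 (foldl (@star n) x [seq << B >> | B <- As]).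
Proof.
elim: As y x => [//|B As IH] y x e; apply: IH.
rewrite ext_Km e ev1_star; apply: (congr1 (Qstar (ev1 x))).
by rewrite ev1_1 ext_mapc mapc1.
Qed.

Lemma Km_stabilizes A (As : seq (tXi n)) :
  stabilizes_to A As (foldl Km << A >> [seq << B >> | B <- As]).
Proof.
pose x := foldl (@star n) << A >> [seq << B >> | B <- As]; pose s : seq (tXi n) := msupp x.
have hs := sp_fold_star << A >> As; rewrite -/x in hs.
have tot : forall C, C \in msupp x -> psum (val C) N N = psum (val A) N N.
  apply: (@sp_totals x A); apply: evl_mono hs => m hm d hd.
  by rewrite hm sp1 stdQ_dim // fold_qmul0.
(* The Z_i and G_i are the support and the coefficients of the product over Q(v)[t]. *)
exists (size s), (fun i => tnth (in_tuple s) i), (fun i => x@_(tnth (in_tuple s) i)); split.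
  have [p0 h] := evl_and hs (evl_all s (@shift_diag_ge0 n)).
  exists p0 => p d /h [hx hd]; rewrite -psum_full => eD; split=> [i|].
    have si := mem_tnth i (in_tuple s); apply: Xi_of_int; [exact: hd|exact: rot_shift|].
    by rewrite -eD !psum_shift // tot.
  apply: etrans (ext_fold_schur _ _ _) _; rewrite -stdQE -[in LHS](sp1 p d A) -hx spE sum_msupp.
  by apply: eq_bigr => i _; rewrite stdQE.
rewrite (@ext_fold_Km _ << A >>) -/x; last by rewrite ev1_1 ext_mapc mapc1.
rewrite {1}[x]malg_sumE /ev1 mapc_sum sum_msupp; apply: eq_bigr => i _.
by rewrite mapcZ mapc1.
Qed.

Lemma Km_is_product : is_Kj_product Km.
Proof.
split; first exact: Km_bilinear.
- by move=> x y z; apply: ext_inj; rewrite !ext_Km Qstar_assoc.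
- move=> A B /negbTE nc; apply: ext_inj; rewrite ext_Km1 star1 /starb nc /ev1 mapc0.
  by rewrite ext_mapc mapc0.
- by move=> A As _; exact: Km_stabilizes.
Qed.

Lemma Kj_mul_spec : is_Kj_product (@Kj_mul n).
Proof. by apply: the_spec; exists Km; exact: Km_is_product. Qed.

(** Every product that meets the specification has this value: the Z_i and G_i that it provides form
    an element over Q(v)[t] with the same specializations as [star], so [sp_inj] identifies the
    two. *)
Lemma ext_Kj_mul1 A B : ext (Kj_mul << A >> << B >>) = ev1 (star << A >> << B >>).
Proof.
have [_ _ nc st] := Kj_mul_spec; have [c|c] := boolP (composable A B); last first.
  rewrite (nc _ _ c) star1 /starb (negbTE c) /ev1 mapc0; exact: mapc0.
have := st A [:: B]; rewrite /= c => /(_ isT) [r [Z [G [[p0 hp] ->]]]].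
pose x : Kt := \sum_i G i *: << Z i >>.
suff -> : star << A >> << B >> = x.
  by rewrite /x /ev1 mapc_sum; apply: eq_bigr => i _; rewrite mapcZ mapc1.
(* For [d] of another size both sides must specialize to 0. This needs each [Z i] to have the entry
   sum of [A], which one admissible pair (p, d) shows. *)
have tot i : psum (val (Z i)) N N = psum (val A) N N.
  have [p1 h1] := shift_dim A; have [d hd] := h1 _ (leq_maxr p0 p1).
  have [hZ _] := hp _ d (leq_maxl p0 p1) (etrans (esym (psum_full _)) hd).
  have [C eC] := hZ i; have := Xi_int_psum C; rewrite eC -hd !psum_shift //; exact: addIr.
apply: sp_inj; apply: evl_mono (evl_and (ex_intro _ p0 (fun p (h : (p0 <= p)%N) => h)) (sp_star << A >> << B >>)).
move=> m [hm hs] d; rewrite hs.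
have ex : sp m d x = \sum_i (G i).[tm m] *: stdQ d (shift (Z i) m).
  by rewrite /x sp_sum; apply: eq_bigr => i _; rewrite spZ sp1.
have eq2 : qmul (sp m d << A >>) (sp m d << B >>) = qmul (stdQ d (shift A m)) (stdQ d (shift B m)).
  by apply: (congr2 (@qmul n d)); exact: sp1.
rewrite ex eq2; have [e|e] := eqVneq (psum (shift A m) N N) (dimN d).
  have [_] := hp m d hm (etrans (esym (psum_full _)) e).
  rewrite ext_schur_mul !stdQE => ->; by apply: eq_bigr => i _; rewrite stdQE.
rewrite (stdQ_dim e) (bop0l (@qmul_bilinear n d)) big1 // => i _.
by rewrite stdQ_dim ?scaler0 //; move: e; rewrite !psum_shift // tot.
Qed.

Lemma QKj_mulE (x y : QKj n) : QKj_mul x y = Qstar x y.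
Proof.
apply: (bop_basis (bilin_bilinear _) Qstar_bilinear) => A B.
by rewrite /QKj_mul bilin1 ext_Kj_mul1 Qstar1.
Qed.
End Kproduct.

(** * Operators of the generators on K^j *)

Section RowWeights.
Variable n : nat.
Local Notation N := (dimN n).
Implicit Types (A B : tXi n) (la mu : tXi_diag n) (r : 'I_(n.*2)) (p : 'I_N).

Fact tr_in A : in_tXi (val A)^T.
Proof.
have /and3P[_ oA _] := valP A; have rA := rot_symE (tXi_rot A).
apply/and3P; split; rewrite ?mxE //.
  by apply/forallP=> i; apply/forallP=> j; apply/implyP=> ij; rewrite mxE tXi_offdiag // eq_sym.
by apply/forallP=> i; apply/forallP=> j; rewrite !mxE rA.
Qed.
Definition trX A : tXi n := exist (fun M => is_true (in_tXi M)) _ (tr_in A).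
(** The left idempotent of [A]: row sums as column sums of the transpose. *)
Definition ro A : tXi_diag n := co (trX A).

Lemma psum_ro A k : (k <= N)%N -> psum (val (val (ro A))) k N = psum (val A) k N.
Proof. by move=> kN; rewrite (psum_diag_sym _ _ (valP (ro A))) val_co psum_co // psum_tr. Qed.

Lemma composable_ro la A : composable (val la) A = (la == ro A).
Proof.
apply/composableP/eqP => [h|-> k kN]; last by rewrite (psum_diag_sym _ _ (valP (ro A))) psum_ro.
by apply: diag_ext => k kN; rewrite h // (psum_diag_sym _ _ (valP (ro A))) psum_ro.
Qed.

Lemma ro_diag la : ro (val la) = la.
Proof.
apply: diag_ext => k kN; rewrite (psum_diag_sym N k (valP (ro (val la)))) psum_ro //.
exact: psum_diag_sym (valP la).
Qed.

Lemma star_unitl A : star << val (ro A) >> << A >> = << A >>.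
Proof.
have c : composable (val (ro A)) A by rewrite composable_ro.
apply: sp_inj; apply: evl_mono (evl_and (sp_star << val (ro A) >> << A >>) (shift_diag_ge0 (val (ro A)))).
move=> m [h hd] d; rewrite h.
apply: etrans (congr2 (@qmul n d) (sp1 m d _) (sp1 m d A)) (etrans _ (esym (sp1 m d A))).
exact: shift_diag_unit.
Qed.

Lemma Qstar_unitl la A : Qstar << val la >> << A >> = (la == ro A)%:R *: << A >>.
Proof.
rewrite Qstar1; case: eqVneq => [->|h]; first by rewrite star_unitl ev1_1 scale1r.
by rewrite star1 /starb composable_ro (negbTE h) scale0r /ev1 mapc0.
Qed.

Lemma Qstar_unitr A mu : Qstar << A >> << val mu >> = (mu == co A)%:R *: << A >>.
Proof.
rewrite Qstar1 star1 /starb composable_co composable_ro ro_diag [mu == _]eq_sym.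
case: eqVneq => [<-|h]; last by rewrite scale0r /ev1 mapc0.
by rewrite word_repE ev1_1 scale1r.
Qed.

Lemma Qstar_rowE la x : Qstar << val la >> x = lin (fun A => (la == ro A)%:R *: << A >>) x.
Proof.
move: x; apply: lm_ext => [||A]; [exact: bop_lmr (@Qstar_bilinear n)|exact: lin_lm|].
by rewrite lin1 Qstar_unitl.
Qed.

Lemma proj_row_coef la (x : QKj n) A : (Qstar << val la >> x)@_A = (la == ro A)%:R * x@_A.
Proof. by rewrite Qstar_rowE lin_diag_coef. Qed.

Lemma Qstar_unit_ro A x : Qstar << val (ro A) >> (Qstar << A >> x) = Qstar << A >> x.
Proof.
have e : Qstar << val (ro A) >> << A >> = << A >> by rewrite Qstar_unitl eqxx scale1r.
apply: (etrans (Qstar_assoc << val (ro A) >> << A >> x)).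
exact: (congr1 (fun z => Qstar z x) e).
Qed.

Lemma Qstar_row A B C : (Qstar << A >> << B >>)@_C != 0 -> ro C = ro A.
Proof.
rewrite -Qstar_unit_ro proj_row_coef; have [->//|nE] := eqVneq (ro A) (ro C).
by rewrite mul0r eqxx.
Qed.

(** The action of torus elements: d_a acts with c(la) = v^{-la_a}, taken at the left weight. *)
Definition dgo (c : tXi_diag n -> Qv) : QKj n -> QKj n :=
  locked (lin (fun A => c (ro A) *: << A >>) : QKj n -> QKj n).

Lemma dgo_lm c : lin_map (dgo c).
Proof. by rewrite /dgo -lock; exact: lin_lm. Qed.
Lemma dgo1 c A : dgo c << A >> = c (ro A) *: << A >>.
Proof. by rewrite /dgo -lock lin1. Qed.
End RowWeights.

Section Operators.
Variable n : nat.
Local Notation N := (dimN n).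
Implicit Types (A B : tXi n) (la mu : tXi_diag n) (r : 'I_(n.*2)) (p : 'I_N) (F : QKj n -> QKj n).

(** Operators that commute with right multiplications, as left multiplications do. They are
    determined by their values on diagonal matrices ([rlin_eq]), so relations need to be checked
    only there. *)
Definition rlin F := lin_map F /\ forall x y, F (Qstar x y) = Qstar (F x) y.

Lemma rlin_eq F G : rlin F -> rlin G -> (forall la, F << val la >> = G << val la >>) -> F =1 G.
Proof.
move=> [hF hF'] [hG hG'] e; apply: (lm_ext hF hG) => A.
have -> : << A >> = Qstar << val (ro A) >> << A >> by rewrite Qstar_unitl eqxx scale1r.
by rewrite hF' hG' e.
Qed.

Lemma rlin_ext F : lin_map F -> (forall A B, F (Qstar << A >> << B >>) = Qstar (F << A >>) << B >>) ->
  rlin F.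
Proof.
have bl := @Qstar_bilinear n; move=> hF h; split=> // x y.
apply: (lm_ext (F := fun x => F (Qstar x y)) (G := fun x => Qstar (F x) y)) => [||A].
- exact: lm_comp hF (bop_lml _ bl).
- exact: (lm_comp (bop_lml y bl) hF).
apply: (lm_ext (F := fun y => F (Qstar << A >> y)) (G := fun y => Qstar (F << A >>) y)) => [||B].
- exact: lm_comp hF (bop_lmr _ bl).
- exact: bop_lmr bl.
exact: h.
Qed.

Lemma rlin_comp F G : rlin F -> rlin G -> rlin (fun x => F (G x)).
Proof. by move=> [h1 h2] [g1 g2]; split=> [|x y]; [exact: lm_comp|rewrite g2 h2]. Qed.
Lemma rlin_id : rlin id. Proof. by []. Qed.

Lemma rlin_dgo c : rlin (dgo c).
Proof.
apply: rlin_ext => [|A B]; first exact: dgo_lm.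
rewrite dgo1 (bopZl (@Qstar_bilinear n)) /dgo -lock; apply: lin_diag_supp => C /Qstar_row -> //.
Qed.

Definition Er r : QKj n -> QKj n :=
  locked (lin (fun A => \sum_p gcoef (val A) r p *: tb (val A + mv r p)) : QKj n -> QKj n).
Lemma Er1 r A : Er r << A >> = \sum_p gcoef (val A) r p *: tb (val A + mv r p).
Proof. by rewrite /Er -lock lin1. Qed.
Lemma Er_lm r : lin_map (Er r).
Proof. by rewrite /Er -lock; exact: lin_lm. Qed.

Lemma tcf_at1 A r p : (tcf (val A) r p).[1] = gcoef (val A) r p.
Proof.
have := tcf_shift A r p 0; rewrite /tm muln0 expr0 invr1 => ->.
by congr (gcoef _ r p); apply/matrixP=> i j; rewrite shiftE muln0 mul0r addr0.
Qed.

Lemma ev1_tb M : ev1 (tb M : {malg {poly Qv}[tXi n]}) = tb M.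
Proof.
rewrite /tb -!lock; case: insub => [A|]; first exact: ev1_1.
exact: mapc0.
Qed.

Lemma ev1_Th r x : ev1 (Th r x) = Er r (ev1 x).
Proof.
apply: mapc_lm => [a y z||A]; [exact: ThP|exact: Er_lm|].
rewrite Th1 mapc_sum Er1; apply: eq_bigr => p _; rewrite mapcZ; apply: (congr2 *:%R).
  exact: tcf_at1.
exact: ev1_tb.
Qed.

(** After specialization at large m this is associativity in the Schur algebras. *)
Lemma Th_star r (x y : {malg {poly Qv}[tXi n]}) : Th r (star x y) = star (Th r x) y.
Proof.
apply: sp_inj.
have := evl_and (evl_and (sp_Th r (star x y)) (sp_star x y)) (evl_and (sp_star (Th r x) y) (sp_Th r x)).
by apply: evl_mono => m [[h1 h2] [h3 h4]] d; rewrite h1 h2 h3 h4 qmul_assoc.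
Qed.

Lemma rlin_Er r : rlin (Er r).
Proof.
apply: rlin_ext => [|A B]; first exact: Er_lm.
rewrite Qstar1 -ev1_Th Th_star ev1_star; apply: (congr2 (@Qstar n)); last exact: ev1_1.
by rewrite ev1_Th ev1_1.
Qed.
End Operators.

(** * Explicit action of a generator on matrices close to diagonal ones *)

Section Steps.
Variable n : nat.
Local Notation N := (dimN n).
Implicit Types (M : 'M[int]_N) (la : tXi_diag n) (r s : 'I_(n.*2)) (p : 'I_N).

Lemma mvN r p k l : mv r p k l =
  ((k == r.+1 :> nat) && (l == p :> nat))%:Z + ((k == n.*2 - r.+1 :> nat)%N && (l == n.*2 - p :> nat)%N)%:Z
  - ((k == r :> nat) && (l == p :> nat))%:Z - ((k == n.*2 - r :> nat)%N && (l == n.*2 - p :> nat)%N)%:Z.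
Proof. by rewrite mvE -!val_eqE /= /bump /= !subSS add1n opprD addrA. Qed.

(** Partial sums change in two rows only under a move, so in this form the exponents after several
    moves reduce to arithmetic, see [mexp_addmv]. The last term is the effect of the move on its own
    row. *)
Lemma mexpE M r p : mexp M r p = psum M r.+2 p - 2 * psum M r.+1 p + psum M r p + ((r == n :> nat) && (n < p)%N)%:Z.
Proof.
have h : psum (mv r p) r.+1 p - psum (mv r p) r p = - ((r == n :> nat) && (n < p)%N)%:Z.
  by rewrite !psum_mv; have := ltn_ord p; have := ltn_ord r; nlia.
have hi := psumSl M (rhi r) p; have lo := psumSl M (rlo r) p; have lo' := psumSl (mv r p) (rlo r) p.
rewrite /= /bump /= add1n in hi lo lo'.
rewrite /mexp sumrB; under [X in _ - X]eq_bigr do rewrite mxDE.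
rewrite big_split /=; set a := \sum_(l | _) _ in hi *; set b := \sum_(l | _) _ in lo *.
set c := \sum_(l | _) _ in lo' *.
rewrite hi lo; rewrite lo' in h; have hc : c = - ((r == n :> nat) && (n < p)%N)%:Z by rewrite -h; ring.
by rewrite hc; ring.
Qed.

Definition dg la (i : 'I_N) : int := val (val la) i i.

Lemma mexp_diag la r p :
  psum (val (val la)) r.+2 p - 2 * psum (val (val la)) r.+1 p + psum (val (val la)) r p
  = (r.+1 < p)%N%:Z * dg la (rhi r) - (r < p)%N%:Z * dg la (rlo r).
Proof.
have dl := valP la; rewrite (psum_diag r.+2 p dl) (psum_diag r.+1 p dl) (psum_diag r p dl).
have := psum_row (val (val la)) (rlo r); have := psum_row (val (val la)) (rhi r).
have e i : \sum_j val (val la) i j = dg la i.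
  by rewrite (bigD1 i) //= big1 ?addr0 // => j ji; have /is_diag_mxP -> := dl; rewrite // eq_sym.
rewrite !e /= /bump /= add1n.
move=> h1 h2; set P := fun k => psum (val (val la)) k N; rewrite -!/(P _) in h1 h2 *.
have [c|c] := leqP p r.
  have -> : (r.+1 < p)%N = false by apply/negbTE; rewrite -leqNgt ltnW // ltnS leqW.
  by rewrite !(minn_idPr _) ?leqW // /=; ring.
have [c'|c'] := ltnP r.+1 p.
  rewrite (minn_idPl c') h1 h2 /=; ring.
have -> : (p : nat) = r.+1 by apply/eqP; rewrite eqn_leq c' c.
by rewrite (minn_idPr (leqnSn _)) h2 /=; ring.
Qed.

Lemma psum_addmv M r p i j : psum (M + mv r p) i j = psum M i j +
  (((i == (N - r.+1)%N) && (N - p <= j)%N)%:Z - ((i == r.+1) && (p < j)%N)%:Z).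
Proof. by rewrite psumD psum_mv. Qed.

Lemma in_tXi_mv M r p : in_tXi M -> (p == rlo r) || (1 <= M (rlo r) p) -> in_tXi (M + mv r p).
Proof.
move=> hM hp; rewrite in_tXi_move //; apply/asboolP => k l kl.
have /and3P[_ _ rM] := hM; have M0 := @tXi_offdiag n (Sub M hM) k l kl; rewrite /= in M0.
have [epr|npr] := eqVneq p (rlo r); last first.
  rewrite mxDE mv_ge0 //; have h1 : 1 <= M (rlo r) p by move: hp; rewrite (negbTE npr).
  have -> : (r == n :> nat) && (p == n :> nat) = false; last by rewrite addr0.
  by apply: contraNF npr => /andP[/eqP e1 /eqP e2]; rewrite -val_eqE /= e1 e2.
rewrite mxDE mvN epr /=; apply: addr_ge0 => //.
by move: kl; rewrite -val_eqE /=; have := ltn_ord k; have := ltn_ord l; have := ltn_ord r; nlia.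
Qed.

(** A column without a unit in row [r] contributes nothing, as an off-diagonal entry would become
    negative; on the diagonal there is no sign condition. *)
Lemma Er_tb r M : in_tXi M -> Er r (tb M) =
  \sum_(p | (p == rlo r) || (1 <= M (rlo r) p)) gcoef M r p *: tb (M + mv r p).
Proof.
move=> hM; rewrite -[M]/(val (Sub M hM : tXi n)) tb_val Er1 (bigID (fun p => (p == rlo r) || (1 <= M (rlo r) p))) /=.
rewrite [X in _ + X]big1 ?addr0 // => p; rewrite negb_or => /andP[pr Mp].
rewrite tb0 ?scaler0 // in_tXi_move //; apply/asboolP => h.
have := h (rlo r) p; rewrite eq_sym => /(_ pr); rewrite mxDE mvN.
by move: Mp pr; rewrite -val_eqE /=; move: (M _ _) => x; have := ltn_ord p; have := ltn_ord r; nlia.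
Qed.

Definition cf (e f : int) : Qv := v ^ e * qint f.

Lemma int_le0 (x : int) : x <= 0 -> (1 <= x) = false. Proof. lia. Qed.

(** [Estep1], [Estep2] and [Estep3] treat a row [r] with no, one or two positive entries off the
    diagonal; each of these adds one term to the diagonal one. *)
Lemma Estep1 r M M1 e f : in_tXi M -> M1 = M + mv r (rlo r) -> (forall p, p != r :> nat -> M (rlo r) p <= 0) ->
  mexp M r (rlo r) = e -> M (rhi r) (rlo r) + 1 = f ->
  Er r (tb M) = cf e f *: tb M1.
Proof.
move=> hM -> h <- <-; rewrite Er_tb // (big_pred1 (rlo r)) // => p /=.
by case: eqVneq => //= pr; apply: int_le0; exact: h.
Qed.

Lemma Estep2 r M q M1 M2 e f e' f' : in_tXi M -> M1 = M + mv r (rlo r) -> M2 = M + mv r q -> (forall p, p != r :> nat -> p != q -> M (rlo r) p <= 0) ->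
  q != r :> nat -> 1 <= M (rlo r) q ->
  mexp M r (rlo r) = e -> M (rhi r) (rlo r) + 1 = f -> mexp M r q = e' -> M (rhi r) q + 1 = f' ->
  Er r (tb M) = cf e f *: tb M1 + cf e' f' *: tb M2.
Proof.
move=> hM -> -> h qr hq <- <- <- <-; rewrite Er_tb // (bigD1 (rlo r)) ?eqxx //=; congr (_ + _).
rewrite (big_pred1 q) // => p /=; apply/andP/eqP => [[/orP[/eqP->|hp] pr]|->].
- by rewrite eqxx in pr.
- by apply/eqP; apply: contraTT hp => pq; rewrite int_le0 //; apply: h.
by rewrite hq orbT.
Qed.

Lemma Estep3 r M q q' M1 M2 M3 e f e' f' e2 f2 : in_tXi M ->
  M1 = M + mv r (rlo r) -> M2 = M + mv r q -> M3 = M + mv r q' ->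
  (forall p, p != r :> nat -> p != q -> p != q' -> M (rlo r) p <= 0) ->
  q != r :> nat -> q' != r :> nat -> q != q' -> 1 <= M (rlo r) q -> 1 <= M (rlo r) q' ->
  mexp M r (rlo r) = e -> M (rhi r) (rlo r) + 1 = f -> mexp M r q = e' -> M (rhi r) q + 1 = f' ->
  mexp M r q' = e2 -> M (rhi r) q' + 1 = f2 ->
  Er r (tb M) = cf e f *: tb M1 + (cf e' f' *: tb M2 + cf e2 f2 *: tb M3).
Proof.
move=> hM -> -> -> h qr qr' qq hq hq' <- <- <- <- <- <-; rewrite Er_tb // (bigD1 (rlo r)) ?eqxx //=; congr (_ + _).
rewrite (bigD1 q) /= ?hq ?orbT //=; congr (_ + _).
rewrite (big_pred1 q') // => p /=; apply/andP/eqP => [[/andP[/orP[/eqP->|hp] pr] pq]|->].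
- by rewrite eqxx in pr.
- by apply/eqP; apply: contraTT hp => pq'; rewrite int_le0 //; apply: h.
by rewrite hq' orbT [q' == q]eq_sym qq.
Qed.

Lemma la_in la : in_tXi (val (val la)). Proof. exact: valP (val la). Qed.

Lemma la_off la (k l : 'I_N) : k != l :> nat -> val (val la) k l = 0.
Proof. by move=> kl; have /is_diag_mxP -> := valP la. Qed.

Lemma cf1 : cf 0 1 = 1.
Proof. by rewrite /cf expr0z /qint expr1z exprN1 divff ?v_subVneq0 // mulr1. Qed.

Ltac ent := rewrite ?mxDE ?mvN ?la_off /= /bump /= ?add1n.

Lemma E_diag r la : Er r << val la >> = tb (val (val la) + mv r (rlo r)).
Proof.
rewrite -tb_val (@Estep1 r _ _ 0 1 (la_in la) (erefl _)); first by rewrite cf1 scale1r.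
- by move=> p pr; rewrite la_off // eq_sym.
- rewrite mexpE mexp_diag /= ltnn /=; have := ltn_ord r; nlia.
- by rewrite la_off //= /bump /=; nlia.
Qed.

Lemma E_far r s la : (r.+1 < s)%N || (s.+1 < r)%N -> (r + s != n.*2.-1)%N ->
  Er s (Er r << val la >>) = tb (val (val la) + mv r (rlo r) + mv s (rlo s)).
Proof.
move=> rs rs'; rewrite E_diag (@Estep1 s _ _ 0 1 _ (erefl _)); first by rewrite cf1 scale1r.
- by apply: in_tXi_mv; rewrite ?la_in ?eqxx.
- move=> p ps; rewrite mxDE mvN la_off 1?eq_sym //=.
  have := ltn_ord r; have := ltn_ord s; have := ltn_ord p; nlia.
- rewrite mexpE !psum_addmv.
  have := mexp_diag la s (rlo s); have := ltn_ord r; have := ltn_ord s; rewrite /= ltnn; nlia.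
- rewrite mxDE mvN la_off /= /bump /=; first by have := ltn_ord r; have := ltn_ord s; nlia.
  by nlia.
Qed.

Lemma Eth_rev (i j : 'I_N) : Eth (rev_ord i) (rev_ord j) = Eth i j.
Proof. by rewrite /Eth !rev_ordK addrC. Qed.

(** The letters r and 2n-1-r belong to e_i and f_i for the same i: by rotation, a move of one undoes
    a move of the other. *)
Lemma mv_opp r s (p q : 'I_N) : (r + s = n.*2.-1)%N -> (p + q = n.*2)%N -> mv s q = - mv r p.
Proof.
move=> rs pq; have rN := ltn_ord r; have sN := ltn_ord s.
have -> : q = rev_ord p by apply: val_inj; rewrite /= subSS; nlia.
have e1 : rhi s = rev_ord (rlo r) by apply: val_inj; rewrite /= /bump /= subSS; nlia.
have e2 : rlo s = rev_ord (rhi r) by apply: val_inj; rewrite /= /bump /= subSS; nlia.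
by rewrite /mv e1 e2 !Eth_rev opprB.
Qed.

Lemma mvK M r s (p q : 'I_N) : (r + s = n.*2.-1)%N -> (p + q = n.*2)%N -> M + mv r p + mv s q = M.
Proof. by move=> rs pq; rewrite (mv_opp rs pq) addrK. Qed.

End Steps.

(* [lia] cannot cope with many boolean atoms at once: decide them one by one. *)
Ltac dec_atoms := repeat match goal with
  | |- context [@eq_op ?T ?x ?y] =>
      let V := eval hnf in (Equality.sort T) in unify V nat;
      first [ rewrite (_ : @eq_op T x y = false); [|by apply/eqP => ?; nlia]
            | rewrite (_ : @eq_op T x y = true); [|by apply/eqP; nlia] ]
  | |- context [leq ?x ?y] =>
      first [ rewrite (_ : leq x y = false); [|by apply/negbTE; nlia]
            | rewrite (_ : leq x y = true); [|nlia] ]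
  end.
Ltac atoms := rewrite /= ?/bump /= ?add1n; dec_atoms; rewrite ?(andbT, andbF, andTb, andFb) /=; nlia.

Section Steps2.
Variable n : nat.
Local Notation N := (dimN n).
Implicit Types (M : 'M[int]_N) (la : tXi_diag n) (r s : 'I_(n.*2)) (p : 'I_N).

Definition dmexp s (q : nat) r p : int :=
  ((r.+2 == (N - s.+1)%N) && (N - q <= p)%N)%:Z - ((r.+2 == s.+1) && (q < p)%N)%:Z
  - 2 * (((r.+1 == (N - s.+1)%N) && (N - q <= p)%N)%:Z - ((r.+1 == s.+1) && (q < p)%N)%:Z)
  + (((r == (N - s.+1)%N :> nat) && (N - q <= p)%N)%:Z - ((r == s.+1 :> nat) && (q < p)%N)%:Z).
Lemma mexp_addmv M s (q : 'I_N) r p : mexp (M + mv s q) r p = mexp M r p + dmexp s q r p.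
Proof. by rewrite !mexpE !psum_addmv /dmexp; ring. Qed.
Lemma mexp_la la r p : mexp (val (val la)) r p =
  (r.+1 < p)%N%:Z * dg la (rhi r) - (r < p)%N%:Z * dg la (rlo r) + ((r == n :> nat) && (n < p)%N)%:Z.
Proof. by rewrite mexpE mexp_diag. Qed.
Lemma addmvE M r p k l : (M + mv r p) k l = M k l +
  (((k == r.+1 :> nat) && (l == p :> nat))%:Z + ((k == n.*2 - r.+1 :> nat)%N && (l == n.*2 - p :> nat)%N)%:Z
  - ((k == r :> nat) && (l == p :> nat))%:Z - ((k == n.*2 - r :> nat)%N && (l == n.*2 - p :> nat)%N)%:Z).
Proof. by rewrite mxDE mvN. Qed.

End Steps2.

Ltac solve_row := let p := fresh "p" in let pN := fresh "pN" in
  move=> p; have pN := ltn_ord p; rewrite -?val_eqE !addmvE /= /bump /= => *;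
  (rewrite la_off; last by (rewrite /=; nlia)); atoms.
Ltac solve_off := rewrite !addmvE; (rewrite la_off; last by (rewrite /= /bump /=; nlia)); atoms.
Ltac solve_mexp := rewrite !mexp_addmv mexp_la /dmexp; atoms.
Ltac solve_in :=
  repeat match goal with |- is_true (in_tXi (_ + mv _ _)) => apply: in_tXi_mv; last by rewrite eqxx end;
  exact: la_in.

(** In the second summand [s] takes back the unit moved by [r]; it yields the diagonal part of the
    commutator of e_i and f_i. The middle pair, governed by cubic relations, is excluded. *)
Lemma E_opp n (r s : 'I_(n.*2)) (la : tXi_diag n) : (r + s = n.*2.-1)%N -> (r != n.-1 :> nat) -> (r != n :> nat) ->
  Er s (Er r << val la >>) = tb (val (val la) + mv r (rlo r) + mv s (rlo s)) +
    cf (- dg la (rlo s)) (dg la (rlo r)) *: << val la >>.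
Proof.
move=> rs rn rn'; have rN := ltn_ord r; have sN := ltn_ord s.
rewrite E_diag (@Estep2 n s _ (rhi s) _ (val (val la)) 0 1 (- dg la (rlo s)) (dg la (rlo r)) _ (erefl _)).
- by rewrite cf1 scale1r tb_val.
- solve_in.
- by apply: esym; apply: mvK; rewrite /= /bump /=; nlia.
- solve_row.
- by rewrite /= /bump /=; nlia.
- solve_off.
- solve_mexp.
- solve_off.
- solve_mexp.
rewrite addmvE; have -> : val (val la) (rhi s) (rhi s) = dg la (rlo r).
  rewrite -(rot_symE (tXi_rot (val la))); congr (dg la _); apply: val_inj; rewrite /= /bump /=; nlia.
atoms.
Qed.

Lemma cf_1 e : cf e 1 = v ^ e.
Proof. by rewrite /cf /qint expr1z exprN1 divff ?v_subVneq0 // mulr1. Qed.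

Fact qint2_field (F : fieldType) (w : F) : w - w^-1 != 0 -> w != 0 ->
  (w ^+ 2 - w ^- 2) / (w - w^-1) = w + w^-1.
Proof.
move=> h w0; apply: (mulIf h); rewrite divfK //.
by rewrite -exprVn subr_sqr mulrC.
Qed.

Lemma cf_02 : cf 0 2 = v + v^-1.
Proof.
rewrite /cf expr0z mul1r /qint -exprnN -exprnP.
exact: qint2_field v_subVneq0 v_neq0.
Qed.

(** * The relations of U^j on K^j *)

Section Permute.
Variables (V : zmodType) (a b c d : V).
Lemma ac1 : a + b + c = a + c + b. Proof. exact: addrAC. Qed.
Lemma ac2 : a + b + c + c = a + c + c + b.
Proof. by rewrite (addrAC a b) (addrAC (a + c)). Qed.
Lemma ac3 : a + b + d + c = a + b + c + d. Proof. exact: addrAC. Qed.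
End Permute.

Lemma cfM e f : cf e f = v ^ e * cf 0 f.
Proof. by rewrite /cf expr0z mul1r. Qed.

Fact cubic_up (F : fieldType) (V : lmodType F) (w c1 c2 cm1 cm2 : F) (X Y : V) : w != 0 ->
  c1 = 1 -> c2 = w + w^-1 -> cm1 = w ^ (-1) -> cm2 = w ^ (-2) ->
  c1 *: (c2 *: X) + c2 *: (cm2 *: X + c1 *: Y) =
  (w + w^-1) *: (cm1 *: (c2 *: X) + c1 *: (c1 *: Y)).
Proof.
move=> w0 -> -> -> ->; rewrite !scale1r !scalerDr !scalerA addrA -scalerDl; congr (_ *: _ + _).
by rewrite -!invr_expz -!exprnP expr1; field.
Qed.

Lemma E_scale n (r : 'I_(n.*2)) c x x' : Er r x = x' -> Er r (c *: x) = c *: x'.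
Proof. by move=> <-; exact: (lmZ (Er_lm r)). Qed.
Lemma E_comb n (r : 'I_(n.*2)) c x x' y y' : Er r x = x' -> Er r y = y' ->
  Er r (c *: x + y) = c *: x' + y'.
Proof. by move=> <- <-; exact: Er_lm. Qed.
Lemma cubic_trans (R : pzRingType) (V : lmodType R) (c : R) (x y z x' y' z' : V) : x = x' -> y = y' -> z = z' ->
  x' + y' = c *: z' -> x + y = c *: z.
Proof. by move=> -> -> ->. Qed.

Section Up.
Variable n : nat.
Local Notation N := (dimN n).
Variables (r s : 'I_(n.*2)) (la : tXi_diag n).
Hypotheses (es : s = r.+1 :> nat) (rs : (r + s)%N != n.*2.-1).
Let rN := ltn_ord r.
Let sN := ltn_ord s.
Local Notation L := (val (val la)).
Local Notation R := (mv r (rlo r)).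
Local Notation S := (mv s (rlo s)).
Local Notation Y := (mv s (rlo r)).

Lemma up_r_s : Er r (tb (L + S)) = cf 0 1 *: tb (L + S + R).
Proof. by apply: Estep1; [solve_in| |solve_row|solve_mexp|solve_off]. Qed.
Lemma up_r_sr : Er r (tb (L + S + R)) = cf 0 2 *: tb (L + S + R + R).
Proof. by apply: Estep1; [solve_in| |solve_row|solve_mexp|solve_off]. Qed.
Lemma up_r_r : Er r (tb (L + R)) = cf 0 2 *: tb (L + R + R).
Proof. by apply: Estep1; [solve_in| |solve_row|solve_mexp|solve_off]. Qed.
Lemma up_s_rr : Er s (tb (L + R + R)) = cf (-2) 1 *: tb (L + S + R + R) + cf 0 1 *: tb (L + R + Y + R).
Proof.
by apply: Estep2; [solve_in|exact: ac2|exact: ac3|solve_row|rewrite /=; nlia|solve_off|solve_mexp|solve_off|solve_mexp|solve_off].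
Qed.
Lemma up_s_r : Er s (tb (L + R)) = cf (-1) 1 *: tb (L + S + R) + cf 0 1 *: tb (L + R + Y).
Proof.
by apply: Estep2; [solve_in|exact: ac1|exact: erefl|solve_row|rewrite /=; nlia|solve_off|solve_mexp|solve_off|solve_mexp|solve_off].
Qed.
Lemma up_r_ry : Er r (tb (L + R + Y)) = cf 0 1 *: tb (L + R + Y + R).
Proof.
have h : 1 <= (L + R) (rlo s) (rlo r) by solve_off.
by apply: Estep1; [apply: in_tXi_mv; [solve_in|by rewrite h orbT]| |solve_row|solve_mexp|solve_off].
Qed.

(** A Serre relation away from the middle. The letter [s] may carry on a unit placed by [r], which
    produces the terms with [Y]. *)
Lemma up_cubic : Er r (Er r (Er s << val la >>)) + Er s (Er r (Er r << val la >>)) =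
  (v + v^-1) *: Er r (Er s (Er r << val la >>)).
Proof.
apply: cubic_trans.
- rewrite E_diag up_r_s; exact: E_scale up_r_sr.
- rewrite E_diag up_r_r; exact: E_scale up_s_rr.
- rewrite E_diag up_s_r; exact: E_comb up_r_sr (E_scale _ up_r_ry).
exact: cubic_up v_neq0 cf1 cf_02 (cf_1 _) (cf_1 _).
Qed.
End Up.

Fact cubic_down (F : fieldType) (V : lmodType F) (w : F) (X Y : V) : w != 0 -> let q := w + w^-1 in
  w ^ (-1) *: (w ^ (-1) *: (q *: X) + Y) + w *: Y + q *: X = q *: (w ^ (-1) *: (q *: X) + Y).
Proof.
move=> w0 q; rewrite !scalerDr !scalerA -addrA [w *: Y + _]addrC addrACA -!scalerDl.
by congr (_ *: _ + _ *: _); rewrite -!invr_expz -!exprnP expr1 /q; field.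
Qed.

Section Down.
Variable n : nat.
Local Notation N := (dimN n).
Variables (r s : 'I_(n.*2)) (la : tXi_diag n).
Hypotheses (es : r = s.+1 :> nat) (rs : (r + s)%N != n.*2.-1).
Let rN := ltn_ord r.
Let sN := ltn_ord s.
Local Notation L := (val (val la)).
Local Notation R := (mv r (rlo r)).
Local Notation S := (mv s (rlo s)).
Local Notation Y := (mv r (rlo s)).

Lemma dn_r_s : Er r (tb (L + S)) = cf (-1) 1 *: tb (L + S + R) + cf 0 1 *: tb (L + S + Y).
Proof.
by apply: Estep2; [solve_in|exact: erefl|exact: erefl|solve_row|rewrite /=; nlia|solve_off|solve_mexp|solve_off|solve_mexp|solve_off].
Qed.
Lemma dn_r_sr : Er r (tb (L + S + R)) = cf (-1) 2 *: tb (L + S + R + R) + cf 0 1 *: tb (L + S + R + Y).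
Proof.
by apply: Estep2; [solve_in|exact: erefl|exact: erefl|solve_row|rewrite /=; nlia|solve_off|solve_mexp|solve_off|solve_mexp|solve_off].
Qed.
Lemma dn_r_sy : Er r (tb (L + S + Y)) = cf 1 1 *: tb (L + S + R + Y).
Proof.
have h : 1 <= (L + S) (rlo r) (rlo s) by solve_off.
by apply: Estep1; [apply: in_tXi_mv; [solve_in|by rewrite h orbT]|exact: ac3|solve_row|solve_mexp|solve_off].
Qed.
Lemma dn_r_r : Er r (tb (L + R)) = cf 0 2 *: tb (L + R + R).
Proof. by apply: Estep1; [solve_in| |solve_row|solve_mexp|solve_off]. Qed.
Lemma dn_s_rr : Er s (tb (L + R + R)) = cf 0 1 *: tb (L + S + R + R).
Proof. by apply: Estep1; [solve_in|exact: ac2|solve_row|solve_mexp|solve_off]. Qed.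
Lemma dn_s_r : Er s (tb (L + R)) = cf 0 1 *: tb (L + S + R).
Proof. by apply: Estep1; [solve_in|exact: ac1|solve_row|solve_mexp|solve_off]. Qed.

(** The companion of [up_cubic]: here [r] carries on the unit placed by [s], so the order in which
    the letters act decides which expansions acquire a second term. *)
Lemma dn_cubic : Er r (Er r (Er s << val la >>)) + Er s (Er r (Er r << val la >>)) =
  (v + v^-1) *: Er r (Er s (Er r << val la >>)).
Proof.
apply: cubic_trans.
- rewrite E_diag dn_r_s; exact: E_comb dn_r_sr (E_scale _ dn_r_sy).
- rewrite E_diag dn_r_r; exact: E_scale dn_s_rr.
- rewrite E_diag dn_s_r; exact: E_scale dn_r_sr.
rewrite (cfM (-1) 2) !cf_1 cf_02 !expr0z !scale1r expr1z -!(scalerA (v ^ (-1))).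
exact: cubic_down v_neq0.
Qed.
End Down.

Fact ac4 (V : zmodType) (a b c d : V) : a + b + c + d = a + c + d + b.
Proof. by rewrite (addrAC a b) (addrAC (a + c)). Qed.

Section MiddleScalars.
Variables (F : fieldType) (w : F) (a b : int).
Hypotheses (w0 : w != 0) (h : w - w^-1 != 0).
(** [cf] over an abstract field, for the scalar identities of the middle relations. *)
Definition cfF (e f : int) : F := w ^ e * ((w ^ f - w ^ (- f)) / (w - w^-1)).

Fact w2_neq1 : w * w - 1 != 0.
Proof. by apply: contraNneq h => e; rewrite -(mulKf w0 (w - w^-1)) mulrBr divff // e mulr0. Qed.

Fact midA_id : cfF 0 1 * cfF (2 - a) (b - 1) + cfF (- a) (b - 1) + cfF 0 2 * cfF (-1 - b) (a - 1) =
  (w + w^-1) * (cfF (-1) 1 * cfF (2 - a) (b - 1) + (cfF 0 1 * cfF (b - a + 1) 1 + cfF (- b) a)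
    - (w ^ (1 - a + b) + w ^ (-1 + a - b))).
Proof.
have x0 : w ^ a != 0 by rewrite expfz_neq0.
have y0 : w ^ b != 0 by rewrite expfz_neq0.
rewrite /cfF !opprD !opprK !expfzDr // -!invr_expz -!exprnP expr1 expr0.
move: (w ^ a) (w ^ b) x0 y0 => x y x0 y0.
by field; rewrite w2_neq1 x0 y0 w0.
Qed.

Fact midB_id : cfF (-1) 1 * cfF (3 - b) a + cfF (- b) a + cfF 0 2 * cfF (- a) (b - 3) =
  (w + w^-1) * (cfF 0 1 * cfF (3 - b) a + cfF (- a) (b - 1) - (w ^ (b - a - 2) + w ^ (a - b + 2))).
Proof.
have x0 : w ^ a != 0 by rewrite expfz_neq0.
have y0 : w ^ b != 0 by rewrite expfz_neq0.
rewrite /cfF !opprD !opprK !expfzDr // -!invr_expz -!exprnP expr1 expr0.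
move: (w ^ a) (w ^ b) x0 y0 => x y x0 y0.
by field; rewrite w2_neq1 x0 y0 w0.
Qed.
End MiddleScalars.

Fact lincomb3 (F : fieldType) (V : lmodType F) (X Y Z : V) : exists lc : F -> F -> F -> V,
  [/\ X = lc 1 0 0, Y = lc 0 1 0, Z = lc 0 0 1,
    forall x y z x' y' z', lc x y z + lc x' y' z' = lc (x + x') (y + y') (z + z') &
    forall k x y z, k *: lc x y z = lc (k * x) (k * y) (k * z)].
Proof.
exists (fun x y z => x *: X + y *: Y + z *: Z); split=> *; rewrite ?scale0r ?scale1r ?addr0 ?add0r //.
  by rewrite addrACA [X in X + _]addrACA -!scalerDl.
by rewrite !scalerDr !scalerA.
Qed.
Fact lincomb3N (F : fieldType) (V : lmodType F) (lc : F -> F -> F -> V) :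
  (forall k x y z, k *: lc x y z = lc (k * x) (k * y) (k * z)) ->
  forall x y z, - lc x y z = lc (- x) (- y) (- z).
Proof. by move=> h x y z; rewrite -scaleN1r h !mulN1r. Qed.

Fact mid_lmod (F : fieldType) (V : lmodType F) (w c1 c2 cm1 cm2 p q t u k tau : F) (X Y Z : V) :
  w != 0 -> c1 = 1 -> c2 = w + w^-1 -> cm1 = w ^ (-1) -> cm2 = w ^ (-2) ->
  c1 * p + q + c2 * t = (w + w^-1) * (cm1 * p + (c1 * u + k) - tau) ->
  c1 *: (c2 *: X + p *: Z) + q *: Z + c2 *: (cm2 *: X + (c1 *: Y + t *: Z)) =
  (w + w^-1) *: (cm1 *: (c2 *: X + p *: Z) + (c1 *: (c1 *: Y + u *: Z) + k *: Z) - tau *: Z).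
Proof.
move=> w0 -> -> -> -> e; have [lc [hX hY hZ hD hS]] := lincomb3 X Y Z; have hN := lincomb3N hS.
rewrite hX hY hZ !(hN, hS, hD) !mulr0 !mulr1 !addr0 !add0r.
congr (lc _ _ _); first by rewrite -!invr_expz -!exprnP expr1; field.
  ring.
exact: e.
Qed.

Fact midB_lmod (F : fieldType) (V : lmodType F) (w c1 c2 cm1 cm2 p k q u tau cp : F) (X Y Z : V) :
  w != 0 -> c1 = 1 -> c2 = w + w^-1 -> cm1 = w ^ (-1) -> cm2 = w ^ (-1) * c2 -> cp = w ^ 1 ->
  cm1 * p + k + c2 * q = (w + w^-1) * (c1 * p + u - tau) ->
  cm1 *: (cm2 *: X + (c1 *: Y + p *: Z)) + (c1 *: (cp *: Y) + k *: Z) + c2 *: (c1 *: X + q *: Z) =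
  (w + w^-1) *: (c1 *: (cm2 *: X + (c1 *: Y + p *: Z)) + u *: Z - tau *: Z).
Proof.
move=> w0 -> -> -> -> -> e; have [lc [hX hY hZ hD hS]] := lincomb3 X Y Z; have hN := lincomb3N hS.
rewrite hX hY hZ !(hN, hS, hD) !mulr0 !mulr1 !addr0 !add0r.
congr (lc _ _ _).
- by rewrite -!invr_expz -!exprnP expr1; field.
- by rewrite -!invr_expz -!exprnP expr1; field.
exact: e.
Qed.

Section Middle.
Variable n : nat.
Local Notation N := (dimN n).
Variables (r s : 'I_(n.*2)) (la : tXi_diag n).
Hypotheses (er : r.+1 = n :> nat) (es : s = n :> nat).
Let rN := ltn_ord r.
Let sN := ltn_ord s.
Local Notation L := (val (val la)).
Local Notation R := (mv r (rlo r)).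
Local Notation S := (mv s (rlo s)).
Local Notation Y := (mv s (rlo r)).
Local Notation a := (dg la (rlo r)).
Local Notation b := (dg la (rlo s)).

Fact rs_eq : (r + s = n.*2.-1)%N. Proof. nlia. Qed.
Fact dg_hi_r : dg la (rhi r) = b.
Proof. by congr (dg la _); apply: ord_inj; rewrite /= /bump /=; nlia. Qed.
Fact dg_hi_s : dg la (rhi s) = a.
Proof.
rewrite /dg -(rot_symE (tXi_rot (val la))); congr (dg la _); apply: val_inj; rewrite /= /bump /= subSS; nlia.
Qed.
Fact dgE_n : L (rhi r) (rlo s) = b.
Proof.
have e : rlo s = rhi r by apply: ord_inj; rewrite /= /bump /=; nlia.
by rewrite e; congr (dg la _).
Qed.
Fact dgE_P : L (rhi s) (rhi s) = a. Proof. exact: dg_hi_s. Qed.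

Fact cancel_S (M : 'M[int]_N) : M = M + S + mv r (rlo s).
Proof. by apply: esym; apply: mvK; [rewrite addnC rs_eq|rewrite /=; nlia]. Qed.
Fact cancel_R (M : 'M[int]_N) : M = M + R + mv s (rhi s).
Proof. by apply: esym; apply: mvK; [rewrite rs_eq|rewrite /= /bump /=; nlia]. Qed.
Fact cancel_Y (M : 'M[int]_N) : M = M + Y + mv r (rhi s).
Proof. by apply: esym; apply: mvK; [rewrite addnC rs_eq|rewrite /= /bump /=; nlia]. Qed.

Ltac solve_diag e := rewrite !addmvE e; atoms.
Ltac solve_mexpd := rewrite !mexp_addmv mexp_la ?dg_hi_r ?dg_hi_s /dmexp; atoms.
Ltac solve_ne := rewrite -?val_eqE /= /bump /=; nlia.

Lemma mid_r_s : Er r (tb (L + S)) = cf 0 1 *: tb (L + S + R) + cf (- a) (b - 1) *: tb L.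
Proof.
by apply: Estep2; [solve_in|exact: erefl|exact: cancel_S|solve_row|solve_ne|solve_off|solve_mexpd|solve_off|solve_mexpd|solve_diag dgE_n].
Qed.
Lemma mid_r_sr : Er r (tb (L + S + R)) = cf 0 2 *: tb (L + S + R + R) + cf (2 - a) (b - 1) *: tb (L + R).
Proof.
by apply: Estep2; [solve_in|exact: erefl|rewrite (addrAC L S); exact: cancel_S|solve_row|solve_ne|solve_off|solve_mexpd|solve_off|solve_mexpd|solve_diag dgE_n].
Qed.
Lemma mid_r_r : Er r (tb (L + R)) = cf 0 2 *: tb (L + R + R).
Proof. by apply: Estep1; [solve_in| |solve_row|solve_mexpd|solve_off]. Qed.
Lemma mid_s_rr : Er s (tb (L + R + R)) = cf (-2) 1 *: tb (L + S + R + R) +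
  (cf 0 1 *: tb (L + R + Y + R) + cf (-1 - b) (a - 1) *: tb (L + R)).
Proof.
by apply: Estep3; [solve_in|exact: ac2|exact: ac3|exact: cancel_R|solve_row|solve_ne|solve_ne|solve_ne|
  solve_off|solve_off|solve_mexpd|solve_off|solve_mexpd|solve_off|solve_mexpd|solve_diag dgE_P].
Qed.
Lemma mid_s_r : Er s (tb (L + R)) = cf (-1) 1 *: tb (L + S + R) +
  (cf 0 1 *: tb (L + R + Y) + cf (- b) a *: tb L).
Proof.
by apply: Estep3; [solve_in|exact: ac1|exact: erefl|exact: cancel_R|solve_row|solve_ne|solve_ne|solve_ne|
  solve_off|solve_off|solve_mexpd|solve_off|solve_mexpd|solve_off|solve_mexpd|solve_diag dgE_P].
Qed.
Fact ry_in : in_tXi (L + R + Y).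
Proof.
have h : 1 <= (L + R) (rlo s) (rlo r) by solve_off.
by apply: in_tXi_mv; [solve_in|rewrite h orbT].
Qed.
Lemma mid_r_ry : Er r (tb (L + R + Y)) = cf 0 1 *: tb (L + R + Y + R) + cf (b - a + 1) 1 *: tb (L + R).
Proof.
by apply: Estep2; [exact: ry_in|exact: erefl|exact: cancel_Y|solve_row|solve_ne|solve_off|solve_mexpd|solve_off|solve_mexpd|solve_off].
Qed.
Lemma mid_s_sr : Er s (tb (L + S + R)) = cf (-1) 2 *: tb (L + R + S + S) +
  (cf 0 1 *: tb (L + S + R + Y) + cf (3 - b) a *: tb (L + S)).
Proof.
by apply: Estep3; [solve_in|rewrite (addrAC L S); exact: erefl|exact: erefl|exact: cancel_R|solve_row|solve_ne|solve_ne|solve_ne|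
  solve_off|solve_off|solve_mexpd|solve_off|solve_mexpd|solve_off|solve_mexpd|solve_diag dgE_P].
Qed.
Lemma mid_s_ry : Er s (tb (L + R + Y)) = cf 1 1 *: tb (L + S + R + Y).
Proof.
by apply: Estep1; [exact: ry_in|exact: ac4|solve_row|solve_mexpd|solve_off].
Qed.
Lemma mid_s_s : Er s (tb (L + S)) = cf 0 2 *: tb (L + S + S).
Proof. by apply: Estep1; [solve_in| |solve_row|solve_mexpd|solve_off]. Qed.
Lemma mid_r_ss : Er r (tb (L + S + S)) = cf 0 1 *: tb (L + R + S + S) + cf (- a) (b - 3) *: tb (L + S).
Proof.
by apply: Estep2; [solve_in|rewrite (addrAC L R) (addrAC (L + S)); exact: erefl|exact: cancel_S|solve_row|solve_ne|solve_off|solve_mexpd|solve_off|solve_mexpd|solve_diag dgE_n].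
Qed.

Fact r_L : Er r (tb L) = tb (L + R). Proof. by rewrite tb_val; exact: E_diag. Qed.
Fact s_L : Er s (tb L) = tb (L + S). Proof. by rewrite tb_val; exact: E_diag. Qed.

Fact cubic_mid_trans (V : lmodType Qv) (c t : Qv) (x y z u x' y' z' u' : V) : x = x' -> y = y' -> z = z' -> u = u' ->
  x' + y' = c *: (z' - t *: u') -> x + y = c *: (z - t *: u).
Proof. by move=> -> -> -> ->. Qed.

(** Each of the two middle letters can take back a unit moved by the other, which adds a third kind
    of term to the Serre computation; by [midA_id] these terms add up to the correction. *)
Lemma midA : Er r (Er r (Er s << val la >>)) + Er s (Er r (Er r << val la >>)) =
  (v + v^-1) *: (Er r (Er s (Er r << val la >>)) - (v ^ (1 - a + b) + v ^ (-1 + a - b)) *: Er r << val la >>).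
Proof.
apply: cubic_mid_trans.
- rewrite E_diag mid_r_s; exact: E_comb mid_r_sr (E_scale _ r_L).
- rewrite E_diag mid_r_r; exact: E_scale mid_s_rr.
- rewrite E_diag mid_s_r; exact: E_comb mid_r_sr (E_comb _ mid_r_ry (E_scale _ r_L)).
- exact: E_diag.
apply: (mid_lmod _ _ _ v_neq0 cf1 cf_02 (cf_1 _) (cf_1 _)); exact: midA_id v_neq0 v_subVneq0.
Qed.

(** The correction is taken at the weight reached after [s] has acted: [a] has grown by 1 and the
    central entry [b] has lost 2, hence the exponents. *)
Lemma midB : Er s (Er s (Er r << val la >>)) + Er r (Er s (Er s << val la >>)) =
  (v + v^-1) *: (Er s (Er r (Er s << val la >>)) - (v ^ (b - a - 2) + v ^ (a - b + 2)) *: Er s << val la >>).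
Proof.
apply: cubic_mid_trans.
- rewrite E_diag mid_s_r; exact: E_comb mid_s_sr (E_comb _ mid_s_ry (E_scale _ s_L)).
- rewrite E_diag mid_s_s; exact: E_scale mid_r_ss.
- rewrite E_diag mid_r_s; exact: E_comb mid_s_sr (E_scale _ s_L).
- exact: E_diag.
apply: (midB_lmod _ _ _ v_neq0 cf1 cf_02 (cf_1 _) (cfM _ _) (cf_1 _)); exact: midB_id v_neq0 v_subVneq0.
Qed.
End Middle.

Section RowEntries.
Variable n : nat.
Local Notation N := (dimN n).
Implicit Types (la : tXi_diag n) (r : 'I_(n.*2)) (a : 'I_n.+1) (i : 'I_n).

Lemma diag_ent_dg la a : diag_ent la a = dg la (inord a). Proof. by []. Qed.

Fact inord_val a : (inord a : 'I_N) = a :> nat.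
Proof. by rewrite inordN // -ltnS. Qed.

Lemma diag_ent_ro (A : tXi n) a : diag_ent (ro A) a = psum (val A) a.+1 N - psum (val A) a N.
Proof.
have aN : (inord a : 'I_N) = a :> nat := inord_val a.
have an : (a <= N)%N by rewrite -aN ltnW // ltn_ord.
have an1 : (a < N)%N by rewrite -aN ltn_ord.
rewrite -(psum_ro A an) -(psum_ro A an1) -aN psum_row addrC addKr (bigD1 (inord a)) //=.
rewrite big1 ?addr0 // => j ja; have /is_diag_mxP -> // := valP (ro A).
by apply: contraNneq ja => e; apply/eqP/ord_inj.
Qed.

Definition mvw r a : int := ((a.+1 == n.*2 - r)%N)%:Z - (a == r :> nat)%:Z - (a == n.*2 - r :> nat)%N%:Z + (a == r.+1 :> nat)%:Z.

Lemma diag_ent_mv (A B : tXi n) r p a : val B = val A + mv r p ->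
  diag_ent (ro B) a = diag_ent (ro A) a + mvw r a.
Proof.
move=> e; rewrite !diag_ent_ro e !psum_addmv /mvw.
have := ltn_ord p; have := ltn_ord a; have := ltn_ord r; move: (psum _ _ _) (psum _ _ _) => x y.
move=> h1 h2 h3; have -> : (N - p <= N)%N by rewrite leq_subr.
by rewrite h3 !andbT !subSS eqSS; ring.
Qed.

Definition eix i : 'I_(n.*2) := widen_ord (leq_trans (leq_addr n n) (eq_leq (addnn n))) i.
Definition fix_ i : 'I_(n.*2) := rev_ord (eix i).

Lemma dgo_comp c c' x : dgo c (dgo c' x) = dgo (fun la : tXi_diag n => c' la * c la) x.
Proof.
move: x; apply: lm_ext => [||A]; [exact: lm_comp (dgo_lm c) (dgo_lm c')|exact: dgo_lm|].
by rewrite !dgo1 (lmZ (dgo_lm c)) dgo1 scalerA.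
Qed.

Lemma dgo_la c la : dgo c << val la >> = c la *: << val la >>.
Proof. by rewrite dgo1 ro_diag. Qed.

Lemma E_weight r la : exists la' : tXi_diag n, (forall a, diag_ent la' a = diag_ent la a + mvw r a) /\
  forall c, dgo c (Er r << val la >>) = c la' *: Er r << val la >>.
Proof.
have h : in_tXi (val (val la) + mv r (rlo r)) by solve_in.
pose B : tXi n := exist (fun M => is_true (in_tXi M)) _ h.
have eB : Er r << val la >> = << B >> by rewrite E_diag -tb_val.
exists (ro B); split=> [a|c]; first by rewrite (@diag_ent_mv (val la) B r (rlo r)) ?ro_diag.
by apply: (etrans (congr1 (dgo c) eB) (etrans (dgo1 c B) (congr1 _ (esym eB)))).
Qed.
End RowEntries.

Fact T_scalar (F : fieldType) (V : lmodType F) (w : F) (x y : int) (z : V) : w != 0 ->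
  w *: ((w ^ y * w ^ (- x)) *: z) + w^-1 *: ((w ^ (- y) * w ^ x) *: z) =
  (w ^ (1 - x + y) + w ^ (-1 + x - y)) *: z.
Proof.
move=> w0; rewrite !scalerA -scalerDl !expfzDr // exprN1 expr1z; congr (_ *: _).
by ring.
Qed.

Fact Uef_scalar (F : fieldType) (V : lmodType F) (w : F) (x y : int) (X z : V) : w != 0 ->
  X + (w ^ (- x) * ((w ^ y - w ^ (- y)) / (w - w^-1))) *: z -
  (X + (w ^ (- y) * ((w ^ x - w ^ (- x)) / (w - w^-1))) *: z) =
  (w - w^-1)^-1 *: ((w ^ y * w ^ (- x)) *: z - (w ^ (- y) * w ^ x) *: z).
Proof.
move=> w0; rewrite opprD addrACA subrr add0r -!scalerBl scalerA; congr (_ *: _).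
by ring.
Qed.

Section UrelAct.
Variables (n : nat) (A : lalgType Qv) (e f : 'I_n -> A) (d dV : 'I_n.+1 -> A).
Variable act : A -> QKj n -> QKj n.
Hypothesis aM : forall x y z, act (x * y) z = act x (act y z).
Hypothesis aL : forall z, lin_map (act^~ z).
Hypothesis a1 : forall z, act 1 z = z.
Hypothesis ae : forall i z, act (e i) z = Er (eix i) z.
Hypothesis af : forall i z, act (f i) z = Er (fix_ i) z.
Hypothesis ad : forall a z, act (d a) z = dgo (fun la => v ^ (- diag_ent la a)) z.
Hypothesis adV : forall a z, act (dV a) z = dgo (fun la => v ^ diag_ent la a) z.

Let aD x y z : act (x + y) z = act x z + act y z. Proof. exact: (lmD (aL z)). Qed.
Let aB x y z : act (x - y) z = act x z - act y z. Proof. exact: (lmB (aL z)). Qed.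
Let aZ c x z : act (c *: x) z = c *: act x z. Proof. exact: (lmZ (aL z)). Qed.
Let a0 z : act 0 z = 0. Proof. exact: (lm0 (aL z)). Qed.

Let lo i : 'I_n.+1 := widen_ord (leqnSn n) i.
Let hi i : 'I_n.+1 := lift ord0 i.

Fact dg_eix (la : tXi_diag n) i : dg la (rlo (eix i)) = diag_ent la (lo i).
Proof. by rewrite diag_ent_dg; congr (dg la _); apply: ord_inj; rewrite inord_val. Qed.
Fact dg_fix (la : tXi_diag n) i : dg la (rlo (fix_ i)) = diag_ent la (hi i).
Proof.
rewrite diag_ent_dg {1}/dg -(rot_symE (tXi_rot (val la))); congr (dg la _).
by apply: ord_inj; rewrite inord_val /= /bump /= !subSS; have := ltn_ord i; nlia.
Qed.

Lemma T_act i z : act (v *: (d (lo i) * dV (hi i)) + v^-1 *: (dV (lo i) * d (hi i))) z =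
  dgo (fun la => v ^ (1 - diag_ent la (lo i) + diag_ent la (hi i)) + v ^ (-1 + diag_ent la (lo i) - diag_ent la (hi i))) z.
Proof.
rewrite aD !aZ !aM !ad !adV !dgo_comp.
move: z; apply: lm_ext => [||C].
- by apply: lm_add; apply: (lm_comp (lm_scale _)); exact: dgo_lm.
- exact: dgo_lm.
rewrite dgo1 (dgo1 _ C) (dgo1 _ C); exact: T_scalar v_neq0.
Qed.

(** The commutation relations follow from [E_far] and [E_opp], the Serre relations from [up_cubic]
    and [dn_cubic], whose roles are exchanged for the f_i because their letters run backwards, and
    the two middle relations from [midB] and [midA]. *)
Lemma Urel_act l r (la : tXi_diag n) : Urel e f d dV l r -> act l << val la >> = act r << val la >>.
Proof.
case=> [a|a|a b|a j|a j|i j nij|i j ij|i j ij|i j ij|i j ij|i ni|i ni].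
- rewrite aM a1 ad adV dgo_comp dgo_la -expfzDr ?v_neq0 // subrr expr0z scale1r //.
- rewrite aM a1 ad adV dgo_comp dgo_la -expfzDr ?v_neq0 // addNr expr0z scale1r //.
- rewrite !aM !ad !dgo_comp !dgo_la mulrC //.
- rewrite !aM aZ !ad !adV !ae dgo_la (lmZ (Er_lm _)) (lmZ (dgo_lm _)).
  have [la' [hla ->]] := E_weight (eix j) la; rewrite scalerA; apply: (congr1 (fun c => c *: _)).
  rewrite -expfzDr ?v_neq0 //; congr (v ^ _); rewrite hla /mvw /wt_e /=.
  have := ltn_ord a; have := ltn_ord j; move: (diag_ent la a) => x; nlia.
- rewrite !aM aZ !ad !adV !af dgo_la (lmZ (Er_lm _)) (lmZ (dgo_lm _)).
  have [la' [hla ->]] := E_weight (fix_ j) la; rewrite scalerA; apply: (congr1 (fun c => c *: _)).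
  rewrite -expfzDr ?v_neq0 //; congr (v ^ _); rewrite hla /mvw /wt_f /=.
  have := ltn_ord a; have := ltn_ord j; move: (diag_ent la a) => x; nlia.
- have iN := ltn_ord i; have jN := ltn_ord j; case: eqVneq nij => [<-|ij] /= nij; last first.
    rewrite a0 aB !aM !ae !af; apply/eqP; rewrite subr_eq0; apply/eqP.
    have ij' : i != j :> nat by apply: contraNneq ij => h; apply/eqP/ord_inj.
    rewrite !E_far; try (rewrite /= ?subSS; nlia).
    by rewrite addrAC.
  rewrite aZ !aB !aM !ae !af.
  rewrite !E_opp; try (rewrite /= ?subSS; nlia).
  rewrite !ad !adV !dgo_comp !dgo_la dg_eix dg_fix [_ + mv (fix_ i) _ + _]addrAC.
  exact: Uef_scalar v_neq0.
- rewrite expr2 aD aZ !aM !ae; move: ij; rewrite /adj_idx => /orP[/eqP ij|/eqP ij].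
    by apply: up_cubic; rewrite /=; have := ltn_ord j; nlia.
  by apply: dn_cubic; rewrite /=; have := ltn_ord i; nlia.
- rewrite expr2 aD aZ !aM !af; move: ij; rewrite /adj_idx => /orP[/eqP ij|/eqP ij].
    by apply: dn_cubic; rewrite /= ?subSS; have := ltn_ord j; nlia.
  by apply: up_cubic; rewrite /= ?subSS; have := ltn_ord i; nlia.
- rewrite !aM !ae !E_far; try (move: ij; rewrite /far_idx /=; have := ltn_ord i; have := ltn_ord j; nlia).
  by rewrite addrAC.
- rewrite !aM !af !E_far; try (move: ij; rewrite /far_idx /= ?subSS; have := ltn_ord i; have := ltn_ord j; nlia).
  by rewrite addrAC.
- rewrite expr2 aD aZ aB !aM T_act !ae !af.
  apply: etrans (@midB n (eix i) (fix_ i) la _ _) _; try (rewrite /= ?subSS; nlia).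
  (* The torus element stands to the left of f_n here, so it is evaluated at the weight [la']. *)
  have [la' [hla ->]] := E_weight (fix_ i) la; rewrite dg_eix dg_fix !hla.
  apply: (congr1 (fun c => _ *: (_ - c *: _))).
  rewrite /mvw /= /bump /= ?subSS; move: (diag_ent _ _) (diag_ent _ _) => x y.
  by congr (v ^ _ + v ^ _); nlia.
- rewrite expr2 aD aZ aB !aM T_act !ae !af.
  apply: etrans (@midA n (eix i) (fix_ i) la _ _) _; try (rewrite /= ?subSS; nlia).
  by rewrite dgo_la (lmZ (Er_lm _)) dg_eix dg_fix.
Qed.
End UrelAct.

(** * The map aleph *)

Section FreeAction.
Variable n : nat.
Local Notation N := (dimN n).
Local Notation W := {fmonom gen n}.

Definition opg (g : gen n) : QKj n -> QKj n :=
  match g with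
  | ge i => Er (eix i)
  | gf i => Er (fix_ i)
  | gd a => dgo (fun la => v ^ (- diag_ent la a))
  | gdV a => dgo (fun la => v ^ diag_ent la a)
  end.

Lemma rlin_opg g : rlin (opg g).
Proof. by case: g => i; [exact: rlin_Er|exact: rlin_Er|exact: rlin_dgo|exact: rlin_dgo]. Qed.

Definition actw (s : seq (gen n)) (z : QKj n) : QKj n := foldr opg z s.
Lemma rlin_actw s : rlin (actw s).
Proof. elim: s => [|g s IH]; [exact: rlin_id|exact: rlin_comp (rlin_opg g) IH]. Qed.

Definition act : Ufree n -> QKj n -> QKj n :=
  locked (fun x z => lin (fun m : W => actw m z) x).

Lemma act_lm z : lin_map (act^~ z).
Proof. by rewrite /act -lock; exact: lin_lm. Qed.
Lemma act_word (m : W) z : act << m >> z = actw m z.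
Proof. by rewrite /act -lock lin1. Qed.
Lemma act_gen g z : act (Ugen g) z = opg g z.
Proof. by rewrite /Ugen act_word fmuE. Qed.
Lemma act_1 z : act 1 z = z.
Proof. by rewrite free_1 act_word fm1. Qed.
Lemma actM x y z : act (x * y) z = act x (act y z).
Proof.
apply: (lm_ext (F := fun x => act (x * y) z) (G := fun x => act x (act y z))) => [a u w||m].
- by rewrite mulrDl -scalerAl act_lm.
- exact: act_lm.
apply: (lm_ext (F := fun y => act (<< m >> * y) z) (G := fun y => act << m >> (act y z))) => [a u w|a u w|m'].
- by rewrite mulrDr -Ufree_scalerAr act_lm.
- by rewrite act_lm !act_word; exact: (rlin_actw m).1.
by rewrite free_mulUU !act_word fmM /actw foldr_cat.
Qed.

Lemma act_rlin x : rlin (act x).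
Proof.
split=> [a y z|y z].
  apply: (lm_ext (F := fun x => act x (a *: y + z)) (G := fun x => a *: act x y + act x z)) => [||m].
  - exact: act_lm.
  - exact: lm_add (lm_comp (lm_scale a) (act_lm y)) (act_lm z).
  by rewrite !act_word; exact: (rlin_actw m).1.
apply: (lm_ext (F := fun x => act x (Qstar y z)) (G := fun x => Qstar (act x y) z)) => [||m].
- exact: act_lm.
- exact: lm_comp (bop_lml z (@Qstar_bilinear n)) (act_lm y).
by rewrite !act_word; exact: (rlin_actw m).2.
Qed.

(** Both sides of a relation act by operators that commute with right multiplication, so [Urel_act]
    on diagonal matrices suffices. *)
Lemma act_ideal x : Uj_ideal x -> forall z, act x z = 0.
Proof.
elim=> [z|x' y l r w _ IH h z]; first exact: (lm0 (act_lm z)).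
rewrite (lmD (act_lm z)) IH add0r !actM.
suff -> : act (l - r) (act w z) = 0 by exact: lm0 (act_rlin y).1.
rewrite (lmB (act_lm _)); apply/eqP; rewrite subr_eq0; apply/eqP.
apply: (rlin_eq (act_rlin l) (act_rlin r)) => la.
exact: (@Urel_act n (Ufree n) _ _ _ _ act actM act_lm act_1 (fun i => act_gen (ge i)) (fun i => act_gen (gf i))
  (fun a => act_gen (gd a)) (fun a => act_gen (gdV a)) l r la h).
Qed.

Definition actU (x : Uj n) (z : QKj n) : QKj n := act (repr x) z.

Lemma actU_pi x z : actU (Uj_pi x) z = act x z.
Proof.
apply/eqP; rewrite -subr_eq0 -(lmB (act_lm z)); apply/eqP/act_ideal.
by apply/Uj_pi_eq; exact: quotl_piP.
Qed.

Lemma Uj_piP (q : Uj n) : exists x, q = Uj_pi x.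
Proof. by exists (repr q); rewrite /Uj_pi quotl_piP. Qed.

Fact Uj_piD (x y : Ufree n) : Uj_pi (x + y) = Uj_pi x + Uj_pi y.
Proof. exact: raddfD. Qed.
Fact Uj_pi1 : Uj_pi (1 : Ufree n) = 1.
Proof. by []. Qed.

Lemma actU_lm z : lin_map (actU^~ z).
Proof.
move=> a x y; have [x' ->] := Uj_piP x; have [y' ->] := Uj_piP y.
by rewrite -Uj_piZ -Uj_piD !actU_pi act_lm.
Qed.
Lemma actUM x y z : actU (x * y) z = actU x (actU y z).
Proof.
have [x' ->] := Uj_piP x; have [y' ->] := Uj_piP y.
by rewrite -Uj_piM !actU_pi actM.
Qed.
Lemma actU1 z : actU 1 z = z.
Proof. by rewrite -Uj_pi1 actU_pi act_1. Qed.
Lemma actU_gen g z : actU (Uj_gen g) z = opg g z.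
Proof. by rewrite /Uj_gen actU_pi act_gen. Qed.
Lemma actU_rlin x : rlin (actU x).
Proof. exact: act_rlin. Qed.
End FreeAction.

Section DsumLin.
Variables (R : pzRingType) (I : choiceType) (M : I -> lmodType R) (V : lmodType R).
Variable F : forall i, M i -> V.
Hypothesis F_lm : forall i, lin_map (@F i).

Definition dsupp (x : dsum M) : seq I := undup (projT1 (cid (dsum_fin x))).

Lemma dsuppP (x : dsum M) i : i \notin dsupp x -> x i = 0.
Proof. by rewrite mem_undup; exact: (projT2 (cid (dsum_fin x))). Qed.

Definition dlin (x : dsum M) : V := \sum_(i <- dsupp x) F (x i).

Lemma dlinE (x : dsum M) s : uniq s -> (forall i, i \notin s -> x i = 0) -> dlin x = \sum_(i <- s) F (x i).
Proof.
move=> us hs; rewrite /dlin.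
rewrite [LHS](bigID (mem s)) [RHS](bigID (mem (dsupp x))) /=.
rewrite [X in _ + X]big1 ?addr0 => [|i /hs ->]; last exact: lm0.
rewrite [X in _ = _ + X]big1 ?addr0 => [|i /dsuppP ->]; last exact: lm0.
rewrite -[LHS]big_filter -[RHS]big_filter; apply: perm_big; apply: uniq_perm => [||i].
- exact: filter_uniq (undup_uniq _).
- exact: filter_uniq us.
by rewrite !mem_filter andbC.
Qed.

Lemma dlin_lm : lin_map dlin.
Proof.
move=> a x y; set s := undup (dsupp (a *: x + y) ++ dsupp x ++ dsupp y).
have hs z : {subset dsupp z <= s} -> forall i, i \notin s -> z i = 0.
  by move=> h i /(contra (h i)); exact: dsuppP.
rewrite !(@dlinE _ s) ?undup_uniq //; first 1 last.
- by apply: hs => i; rewrite /s mem_undup !mem_cat => ->; rewrite !orbT.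
- by apply: hs => i; rewrite /s mem_undup !mem_cat => ->; rewrite !orbT.
- by apply: hs => i; rewrite /s mem_undup !mem_cat => ->.
rewrite scaler_sumr -big_split; apply: eq_bigr => i _ /=; exact: F_lm.
Qed.

Lemma dlin_dinj (z : forall i, M i) i : dlin (dinj z i) = F (z i).
Proof.
rewrite (@dlinE _ [:: i]) // => [|j]; last by rewrite inE /= => /negbTE ->.
by rewrite big_seq1 /= eqxx.
Qed.

Lemma dsum_ind (x : dsum M) : x = \sum_(i <- dsupp x) dinj (fun j => x j) i.
Proof.
have ev (T : Type) (s : seq T) (f : T -> dsum M) i : (\sum_(t <- s) f t) i = \sum_(t <- s) f t i.
  by elim: s => [|t s IH]; rewrite ?big_nil ?big_cons //= IH.
apply: dsumP => i; rewrite ev; case: (boolP (i \in dsupp x)) => h.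
  rewrite (bigD1_seq i) ?undup_uniq //= eqxx big1 ?addr0 // => j; by rewrite eq_sym => /negbTE ->.
rewrite dsuppP // big1_seq // => j /andP[_ hj] /=.
by have /negbTE -> : i != j by apply: contraNneq h => ->.
Qed.
End DsumLin.

Lemma lm_side0 (R : pzRingType) (V W : lmodType R) (F : V -> W) (I : finType) (f g : I -> V) : lin_map F ->
  (forall i, F (f i) = 0) -> (forall i, F (g i) = 0) -> F (\sum_i f i + \sum_i g i) = 0.
Proof. by move=> hF h1 h2; rewrite (lmD hF) !(lm_sum hF) !big1 ?addr0. Qed.

Section Aleph.
Variable n : nat.
Local Notation N := (dimN n).
Implicit Types (la mu : tXi_diag n) (x y : Uj n).

Definition blockmap (p : tXi_diag n * tXi_diag n) (q : Ublock p) : QKj n :=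
  Qstar << val p.1 >> (actU (repr q) << val p.2 >>).

Lemma row_dgo c la z : Qstar << val la >> (dgo c z) = c la *: Qstar << val la >> z.
Proof.
move: z; apply: lm_ext => [||A].
- exact: lm_comp (bop_lmr _ (@Qstar_bilinear n)) (dgo_lm c).
- exact: lm_comp (lm_scale _) (bop_lmr _ (@Qstar_bilinear n)).
rewrite dgo1 (bopZr (@Qstar_bilinear n)) Qstar_unitl.
by case: eqVneq => [->//|_]; rewrite scale0r !scaler0.
Qed.

Lemma actU_dshift la a z : actU (dshift la a) z = dgo (fun mu => v ^ (- diag_ent mu a)) z - v ^ (- diag_ent la a) *: z.
Proof.
by rewrite (lmB (actU_lm z)) actU_gen (lmZ (actU_lm z)) actU1.
Qed.

(** After projection to the row weight [p.1] the left factors d_a - v^{-la_a} act by 0, and the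
    right factors kill the idempotent of [p.2]. *)
Lemma blockmap_J p x : in_J p.1 p.2 x -> Qstar << val p.1 >> (actU x << val p.2 >>) = 0.
Proof.
case: p => la mu /= /asboolP [y [z ->]].
pose F x := Qstar << val la >> (actU x << val mu >>).
have hF : lin_map F := lm_comp (bop_lmr _ (@Qstar_bilinear n)) (actU_lm _).
have h1 a : F (dshift la a * y a) = 0.
  by rewrite /F actUM actU_dshift (lmB (bop_lmr _ (@Qstar_bilinear n))) row_dgo (bopZr (@Qstar_bilinear n)) subrr.
have h2 a : F (z a * dshift mu a) = 0.
  rewrite /F actUM actU_dshift dgo_la subrr (lm0 (actU_rlin _).1); exact: bop0r (@Qstar_bilinear n) _.
exact: lm_side0 hF h1 h2.
Qed.

Lemma blockmap_pi p x : @blockmap p (quotl_pi (in_J_submod p.1 p.2) x) =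
  Qstar << val p.1 >> (actU x << val p.2 >>).
Proof.
apply/eqP; rewrite -subr_eq0 -(lmB (bop_lmr _ (@Qstar_bilinear n))) -(lmB (actU_lm _)).
apply/eqP/blockmap_J; have := quotl_eq (in_J_submod p.1 p.2) (repr (quotl_pi (in_J_submod p.1 p.2) x)) x.
by rewrite quotl_piP eqxx => /esym.
Qed.

Lemma Ublock_ind p (q : Ublock p) : exists x, q = quotl_pi (in_J_submod p.1 p.2) x.
Proof. by exists (repr q); rewrite quotl_piP. Qed.

Fact quotl_pi_lm (R : pzRingType) (V : lmodType R) (S : V -> bool) (h : submod_closed S) :
  lin_map (quotl_pi h : V -> quotl h).
Proof. by move=> a x y; rewrite raddfD; congr (_ + _); exact: esym (quotl_scaleE _ _ _). Qed.

Lemma blockmap_lm p : lin_map (@blockmap p).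
Proof.
move=> a q q'; have [x ->] := Ublock_ind q; have [y ->] := Ublock_ind q'.
rewrite -(quotl_pi_lm _ a x y) !blockmap_pi actU_lm; exact: (@Qstar_bilinear n).2.
Qed.

Definition alephf : Udot n -> QKj n := dlin (@blockmap).
Lemma alephf_lm : lin_map alephf.
Proof. exact: dlin_lm blockmap_lm. Qed.

Lemma alephf_Upi la mu x : alephf (Upi la mu x) = Qstar << val la >> (actU x << val mu >>).
Proof. by rewrite /alephf /Upi dlin_dinj ?blockmap_pi //; exact: blockmap_lm. Qed.

Lemma Upi_lm la mu : lin_map (@Upi n la mu).
Proof.
move=> a x y; apply: dsumP => i /=; case: eqP => _; last by rewrite scaler0 addr0.
exact: quotl_pi_lm.
Qed.

Lemma Upi_J la mu x : in_J la mu x -> Upi la mu x = 0.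
Proof.
move=> h; apply: dsumP => i /=; case: eqP => // ->.
by apply/eqP; rewrite -[0](raddf0 (quotl_pi (in_J_submod la mu))) quotl_eq subr0.
Qed.

Lemma Udot_span (P : Udot n -> Prop) : (forall la mu x, P (Upi la mu x)) ->
  P 0 -> (forall x y : Udot n, P x -> P y -> P (x + y)) -> forall x : Udot n, P x.
Proof.
move=> h P0 PD x; rewrite (dsum_ind x); elim/big_ind: _ => // p _.
case: p => la mu; have [y e] := Ublock_ind (x (la, mu)).
have -> : dinj (fun j => x j) (la, mu) = Upi la mu y; last exact: h.
by apply: dsumP => i; rewrite /Upi /=; case: (i =P (la, mu)) => [->|//]; exact: e.
Qed.

(** Rotation symmetry recovers the remaining diagonal entries from the first n+1. *)
Lemma diag_ent_inj la mu : (forall a, diag_ent la a = diag_ent mu a) -> la = mu.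
Proof.
move=> h; apply: val_inj; apply: val_inj; apply/matrixP => i j.
have [<-|ij] := eqVneq i j; last first.
  by have /is_diag_mxP -> // := valP la; have /is_diag_mxP -> // := valP mu.
have hl (k : 'I_N) : (k <= n)%N -> val (val la) k k = val (val mu) k k.
  move=> kn; have := h (inord k); rewrite /diag_ent inordK ?ltnS //.
  by have -> : (inord k : 'I_N) = k by apply: ord_inj; rewrite inordK.
case: (leqP i n) => [/hl //|ni].
rewrite -(rot_symE (tXi_rot (val la))) -(rot_symE (tXi_rot (val mu))); apply: hl.
by rewrite /= subSS; have := ltn_ord i; nlia.
Qed.

Lemma v_expz_inj : injective (fun k : int => v ^ k).
Proof.
have h (k l : int) : k < l -> v ^ k != v ^ l.
  move=> kl; have [m e] : exists m : nat, l = k + m.+1%:Z.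
    exists (absz (l - k - 1)%R); rewrite -addn1 PoszD gez0_abs; [lia|move: kl; lia].
  rewrite e expfzDr ?v_neq0 // -[X in X != _]mulr1 (inj_eq (mulfI (vX_neq0 k))) eq_sym.
  exact: v_free.
by move=> k l e; case: (ltgtP k l) => // /h; rewrite e eqxx.
Qed.

(** Homogeneity makes the image a joint eigenvector of the d_a; since distinct powers of v differ,
    the eigenvalues determine the row weight of every matrix in its support. *)
Lemma homog_row la la' x : homog la la' x -> Qstar << val la >> (actU x << val la' >>) = actU x << val la' >>.
Proof.
move=> hx; set z := actU x << val la' >>.
have hz a : dgo (fun mu => v ^ (- diag_ent mu a)) z = v ^ (- diag_ent la a) *: z.
  have := congr1 (fun y => actU y << val la' >>) (hx a).
  rewrite !actUM !actU_gen /= dgo_la (lmZ (actU_rlin x).1) (lmZ (actU_lm _)) -/z (lmZ (dgo_lm _)) => e.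
  apply: (scalerI (vX_neq0 (diag_ent la' a))); apply: etrans e _.
  by rewrite scalerA -expfzDr ?v_neq0.
apply/malgP=> A; rewrite proj_row_coef; case: eqVneq => [_|nla]; first by rewrite mul1r.
rewrite mul0r; apply: contraTeq nla => zA; rewrite eq_sym in zA; apply/negPn/eqP.
apply: diag_ent_inj => a; have := congr1 (fun y : QKj n => y@_A) (hz a).
rewrite mcoeffZ /dgo -lock lin_diag_coef => /(mulIf zA) /v_expz_inj /oppr_inj //.
Qed.
End Aleph.

(** * Spanning words in algebras with Serre relations *)

Section Span.
Variables (R : pzRingType) (V : lmodType R).
Inductive span (P : V -> Prop) : V -> Prop :=
  | Span0 : span P 0
  | SpanS c x y : P x -> span P y -> span P (c *: x + y).

Lemma spanD (P : V -> Prop) x y : span P x -> span P y -> span P (x + y).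
Proof. by elim=> [|c x' y' h _ IH] hy; rewrite ?add0r // -addrA; apply: SpanS => //; exact: IH. Qed.
Lemma spanZ (P : V -> Prop) c x : span P x -> span P (c *: x).
Proof.
elim=> [|c' x' y' h _ IH]; first by rewrite scaler0; exact: Span0.
by rewrite scalerDr scalerA; apply: SpanS.
Qed.
Lemma span1 (P : V -> Prop) x : P x -> span P x.
Proof. by move=> h; rewrite -[x]scale1r -[_ *: _]addr0; apply: SpanS => //; exact: Span0. Qed.
Lemma spanN (P : V -> Prop) x : span P x -> span P (- x).
Proof. by rewrite -scaleN1r; exact: spanZ. Qed.
Lemma spanB (P : V -> Prop) x y : span P x -> span P y -> span P (x - y).
Proof. by move=> hx /spanN; exact: spanD. Qed.
Lemma span_sum (P : V -> Prop) (T : Type) (s : seq T) (Q : pred T) (f : T -> V) :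
  (forall i, Q i -> span P (f i)) -> span P (\sum_(i <- s | Q i) f i).
Proof. move=> h; elim/big_ind : _ => //; [exact: Span0|exact: spanD]. Qed.
End Span.

Lemma span_map (R : pzRingType) (V W : lmodType R) (f : V -> W) (P : V -> Prop) (Q : W -> Prop) x : lin_map f ->
  (forall x, P x -> span Q (f x)) -> span P x -> span Q (f x).
Proof.
move=> hf h; elim=> [|c x' y hx _ IH]; first by rewrite (lm0 hf); exact: Span0.
by rewrite hf; apply: spanD => //; apply: spanZ; exact: h.
Qed.
Lemma span_sub (R : pzRingType) (V : lmodType R) (P Q : V -> Prop) x :
  (forall x, P x -> span Q x) -> span P x -> span Q x.
Proof. by apply: (span_map (f := id)). Qed.

Fact zac1 (V : zmodType) (a b c d : V) : a - b + c - d = a - d - (b - c).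
Proof. by rewrite opprB addrAC [a - b - d]addrAC -addrA [- b + c]addrC. Qed.
Fact zac2 (V : zmodType) (a b c d : V) : a - b - c = a - c + (d - b) - d.
Proof. by rewrite -[RHS]addrA [d - b - d]addrAC subrr add0r addrAC. Qed.

Section RankTwo.
Variables (F : fieldType) (w : F) (A : algType F).
Hypothesis w0 : w != 0.
Local Notation q := (w + w^-1).
(** Two consecutive quantum integers by their recursion; [qnE] gives the closed form. *)
Fixpoint qn2 (k : nat) : F * F := if k is k'.+1 then let: (a, b) := qn2 k' in (b, q * b - a) else (0, 1).
Definition qn k := (qn2 k).1.
Hypothesis qn0 : forall k, qn k.+1 != 0.

Lemma qnSS k : qn k.+2 = q * qn k.+1 - qn k.
Proof. by rewrite /qn /=; case: (qn2 k). Qed.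

Definition serre (x y : A) := x * x * y + y * (x * x) = q *: (x * y * x).

Lemma lm_mull (x : A) : lin_map ( *%R x).
Proof. by move=> a y z; rewrite mulrDr scalerAr. Qed.
Lemma lm_mulr (x : A) : lin_map (fun y => y * x).
Proof. by move=> a y z; rewrite mulrDl scalerAl. Qed.

Variables x y : A.
Hypothesis hx : serre x y.
Hypothesis hy : serre y x.

(** Repeated use of the Serre relation as a rule for x x y; the coefficients obey the recursion of
    the quantum integers. *)
Lemma push_formula i k : x ^+ i.+1 * y * x ^+ k =
  qn i.+1 *: (x * y * x ^+ (k + i)) - qn i *: (y * x ^+ (k + i).+1).
Proof.
elim/ltn_ind: i k => -[|[|i]] IH k.
- by rewrite expr1 addn0 /qn /= scale1r scale0r subr0.
- rewrite addn1 /qn /= mulr1 subr0 scale1r -[x ^+ 2]/(x * x).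
  have -> : x * x * y = q *: (x * y * x) - y * (x * x) by rewrite -hx addrK.
  by rewrite mulrBl -scalerAl -!mulrA -!exprS.
rewrite qnSS; have e : x ^+ i.+3 * y * x ^+ k = q *: (x ^+ i.+2 * y * x ^+ k.+1) - x ^+ i.+1 * y * x ^+ k.+2.
  have e2 : x * x * y = q *: (x * y * x) - y * (x * x) by rewrite -hx addrK.
  have -> : x ^+ i.+3 * y * x ^+ k = x ^+ i.+1 * (x * x * y) * x ^+ k.
    by rewrite !mulrA -!exprSr.
  rewrite e2 mulrBr mulrBl -scalerAr -scalerAl; congr (q *: _ - _).
    by rewrite (exprSr x i.+1) (exprS x k) !mulrA.
  by rewrite (exprS x k.+1) (exprS x k) !mulrA.
rewrite e (IH i.+1) // (IH i) // !addSnnS !addnS !scalerBr !scalerBl !scalerA opprB addrA.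
rewrite (_ : qn i.+2 *: (y * x ^+ (k + i).+3) = (q * qn i.+1) *: (y * x ^+ (k + i).+3) - qn i *: (y * x ^+ (k + i).+3)).
  exact: zac1.
by rewrite qnSS scalerBl.
Qed.

Lemma push1 a : span (fun z => z = y * x ^+ a.+1 \/ z = x ^+ a.+1 * y) (x * y * x ^+ a).
Proof.
have := push_formula a 0; rewrite add0n expr0 mulr1 => e.
have -> : x * y * x ^+ a = (qn a.+1)^-1 *: (x ^+ a.+1 * y + qn a *: (y * x ^+ a.+1)).
  by rewrite e subrK scalerA mulVf ?scale1r.
by apply: spanZ; apply: spanD; [|apply: spanZ]; apply: span1; [right|left].
Qed.

Lemma push2 b : span (fun z => z = y ^+ b * x * y \/ z = y ^+ b.+1 * x) (x * y ^+ b.+1).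
Proof.
elim: b => [|b IH]; first by apply: span1; left; rewrite mul1r.
have -> : x * y ^+ b.+2 = x * y ^+ b.+1 * y by rewrite (exprSr y b.+1) mulrA.
apply: (span_map (lm_mulr y) _ IH) => z [->|->]; last by apply: span1; left.
have e : x * (y * y) = q *: (y * x * y) - y * y * x by rewrite -hy addrAC subrr add0r.
have -> : y ^+ b * x * y * y = q *: (y ^+ b.+1 * x * y) - y ^+ b.+2 * x.
  by rewrite -!mulrA e mulrBr -scalerAr !mulrA -!exprSr.
by apply: spanB; [apply: spanZ|]; apply: span1; [left|right].
Qed.

(** [push2] leaves at most one y between the new x and the power of x, and [push1] removes it. *)
Lemma rank2_left a b : span (fun z => exists s u, z = y ^+ s * x ^+ a.+1 * y ^+ u) (x * y ^+ b * x ^+ a).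
Proof.
case: b => [|b].
  by apply: span1; exists 0%N, 0%N; rewrite !expr0 mulr1 mul1r mulr1 exprS.
apply: (span_map (lm_mulr (x ^+ a)) _ (push2 b)) => z [->|->]; last first.
  by apply: span1; exists b.+1, 0%N; rewrite mulr1 -mulrA -exprS.
rewrite -!mulrA [x * _]mulrA; apply: (span_map (lm_mull (y ^+ b)) _ (push1 a)) => z' [->|->]; apply: span1.
  by exists b.+1, 0%N; rewrite mulr1 mulrA -exprSr.
by exists b, 1%N; rewrite mulrA.
Qed.

(** A quantum commutator with y, twisted by the weight [c] of [z]. *)
Definition dlt (c : int) (z : A) : A := y * z - w ^ c *: (z * y).
Lemma dlt_lm c : lin_map (dlt c).
Proof.
move=> a u v; rewrite /dlt mulrDr mulrDl -scalerAr -scalerAl scalerDr opprD addrACA scalerBr.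
by rewrite !scalerA mulrC.
Qed.

Lemma dltM c d u v : dlt (c + d) (u * v) = dlt c u * v + w ^ c *: (u * dlt d v).
Proof.
rewrite /dlt mulrBl mulrBr scalerBr -scalerAl -scalerAr scalerA expfzDr // !mulrA.
by rewrite addrA subrK.
Qed.

Fixpoint Dlt (c : int) (k : nat) (z : A) : A := if k is k'.+1 then dlt (c - (2 * k')%N%:Z) (Dlt c k' z) else z.

Let p := dlt 1 x.
(** Expanded, this is y y x - (w + w^-1) y x y + x y y = 0, the Serre relation. *)
Lemma dlt_p : dlt (-1) p = 0.
Proof.
rewrite /p /dlt exprN1 expr1z mulrBr mulrBl scalerBr -!scalerAl -!scalerAr scalerA mulVf // scale1r !mulrA.
have := hy; rewrite /serre scalerDl !mulrA => e.
have -> : x * y * y = w *: (y * x * y) + w^-1 *: (y * x * y) - y * y * x by rewrite -e addrAC subrr add0r.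
rewrite opprB [X in _ + X]addrAC addrK addrA subrK subrr //.
Qed.

(** Leibniz rule: by [dlt_p] at most one of the k commutators can fall on the factor x, so two kinds
    of terms survive. *)
Lemma Dlt_x c k z : exists a : F, Dlt c k (x * z) = w ^+ k *: (x * Dlt (c - 1) k z) +
  (if k is k'.+1 then a *: (p * Dlt (c - 1) k' z) else 0).
Proof.
elim: k => [|k [a IH]]; first by exists 0; rewrite /= expr0 scale1r addr0.
have e1 : c - (2 * k)%N%:Z = 1 + (c - 1 - (2 * k)%N%:Z) by ring.
have h1 : dlt (c - (2 * k)%N%:Z) (x * Dlt (c - 1) k z) =
  p * Dlt (c - 1) k z + w *: (x * Dlt (c - 1) k.+1 z) by rewrite e1 dltM expr1z.
case: k => [|k] in IH e1 h1 *.
  exists 1; rewrite -[LHS]/(dlt (c - (2 * 0)%N%:Z) (x * Dlt (c - 1) 0 z)) h1 expr1 scale1r; exact: addrC.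
have h2 : dlt (c - (2 * k.+1)%N%:Z) (p * Dlt (c - 1) k z) = w^-1 *: (p * Dlt (c - 1) k.+1 z).
  have -> : c - (2 * k.+1)%N%:Z = -1 + (c - 1 - (2 * k)%N%:Z) by rewrite mulnS PoszD; ring.
  by rewrite dltM dlt_p mul0r add0r exprN1.
exists (w ^+ k.+1 + a * w^-1); rewrite [LHS]/= -/(Dlt c k.+1 _) IH (dlt_lm _) (lmZ (dlt_lm _)) h1 h2.
by rewrite scalerDr !scalerA -exprSr scalerDl addrA addrAC addrC addrA [_ *: _ + _ *: _]addrC.
Qed.

(* The quantum analogue of ad(y)^{a+1} (x^a) = 0. *)
Lemma higher_serre a : Dlt a%:Z a.+1 (x ^+ a) = 0.
Proof.
elim: a => [|a IH]; first by rewrite /= /dlt /= muln0 subr0 expr0z scale1r mulr1 mul1r subrr.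
rewrite exprS; have [b ->] := Dlt_x a.+1%:Z a.+2 (x ^+ a).
have -> : a.+1%:Z - 1 = a%:Z by rewrite -addn1 PoszD addrK.
have e2 : Dlt a%:Z a.+2 (x ^+ a) = 0 by rewrite -[LHS]/(dlt _ (Dlt a%:Z a.+1 (x ^+ a))) IH (lm0 (dlt_lm _)).
by rewrite IH e2 !mulr0 !scaler0 addr0.
Qed.

Lemma Dlt_expand c k z : span (fun t => exists s u, [/\ (s < k)%N, (s + u = k)%N & t = y ^+ s * z * y ^+ u])
  (Dlt c k z - y ^+ k * z).
Proof.
elim: k => [|k IH]; first by rewrite /= mul1r subrr; exact: Span0.
set P := fun t => _ in IH; have -> : Dlt c k.+1 z - y ^+ k.+1 * z = y * (Dlt c k z - y ^+ k * z) -
    w ^ (c - (2 * k)%N%:Z) *: ((Dlt c k z - y ^+ k * z) * y) - w ^ (c - (2 * k)%N%:Z) *: (y ^+ k * z * y).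
  rewrite [X in X - _]/= /dlt mulrBr mulrBl scalerBr opprB exprS !mulrA.
  exact: zac2.
apply: spanB; last first.
  by apply: spanZ; apply: span1; exists k, 1%N; split; rewrite ?addn1.
apply: spanB; last apply: spanZ.
  apply: (span_map (lm_mull y) _ IH) => t [s [u [sk su ->]]]; apply: span1.
  by exists s.+1, u; split=> //; rewrite ?addSn ?su // exprS !mulrA.
apply: (span_map (lm_mulr y) _ IH) => t [s [u [sk su ->]]]; apply: span1.
by exists s, u.+1; split; rewrite ?addnS ?su ?(ltn_trans sk) // exprSr !mulrA.
Qed.

(** The relation [higher_serre] rewrites y^{a+1} x^a with fewer letters y on the left and the others
    on the right; it is applied as often as the left exponent exceeds a. *)
Lemma rank2_right a b : span (fun z => exists s u, (s <= a)%N /\ z = y ^+ s * x ^+ a * y ^+ u) (y ^+ b * x ^+ a).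
Proof.
elim: b => [|b IH]; first by apply: span1; exists 0%N, 0%N; rewrite mulr1.
rewrite exprS -mulrA; apply: (span_map (lm_mull y) _ IH) => z [s [u [sa ->]]].
rewrite !mulrA -exprS; move: sa; rewrite leq_eqVlt => /orP[/eqP ->|sa]; last by apply: span1; exists s.+1, u.
apply: (span_map (f := fun t => t * y ^+ u) (lm_mulr _) (P := fun z => exists s u, (s <= a)%N /\ z = y ^+ s * x ^+ a * y ^+ u)).
  by move=> z' [s' [u' [h ->]]]; apply: span1; exists s', (u' + u)%N; rewrite -!mulrA -exprD.
have := Dlt_expand a%:Z a.+1 (x ^+ a); rewrite higher_serre sub0r => /spanN; rewrite opprK.
by apply: span_sub => t [s' [u' [h _ ->]]]; apply: span1; exists s', u'.
Qed.
End RankTwo.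

Section Words.
Variables (F : fieldType) (w : F) (A : algType F).
Hypothesis w0 : w != 0.
Hypothesis qn0 : forall k, qn w k.+1 != 0.
Variable B : nat -> A.
Hypothesis B_far : forall i j, (i.+1 < j)%N -> B i * B j = B j * B i.
Hypothesis B_serre : forall i, serre w (B i) (B i.+1) /\ serre w (B i.+1) (B i).

Definition wp (s : seq nat) : A := \prod_(i <- s) B i.
Lemma wp_cons i s : wp (i :: s) = B i * wp s. Proof. exact: big_cons. Qed.
Lemma wp_cat s t : wp (s ++ t) = wp s * wp t. Proof. exact: big_cat. Qed.
Lemma wp0 : wp [::] = 1. Proof. exact: big_nil. Qed.
Lemma wp_nseq k i : wp (nseq k i) = B i ^+ k.
Proof. by elim: k => [|k IH]; rewrite ?wp0 // /= wp_cons IH exprS. Qed.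

Variable m : nat.

(* The word (k-1)^{c(k-1)} ... (j+1)^{c(j+1)} j^{c(j)}. *)
Fixpoint dsc (j k : nat) (c : nat -> nat) : seq nat :=
  if k is k'.+1 then (if (j <= k')%N then nseq (c k') k' else [::]) ++ dsc j k' c else [::].

Definition mono (j k : nat) (c : nat -> nat) := forall i, (j <= i)%N -> (i.+1 < k)%N -> (c i.+1 <= c i)%N.
Definition letters (j : nat) (s : seq nat) := all (fun i => (j <= i)%N && (i < m)%N) s.

Fixpoint stdw (t j : nat) (s : seq nat) : Prop :=
  if t is t'.+1 then exists c s', [/\ mono j m c, s = dsc j m c ++ s' & stdw t' j.+1 s'] else s = [::].

Lemma dsc_ext j k c c' : (forall i, (i < k)%N -> c i = c' i) -> dsc j k c = dsc j k c'.
Proof.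
elim: k => // k IH h /=; rewrite h // IH // => i ik; apply: h; exact: ltnW.
Qed.

Lemma wp_dscS j k c : (j <= k)%N -> wp (dsc j k.+1 c) = B k ^+ c k * wp (dsc j k c).
Proof. by move=> jk; rewrite /= jk wp_cat wp_nseq. Qed.

Lemma comm_dsc j k c i u : (k <= i)%N -> wp (dsc j k c) * B i.+1 ^+ u = B i.+1 ^+ u * wp (dsc j k c).
Proof.
move=> ki; apply: commrX; rewrite /GRing.comm; elim: k ki => [|k IH] ki; first by rewrite /= wp0 mulr1 mul1r.
rewrite /= wp_cat; case: (j <= k)%N; last by rewrite wp0 mul1r IH // ltnW.
rewrite -mulrA IH ?(ltnW ki) // !mulrA; congr (_ * _); rewrite wp_nseq.
by apply/esym/commrX/esym; apply: B_far; rewrite ltnS.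
Qed.

Definition dspan j k (P : (nat -> nat) -> Prop) :=
  span (fun z => exists c s, [/\ P c, letters j.+1 s & z = wp (dsc j k c) * wp s]).

Definition upd (c : nat -> nat) k a i := if i == k then a else c i.
Lemma dsc_upd j k c a : dsc j k (upd c k a) = dsc j k c.
Proof. by apply: dsc_ext => i ik; rewrite /upd ltn_eqF. Qed.

Lemma letters_nseq j i u s : (j <= i < m)%N -> letters j s -> letters j (nseq u i ++ s).
Proof. by move=> h hs; rewrite /letters all_cat all_nseq h orbT. Qed.

(** Where an exponent exceeds the next one to its right, [rank2_right] sends the excess letters k+1
    to the right; they commute with the letters below k and join the remainder, which may contain
    any letter above j. *)
Lemma straighten j k c s : (k <= m)%N -> letters j.+1 s -> dspan j k (mono j k) (wp (dsc j k c) * wp s).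
Proof.
elim: k => [|k IH] km hs; first by apply: span1; exists c, s.
have [jk|kj] := leqP j k; last first.
  by apply: span1; exists c, s; split=> // i ji ik; exfalso; move: ji ik kj; clear; lia.
rewrite wp_dscS // -mulrA; apply: (span_map (lm_mull (B k ^+ c k)) _ (IH (ltnW km) hs)).
move=> z [c' [s' [mc hs' ->]]]; have [ejk|jk'] := eqVneq j k.
  apply: span1; exists (upd c' k (c k)), s'; split=> //.
    by move=> i ji ik; move: ik; rewrite ltnS ltnNge -ejk ji.
  by rewrite wp_dscS ?ejk // /upd eqxx -/(upd c' k (c k)) dsc_upd mulrA.
case: k => [|k] in IH km jk mc jk' *; first by move: jk jk'; rewrite leqn0 => ->.
have jk1 : (j <= k)%N by rewrite -ltnS ltn_neqAle jk' jk.
have hr := @rank2_right _ _ _ w0 (B k) (B k.+1) (B_serre k).2 (c' k) (c k.+1).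
rewrite wp_dscS // mulrA mulrA -[_ * wp (dsc j k c') * _]mulrA.
apply: (span_map (lm_mulr _) _ hr) => t [a [u [ha ->]]]; apply: span1.
exists (upd c' k.+1 a), (nseq u k.+1 ++ s'); split.
- move=> i ji; rewrite ltnS => ik; rewrite /upd [i == _]ltn_eqF //; case: eqP => [[->]//|ne].
  by apply: mc => //; rewrite ltn_neqAle ik andbT; apply/eqP.
- by apply: letters_nseq; rewrite ?ltnS ?jk1.
rewrite wp_dscS // /upd eqxx -/(upd c' k.+1 a) dsc_upd wp_dscS // wp_cat wp_nseq !mulrA.
by rewrite -[X in _ = X * _]mulrA comm_dsc // !mulrA.
Qed.

(** The new letter commutes with the block down to the letter i+1, where [rank2_left] merges it into
    the power of i; the letters i+1 thrown out to the right commute with the rest of the block. *)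
Lemma left_mul j k c s i : (j <= i < k)%N -> (k <= m)%N -> letters j.+1 s ->
  dspan j k (fun=> True) (B i * (wp (dsc j k c) * wp s)).
Proof.
elim: k c s => [|k IH] c s; first by rewrite ltn0 andbF.
move=> /andP[ji]; rewrite ltnS leq_eqVlt => /orP[/eqP ik | ik] km hs.
  apply: span1; exists (upd c k (c k).+1), s; split=> //.
  by rewrite -ik wp_dscS // wp_dscS // /upd eqxx -/(upd c i (c i).+1) dsc_upd exprS !mulrA.
have jk : (j <= k)%N by rewrite (leq_trans ji) // ltnW.
rewrite wp_dscS //; have [eik|nik] := eqVneq i.+1 k; last first.
  have fik : (i.+1 < k)%N by rewrite ltn_neqAle nik ik.
  have -> : B i * (B k ^+ c k * wp (dsc j k c) * wp s) = B k ^+ c k * (B i * (wp (dsc j k c) * wp s)).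
    rewrite !mulrA; congr (_ * _ * _); apply: commrX; exact: B_far.
  have jik : (j <= i < k)%N by rewrite ji ik.
  apply: (span_map (lm_mull _) _ (IH c s jik (ltnW km) hs)).
  move=> z [c' [s' [_ hs' ->]]]; apply: span1; exists (upd c' k (c k)), s'; split=> //.
  by rewrite wp_dscS // /upd eqxx -/(upd c' k (c k)) dsc_upd mulrA.
case: k => // k in IH eik ik km jk *; case: eik => eik; rewrite -eik in IH km jk ik *.
rewrite wp_dscS // !mulrA -[_ * wp (dsc j i c) * _]mulrA.
apply: (span_map (lm_mulr _) _ (rank2_left qn0 (B_serre i).1 (B_serre i).2 (c i) (c i.+1))).
move=> z [a [u ->]]; apply: span1.
exists (upd (upd c i (c i).+1) i.+1 a), (nseq u i.+1 ++ s); split=> //.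
  by apply: letters_nseq; rewrite ?ltnS ?ji.
rewrite wp_dscS // /upd eqxx -/(upd _ i.+1 a) dsc_upd wp_dscS // /upd eqxx -/(upd _ i _) dsc_upd.
by rewrite wp_cat wp_nseq !mulrA -[X in _ = X * _]mulrA comm_dsc // !mulrA.
Qed.

Lemma dsc_span j s : letters j s -> dspan j m (mono j m) (wp s).
Proof.
elim: s => [|i s IH] => [_|/andP[hi hs]].
  rewrite (_ : wp [::] = wp (dsc j m (fun=> 0%N)) * wp [::]); first exact: straighten.
  rewrite wp0 mulr1; elim: m => [|k IH]; first by rewrite /= wp0.
  by rewrite /=; case: (j <= k)%N; rewrite -IH.
rewrite wp_cons; apply: (span_map (lm_mull _) _ (IH hs)) => z [c [s' [_ hs' ->]]].
apply: (span_sub _ (left_mul c hi (leqnn m) hs')) => z' [c' [s2 [_ hs2 ->]]].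
exact: straighten.
Qed.

(** Once the block for [j] has been split off, the remainder contains only letters above [j]. *)
Lemma std_span t j s : (j + t = m)%N -> letters j s -> span (fun z => exists2 s', stdw t j s' & z = wp s') (wp s).
Proof.
elim: t j s => [|t IH] j s jt hs.
  apply: span1; exists [::]; rewrite //=; case: s hs => // i s /andP[]; rewrite -jt addn0.
  by move=> h; exfalso; move: h; clear; lia.
apply: (span_sub _ (dsc_span hs)) => z [c [s' [mc hs' ->]]].
have jt' : (j.+1 + t = m)%N by rewrite addSnnS.
apply: (span_map (lm_mull _) _ (IH j.+1 s' jt' hs')).
move=> z' [s2 h2 ->]; apply: span1; exists (dsc j m c ++ s2); last by rewrite wp_cat.
by exists c, s2.
Qed.
End Words.

(** * Serre relations that hold up to shorter words *)

Section SerreFiltration.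
Variables (F : fieldType) (w : F) (U : algType F).
Hypothesis w0 : w != 0.
Hypothesis qn0 : forall k, qn w k.+1 != 0.
Variables (J : U -> Prop) (phi : nat -> U) (m : nat).
Hypothesis phi_out : forall i, (m <= i)%N -> phi i = 0.

Definition lowspan (l : nat) := span (fun z => J z \/ exists2 s, (size s < l)%N & z = wp phi s).

Definition serre_diff (x y : U) := x * x * y + y * (x * x) - (w + w^-1) *: (x * y * x).

Hypothesis low_far : forall u u' i j, (i.+1 < j)%N ->
  lowspan (size u + size u' + 2) (wp phi u * (phi i * phi j - phi j * phi i) * wp phi u').
Hypothesis low_serre : forall u u' i,
  lowspan (size u + size u' + 3) (wp phi u * serre_diff (phi i) (phi i.+1) * wp phi u') /\
  lowspan (size u + size u' + 3) (wp phi u * serre_diff (phi i.+1) (phi i) * wp phi u').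

Let W := {fmonom nat}.
Let Fr : lalgType F := {malg F[W]}.
Let L (s : seq nat) : Fr := << FMonom s >>.

Fact L_mul s t : L s * L t = L (s ++ t).
Proof. by rewrite /L free_mulUU; congr << _ >>; apply: val_inj => /=; exact: fmM. Qed.
Fact L_one : 1 = L [::].
Proof. by rewrite free_1; congr << _ >>; apply: val_inj => /=; exact: fm1. Qed.

Fact L_ind (x : Fr) : span (fun z => exists s, z = L s) x.
Proof.
rewrite [x]malg_sumE; apply: span_sum => i _; apply: spanZ; apply: span1.
by exists (val i); congr << _ >>; apply: val_inj.
Qed.

Fact Fr_scalerAr (c : F) (x y : Fr) : c *: (x * y) = x * (c *: y).
Proof.
have cc (z : Fr) : c%:MP * z = z * c%:MP.
  rewrite [z]monalgE mulr_sumr mulr_suml; apply: eq_bigr => i _.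
  by rewrite !malgM_def !fgmulUU mul1m mulm1 mulrC.
by rewrite -[LHS]mul_malgC -[c *: y]mul_malgC mulrA cc -mulrA.
Qed.
Fact Fr_mull (x : Fr) : lin_map ( *%R x).
Proof. by move=> a y z; rewrite mulrDr Fr_scalerAr. Qed.
Fact Fr_mulr (x : Fr) : lin_map (fun y => y * x).
Proof. by move=> a y z; rewrite mulrDl scalerAl. Qed.

(** Only words of length exactly [l] are evaluated: the Serre relations are homogeneous, and this
    keeps the errors of different degrees apart. *)
Let g l : Fr -> U := lin (fun s : W => if size s == l then wp phi s else 0).
Let g_lm l : lin_map (g l). Proof. exact: lin_lm. Qed.
Let g_L l s : g l (L s) = if size s == l then wp phi s else 0.
Proof. exact: lin1. Qed.

(* A two-sided ideal containing the Serre relations: [x] lies in it if all its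
   multiples, evaluated degree by degree, drop in the filtration by length. *)
Let S (x : Fr) : bool := `[< forall l u u', lowspan l (g l (L u * x * L u')) >].

Fact S_submod : submod_closed S.
Proof.
split.
  by apply/asboolP => l u u'; rewrite mulr0 mul0r (lm0 (g_lm l)); exact: Span0.
move=> c x y /asboolP hx /asboolP hy; apply/asboolP => l u u'.
rewrite Fr_mull Fr_mulr g_lm; apply: spanD; last exact: hy.
by apply: spanZ; exact: hx.
Qed.

Fact S_ideal (x y z : Fr) : S x -> S (y * x * z).
Proof.
move=> /asboolP hx; apply/asboolP => l u u'.
apply: (span_map (f := fun t => g l (L u * (t * x * z) * L u')) (P := fun z => exists s, z = L s)) (L_ind y).
  apply: lm_comp (g_lm l) (lm_comp (Fr_mulr _) (lm_comp (Fr_mull _) (lm_comp (Fr_mulr _) (Fr_mulr _)))).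
move=> _ [s ->].
apply: (span_map (f := fun t => g l (L u * (L s * x * t) * L u')) (P := fun z => exists s, z = L s)) (L_ind z).
  apply: lm_comp (g_lm l) (lm_comp (Fr_mulr _) (lm_comp (Fr_mull _) (Fr_mull _))).
move=> _ [t ->]; rewrite -[L u * _ * _]mulrA -!mulrA L_mul !mulrA L_mul; exact: hx.
Qed.

Fact S_far i j : (i.+1 < j)%N -> S (L [:: i; j] - L [:: j; i]).
Proof.
move=> ij; apply/asboolP => l u u'; rewrite (lmB (Fr_mull _)) (lmB (Fr_mulr _)) !L_mul (lmB (g_lm l)) !g_L.
rewrite !size_cat /=; case: eqP => [<-|_]; last by rewrite subr0; exact: Span0.
have := low_far u u' ij; rewrite addnAC.
by rewrite !wp_cat !wp_cons wp0 !mulr1 mulrBr mulrBl !mulrA.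
Qed.

Fact S_serre i j : 
  (forall u u', lowspan (size u + size u' + 3) (wp phi u * serre_diff (phi i) (phi j) * wp phi u')) ->
  S (L [:: i; i; j] + L [:: j; i; i] - (w + w^-1) *: L [:: i; j; i]).
Proof.
move=> h; apply/asboolP => l u u'.
rewrite (lmB (Fr_mull _)) (lmB (Fr_mulr _)) (lmB (g_lm l)) (lmD (Fr_mull _)) (lmD (Fr_mulr _)) (lmD (g_lm l)).
rewrite (lmZ (Fr_mull _)) (lmZ (Fr_mulr _)) (lmZ (g_lm l)) !L_mul !g_L.
rewrite !size_cat /=; case: eqP => [<-|_]; last by rewrite scaler0 addr0 subr0; exact: Span0.
have := h u u'; rewrite addnAC /serre_diff.
by rewrite !wp_cat !wp_cons wp0 !mulr1 mulrBr mulrBl mulrDr mulrDl -scalerAr -scalerAl !mulrA.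
Qed.

Let stdspan := span (fun z => J z \/ exists2 s, stdw m m 0 s & z = wp phi s).

(** In the quotient by [S] the Serre relations hold exactly, so [std_span] applies there; the
    combination of standard words is then lifted to the free algebra. *)
Fact S_reduce s : letters m 0 s -> exists2 y, span (fun z => exists2 s', stdw m m 0 s' & z = L s') y & S (L s - y).
Proof.
(* [quota_of] takes a proper ideal; if [S] contains 1, it contains every word. *)
case: (boolP (S 1)) => [S1 hs|S1].
  exists 0; first exact: Span0; rewrite subr0 -[L s]mulr1 -[L s * 1]mulr1; exact: S_ideal S1.
pose Q : algType F := quota_of S_submod S_ideal S1 Fr_scalerAr.
pose p (x : Fr) : Q := quotl_pi S_submod x.
have pM x y : p (x * y) = p x * p y by symmetry; exact: quota_mulE.
have pZ c x : p (c *: x) = c *: p x by exact: qpiZ.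
have pD x y : p (x + y) = p x + p y by exact: raddfD.
have pE x y : S (x - y) -> p x = p y by move=> h; apply/eqP; rewrite [_ == _]quotl_eq.
have pP x y : p x = p y -> S (x - y) by move=> /eqP; rewrite [_ == _]quotl_eq.
pose B i := p (L [:: i]).
have wpB s' : wp B s' = p (L s').
  elim: s' => [|i s' IH]; first by rewrite wp0 -L_one.
  by rewrite wp_cons IH -pM L_mul.
have far i j : (i.+1 < j)%N -> B i * B j = B j * B i.
  by move=> ij; rewrite /B -!pM !L_mul; apply/pE/S_far.
have ser i j : (forall u u', lowspan (size u + size u' + 3) (wp phi u * serre_diff (phi i) (phi j) * wp phi u')) ->
    serre w (B i) (B j).
  move=> h; have e := pE _ _ (S_serre h).
  have q3 a b c : B a * B b * B c = p (L [:: a; b; c]).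
    by rewrite /B -(pM (L [:: a]) (L [:: b])) L_mul -(pM (L _) (L [:: c])) L_mul.
  have q3' a b c : B a * (B b * B c) = p (L [:: a; b; c]) by rewrite mulrA q3.
  have e1 : B i * B i * B j + B j * (B i * B i) = p (L [:: i; i; j] + L [:: j; i; i]).
    exact: etrans (congr2 +%R (q3 i i j) (q3' j i i)) (esym (pD _ _)).
  have e2 : (w + w^-1) *: (B i * B j * B i) = p ((w + w^-1) *: L [:: i; j; i]).
    exact: etrans (congr1 _ (q3 i j i)) (esym (pZ _ _)).
  exact: etrans e1 (etrans e (esym e2)).
have B_serre i : serre w (B i) (B i.+1) /\ serre w (B i.+1) (B i).
  by split; apply: ser => u u'; have [] := low_serre u u' i.
move=> hs; have := std_span w0 qn0 far B_serre (t := m) (j := 0) (add0n m) hs; rewrite wpB.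
suff h z : span (fun z => exists2 s', stdw m m 0 s' & z = wp B s') z ->
   exists2 y, span (fun z => exists2 s', stdw m m 0 s' & z = L s') y & z = p y.
  by move=> /h [y hy /pP]; exists y.
elim=> [|c _ z' [s' hs' ->] _ [y hy ->]].
  exists 0; [exact: Span0|exact: esym (raddf0 (quotl_pi S_submod))].
by exists (c *: L s' + y); [apply: SpanS => //; exists s'|rewrite pD pZ wpB].
Qed.

(** Induction on the length: [g] in the degree of [s] turns membership of the difference in [S] into
    an error made of shorter words and elements of [J]. *)
Lemma serre_filtration s : stdspan (wp phi s).
Proof.
have [l] := ubnP (size s); elim: l s => // l IH s; rewrite ltnS => sl.
have lowS : forall z, lowspan (size s) z -> stdspan z.
  move=> z; apply: span_sub => t [Jt|[s' ss ->]]; first by apply: span1; left.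
  by apply: IH; exact: leq_trans ss sl.
case: (boolP (letters m 0 s)) => [hs|].
  have [y hy /asboolP/(_ (size s) [::] [::])] := S_reduce hs.
  rewrite -!L_one mul1r mulr1 (lmB (g_lm _)) g_L eqxx => /lowS h.
  rewrite -[wp phi s](subrK (g (size s) y)); apply: spanD => //.
  apply: (span_map (g_lm _) _ hy) => _ [s' hs' ->]; rewrite g_L.
  by case: ifP => _; [apply: span1; right; exists s'|exact: Span0].
rewrite /letters -has_predC => /hasP[i /splitPr[a b]]; rewrite /= -leqNgt => /phi_out e.
by rewrite wp_cat wp_cons e mul0r mulr0; exact: Span0.
Qed.
End SerreFiltration.

Lemma qnE (F : fieldType) (w : F) (k : nat) : w != 0 -> qn w k * (w - w^-1) = w ^+ k - w ^- k.
Proof.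
move=> w0; suff [] : qn w k * (w - w^-1) = w ^+ k - w ^- k /\ qn w k.+1 * (w - w^-1) = w ^+ k.+1 - w ^- k.+1 by [].
elim: k => [|k [IH1 IH2]]; first by rewrite /qn /= expr0 invr1 subrr mul0r mul1r.
split=> //; rewrite qnSS mulrBl -mulrA IH2 IH1 !exprSr.
have X0 : w ^+ k != 0 by rewrite expf_neq0.
by move: X0; set X := w ^+ k => X0; field; rewrite w0 X0.
Qed.

Lemma qn_neq0 (F : fieldType) (w : F) : w != 0 -> (forall k, (0 < k)%N -> w ^+ k != 1) -> forall k, qn w k.+1 != 0.
Proof.
move=> w0 h k; apply/negP => /eqP e; have := qnE k.+1 w0; rewrite e mul0r => /esym/eqP; rewrite subr_eq0 => /eqP e1.
have /eqP := h (k.+1 + k.+1)%N isT; apply; rewrite exprD [X in X * _]e1 mulVf // expf_neq0 //.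
Qed.

(** * Spanning words in U^j *)

Section UrelSpan.
Variables (n : nat) (A : algType Qv) (e f : 'I_n -> A) (d dV : 'I_n.+1 -> A).
Hypothesis rel : forall l r, Urel e f d dV l r -> l = r.
Variable kap : 'I_n.+1 -> Qv.

(** Modulo this left ideal [d a] at the right end of a product is the scalar [kap a]. *)
Definition leftJ (x : A) := exists z : 'I_n.+1 -> A, x = \sum_a z a * (d a - (kap a)%:A).

Lemma leftJ0 : leftJ 0.
Proof. by exists (fun=> 0); rewrite big1 // => a _; rewrite mul0r. Qed.
Lemma leftJ_lin c x y : leftJ x -> leftJ y -> leftJ (c *: x + y).
Proof.
move=> [z ->] [z' ->]; exists (fun a => c *: z a + z' a).
by rewrite scaler_sumr -big_split; apply: eq_bigr => a _ /=; rewrite mulrDl scalerAl.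
Qed.
Lemma leftJD x y : leftJ x -> leftJ y -> leftJ (x + y).
Proof. by move=> hx hy; rewrite -[x]scale1r; exact: leftJ_lin. Qed.
Lemma leftJZ c x : leftJ x -> leftJ (c *: x).
Proof. by move=> hx; rewrite -[_ *: _]addr0; exact: leftJ_lin leftJ0. Qed.
Lemma leftJM y x : leftJ x -> leftJ (y * x).
Proof. by move=> [z ->]; exists (fun a => y * z a); rewrite mulr_sumr; apply: eq_bigr => a _; rewrite mulrA. Qed.
Lemma leftJ1 a : leftJ (d a - (kap a)%:A).
Proof.
exists (fun b => if b == a then 1 else 0); rewrite (bigD1 a) //= eqxx mul1r big1 ?addr0 // => b /negbTE ->.
by rewrite mul0r.
Qed.

Definition phi (r : nat) : A :=
  if (r < n)%N then (if insub r is Some i then e i else 0)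
  else if (r < n.*2)%N then (if insub (n.*2.-1 - r)%N is Some i then f i else 0) else 0.

Lemma phi_out r : (n.*2 <= r)%N -> phi r = 0.
Proof. by move=> h; rewrite /phi !ifF //; move: h; clear; lia. Qed.
Lemma phi_e (i : 'I_n) : phi i = e i.
Proof. by rewrite /phi ltn_ord (insubT (fun k => k < n)%N (ltn_ord i)); congr e; apply: ord_inj. Qed.
Lemma phi_f (i : 'I_n) : phi (n.*2.-1 - i) = f i.
Proof.
have := ltn_ord i; rewrite /phi => h; rewrite ifF; last by move: h; clear; lia.
rewrite ifT; last by move: h; clear; lia.
have -> : (n.*2.-1 - (n.*2.-1 - i))%N = i by move: h; clear; lia.
by rewrite insubT; congr f; apply: ord_inj.
Qed.
Lemma letterP (r : nat) : [\/ exists i : 'I_n, r = i :> nat, exists i : 'I_n, r = (n.*2.-1 - i)%N :> nat | (n.*2 <= r)%N].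
Proof.
case: (ltnP r n) => h; first by constructor 1; exists (Ordinal h).
case: (ltnP r n.*2) => h'; last by constructor 3.
have h2 : (n.*2.-1 - r < n)%N by move: h h'; clear; lia.
by constructor 2; exists (Ordinal h2) => /=; move: h h'; clear; lia.
Qed.

Lemma d_comm a r : exists c : Qv, d a * phi r = c *: (phi r * d a) /\ dV a * phi r = c^-1 *: (phi r * dV a).
Proof.
suff h : exists2 c : Qv, c != 0 & d a * phi r * dV a = c *: phi r.
  have dVd := rel (Uvd e f d dV a); have ddV := rel (Udv e f d dV a).
  have [c c0 ec] := h; exists c.
  have e1 : d a * phi r = c *: (phi r * d a) by rewrite scalerAl -ec -(mulrA _ (dV a)) dVd mulr1.
  split=> //; apply: (scalerI c0); rewrite scalerA divff // scale1r.
  have := congr1 (fun z => dV a * z) ec; rewrite !mulrA dVd mul1r => ->; by rewrite -scalerAr.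
case: (letterP r) => [[i ->]|[i ->]|/phi_out ->].
- by exists (v ^ wt_e a i); [exact: vX_neq0|rewrite phi_e; exact: rel (Ude _ _ _ _ _ _)].
- by exists (v ^ wt_f a i); [exact: vX_neq0|rewrite phi_f; exact: rel (Udf _ _ _ _ _ _)].
- by exists 1; [exact: oner_neq0|rewrite mulr0 mul0r scaler0].
Qed.

(** The property shared by the torus elements: up to a scalar they pass to the right end of a word,
    where they become scalars modulo [leftJ]. *)
Definition sc (x : A) := forall s, exists c : Qv, leftJ (x * wp phi s - c *: wp phi s).

Lemma sc_M x y : sc x -> sc y -> sc (x * y).
Proof.
move=> hx hy s; have [c hc] := hy s; have [c' hc'] := hx s; exists (c * c').
have -> : x * y * wp phi s - (c * c') *: wp phi s = x * (y * wp phi s - c *: wp phi s) + c *: (x * wp phi s - c' *: wp phi s).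
  by rewrite mulrBr scalerBr scalerA -scalerAr mulrA addrA subrK.
by apply: leftJD; [exact: leftJM|exact: leftJZ].
Qed.
Lemma sc_lin a x y : sc x -> sc y -> sc (a *: x + y).
Proof.
move=> hx hy s; have [c hc] := hx s; have [c' hc'] := hy s; exists (a * c + c').
have -> : (a *: x + y) * wp phi s - (a * c + c') *: wp phi s =
    a *: (x * wp phi s - c *: wp phi s) + (y * wp phi s - c' *: wp phi s).
  by rewrite mulrDl scalerDl opprD addrACA scalerBr scalerA scalerAl.
exact: leftJ_lin.
Qed.
Lemma sc_0 : sc 0.
Proof. by move=> s; exists 0; rewrite mul0r scale0r subr0; exact: leftJ0. Qed.
Lemma sc_Z a x : sc x -> sc (a *: x).
Proof. by move=> h; rewrite -[_ *: _]addr0; exact: sc_lin sc_0. Qed.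
Lemma sc_D x y : sc x -> sc y -> sc (x + y).
Proof. by move=> h h'; rewrite -[x]scale1r; exact: sc_lin. Qed.
Lemma sc_B x y : sc x -> sc y -> sc (x - y).
Proof. by move=> h h'; apply: sc_D => //; rewrite -scaleN1r; exact: sc_Z. Qed.

Lemma sc_comm x : (exists c, leftJ (x - c%:A)) -> (forall r, exists c : Qv, x * phi r = c *: (phi r * x)) -> sc x.
Proof.
move=> [c0 h0] h; elim=> [|r s [c IH]]; first by exists c0; rewrite wp0 mulr1.
have [c' e'] := h r; exists (c' * c); rewrite wp_cons mulrA e'.
have -> : c' *: (phi r * x) * wp phi s - (c' * c) *: (phi r * wp phi s) = c' *: (phi r * (x * wp phi s - c *: wp phi s)).
  by rewrite mulrBr scalerBr -scalerAl mulrA -scalerAr scalerA.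
by apply/leftJZ/leftJM.
Qed.

Hypothesis kap0 : forall a, kap a != 0.
Lemma sc_d a : sc (d a).
Proof.
apply: sc_comm => [|r]; first by exists (kap a); exact: leftJ1.
by have [c []] := d_comm a r; exists c.
Qed.
Lemma sc_dV a : sc (dV a).
Proof.
apply: sc_comm => [|r]; last by have [c []] := d_comm a r; exists c^-1.
exists (kap a)^-1; have -> : dV a - (kap a)^-1%:A = (- (kap a)^-1) *: (dV a * (d a - (kap a)%:A)).
  rewrite mulrBr (rel (Uvd e f d dV a)) -scalerAr mulr1 scalerBr scalerA mulNr mulVf // !scaleNr scale1r opprK.
  exact: addrC.
by apply/leftJZ/leftJM/leftJ1.
Qed.

Local Notation low := (lowspan leftJ phi).

Lemma low_sc x u u' l : (size u + size u' < l)%N -> sc x -> low l (wp phi u * x * wp phi u').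
Proof.
move=> h /(_ u') [c hc]; have -> : wp phi u * x * wp phi u' =
  wp phi u * (x * wp phi u' - c *: wp phi u') + c *: wp phi (u ++ u').
  by rewrite mulrBr -scalerAr wp_cat subrK mulrA.
apply: spanD; first by apply: span1; left; exact: leftJM.
by apply: spanZ; apply: span1; right; exists (u ++ u'); rewrite ?size_cat.
Qed.

Lemma lowspan0 l x y : low l (x * 0 * y).
Proof. by rewrite mulr0 mul0r; exact: Span0. Qed.

(** The letters of e_i and f_j are far apart unless i = j = n. Their commutator is 0 or a torus
    element, so two letters are lost; far letters of the same kind commute exactly. *)
Lemma urel_far u u' i j : (i.+1 < j)%N ->
  low (size u + size u' + 2) (wp phi u * (phi i * phi j - phi j * phi i) * wp phi u').
Proof.
move=> ij; case: (letterP j) => [[j' ej]|[j' ej]|/phi_out ->]; last first.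
- by rewrite mulr0 mul0r subrr; exact: lowspan0.
- case: (letterP i) => [[i' ei]|[i' ei]|h].
  + rewrite ei ej phi_e phi_f; apply: low_sc; first by rewrite addn2.
    have nij : ~~ ((i' == j') && (i'.+1 == n)).
      by apply/negP => /andP[/eqP h1 /eqP h2]; move: ij; rewrite ei ej h1; move: h2; rewrite h1; move: (nat_of_ord j') => k; clear; lia.
    rewrite (rel (Uef _ _ _ _ nij)); case: ifP => _; last exact: sc_0.
    by apply: sc_Z; apply: sc_B; apply: sc_M; (exact: sc_d || exact: sc_dV).
  + rewrite ei ej !phi_f (rel (@Uff n A e f d dV i' j' _)) ?subrr; first exact: lowspan0.
    rewrite /far_idx; move: ij; rewrite ei ej; have := ltn_ord i'; have := ltn_ord j'; clear; lia.
  + exfalso; move: ij; rewrite ej; have := ltn_ord j'; move: h; clear; lia.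
case: (letterP i) => [[i' ei]|[i' ei]|h].
- rewrite ei ej !phi_e (rel (@Uee n A e f d dV i' j' _)) ?subrr; first exact: lowspan0.
  by rewrite /far_idx; move: ij; rewrite ei ej => ->.
- exfalso; move: ij; rewrite ei ej; have := ltn_ord i'; have := ltn_ord j'; clear; lia.
- exfalso; move: ij h; rewrite ej; have := ltn_ord j'; clear; lia.
Qed.

Lemma serre_diff0r x : serre_diff v x 0 = 0 :> A.
Proof. by rewrite /serre_diff !mulr0 !mul0r scaler0 addr0 subr0. Qed.
Lemma serre_diff0l x : serre_diff v 0 x = 0 :> A.
Proof. by rewrite /serre_diff !(mulr0, mul0r) scaler0 addr0 subr0. Qed.
Lemma serre_diff_eq (x y z : A) : x ^+ 2 * y + y * x ^+ 2 = (v + v^-1) *: (x * y * x - z) ->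
  serre_diff v x y = (- (v + v^-1)) *: z.
Proof. by rewrite /serre_diff expr2 => ->; rewrite scalerBr scaleNr addrAC subrr add0r. Qed.
Lemma serre_diff_eq0 (x y : A) : x ^+ 2 * y + y * x ^+ 2 = (v + v^-1) *: (x * y * x) -> serre_diff v x y = 0.
Proof. by rewrite /serre_diff expr2 => ->; rewrite subrr. Qed.

(** An error occurs only between e_n and f_n, the letters n-1 and n: three letters are replaced by
    one letter and torus elements. *)
Lemma urel_serre u u' i :
  low (size u + size u' + 3) (wp phi u * serre_diff v (phi i) (phi i.+1) * wp phi u') /\
  low (size u + size u' + 3) (wp phi u * serre_diff v (phi i.+1) (phi i) * wp phi u').
Proof.
case: (letterP i.+1) => [[j ej]|[j ej]|/phi_out ->]; last first.
- by rewrite serre_diff0r serre_diff0l; split; exact: lowspan0.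
- case: (letterP i) => [[k ek]|[k ek]|h].
  + have kj : k = j by apply: ord_inj; move: ej; rewrite ek; have := ltn_ord j; have := ltn_ord k; clear; lia.
    have kn : k.+1 = n by move: ej; rewrite ek kj; have := ltn_ord j; clear; lia.
    rewrite ej -kj phi_f ek phi_e; split.
    * rewrite (serre_diff_eq (rel (Ueef _ _ _ _ kn))) -scalerAr -scalerAl; apply: spanZ.
      rewrite mulrA -phi_e -[phi k]mulr1 -(wp0 phi) -wp_cons -wp_cat; apply: low_sc.
        by rewrite size_cat /=; clear; lia.
      by apply: sc_D; apply: sc_Z; apply: sc_M; (exact: sc_d || exact: sc_dV).
    * rewrite (serre_diff_eq (rel (Uffe _ _ _ _ kn))) -scalerAr -scalerAl; apply: spanZ.
      rewrite -!mulrA -phi_f -wp_cons mulrA; apply: low_sc.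
        by rewrite /= !addnS addn0.
      by apply: sc_D; apply: sc_Z; apply: sc_M; (exact: sc_d || exact: sc_dV).
  + have h1 : adj_idx k j /\ adj_idx j k.
      by rewrite /adj_idx; move: ej; rewrite ek; have := ltn_ord j; have := ltn_ord k; clear; lia.
    rewrite ej ek !phi_f (serre_diff_eq0 (rel (Ufff _ _ _ _ h1.1))) (serre_diff_eq0 (rel (Ufff _ _ _ _ h1.2))).
    by split; exact: lowspan0.
  + exfalso; move: ej h; have := ltn_ord j; clear; lia.
case: (letterP i) => [[k ek]|[k ek]|h].
- have h1 : adj_idx k j /\ adj_idx j k.
    by rewrite /adj_idx; move: ej; rewrite ek; have := ltn_ord j; have := ltn_ord k; clear; lia.
  rewrite ej ek !phi_e (serre_diff_eq0 (rel (Ueee _ _ _ _ h1.1))) (serre_diff_eq0 (rel (Ueee _ _ _ _ h1.2))).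
  by split; exact: lowspan0.
- exfalso; move: ej; rewrite ek; have := ltn_ord j; have := ltn_ord k; clear; lia.
- exfalso; move: ej h; have := ltn_ord j; clear; lia.
Qed.

Definition wspan := span (fun z => leftJ z \/ exists s, z = wp phi s).

Lemma wspan_letter r y : wspan y -> wspan (phi r * y).
Proof.
apply: (span_map (lm_mull _)) => z [h|[s ->]]; apply: span1; first by left; exact: leftJM.
by right; exists (r :: s); rewrite wp_cons.
Qed.
Lemma wspan_sc x y : sc x -> wspan y -> wspan (x * y).
Proof.
move=> hx; apply: (span_map (lm_mull _)) => z [h|[s ->]]; first by apply: span1; left; exact: leftJM.
have [c hc] := hx s; rewrite -[_ * _](subrK (c *: wp phi s)); apply: spanD; first by apply: span1; left.
by apply: spanZ; apply: span1; right; exists s.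
Qed.

Lemma std_wspan y : wspan y -> span (fun z => leftJ z \/ exists2 s, stdw n.*2 n.*2 0 s & z = wp phi s) y.
Proof.
apply: span_sub => z [h|[s ->]]; first by apply: span1; left.
apply: (serre_filtration v_neq0 (qn_neq0 v_neq0 v_free) phi_out urel_far urel_serre).
Qed.
End UrelSpan.

Section UjSpan.
Variable n : nat.
Local Notation ue := (fun i : 'I_n => Uj_gen (ge i)).
Local Notation uf := (fun i : 'I_n => Uj_gen (gf i)).
Local Notation ud := (fun a : 'I_n.+1 => Uj_gen (gd a)).
Local Notation udV := (fun a : 'I_n.+1 => Uj_gen (gdV a)).

Lemma Urel_image (A B : lalgType Qv) (h : A -> B) e f d dV : lin_map h -> {morph h : x y / x * y} -> h 1 = 1 ->
  (forall l r, @Urel n A e f d dV l r -> h l = h r) ->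
  forall l r, Urel (fun i => h (e i)) (fun i => h (f i)) (fun a => h (d a)) (fun a => h (dV a)) l r -> l = r.
Proof.
move=> hl hM h1 hr l r; have h2 x : h (x ^+ 2) = h x ^+ 2 by rewrite !expr2 hM.
have hif (b : bool) x : h (if b then x else 0) = if b then h x else 0 by case: b; rewrite ?(lm0 hl).
pose hE := (lmB hl, lmD hl, lmZ hl, hM, h2, h1, hif).
case=> [a|a|a b|a j|a j|i j nij|i j ij|i j ij|i j ij|i j ij|i ni|i ni].
- by have := hr _ _ (Udv e f d dV a); rewrite !hE.
- by have := hr _ _ (Uvd e f d dV a); rewrite !hE.
- by have := hr _ _ (Udd e f d dV a b); rewrite !hE.
- by have := hr _ _ (Ude e f d dV a j); rewrite !hE.
- by have := hr _ _ (Udf e f d dV a j); rewrite !hE.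
- by have := hr _ _ (Uef e f d dV nij); rewrite !hE.
- by have := hr _ _ (Ueee e f d dV ij); rewrite !hE.
- by have := hr _ _ (Ufff e f d dV ij); rewrite !hE.
- by have := hr _ _ (Uee e f d dV ij); rewrite !hE.
- by have := hr _ _ (Uff e f d dV ij); rewrite !hE.
- by have := hr _ _ (Uffe e f d dV ni); rewrite !hE.
- by have := hr _ _ (Ueef e f d dV ni); rewrite !hE.
Qed.

Fact Uj_pi_lm : lin_map (@Uj_pi n).
Proof. by move=> a x y; rewrite Uj_piD Uj_piZ. Qed.

Lemma Uj_rel l r : Urel ue uf ud udV l r -> l = r.
Proof.
apply: (Urel_image Uj_pi_lm (@Uj_piM n) (@Uj_pi1 n)) => x y hr; apply/Uj_pi_eq.
have -> : x - y = 0 + 1 * (x - y) * 1 by rewrite add0r mul1r mulr1.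
by apply: UidealD; [left|exact: hr].
Qed.

Lemma Ufree_ind (P : Ufree n -> Prop) : (forall c x y, P x -> P y -> P (c *: x + y)) -> P 0 ->
  P 1 -> (forall g x, P x -> P (Ugen g * x)) -> forall x, P x.
Proof.
move=> PD P0 P1 PM x; rewrite [x]malg_sumE; elim/big_ind: _ => // [y z hy hz|m _].
  by rewrite -[y]scale1r; exact: PD.
rewrite -[_ *: _]addr0; apply: (PD) => //; case: m => s; elim: s => [|g s IH].
  have -> : << FMonom [::] >> = 1 :> Ufree n by rewrite free_1; congr << _ >>; apply: val_inj => /=; exact/esym/fm1.
  exact: P1.
have -> : << FMonom (g :: s) >> = Ugen g * << FMonom s >> :> Ufree n; last exact: PM.
rewrite /Ugen free_mulUU; congr << _ >>; apply: val_inj => /=.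
by apply: etrans (esym (fmM _ _)); rewrite fmuE.
Qed.

Definition up : nat -> Uj n := phi ue uf.

Lemma Uj_span (kap : 'I_n.+1 -> Qv) (x : Uj n) : (forall a, kap a != 0) ->
  span (fun z => leftJ ud kap z \/ exists2 s, stdw n.*2 n.*2 0 s & z = wp up s) x.
Proof.
move=> kap0; apply: (std_wspan Uj_rel kap0); have [x' ->] := Uj_piP x.
move: x'; apply: Ufree_ind => [c y z hy hz||| g y hy].
- by rewrite Uj_pi_lm; apply: spanD => //; exact: spanZ.
- rewrite (lm0 Uj_pi_lm); exact: Span0.
- by rewrite Uj_pi1; apply: span1; right; exists [::]; rewrite wp0.
rewrite Uj_piM; case: g => [i|i|a|a].
- have := wspan_letter i hy; rewrite phi_e; exact.
- have := wspan_letter (n.*2.-1 - i) hy; rewrite phi_f; exact.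
- apply: wspan_sc hy; exact: (sc_d Uj_rel).
- apply: wspan_sc hy; exact: (sc_dV Uj_rel).
Qed.
End UjSpan.

Fact scale_split (F : pzRingType) (V : lmodType F) (u g : F) (a S X : V) :
  u *: (g *: a + S) + X = (u * g) *: a + (u *: S + X).
Proof. by rewrite scalerDr scalerA addrA. Qed.

Fact sumD1 (I : finType) (V : zmodType) (f : I -> V) j : \sum_i f i = f j + \sum_(i | i != j) f i.
Proof. by rewrite (bigD1 j). Qed.

(** * Words and matrices *)

Section WordOf.
Variable n : nat.
Local Notation N := (dimN n).
Implicit Types (A B : tXi n) (M : 'M[int]_N) (r : 'I_(n.*2)) (p j : 'I_N) (s : seq nat).

(* The word of A records its successive last moves, the latest first. *)
Inductive wordof : tXi n -> seq nat -> Prop :=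
  | WO_diag A : is_diag_mx (val A) -> wordof A [::]
  | WO_step A0 A r j s : wordof A0 s -> last_move (val A) r j -> val A = val A0 + mv r j ->
      wordof A (val r :: s).

Lemma last_move_uniq M r j r' j' : last_move M r j -> last_move M r' j' -> r = r' /\ j = j'.
Proof.
have h r1 j1 r2 j2 : last_move M r1 j1 -> last_move M r2 j2 -> (j1 <= j2)%N.
  move=> [_ _ h1 _] [h2 h3 _ _]; rewrite leqNgt; apply/negP => jj.
  by move: h3; rewrite h1 // /= /bump /= ltnS.
move=> l l'; have e : j = j' by apply: ord_inj; apply/eqP; rewrite eqn_leq !(h _ _ _ _ l l', h _ _ _ _ l' l).
split=> //; rewrite -e in l'; have g r1 r2 : last_move M r1 j -> last_move M r2 j -> (r1 <= r2)%N.
  move=> [_ h3 _ _] [_ _ _ h1]; rewrite leqNgt; apply/negP => rr.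
  by move: h3; rewrite h1.
by apply: ord_inj; apply/eqP; rewrite eqn_leq !(g _ _ l l', g _ _ l' l).
Qed.

Lemma last_move_diag M r j : last_move M r j -> ~~ is_diag_mx M.
Proof.
move=> [jr h _ _]; apply/negP => /is_diag_mxP h0; move: h; rewrite h0 //.
by apply: contraTneq jr => e; rewrite -ltnNge -e /= /bump.
Qed.

Lemma wordof_inv A s : wordof A s -> (is_diag_mx (val A) /\ s = [::]) \/
  exists A0 r j s', [/\ wordof A0 s', last_move (val A) r j, val A = val A0 + mv r j & s = val r :: s'].
Proof. by case=> [{}A dA|A0 {}A r j {}s w lm e]; [left|right; exists A0, r, j, s]. Qed.

Lemma wordof_uniq A s s' : wordof A s -> wordof A s' -> s = s'.
Proof.
move=> h; elim: h s' => [{}A dA|A0 {}A r j {}s w IH lm e] s' /wordof_inv.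
  by case=> [[_ ->//]|[A0 [r [j [s2 [_ /last_move_diag]]]]]]; rewrite dA.
case=> [[dA _]|[A0' [r' [j' [s2 [w' lm' e' ->]]]]]]; first by have := last_move_diag lm; rewrite dA.
have [er ej] := last_move_uniq lm lm'; rewrite -er (IH s2) //.
suff -> : A0 = A0' by []; apply: val_inj; apply: (addIr (mv r j)).
by apply: etrans (esym e) (etrans e' _); rewrite er ej.
Qed.

Lemma wordof_ex A : exists s, wordof A s.
Proof.
have [k] := ubnP `|mu (val A)|%N; elim: k => // k IH in A *; rewrite ltnS => hk.
have muA := mu_ge0 (@tXi_offdiag _ A).
case: (boolP (is_diag_mx (val A))) => [dA|/(last_move_ex (tXi_rot A) (@tXi_offdiag _ A)) [r [j lm]]].
  by exists [::]; exact: WO_diag.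
pose A0 : tXi n := exist (fun M => is_true (in_tXi M)) _ (tXi_minus_move lm).
have [s ws] : exists s, wordof A0 s.
  apply: IH; have := mu_ge0 (@tXi_offdiag _ A0); have := mu_last_move lm; rewrite -[val A - _]/(val A0).
  by move: (mu (val A)) (mu (val A0)) hk muA => a b; nlia.
exists (val r :: s); apply: (@WO_step A0 A r j s ws lm); by rewrite /= subrK.
Qed.

Definition wof A : seq nat := projT1 (cid (wordof_ex A)).
Lemma wofP A : wordof A (wof A). Proof. exact: projT2 (cid (wordof_ex A)). Qed.

Definition below A B := (forall i k, (k <= i < N)%N -> low (val B) i k <= low (val A) i k) /\ mu (val B) < mu (val A).

Lemma muD M M' : mu (M + M') = mu M + mu M'.
Proof. by rewrite /mu -big_split; apply: eq_bigr => i _; rewrite -big_split; apply: eq_bigr => k _; rewrite lowD. Qed.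

(** Left of column [j] nothing lies below the diagonal of [A0], so the corner sum at (r, p+1) is 0
    for [A0] and not positive for [B0]. Hence [B0] has no unit to move in column p < j. *)
Lemma no_left_move_below A A0 B0 B r j p : last_move (val A) r j -> val A = val A0 + mv r j ->
  (forall i k, (k <= i < N)%N -> low (val B0) i k <= low (val A0) i k) -> val B = val B0 + mv r p -> (j <= p)%N.
Proof.
move=> [jr _ h0 _] e le eB; rewrite leqNgt; apply/negP => pj; have rN := ltn_ord r; have jN := ltn_ord j.
have hA (k l : 'I_N) : (l < j)%N -> (l < k)%N -> val A0 k l = 0.
  move=> lj lk; have := h0 k l lj lk; rewrite e addmvE; have := ltn_ord k; move: (val A0 k l) lj lk => x; nlia.
have lA : low (val A0) r p.+1 = 0.
  rewrite low_sum big1 // => k rk; rewrite big1 // => l lp; apply: hA; nlia.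
have := le r p.+1 _; rewrite lA low_sum (bigD1 (rlo r)) //= (bigD1 p) //= => /(_ _) h.
have off (k l : 'I_N) : (r <= k)%N -> (l < p.+1)%N -> 0 <= val B0 k l.
  move=> rk lp; apply: (@tXi_offdiag _ B0); rewrite -val_eqE /=; nlia.
have h1 : val B0 (rlo r) p <= 0.
  apply: le_trans (h _); last by nlia.
  rewrite -addrA lerDl addr_ge0 //; apply: sumr_ge0 => i /andP[h1 _]; first exact: off.
  by apply: sumr_ge0 => l lp; apply: off.
have := @tXi_offdiag _ B (rlo r) p; rewrite eB addmvE -val_eqE /= => /(_ _) h2.
have : ~~ (nat_of_ord r == p) by nlia.
move/h2; move: (val B0 (rlo r) p) h1 => x; have := ltn_ord p; nlia.
Qed.

Definition lowers A := span (fun z => exists2 B : tXi n, z = << B >> :> QKj n & below A B).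

(** A move in column [j] changes the corner sums of both matrices equally; a move further right adds
    at most as much to them and less to [mu]. *)
Lemma below_move A A0 B0 B r j p : last_move (val A) r j -> val A = val A0 + mv r j ->
  (forall i k, (k <= i < N)%N -> low (val B0) i k <= low (val A0) i k) -> mu (val B0) <= mu (val A0) ->
  (p != j) || (mu (val B0) < mu (val A0)) ->
  val B = val B0 + mv r p -> below A B.
Proof.
move=> lm e le lemu h eB; have := no_left_move_below lm e le eB; rewrite leq_eqVlt => /orP[/eqP/ord_inj ejp|jp].
  split=> [i k ik|]; first by rewrite eB e ejp !lowD lerD2r le.
  by rewrite eB e -ejp !muD ltrD2r; move: h; rewrite -ejp eqxx.
split=> [i k ik|].
  rewrite eB e (lowD (val B0)) (lowD (val A0)); apply: lerD; first exact: le.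
  exact: low_exchange.
have := mu_exchange lm (val A) jp; rewrite eB e addrK (muD (val B0)) (muD (val A0)).
by move=> h'; apply: le_lt_trans h'; rewrite lerD2r.
Qed.

Fixpoint ew s (z : QKj n) : QKj n :=
  if s is r :: s' then (if insub r is Some r' then Er r' (ew s' z) else 0) else z.

Lemma ew_cons r s z : ew (val r :: s) z = Er r (ew s z).
Proof. by rewrite /= valK. Qed.

(** The next letter applied to the leading term gives [A] and moves in other columns; applied to a
    lower matrix it gives lower ones by [below_move], so [A] is not reached a second time. *)
Lemma ew_lead A s : wordof A s -> exists2 u : Qv, u != 0 &
  exists2 x, lowers A x & ew s << val (co A) >> = u *: << A >> + x.
Proof.
elim=> [{}A dA|A0 {}A r j {}s w [u u0 [x hx IH]] lm e].
  exists 1; first exact: oner_neq0; exists 0; first exact: Span0.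
  have -> : A = val (exist (fun M : tXi n => is_true (is_diag_mx (val M))) A dA) by [].
  by rewrite co_diag /= scale1r addr0.
have [jr _ _ _] := lm; exists (u * gcoef (val A0) r j).
  apply: (mulf_neq0 u0); apply: gcoef_neq0; apply: (@tXi_offdiag _ A0).
  by rewrite -val_eqE /= /bump /=; nlia.
have main B0 p : (forall i k, (k <= i < N)%N -> low (val B0) i k <= low (val A0) i k) -> mu (val B0) <= mu (val A0) ->
  (p != j) || (mu (val B0) < mu (val A0)) -> lowers A (tb (val B0 + mv r p)).
  move=> h1 h2 h3; have [[B eB ->]|[_ ->]] := tbP Qv (val B0 + mv r p); last exact: Span0.
  by apply: span1; exists B => //; exact: below_move lm e h1 h2 h3 eB.
exists (u *: \sum_(p | p != j) gcoef (val A0) r p *: tb (val A0 + mv r p) + Er r x).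
  apply: spanD; first by apply: spanZ; apply: span_sum => p pj; apply: spanZ; apply: main; rewrite ?pj.
  apply: (span_map (Er_lm r) _ hx) => _ [B -> [h1 h2]]; rewrite Er1.
  by apply: span_sum => p _; apply: spanZ; apply: main; rewrite ?h2 ?orbT // ltW.
have eEr : Er r << A0 >> = gcoef (val A0) r j *: << A >> + \sum_(p | p != j) gcoef (val A0) r p *: tb (val A0 + mv r p).
  apply: etrans (Er1 _ _) (etrans (sumD1 _ j) _); apply: (congr1 (fun z => _ *: z + _)).
  by rewrite -e; exact: tb_val.
apply: etrans (ew_cons r s _) _; apply: etrans (congr1 (fun mu => Er r (ew s << val mu >>)) (co_move e)) _.
apply: etrans (congr1 (Er r) IH) (etrans (Er_lm r u _ _) _).
by apply: etrans (congr1 (fun z => u *: z + Er r x) eEr) (scale_split _ _ _ _ _).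
Qed.
End WordOf.

Section StdWords.
Variable n : nat.
Local Notation N := (dimN n).
Implicit Types (A B : tXi n) (M : 'M[int]_N) (r : 'I_(n.*2)) (p : 'I_N) (s : seq nat).

Definition clear_cols (j : nat) M := forall k l : 'I_N, (l < j)%N -> (l < k)%N -> M k l = 0.

(* Column [j] of [A] below row [k] when [t] letters [k] have been added to a
   block whose previous letter occurs [u] times. *)
Definition block_state (j k t u : nat) (c : nat -> nat) mu s A :=
  [/\ co A = mu, wordof A s, clear_cols j (val A)
    & forall i l : 'I_N, l = j :> nat -> (j < i)%N ->
       val A i l = if (k.+1 < i)%N then 0 else if i == k.+1 :> nat then t%:Z else
                   if i == k :> nat then u%:Z - t%:Z else val A i l].

(** The letter [k] carries a unit of column [j] from row k to row k+1. For k > j the unit must have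
    been placed there before; for k = j it comes from the diagonal, whose entry may be any
    integer. *)
Lemma block_step j k t u c mu s A : (j <= k < n.*2)%N -> (t < u)%N || (k == j) ->
  block_state j k t u c mu s A -> exists B, block_state j k t.+1 u c mu (k :: s) B.
Proof.
move=> /andP[jk kN] tu [coA wA cl col].
have jN : (j < N)%N by rewrite ltnS (leq_trans jk) // ltnW.
pose r := Ordinal kN; pose J : 'I_N := Ordinal jN.
have hin : in_tXi (val A + mv r J).
  apply: in_tXi_mv; first exact: valP A.
  case: eqVneq => //= nJ; have jk' : (j < k)%N.
    by rewrite ltn_neqAle jk andbT; apply: contraNneq nJ => e; apply/eqP/ord_inj.
  rewrite (col (rlo r) J) //= ltnNge leqnSn /= (ltn_eqF (ltnSn k)) eqxx.
  by move: tu; rewrite gtn_eqF // orbF; clear; lia.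
have [B eB] : exists B : tXi n, val B = val A + mv r J by exists (exist (fun M => is_true (in_tXi M)) _ hin).
have colB : forall i l : 'I_N, l = j :> nat -> (j < i)%N ->
       val B i l = if (k.+1 < i)%N then 0 else if i == k.+1 :> nat then t.+1%:Z else
                   if i == k :> nat then u%:Z - t.+1%:Z else val B i l.
  move=> i l lj ji; case: (ltngtP i k.+1) => hi; last first.
  - rewrite eB addmvE (col i l lj ji) hi ltnn eqxx /= lj; have := ltn_ord i; nlia.
  - rewrite eB addmvE (col i l lj ji) hi /= lj; have := ltn_ord i; nlia.
  case: eqP => // ik; rewrite eB addmvE (col i l lj ji) ltnNge (ltnW hi) /= (ltn_eqF hi) ik eqxx /= lj; nlia.
have clB : clear_cols j (val B).
  by move=> i l lj li; rewrite eB addmvE (cl i l lj li) /=; have := ltn_ord i; nlia.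
exists B; split=> //; first by rewrite (co_move eB).
apply: (@WO_step n A B r J) => //; split=> //.
- by rewrite (colB (rhi r) J) //= /bump /= ?ltnn ?eqxx // ltnS.
- move=> i; rewrite /= => ki; rewrite (colB i J) // ?ki //; exact: leq_ltn_trans jk (ltnW ki).
Qed.

Lemma block_letter j k u c mu s A t : (j <= k < n.*2)%N -> (t <= u)%N || (k == j) ->
  block_state j k 0 u c mu s A -> exists B, block_state j k t u c mu (nseq t k ++ s) B.
Proof.
move=> jk; elim: t => [|t IH] tu h; first by exists A.
have [|B hB] := IH _ h; first by case/orP: tu => [/ltnW ->//|->]; rewrite orbT.
exact: block_step jk tu hB.
Qed.

Lemma block_word j k c mu s A : (k <= n.*2)%N -> mono j k c -> co A = mu -> wordof A s -> clear_cols j.+1 (val A) ->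
  exists B, [/\ co B = mu, wordof B (dsc j k c ++ s), clear_cols j (val B)
    & forall i l : 'I_N, l = j :> nat -> (j < i)%N -> (k < i)%N || (k == i) ->
        val B i l = if (k < i)%N then 0 else (c k.-1)%:Z].
Proof.
elim: k => [|k IH] kn mc coA wA cl.
  exists A; split=> // [i l lj li|i l lj ji _]; first by apply: cl => //; rewrite ltnS ltnW.
  by rewrite (leq_ltn_trans _ ji) // cl ?lj.
have [|B [coB wB clB colB]] := IH (ltnW kn) _ coA wA cl.
  by move=> i ji ik; apply: mc => //; exact: ltnW.
have [jk|kj] := leqP j k; last first.
  exists B; split=> //=; first by rewrite leqNgt kj.
  move=> i l lj ji h; rewrite (colB i l lj ji); last by rewrite (ltn_trans kj).
  have ki : (k < i)%N by apply: ltn_trans kj ji.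
  by rewrite ki; case: ltnP => // ik; move: kj ji ik; clear; lia.
(* Row [k] of column [j] holds the units brought there by the letter k-1. For k = j the value is a
   dummy: [block_state] describes only rows below [j]. *)
have hB : block_state j k 0 (c k.-1) c mu (dsc j k c ++ s) B.
  split=> // i l lj ji; case: (ltngtP i k.+1) => hi; last 1 first.
  - by rewrite (colB i l lj ji) hi ?ltnSn.
  - case: eqP => [ik|//]; rewrite (colB i l lj ji) ?ik ?eqxx ?orbT // ltnn subr0 //.
  - by rewrite (colB i l lj ji) (ltnW hi).
have jk2 : (j <= k < n.*2)%N by rewrite jk.
have cc : (c k <= c k.-1)%N || (k == j).
  case: eqVneq => [->|nkj]; first by rewrite orbT.
  case: k => [|k] in kn mc jk nkj {IH colB hB jk2 wB} *; first by move: jk nkj; case: (j).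
  rewrite orbF; apply: mc => //; move: jk nkj; clear; lia.
have [C [coC wC clC colC]] := block_letter jk2 cc hB.
exists C; split=> //=; first by rewrite jk -catA.
move=> i l lj ji h; rewrite (colC i l lj ji); case: (ltngtP i k.+1) h => // hi _.
Qed.

(** The columns are filled from right to left: the block for [j] acts while the columns left of [j]
    are still empty below the diagonal, so each of its letters is a last move. This bounds the
    spanning set of a block of U^j by matrices. *)
Lemma stdw_wordof t j s mu : (j + t = n.*2)%N -> stdw n.*2 t j s ->
  exists A, [/\ co A = mu, wordof A s & clear_cols j (val A)].
Proof.
elim: t j s => [|t IH] j s jt /=.
  move=> ->; exists (val mu); split; [exact: co_diag|exact: WO_diag (valP mu)|].
  move=> k l _ lk; have /is_diag_mxP -> // := valP mu; apply: contraTneq lk => ->; by rewrite ltnn.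
case=> c [s' [mc -> hs']]; have [|A [coA wA clA]] := IH j.+1 s' _ hs'; first by rewrite addSnnS.
have [B [coB wB clB _]] := block_word (leqnn _) mc coA wA clA.
by exists B.
Qed.
End StdWords.

(** * Weights of words and the triangular comparison map *)

Fact conj_mul (A : pzRingType) (d dV x y : A) : dV * d = 1 -> d * (x * y) * dV = (d * x * dV) * (d * y * dV).
Proof. by move=> e; rewrite !mulrA -(mulrA _ dV d) e mulr1. Qed.
Fact conj_scale (F : fieldType) (A : algType F) (d dV x y : A) (w : F) (k l m : int) : w != 0 -> dV * d = 1 ->
  d * x * dV = w ^ k *: x -> d * y * dV = w ^ l *: y -> m = k + l -> d * (x * y) * dV = w ^ m *: (x * y).
Proof.
by move=> w0 e hx hy ->; rewrite (conj_mul _ _ e) hx hy -scalerAl -scalerAr scalerA expfzDr.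
Qed.

Fact conj_move (F : fieldType) (A : algType F) (d dV x : A) (c : F) : dV * d = 1 ->
  d * x * dV = c *: x -> d * x = c *: (x * d).
Proof. by move=> e h; rewrite scalerAl -h -(mulrA _ dV) e mulr1. Qed.

(** [s a * x] and [x * t a] both lie in the span; when the weight of [x] does not match, a
    combination of them is a nonzero multiple of [x]. *)
Fact side_span_eigen (F : fieldType) (A : algType F) (I : finType) (s t : I -> A) a d x (c k l : F) :
  s a = d - l%:A -> t a = d - k%:A -> d * x = c *: (x * d) -> c * k - l != 0 -> side_span s t x.
Proof.
move=> es et e k0; have [J0 Jl] := side_span_submod s t.
have h1 : side_span s t (s a * x).
  apply/asboolP; exists (fun b => if b == a then x else 0), (fun=> 0).
  rewrite [X in _ = _ + X]big1 ?addr0 => [|b _]; last by rewrite mul0r.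
  by rewrite (bigD1 a) //= eqxx big1 ?addr0 // => b /negbTE ->; rewrite mulr0.
have h2 : side_span s t (x * t a).
  apply/asboolP; exists (fun=> 0), (fun b => if b == a then x else 0).
  rewrite [X in _ = X + _]big1 ?add0r => [|b _]; last by rewrite mulr0.
  by rewrite (bigD1 a) //= eqxx big1 ?addr0 // => b /negbTE ->; rewrite mul0r.
have -> : x = (c * k - l)^-1 *: ((- c) *: (x * t a) + s a * x) + 0.
  rewrite addr0 es et mulrBl mulrBr e -scalerAl -scalerAr mul1r mulr1 scalerBr !scaleNr opprK scalerA.
  by rewrite addrA [- _ + _]addrC subrK -scalerBl scalerA mulVf ?scale1r.
by apply: (Jl) J0; exact: (Jl).
Qed.

Fact exp_cancel (F : fieldType) (w : F) (x y : int) : w != 0 -> w ^ (x - y) * w ^ (- x) = w ^ (- y).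
Proof. by move=> w0; rewrite -expfzDr // addrAC subrr add0r. Qed.

Lemma seq_argmax (T : eqType) (f : T -> int) (s : seq T) : s <> [::] ->
  exists2 a, a \in s & forall b, b \in s -> f b <= f a.
Proof.
elim: s => // a s IH _; case: (altP (s =P [::])) => [->|/eqP/IH [b bs h]].
  by exists a; rewrite ?mem_head // => b; rewrite inE => /eqP ->.
case: (leP (f b) (f a)) => hab.
  exists a; first exact: mem_head.
  by move=> c; rewrite inE => /orP[/eqP ->//|/h hc]; apply: le_trans hc hab.
exists b; first by rewrite inE bs orbT.
by move=> c; rewrite inE => /orP[/eqP ->|/h //]; exact: ltW.
Qed.

Section Words.
Variable n : nat.
Local Notation N := (dimN n).
Implicit Types (A B : tXi n) (r : 'I_(n.*2)) (la mu : tXi_diag n) .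

Fact dVd a : Uj_gen (gdV a) * Uj_gen (gd a) = 1 :> Uj n.
Proof. exact: Uj_rel (Uvd _ _ _ _ a). Qed.
Fact ddV a : Uj_gen (gd a) * Uj_gen (gdV a) = 1 :> Uj n.
Proof. exact: Uj_rel (Udv _ _ _ _ a). Qed.

Lemma letter_cases r : (exists2 i : 'I_n, r = eix i & up n r = Uj_gen (ge i)) \/
  (exists2 i : 'I_n, r = fix_ i & up n r = Uj_gen (gf i)).
Proof.
case: (letterP n r) => [[i e]|[i e]|h].
- by left; exists i; [exact: ord_inj|rewrite e; exact: phi_e].
- right; exists i; last by rewrite e; exact: phi_f.
  by apply: ord_inj; rewrite e /=; clear; have := ltn_ord i; lia.
- by have := ltn_ord r; rewrite ltnNge h.
Qed.

Lemma act_letter r z : actU (up n r) z = Er r z.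
Proof. by case: (letter_cases r) => [[i -> ->]|[i -> ->]]; rewrite actU_gen. Qed.

Lemma act_wp s z : actU (wp (up n) s) z = ew s z.
Proof.
elim: s => [|r s IH]; first by rewrite wp0 actU1.
rewrite wp_cons actUM IH /=; case: insubP => [r' _ <-|h]; first exact: act_letter.
have -> : up n r = 0 by apply: phi_out; rewrite leqNgt.
exact: lm0 (actU_lm _).
Qed.

Lemma letter_weight r a : Uj_gen (gd a) * up n r * Uj_gen (gdV a) = v ^ (- mvw r a) *: up n r.
Proof.
case: (letter_cases r) => [[i -> ->]|[i -> ->]].
  apply: etrans (Uj_rel (Ude _ _ _ _ a i)) _; congr (v ^ _ *: _); rewrite /mvw /wt_e /=.
  have := ltn_ord a; have := ltn_ord i; clear; lia.
apply: etrans (Uj_rel (Udf _ _ _ _ a i)) _; congr (v ^ _ *: _); rewrite /mvw /wt_f /= ?subSS.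
have := ltn_ord a; have := ltn_ord i; clear; lia.
Qed.

Lemma homog_mul la mu nu x y : homog la mu x -> homog mu nu y -> homog la nu (x * y).
Proof.
by move=> hx hy a; apply: (conj_scale v_neq0 (dVd a) (hx a) (hy a)); rewrite [RHS]addrC addrA subrK.
Qed.

Lemma homog_1 la : homog la la 1.
Proof. by move=> a; rewrite mulr1 ddV subrr expr0z scale1r. Qed.

Lemma homog_word A s : wordof A s -> homog (ro A) (co A) (wp (up n) s).
Proof.
elim=> [{}A dA|A0 {}A r j {}s w IH lm e].
  have -> : A = val (exist (fun M : tXi n => is_true (is_diag_mx (val M))) A dA) by [].
  by rewrite ro_diag co_diag wp0; exact: homog_1.
rewrite (co_move e) wp_cons; move=> a.
apply: (conj_scale v_neq0 (dVd a) (letter_weight r a) (IH a)).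
by rewrite (diag_ent_mv a e) opprD; ring.
Qed.

Lemma homog_in_J la la' mu x : homog la' mu x -> la != la' -> in_J la mu x.
Proof.
move=> hx nl; have [a na] : exists a, diag_ent la' a != diag_ent la a.
  apply/existsP; apply: contraR nl => /existsPn h; apply/eqP/diag_ent_inj => a.
  by have := h a; rewrite negbK => /eqP.
have k0 : v ^ (- diag_ent la' a) - v ^ (- diag_ent la a) != 0.
  rewrite subr_eq0; apply: contra na => /eqP/v_expz_inj/oppr_inj ->; exact: eqxx.
apply: (side_span_eigen (a := a) (erefl _) (erefl _) (conj_move (dVd a) (hx a))).
rewrite (exp_cancel _ _ v_neq0); exact: k0.
Qed.

Lemma leftJ_in_J la mu x : leftJ (fun a => Uj_gen (gd a)) (fun a => v ^ (- diag_ent mu a)) x -> in_J la mu x.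
Proof.
move=> [z ->]; apply/asboolP; exists (fun=> 0), z.
by rewrite [X in _ = X + _]big1 ?add0r // => a _; rewrite mulr0.
Qed.

Definition word_map : QKj n -> QKj n := locked (lin (fun A => ew (wof A) << val (co A) >>)).
Lemma word_map_lm : lin_map word_map.
Proof. by rewrite /word_map -lock; exact: lin_lm. Qed.
Lemma word_map1 A : word_map << A >> = ew (wof A) << val (co A) >>.
Proof. by rewrite /word_map -lock lin1. Qed.

Lemma word_map_lead A : exists2 u : Qv, u != 0 & exists2 x, lowers A x & word_map << A >> = u *: << A >> + x.
Proof. by rewrite word_map1; exact: ew_lead (wofP A). Qed.

Lemma word_map_surj (x : QKj n) : exists y : QKj n, word_map y = x.
Proof.
have base A : exists y : QKj n, word_map y = << A >>.
  have [k] := ubnP `|mu (val A)|%N; elim: k => // k IH in A *; rewrite ltnS => hk.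
  have muA := mu_ge0 (@tXi_offdiag _ A); have [u u0 [x' hx e]] := word_map_lead A.
  have [y ey] : exists y : QKj n, word_map y = x'.
    elim: hx => [|c _ z [B -> [_ muB]] _ [y <-]]; first by exists 0; exact: lm0 word_map_lm.
    have [|y' e'] := IH B; last by exists (c *: y' + y); rewrite word_map_lm e'.
    have := mu_ge0 (@tXi_offdiag _ B).
    by move: (mu (val A)) (mu (val B)) muB hk muA => a b; nlia.
  exists (u^-1 *: (<< A >> - y)); rewrite (lmZ word_map_lm) (lmB word_map_lm) e ey addrK scalerA mulVf ?scale1r //.
rewrite [x]malg_sumE; elim/big_ind: _ => [|y z [y' <-] [z' <-]|A _].
- by exists 0; exact: lm0 word_map_lm.
- by exists (y' + z'); rewrite (lmD word_map_lm).
- by have [y e] := base A; exists (x@_A *: y); rewrite (lmZ word_map_lm) e.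
Qed.

Lemma lowers_coef A (x : QKj n) B : lowers A x -> ~~ (mu (val B) < mu (val A)) -> x@_B = 0.
Proof.
move=> hx hB; elim: hx => [|c _ y [C -> [_ muC]] _ IH]; first exact: mcoeff0.
rewrite mcoeffD mcoeffZ IH addr0 mcoeffU; case: eqVneq => [e|_]; last by rewrite mulr0.
by move: hB; rewrite -e muC.
Qed.

Fact word_map_coef (u : Qv) A B (x : QKj n) : (u *: << A >> + x)@_B = (A == B)%:R * u + x@_B.
Proof. by rewrite mcoeffD mcoeffZ mcoeffU mulrC. Qed.

(** At a matrix of the support with the largest [mu] no lower terms interfere, so the coefficient of
    the image there is a nonzero multiple of that of [x]. *)
Lemma word_map_inj (x : QKj n) : word_map x = 0 -> x = 0.
Proof.
move=> e; apply: contraTeq isT => x0.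
have ss0 : (msupp x : seq (tXi n)) <> [::].
  move=> s0; move/eqP: x0; apply; rewrite [x]malg_sumE; have -> : \sum_(i <- msupp x) x@_i *: << i >> = \sum_(i <- (msupp x : seq (tXi n))) x@_i *: << i >> :> QKj n by [].
  by rewrite s0 big_nil.
have [A hA Amax] := seq_argmax (fun A => mu (val A)) ss0.
have xA : x@_A != 0 by rewrite mcoeff_neq0.
have := congr1 (fun y : QKj n => y@_A) e; rewrite mcoeff0 [x in word_map x]malg_sumE (lm_sum word_map_lm).
rewrite (raddf_sum (mcoeff A)) (bigD1_seq A) ?fset_uniq //= big1_seq ?addr0 => [|B /andP[BA hB]].
  rewrite (lmZ word_map_lm) mcoeffZ; have [u u0 [y hy ->]] := word_map_lead A.
  rewrite word_map_coef eqxx mul1r (lowers_coef hy) ?ltxx // addr0 => /eqP; rewrite mulf_eq0 (negbTE xA) (negbTE u0) //.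
rewrite (lmZ word_map_lm) mcoeffZ; have [u u0 [y hy ->]] := word_map_lead B.
by rewrite word_map_coef (negbTE BA) mul0r (lowers_coef hy) ?addr0 ?mulr0 // -leNgt Amax.
Qed.
End Words.

Fact moveE (V : zmodType) (a b c : V) : a - b + c = a + (c - b).
Proof. by rewrite addrAC addrA. Qed.

(** * The isomorphism *)

Section Iso.
Variable n : nat.
Local Notation N := (dimN n).
Implicit Types (A B : tXi n) (r : 'I_(n.*2)) (la mu : tXi_diag n) (s : seq nat).

(** Not the inverse of [alephf]: their composite is the triangular map [word_map], see
    [aleph_beth]. *)
Definition beth : QKj n -> Udot n := locked (lin (fun A => Upi (ro A) (co A) (wp (up n) (wof A)))).
Lemma beth_lm : lin_map beth.
Proof. by rewrite /beth -lock; exact: lin_lm. Qed.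
Lemma beth1 A : beth << A >> = Upi (ro A) (co A) (wp (up n) (wof A)).
Proof. by rewrite /beth -lock lin1. Qed.

Lemma aleph_homog la mu (x : Uj n) : homog la mu x -> alephf (Upi la mu x) = actU x << val mu >>.
Proof. by move=> h; rewrite alephf_Upi homog_row. Qed.

Lemma aleph_beth (x : QKj n) : alephf (beth x) = word_map x.
Proof.
move: x; apply: lm_ext => [||A]; [exact: lm_comp (@alephf_lm n) beth_lm|exact: word_map_lm|].
by rewrite beth1 aleph_homog ?word_map1 ?act_wp //; exact: homog_word (wofP A).
Qed.

(** In each block the standard words span modulo the left ideal. Such a word is the word of a matrix
    with column weight [mu]; if its row weight is not [la], its homogeneity makes it vanish in the
    block. *)
Lemma beth_surj (x : Udot n) : exists z, x = beth z.
Proof.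
move: x; apply: Udot_span => [la mu x||x y [z ->] [z' ->]]; first 1 last.
- by exists 0; rewrite (lm0 beth_lm).
- by exists (z + z'); rewrite (lmD beth_lm).
have kap0 a : v ^ (- diag_ent mu a) != 0 := vX_neq0 _.
elim: (Uj_span x kap0) => [|c y y' hy _ [z' e']]; first by exists 0; rewrite (lm0 beth_lm) (lm0 (@Upi_lm n la mu)).
suff [z ez] : exists z, Upi la mu y = beth z by exists (c *: z + z'); rewrite beth_lm Upi_lm ez e'.
case: hy => [hJ|[s hs ->]]; first by exists 0; rewrite (lm0 beth_lm); apply: Upi_J; exact: leftJ_in_J hJ.
have [A [coA wA _]] := stdw_wordof mu (add0n _) hs; have es := wordof_uniq wA (wofP A).
case: (eqVneq la (ro A)) => [->|nl]; first by exists << A >>; rewrite beth1 coA es.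
exists 0; rewrite (lm0 beth_lm) -coA; apply: Upi_J; exact: homog_in_J (homog_word wA) nl.
Qed.

(** [beth] is surjective and its composite with [alephf] is injective. *)
Lemma alephf_inj : injective (@alephf n).
Proof.
move=> x y e; apply/eqP; rewrite -subr_eq0; have [z ez] := beth_surj (x - y).
have : alephf (x - y) = 0 by rewrite (lmB (@alephf_lm n)) e subrr.
by rewrite ez aleph_beth => /word_map_inj ->; rewrite (lm0 beth_lm).
Qed.

Lemma alephf_surj (x : QKj n) : exists y, alephf y = x.
Proof. by have [z <-] := word_map_surj x; exists (beth z); rewrite aleph_beth. Qed.

Definition alephV (x : QKj n) : Udot n := projT1 (cid (alephf_surj x)).
Lemma alephVK x : alephf (alephV x) = x. Proof. exact: projT2 (cid (alephf_surj x)). Qed.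
Lemma alephfK x : alephV (alephf x) = x. Proof. by apply: alephf_inj; rewrite alephVK. Qed.

Lemma aleph_mul_homog la la' mu mu' (x y : Uj n) : homog la la' x -> homog mu mu' y ->
  Qstar (alephf (Upi la la' x)) (alephf (Upi mu mu' y)) = alephf (if la' == mu then Upi la mu' (x * y) else 0).
Proof.
move=> hx hy; rewrite (aleph_homog hx) (aleph_homog hy) -(homog_row hy) Qstar_assoc.
have e : Qstar (actU x << val la' >>) << val mu >> = (mu == la')%:R *: actU x << val la' >>.
  apply: etrans (esym ((actU_rlin x).2 _ _)) _; apply: etrans (congr1 (actU x) (Qstar_unitr _ _)) _.
  by apply: etrans (lmZ (actU_rlin x).1 _ _) _; rewrite co_diag.
apply: etrans (congr1 (fun z => Qstar z (actU y << val mu' >>)) e) _; clear e.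
case: (eqVneq la' mu) => [emu|nmu]; last first.
  apply: etrans (congr1 (fun z => Qstar z _) (scale0r _)) _.
  by apply: etrans (bop0l (@Qstar_bilinear n) _) (esym (lm0 (@alephf_lm n))).
have hxy : homog la mu' (x * y) by apply: homog_mul hx _; rewrite emu.
rewrite (aleph_homog hxy); apply: etrans (congr1 (fun z => Qstar z _) (scale1r _)) _.
apply: etrans (esym ((actU_rlin x).2 _ _)) _; rewrite emu.
by apply: etrans (congr1 (actU x) (homog_row hy)) (esym (actUM _ _ _)).
Qed.

(** The product is transported from K^j along the linear bijection; [aleph_mul_homog] shows that it
    has the prescribed values on homogeneous elements. *)
Lemma Udot_mul_spec : is_Udot_product (@Udot_mul n).
Proof.
apply: the_spec; exists (fun x y => alephV (Qstar (alephf x) (alephf y))); split.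
  have lV : lin_map alephV by move=> a x y; apply: alephf_inj; rewrite alephf_lm !alephVK.
  split=> [c x y z|c x y z]; rewrite alephf_lm.
    by rewrite (@Qstar_bilinear n).1 lV.
  by rewrite (@Qstar_bilinear n).2 lV.
by move=> la la' mu mu' x y hx hy; rewrite (aleph_mul_homog hx hy) alephfK.
Qed.

(** The specification fixes the product only on homogeneous elements; these suffice because the
    words in the image of [beth] are homogeneous and span. *)
Lemma aleph_mul (x y : Udot n) : alephf (Udot_mul x y) = QKj_mul (alephf x) (alephf y).
Proof.
rewrite QKj_mulE; have [bl hm] := Udot_mul_spec; have [z ->] := beth_surj x; have [z' ->] := beth_surj y.
move: z; apply: (lm_ext (F := fun z => alephf (Udot_mul (beth z) (beth z'))) (G := fun z => Qstar (alephf (beth z)) (alephf (beth z')))) => [||A].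
- exact: lm_comp (@alephf_lm n) (lm_comp (bop_lml _ bl) beth_lm).
- exact: lm_comp (bop_lml _ (@Qstar_bilinear n)) (lm_comp (@alephf_lm n) beth_lm).
move: z'; apply: (lm_ext (F := fun z => alephf (Udot_mul (beth << A >>) (beth z))) (G := fun z => Qstar (alephf (beth << A >>)) (alephf (beth z)))) => [||B].
- exact: lm_comp (@alephf_lm n) (lm_comp (bop_lmr _ bl) beth_lm).
- exact: lm_comp (bop_lmr _ (@Qstar_bilinear n)) (lm_comp (@alephf_lm n) beth_lm).
have hA := homog_word (wofP A); have hB := homog_word (wofP B).
apply: etrans (congr1 (@alephf n) (congr2 (@Udot_mul n) (beth1 A) (beth1 B))) _.
apply: etrans (congr1 (@alephf n) (hm _ _ _ _ _ _ hA hB)) (etrans (esym (aleph_mul_homog hA hB)) _).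
exact: esym (congr2 (fun x y => Qstar (alephf x) (alephf y)) (beth1 A) (beth1 B)).
Qed.

Lemma aleph_D la : alephf (Did la) = << val la >>.
Proof. by rewrite /Did (aleph_homog (@homog_1 n la)) actU1. Qed.

Lemma tb_eq (M : 'M[int]_N) A : val A = M -> tb M = << A >> :> QKj n.
Proof. by move=> <-; exact: tb_val. Qed.

Lemma aleph_e (i : 'I_n) la : alephf (eD i la) = << move (hi i) (lo i) la >>.
Proof.
rewrite /eD (aleph_homog (homog_e i la)) actU_gen /= E_diag; apply: tb_eq.
have iN := ltn_ord i.
have -> : hi i = rhi (eix i) by apply: ord_inj; rewrite /= inordN.
have -> : lo i = rlo (eix i) by apply: ord_inj; rewrite /= inordN // ltnW.
by rewrite -[LHS]/(move_mx _ _ la) /move_mx; exact: moveE.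
Qed.

Lemma aleph_f (i : 'I_n) la : alephf (fD i la) = << move (lo i) (hi i) la >>.
Proof.
rewrite /fD (aleph_homog (homog_f i la)) actU_gen /= E_diag; apply: tb_eq.
have iN := ltn_ord i.
have -> : hi i = rev_ord (rlo (fix_ i)) by apply: ord_inj; rewrite /= inordN // !subSS; nlia.
(* The letter of f_i is the mirror image of that of e_i, so its move appears with reversed indices;
   [Eth_rev] restores the stated form. *)
have -> : lo i = rev_ord (rhi (fix_ i)) by apply: ord_inj; rewrite /= inordN ?(ltnW iN) // /bump /= !subSS; nlia.
by rewrite -[LHS]/(move_mx _ _ la) /move_mx !Eth_rev; exact: moveE.
Qed.

Lemma alephf_bij : bijective (@alephf n).
Proof. by exists alephV; [exact: alephfK|exact: alephVK]. Qed.
End Iso.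

HB.instance Definition _ n := GRing.isLinear.Build Qv (Udot n) (QKj n) *:%R (@alephf n) (@alephf_lm n).

Theorem theorem4p7 (n : nat) (hn : (0 < n)%N) :
  exists aleph : {linear Udot n -> QKj n},
    [/\ bijective aleph,
        forall x y : Udot n, aleph (Udot_mul x y) = QKj_mul (aleph x) (aleph y),
        forall la : tXi_diag n, aleph (Did la) = << val la >>,
        forall (i : 'I_n) (la : tXi_diag n),
          aleph (eD i la) = << move (hi i) (lo i) la >> &
        forall (i : 'I_n) (la : tXi_diag n),
          aleph (fD i la) = << move (lo i) (hi i) la >>].
Proof.
exists (@alephf n : {linear Udot n -> QKj n}).
split; [exact: alephf_bij|exact: aleph_mul|exact: aleph_D|exact: aleph_e|exact: aleph_f].
Qed.
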